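(* Let $G$ be a complex reductive algebraic group, $\Gamma$ a finitely generated group and $\rho:\Gamma\to G$ a representation. (1) $\rho$ is a properly stable point of $Hom(\Gamma,G)$ under the conjugation action of $G$ if and only if $\rho$ is irreducible and $C(G)$ is finite. (2) $\rho$ is a properly stable point of $Hom(\Gamma,G)$ under the conjugation action of $G/C(G)$ if and only if $\rho$ is irreducible.
   Context: Reductive groups are connected complex affine algebraic groups whose radical is an algebraic torus. $C(G)$ is the center of $G$. $Hom(\Gamma,G)$ is the affine algebraic set of all homomorphisms $\Gamma\to G$; $G$, and hence $G/C(G)$, acts on it by conjugation. $\rho$ is irreducible if $\rho(\Gamma)$ lies in no proper parabolic subgroup of $G$. A point $x$ of an affine algebraic set $X$ is stable with respect to an action of a group $K$ on $X$ (and the trivial line bundle on $X$) if there is a Zariski open neighborhood of $x$, preserved by $K$, on which the $K$-action is closed (an action being closed when its orbits are closed). The point $x$ is properly stable if it is stable and its stabilizer in $K$ is finite. *)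

(* Defs.v *)
(* MathComp and MathComp-Analysis.  The notations of [mpoly] clash with those of
   MathComp-Analysis, so [mpoly n K] stands for the ring of polynomials in [n]
   variables; the file comes first because its [symmetric] would hide that of
   [ssrbool]. *)
From mathcomp Require Import -(notations) mpoly.
From HB Require Import structures.
From mathcomp Require Import all_boot all_order all_algebra.
From mathcomp Require Import generic_quotient.
From mathcomp Require Import all_classical reals topology_structure connected.
From mathcomp Require Import complex.

Set Implicit Arguments.
Unset Strict Implicit.
Unset Printing Implicit Defensive.

Import GRing.Theory.
Local Open Scope classical_set_scope.
Local Open Scope quotient_scope.
Local Open Scope ring_scope.

(** A set of points [T] is coordinatized by a map [c : T -> 'rV[K]_n]; all
    geometric notions below are relative to such a map. *)

Definition poly_eval (K : fieldType) (n : nat) (p : mpoly n K)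
    (v : 'rV[K]_n) : K :=
  meval (v ord0) p.

Definition zero_locus (K : fieldType) (T : Type) (n : nat) (c : T -> 'rV[K]_n)
    (S : set (mpoly n K)) : set T :=
  [set x | forall p, S p -> poly_eval p (c x) = 0].

Definition affine_algebraic (K : fieldType) (T : Type) (n : nat)
    (c : T -> 'rV[K]_n) : Prop :=
  injective c /\
  exists S : set (mpoly n K), range c = zero_locus (@idfun 'rV[K]_n) S.

(** [zariski c] is a copy of [T] carrying the Zariski topology that it inherits
    from affine space through [c]. *)
Definition zariski (K : fieldType) (T : Type) (n : nat) (c : T -> 'rV[K]_n)
  : Type := T.

Section ZariskiTopology.
Variables (K : fieldType) (T : Type) (n : nat) (c : T -> 'rV[K]_n).

HB.instance Definition _ := gen_eqMixin (zariski c).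
HB.instance Definition _ := gen_choiceMixin (zariski c).

Definition zariski_open (U : set (zariski c)) : Prop :=
  exists S : set (mpoly n K), ~` U = zero_locus c S.

Lemma zariski_openT : zariski_open setT.
Proof.
exists [set (1 : mpoly n K)]; rewrite setCT; apply/seteqP; split=> [x []|x /= /(_ 1 erefl)].
by rewrite /poly_eval meval1 => /eqP; rewrite oner_eq0.
Qed.

Lemma zariski_openI : setI_closed zariski_open.
Proof.
move=> A B [S AS] [S' BS'].
exists [set r | exists p q, [/\ S p, S' q & r = p * q]].
rewrite setCI AS BS'; apply/seteqP; split=> x /=.
  move=> [Zx|Zx] _ [p [q [Sp Sq ->]]]; rewrite /poly_eval mevalM.
    by move: (Zx p Sp); rewrite /poly_eval => ->; rewrite mul0r.
  by move: (Zx q Sq); rewrite /poly_eval => ->; rewrite mulr0.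
move=> Zx; apply: contrapT => /not_orP [/existsNP[p /not_implyP[Sp px]]].
move=> /existsNP[q /not_implyP[Sq qx]].
have /eqP : poly_eval (p * q) (c x) = 0 by apply: Zx; exists p, q.
by rewrite /poly_eval mevalM mulf_eq0 => /orP[] /eqP.
Qed.

Lemma zariski_open_bigU (I : Type) (f : I -> set (zariski c)) :
  (forall i, zariski_open (f i)) -> zariski_open (\bigcup_i f i).
Proof.
move=> /choice[S fS]; exists (\bigcup_i S i).
rewrite setC_bigcup; apply/seteqP; split=> x /= Zx.
  by move=> p [i _ Sp]; move: (Zx i Logic.I); rewrite fS; apply.
by move=> i _; rewrite fS => p Sp; apply: Zx; exists i.
Qed.

HB.instance Definition _ := isOpenTopological.Build (zariski c)
  zariski_openT zariski_openI zariski_open_bigU.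

Lemma zariski_closedP (A : set (zariski c)) :
  closed A <-> exists S : set (mpoly n K), A = zero_locus c S.
Proof. by rewrite -openC /open/= /zariski_open setCK. Qed.

End ZariskiTopology.

(** [f] is, on [D], the restriction of a polynomial map. *)
Definition regular_on (K : fieldType) (T U : Type) (n m : nat) (D : set T)
    (c : T -> 'rV[K]_n) (d : U -> 'rV[K]_m) (f : T -> U) : Prop :=
  exists q : 'I_m -> mpoly n K,
    forall x, D x -> d (f x) = \row_j poly_eval (q j) (c x).

Definition prod_coord (K : fieldType) (T U : Type) (n m : nat)
    (c : T -> 'rV[K]_n) (d : U -> 'rV[K]_m) (x : T * U) : 'rV[K]_(n + m) :=
  row_mx (c x.1) (d x.2).

Local Open Scope group_scope.

Definition subgroup (G : groupType) (H : set G) : Prop :=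
  H 1 /\ forall x y, H x -> H y -> H (x / y).

Definition normal (G : groupType) (H : set G) : Prop :=
  forall x y, H x -> H (x ^ y).

Definition generated (G : groupType) (A : set G) : set G :=
  [set x | forall H, subgroup H -> A `<=` H -> H x].

Fixpoint derived_series (G : groupType) (H : set G) (k : nat) : set G :=
  if k is k'.+1 then
    let D := derived_series H k' in
    generated [set [~ x, y] | x in D & y in D]
  else H.

Definition solvable_group (G : groupType) (H : set G) : Prop :=
  exists k, derived_series H k = [set 1].

Definition center (G : groupType) : set G :=
  [set z | forall x, z * x = x * z].
Arguments center : clear implicits.

Section CenterQuotient.
Variable G : groupType.

Definition center_eq (x y : G) : bool := `[< center G (x^-1 * y) >].

Lemma center_eqP (x y : G) : reflect (exists2 z, center G z & y = x * z)
  (center_eq x y).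
Proof.
apply: (iffP idP) => [/asboolP Z|[z Zz ->]]; last first.
  by apply/asboolP; rewrite mulKg.
by exists (x^-1 * y) => //; rewrite mulVKg.
Qed.

Lemma center1 : center G 1.
Proof. by move=> x; rewrite mulg1 mul1g. Qed.

Lemma centerM (u v : G) : center G u -> center G v -> center G (u * v).
Proof. by move=> Zu Zv x; rewrite -mulgA (Zv x) mulgA (Zu x) mulgA. Qed.

Lemma centerV (u : G) : center G u -> center G u^-1.
Proof. by move=> Zu x; apply: (mulgI u); rewrite mulVKg mulgA (Zu x) mulgK. Qed.

Lemma center_eq_refl : reflexive center_eq.
Proof.
by move=> x; apply/center_eqP; exists 1; [exact: center1|rewrite mulg1].
Qed.

Lemma center_eq_sym : symmetric center_eq.
Proof.
suff H x y : center_eq x y -> center_eq y x by move=> x y; apply/idP/idP; exact: H.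
move=> /center_eqP[z Zz ->]; apply/center_eqP.
by exists z^-1; [exact: centerV|rewrite mulgK].
Qed.

Lemma center_eq_trans : transitive center_eq.
Proof.
move=> y x z /center_eqP[u Zu ->] /center_eqP[v Zv ->].
by apply/center_eqP; exists (u * v); [exact: centerM|rewrite mulgA].
Qed.

Canonical center_equiv :=
  EquivRel center_eq center_eq_refl center_eq_sym center_eq_trans.

(** [G / C(G)] *)
Definition center_quot := {eq_quot center_eq}.
HB.instance Definition _ := Choice.on center_quot.
HB.instance Definition _ := EqQuotient.on center_quot.

Definition center_proj (x : G) : center_quot := \pi_center_quot x.

Definition center_quot_mul (a b : center_quot) : center_quot :=
  center_proj (repr a * repr b).
Definition center_quot_inv (a : center_quot) : center_quot :=
  center_proj (repr a)^-1.

Lemma center_projP (x y : G) :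
  center_proj x = center_proj y <-> exists2 z, center G z & y = x * z.
Proof.
split=> [/eqP|] H; last by apply/eqP; rewrite eqmodE; apply/center_eqP.
by apply/center_eqP; move: H; rewrite eqmodE.
Qed.

Lemma repr_center_proj (x : G) :
  exists2 z, center G z & repr (center_proj x) = x * z.
Proof. by apply/center_projP; rewrite /center_proj reprK. Qed.

Lemma center_projM (x y : G) :
  center_quot_mul (center_proj x) (center_proj y) = center_proj (x * y).
Proof.
have [u Zu Eu] := repr_center_proj x; have [v Zv Ev] := repr_center_proj y.
apply/esym/center_projP; rewrite Eu Ev; exists (u * v).
  exact: centerM.
by rewrite -!mulgA; congr (_ * _); rewrite !mulgA Zu.
Qed.

Lemma center_projV (x : G) :
  center_quot_inv (center_proj x) = center_proj x^-1.
Proof.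
have [u Zu Eu] := repr_center_proj x.
apply/center_projP; rewrite Eu; exists u => //.
by rewrite invgM -mulgA -Zu mulKg.
Qed.

Lemma center_projK (a : center_quot) : center_proj (repr a) = a.
Proof. exact: reprK. Qed.

Lemma center_quot_mulA : associative center_quot_mul.
Proof.
move=> a b d; rewrite -(center_projK a) -(center_projK b) -(center_projK d).
by rewrite !center_projM mulgA.
Qed.

Lemma center_quot_mul1 : left_id (center_proj 1) center_quot_mul.
Proof. by move=> a; rewrite -(center_projK a) center_projM mul1g. Qed.

Lemma center_quot_mul1r : right_id (center_proj 1) center_quot_mul.
Proof. by move=> a; rewrite -(center_projK a) center_projM mulg1. Qed.

Lemma center_quot_mulV :
  left_inverse (center_proj 1) center_quot_inv center_quot_mul.
Proof.
by move=> a; rewrite -(center_projK a) center_projV center_projM mulVg.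
Qed.

Lemma center_quot_mulVr :
  right_inverse (center_proj 1) center_quot_inv center_quot_mul.
Proof.
by move=> a; rewrite -(center_projK a) center_projV center_projM mulgV.
Qed.

HB.instance Definition _ := isGroup.Build center_quot
  center_quot_mulA center_quot_mul1 center_quot_mul1r
  center_quot_mulV center_quot_mulVr.

End CenterQuotient.
Arguments center_quot : clear implicits.

Definition affine_algebraic_group (K : fieldType) (G : groupType) (n : nat)
    (c : G -> 'rV[K]_n) : Prop :=
  [/\ affine_algebraic c,
      regular_on setT (prod_coord c c) c (fun x => x.1 * x.2) &
      regular_on setT c c (fun x => x^-1)].

(** The points of the [k]-dimensional split torus are the vectors without zero
    entry.  As an affine algebraic set it has coordinates [(t, t^-1)]. *)
Definition torus_set (K : fieldType) (k : nat) : set 'rV[K]_k :=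
  [set t | forall i, t ord0 i != 0%R].

Definition torus_coord (K : fieldType) (k : nat) (t : 'rV[K]_k)
    : 'rV[K]_(k + k) :=
  row_mx t (map_mx (fun a => a^-1)%R t).

Definition torus_mul (K : fieldType) (k : nat) (s t : 'rV[K]_k) : 'rV[K]_k :=
  map2_mx (fun a b => a * b)%R s t.

(** The closed subgroup [H] is isomorphic to some split torus as an algebraic
    group; [f] is the isomorphism and [h] its inverse. *)
Definition algebraic_torus (K : fieldType) (G : groupType) (n : nat)
    (c : G -> 'rV[K]_n) (H : set G) : Prop :=
  exists (k : nat) (f : 'rV[K]_k -> G) (h : G -> 'rV[K]_k),
    [/\ (forall t, torus_set t -> H (f t) /\ h (f t) = t),
        (forall x, H x -> torus_set (h x) /\ f (h x) = x),
        (forall s t, torus_set s -> torus_set t ->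
           f (torus_mul s t) = f s * f t),
        regular_on (@torus_set K k) (@torus_coord K k) c f &
        regular_on H c (@torus_coord K k) h].

Section AlgebraicGroups.
Variables (K : fieldType) (G : groupType) (n : nat) (c : G -> 'rV[K]_n).

Definition closed_subgroup (H : set G) : Prop :=
  subgroup H /\ closed (H : set (zariski c)).

Definition connected_solvable (H : set G) : Prop :=
  [/\ closed_subgroup H, connected (H : set (zariski c)) & solvable_group H].

Definition is_radical (H : set G) : Prop :=
  [/\ connected_solvable H, normal H &
      forall H', connected_solvable H' -> normal H' -> H' `<=` H].

Definition reductive : Prop :=
  [/\ affine_algebraic_group c,
      connected ([set: G] : set (zariski c)) &
      exists2 H, is_radical H & algebraic_torus c H].

Definition borel (B : set G) : Prop :=
  connected_solvable B /\
  forall B', connected_solvable B' -> B `<=` B' -> B' = B.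

Definition parabolic (P : set G) : Prop :=
  closed_subgroup P /\ exists2 B, borel B & B `<=` P.

Definition irreducible_rep (Gamma : groupType)
    (rho : {multiplicative Gamma -> G}) : Prop :=
  forall P, parabolic P -> range rho `<=` P -> P = setT.

End AlgebraicGroups.

Section Stability.
Variables (K : fieldType) (T : Type) (n : nat) (c : T -> 'rV[K]_n).
Variables (A : groupType) (act : A -> T -> T).

Definition orbit (x : T) : set T := [set act a x | a in setT].

Definition stabilizer (x : T) : set A := [set a | act a x = x].

(** The orbits of the points of [U] are required to be closed in the whole
    space, not merely in [U].  The latter would be too weak: on the open set of
    points with orbits of maximal dimension, all orbits are relatively
    closed. *)
Definition stable_point (x : T) : Prop :=
  exists U : set (zariski c),
    [/\ open U, U x,
        (forall a y, U y -> U (act a y)) &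
        (forall y, U y -> closed (orbit y : set (zariski c)))].

Definition properly_stable_point (x : T) : Prop :=
  stable_point x /\ finite_set (stabilizer x).

End Stability.

(** If [g] generates [Gamma], then [rho |-> (rho (g i))_i] identifies
    [Hom(Gamma, G)] with an affine algebraic subset of [G^N]. *)
Definition hom_coord (K : fieldType) (Gamma G : groupType) (n N : nat)
    (c : G -> 'rV[K]_n) (g : 'I_N -> Gamma)
    (rho : {multiplicative Gamma -> G}) : 'rV[K]_(N * n) :=
  mxvec (\matrix_(i < N) c (rho (g i))).

Section Conjugation.
Variables (Gamma G : groupType).

Definition conj_fun (a : G) (rho : Gamma -> G) (x : Gamma) : G :=
  a * rho x * a^-1.

Lemma conj_fun_multiplicative (a : G) (rho : {multiplicative Gamma -> G}) :
  {morph conj_fun a rho : x y / x * y}.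
Proof. by move=> x y; rewrite /conj_fun gmulfM -!mulgA mulKg. Qed.

HB.instance Definition _ (a : G) (rho : {multiplicative Gamma -> G}) :=
  isMultiplicative.Build Gamma G (conj_fun a rho)
    (conj_fun_multiplicative a rho).

Definition conj_action (a : G) (rho : {multiplicative Gamma -> G})
    : {multiplicative Gamma -> G} :=
  conj_fun a rho.

(** The induced action of [G / C(G)]; it does not depend on the chosen
    representative, see [center_conj_actionE]. *)
Definition center_conj_action (a : center_quot G)
    (rho : {multiplicative Gamma -> G}) : {multiplicative Gamma -> G} :=
  conj_action (repr a) rho.

Lemma multiplicative_ext (f h : {multiplicative Gamma -> G}) :
  f =1 h -> f = h.
Proof.
case: f h => [f [[fM]]] [h [[hM]]] /= /funext E; subst h.
by rewrite (Prop_irrelevance hM fM).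
Qed.

Lemma conj_action1 (rho : {multiplicative Gamma -> G}) :
  conj_action 1 rho = rho.
Proof.
by apply: multiplicative_ext => x; rewrite /= /conj_fun invg1 mulg1 mul1g.
Qed.

Lemma conj_actionM (a b : G) (rho : {multiplicative Gamma -> G}) :
  conj_action (a * b) rho = conj_action a (conj_action b rho).
Proof.
by apply: multiplicative_ext => x; rewrite /= /conj_fun/= /conj_fun invgM !mulgA.
Qed.

Lemma center_conj_actionE (a : G) (rho : {multiplicative Gamma -> G}) :
  center_conj_action (center_proj a) rho = conj_action a rho.
Proof.
have [z Zz Ez] := repr_center_proj a.
apply: multiplicative_ext => x; rewrite /= /conj_fun Ez.
by rewrite invgM -!mulgA; congr (_ * _); rewrite !mulgA Zz mulgK.
Qed.

End Conjugation.

(* Main.v *)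
From mathcomp Require Import -(notations) mpoly.
Require Import Defs.
From HB Require Import structures.
From mathcomp Require Import all_boot all_order all_algebra.
From mathcomp Require Import all_classical reals topology_structure connected complex.
From mathcomp Require Import ring zify.

(** A representation is called bad when it normalizes a nonzero nil subspace [u]
    of the Lie algebra [g] that is orthogonal, for the trace form, to a subspace
    [p] containing [u] with [[p, u] <= u] and [dim u + dim p >= dim g]; then [p]
    is a parabolic subalgebra and [u] its nilradical.  The normalizer of [u]
    is a proper parabolic subgroup; conversely the orthogonal of the Lie algebra
    of a proper parabolic subgroup is such a [u].  So irreducible means not bad.

    If [rho] is bad, an element of [g] that grades [u] yields a torus
    [c : K^* -> G] such that [c t rho (c t)^-1] extends polynomially to [t = 0],
    with a limit fixed by the torus.  A closed orbit would contain this limit, so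
    that the stabilizer of [rho] would be infinite modulo the center.

    If [rho] is not bad and the conjugates [a_i rho a_i^-1] converge along a
    place, then [Ad a_i] and its inverse converge on [g]: otherwise the limit of
    the graphs of the [Ad a_i] produces a space [u] normalized by [rho].  Hence
    [rho] lies in turn in the closure of the orbit of the limit, the two orbits
    satisfy the same equations, and they meet because each of them contains a
    generic part of the common closure.  Orbits that are not bad are thus closed;
    being bad is a closed condition since limits of good pairs [(u, p)] are good;
    and an entry of [Ad] with infinitely many values on the stabilizer would
    diverge along some place. *)

Set Implicit Arguments.
Unset Strict Implicit.
Unset Printing Implicit Defensive.

Import Order.TTheory GRing.Theory Num.Theory.
Local Open Scope classical_set_scope.
Local Open Scope ring_scope.

(** * Linear operators and their spectra *)

(** The classical arguments rest on the structure theory of algebraic groups and on groups over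
    Laurent series. The obstacle is to pass between a group and its Lie algebra with polynomial
    functions alone. In characteristic 0 a polynomial function on a connected group is determined by
    its invariant derivatives at 1; Krull's intersection theorem turns formal vanishing into
    vanishing near 1. Reductivity enters as the absence of nonzero nil ideals. Its main effect is
    that the trace form is nondegenerate on [g]: an element orthogonal to [g] is orthogonal to its
    replicas, which are functions of it that lie again in [g], and this makes it nilpotent.
    Parabolic subgroups become pairs of subspaces because the conditions on such pairs survive
    limits, and limits of subspaces keep their dimension. Places are maximal ring morphisms from
    rings of functions on an index set to [K]; by Zorn's lemma one is centred at every point of a
    closure, so they play the role of curves, and finiteness at a place that of completeness. *)

Lemma set_vspace (K : fieldType) (vT : vectType K) (S : set vT) :
  S 0 -> (forall a u v, S u -> S v -> S (a *: u + v)) ->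
  exists U : {vspace vT}, forall v, v \in U <-> S v.
Proof.
move=> S0 Slin.
(* A subspace of maximal dimension inside [S] exhausts [S], since otherwise a line could be added to
   it. *)
pose P d := `[< exists2 U : {vspace vT}, \dim U = d & forall v, v \in U -> S v >].
have exP : exists d, P d.
  exists 0%N; apply/asboolP; exists 0%VS; first by rewrite dimv0.
  by move=> v; rewrite memv0 => /eqP ->.
have ubP d : P d -> (d <= \dim {:vT})%N.
  by move=> /asboolP[U <- _]; apply/dimvS/subvf.
case: (ex_maxnP exP ubP) => d /asboolP[U dU SU] dmax.
exists U => v; split=> [/SU//|Sv]; apply: contrapT => /negP vU.
have : P (\dim (U + <[v]>)%VS).
  apply/asboolP; exists (U + <[v]>)%VS => // w /memv_addP[x xU [y /vlineP[k ->] ->]].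
  by rewrite addrC; apply: Slin => //; exact: SU.
move=> /dmax; rewrite leqNgt -dU => /negP; apply.
rewrite ltn_neqAle dimvS ?addvSl// andbT; apply/eqP => dE.
have /eqP UE : (U == U + <[v]>)%VS by rewrite eqEdim addvSl -dE leqnn.
by move/negP: vU; apply; rewrite UE (subvP (addvSr _ _))// memv_line.
Qed.

Section Interpolation.
Variable K : fieldType.
Implicit Types (E : seq K) (k : nat) (f : {poly K}).

Lemma coprimep_XsubC_exp (a b : K) k l : a != b ->
  coprimep (('X - a%:P) ^+ k) (('X - b%:P) ^+ l).
Proof.
move=> ab; apply: coprimep_expl; apply: coprimep_expr.
by rewrite coprimep_XsubC rootE hornerXsubC subr_eq0 eq_sym.
Qed.

Lemma dvdp_prod_XsubC_exp E k f : uniq E ->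
  (forall b, b \in E -> ('X - b%:P) ^+ k %| f) ->
  \prod_(b <- E) ('X - b%:P) ^+ k %| f.
Proof.
elim: E => [|a E IH] /=; first by rewrite big_nil dvd1p.
move=> /andP[aE uE] H; rewrite big_cons Gauss_dvdp; last first.
  elim: {IH H uE}E aE => [|b E IH]; first by rewrite big_nil coprimep1.
  rewrite inE negb_or big_cons coprimepMr => /andP[ab /IH ->].
  by rewrite coprimep_XsubC_exp.
by rewrite H ?mem_head// IH// => b bE; apply: H; rewrite inE bE orbT.
Qed.

(** Chinese remainder theorem, one point at a time: with the Bezout relation, [q * u] is 1 modulo
    the new power and 0 modulo the old ones. *)
Lemma interpolation E k (v : K -> K) : uniq E ->
  exists f, forall b, b \in E -> ('X - b%:P) ^+ k %| f - (v b)%:P.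
Proof.
elim: E => [|a E IH] /=; first by exists 0.
move=> /andP[aE /IH[f Hf]].
pose q := \prod_(b <- E) ('X - b%:P) ^+ k.
have cq : coprimep q (('X - a%:P) ^+ k).
  rewrite /q; elim: (E) aE => [|b E' IH']; first by rewrite big_nil coprime1p.
  rewrite inE negb_or big_cons coprimepMl => /andP[ab /IH' ->].
  by rewrite coprimep_XsubC_exp// eq_sym.
have /Bezout_eq1_coprimepP[[u w] /= uw] := cq.
exists (f + q * u * ((v a)%:P - f)) => b; rewrite inE => /predU1P[->|bE].
  rewrite [X in _ %| X](_ : _ = (1 - q * u) * (f - (v a)%:P)); last by ring.
  rewrite -uw (mulrC q) addrAC subrr add0r.
  by rewrite mulrAC dvdp_mull.
rewrite addrAC dvdp_add ?Hf// -mulrA dvdp_mulr//.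
rewrite /q; elim: (E) bE => [//|c E' IH']; rewrite inE big_cons => /predU1P[->|/IH' H].
  exact: dvdp_mulr.
exact: dvdp_mull.
Qed.

End Interpolation.

Section Spectrum.
Variables (K : numClosedFieldType) (n : nat).
Local Notation M := 'M[K]_n.+1.
Implicit Types (X Y N : M) (E : seq K).

(** All eigenvalues of [X] lie in [E], which may be larger than the spectrum; the exponent [n.+1]
    bounds every multiplicity. *)
Definition kills (E : seq K) (X : M) : Prop :=
  horner_mx X (\prod_(b <- E) ('X - b%:P) ^+ n.+1) = 0.

Lemma horner_mx_dvd X (f g : {poly K}) : f %| g -> horner_mx X f = 0 ->
  horner_mx X g = 0.
Proof. by move=> /dvdpP[h ->] H; rewrite rmorphM /= H mulr0. Qed.

Lemma kills_sub E E' X : uniq E -> {subset E <= E'} -> kills E X -> kills E' X.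
Proof.
move=> uE sE; apply: horner_mx_dvd; apply: dvdp_prod_XsubC_exp => // b /sE bE.
elim: E' bE {sE} => [//|c E' IH]; rewrite inE big_cons => /predU1P[->|/IH H].
  exact: dvdp_mulr.
exact: dvdp_mull.
Qed.

Lemma spectrum X : exists2 E, uniq E &
  kills E X /\ forall b, b \in E -> eigenvalue X b.
Proof.
have [r Er] := closed_field_poly_normal (char_poly X).
exists (undup r); first exact: undup_uniq.
have rE b : b \in r -> eigenvalue X b.
  move=> br; rewrite eigenvalue_root_char Er rootZ.
    by rewrite root_prod_XsubC.
  by rewrite lead_coef_eq0 -size_poly_eq0 size_char_poly.
split; last by move=> b; rewrite mem_undup; exact: rE.
apply: (@horner_mx_dvd _ (char_poly X)); last exact: Cayley_Hamilton.
rewrite Er (monicP (char_poly_monic X)) scale1r.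
have sr : (size r <= n.+1)%N.
  have := size_char_poly X.
  by rewrite Er (monicP (char_poly_monic X)) scale1r size_prod_XsubC => -[->].
have cnt b : (count_mem b r <= n.+1)%N by apply: leq_trans sr; exact: count_size.
rewrite -big_undup_iterop_count/= big_seq [X in _ %| X]big_seq.
elim/big_ind2: _ => // [p q p' q' pq pq'|b _]; first exact: dvdp_mul.
rewrite -/(GRing.exp _ _).
by apply: dvdp_exp2l; apply: cnt.
Qed.

Lemma horner_mx_eqmod E X (f g : {poly K}) : uniq E -> kills E X ->
  (forall b, b \in E -> ('X - b%:P) ^+ n.+1 %| f - g) ->
  horner_mx X f = horner_mx X g.
Proof.
move=> uE kX H; apply/eqP; rewrite -subr_eq0 -rmorphB; apply/eqP.
by apply: horner_mx_dvd kX; apply: dvdp_prod_XsubC_exp.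
Qed.

Lemma nilp_trace N k : N ^+ k = 0 -> \tr N = 0.
Proof.
move=> Nk; have [r Er] := closed_field_poly_normal (char_poly N).
move: Er; rewrite (monicP (char_poly_monic N)) scale1r => Er.
have r0 b : b \in r -> b = 0.
  move=> br; have : root (char_poly N) b by rewrite Er root_prod_XsubC.
  rewrite -eigenvalue_root_char => /eigenvalueP[v vN v0].
  have H j : v *m (N ^+ j) = b ^+ j *: v.
    elim: j => [|j IH]; first by rewrite !expr0 mulmx1 scale1r.
    by rewrite exprSr -mulmxE mulmxA IH -scalemxAl vN scalerA -exprSr.
  move: (H k); rewrite Nk mulmx0 => /esym/eqP; rewrite scaler_eq0 (negPf v0) orbF.
  by rewrite expf_eq0 => /andP[_ /eqP].
have sr : size r = n.+1.
  by have := size_char_poly N; rewrite Er size_prod_XsubC => -[].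
have : char_poly N = 'X^(n.+1).
  rewrite Er big_seq (eq_bigr (fun=> 'X)); last by move=> b /r0 ->; rewrite subr0.
  rewrite -big_seq -sr; elim: (r) => [|a s IH]; first by rewrite big_nil.
  by rewrite big_cons IH -exprS.
move=> cp; have := char_poly_trace N isT; rewrite cp coefXn /=.
by rewrite eqn_leq ltnn andbF => /esym/eqP; rewrite oppr_eq0 => /eqP.
Qed.

End Spectrum.

(** * Functions of an operator *)

(** A [Q]-linear functional with rational values, composed with the inclusion of [Q] in [K]. In
    Cartan's criterion such functionals take the place of complex conjugation. *)
Definition rat_functional (K : numFieldType) (th : K -> K) : Prop :=
  [/\ {morph th : x y / x + y},
      forall (r : rat) x, th (ratr r * x) = ratr r * th x &
      forall x, exists r : rat, th x = ratr r].

(** A [Q]-subspace that is maximal among those avoiding [a] is a complement of the line of [a]; the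
    functional is the projection to this line. *)
Lemma rat_functional_exists (K : numFieldType) (a : K) : a != 0 ->
  exists2 th : K -> K, rat_functional th & th a = 1.
Proof.
move=> a0.
pose sub (H : set K) := H 0 /\ forall (r : rat) x y, H x -> H y -> H (ratr r * x + y).
pose P (H : set K) := H = set0 \/ (sub H /\ ~ H a).
have [F FP Ftot|H [PH Hmax]] := @Zorn_bigcup K P.
  have [[X FX [x Xx]]|nX] := pselect (exists2 X, F X & X !=set0); last first.
    left; apply/seteqP; split=> // x [X FX Xx]; apply: nX; exists X => //.
    by exists x.
  right; split; last first.
    move=> [Y FY Ya]; have [Y0|[_ /(_ Ya)//]] := FP _ FY.
    by rewrite Y0 in Ya.
  have nz Y y : F Y -> Y y -> sub Y /\ ~ Y a.
    by move=> FY Yy; have [Y0|//] := FP _ FY; rewrite Y0 in Yy.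
  split; first by exists X => //; have [[]] := nz _ _ FX Xx.
  move=> r u v [Y FY Yu] [Z FZ Zv].
  have [YZ|ZY] := Ftot _ _ FY FZ.
    by exists Z => //; have [[_ H] _] := nz _ _ FZ Zv; apply: H => //; exact: YZ.
  by exists Y => //; have [[_ H] _] := nz _ _ FY Yu; apply: H => //; exact: ZY.
have [H0|[sH Ha]] := PH.
  exfalso; apply: (Hmax [set 0]); last first.
    right; split; last by move=> /eqP; rewrite (negPf a0).
    by split=> // r x y /= -> ->; rewrite mulr0 addr0.
  by rewrite H0; split=> // /(_ 0 erefl).
have [H00 Hlin] := sH.
have dec x : exists r : rat, H (x - ratr r * a).
  have [Hx|Hx] := pselect (H x); first by exists 0; rewrite rmorph0 mul0r subr0.
  pose H' := [set y | exists r h, H h /\ y = ratr r * x + h].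
  have sH' : sub H'.
    split; first by exists 0, 0; rewrite rmorph0 mul0r addr0.
    move=> r _ _ [s [h [Hh ->]]] [s' [h' [Hh' ->]]].
    exists (r * s + s'), (ratr r * h + h'); split; first exact: Hlin.
    by rewrite rmorphD rmorphM /=; ring.
  have : ~ ~ H' a.
    move=> nH'; apply: (Hmax H'); last by right.
    split; last first.
      move=> /(_ x) H'x; apply: Hx; apply: H'x.
      by exists 1, 0; rewrite rmorph1 mul1r addr0.
    by move=> y Hy; exists 0, y; rewrite rmorph0 mul0r add0r.
  move=> /contrapT[r [h [Hh Ea]]].
  have r0 : r != 0.
    by apply/eqP => r0; apply: Ha; rewrite Ea r0 rmorph0 mul0r add0r.
  exists r^-1; rewrite Ea mulrDr mulrA -rmorphM /= mulVf// rmorph1 mul1r.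
  rewrite opprD addrA subrr add0r -mulNr -rmorphN -[_ * _]addr0.
  exact: Hlin.
have uniqr x (r s : rat) : H (x - ratr r * a) -> H (x - ratr s * a) -> r = s.
  move=> Hr Hs; apply: contrapT => /eqP rs; apply: Ha.
  have rs0 : r - s != 0 by rewrite subr_eq0.
  have := Hlin (-1) _ _ Hr Hs; rewrite rmorphN1 => /(fun h => Hlin (r - s)^-1 _ _ h H00).
  rewrite addr0 (_ : -1 * _ + _ = ratr (r - s) * a); last by rewrite rmorphB /=; ring.
  by rewrite mulrA -rmorphM /= mulVf// rmorph1 mul1r.
have [th Hth] := choice dec.
exists (fun x => ratr (th x)); last first.
  rewrite (uniqr a (th a) 1) ?rmorph1//; rewrite ?rmorph1 ?mul1r ?subrr//.
split=> [x y|r x|x]; last by exists (th x).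
  rewrite -rmorphD; congr (ratr _); apply: uniqr (Hth _) _.
  have := Hlin 1 _ _ (Hth x) (Hth y).
  by rewrite rmorph1 mul1r rmorphD /= mulrDl opprD addrACA.
rewrite -rmorphM /=; congr (ratr _); apply: uniqr (Hth _) _.
have := Hlin r _ _ (Hth x) H00.
by rewrite addr0 mulrBr rmorphM /= mulrA.
Qed.

Section FunctionalCalculus.
Variables (K : numClosedFieldType) (n : nat).
Local Notation M := 'M[K]_n.+1.
Implicit Types (X Y N : M) (E : seq K) (v w : K -> K).

(** Some interpolating polynomial; by [horner_mx_eqmod] its value at an operator killed by [E]
    depends only on [v]. *)
Definition interp E v : {poly K} :=
  xget 0 [set f | forall b, b \in E -> ('X - b%:P) ^+ n.+1 %| f - (v b)%:P].

Lemma interpP E v b : uniq E -> b \in E ->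
  ('X - b%:P) ^+ n.+1 %| interp E v - (v b)%:P.
Proof.
move=> uE; rewrite /interp; case: xgetP => [f _ /(_ b)//|].
by have [f fP] := interpolation n.+1 v uE => /(_ f).
Qed.

(** For [X] killed by [E], the operator acting as the scalar [v b] on the generalized eigenspace of
    [b]. Being a polynomial in [X], it stabilizes every subspace that [X] stabilizes. *)
Definition spfun E v X : M := horner_mx X (interp E v).

Variables (E : seq K) (X : M).
Hypotheses (uE : uniq E) (kX : kills E X).

Lemma spfunE (f : {poly K}) v :
  (forall b, b \in E -> ('X - b%:P) ^+ n.+1 %| f - (v b)%:P) ->
  horner_mx X f = spfun E v X.
Proof.
move=> H; apply: (horner_mx_eqmod uE kX) => b bE.
rewrite (_ : f - _ = (f - (v b)%:P) - (interp E v - (v b)%:P)); last by ring.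
by rewrite dvdp_sub ?H ?interpP.
Qed.

Lemma spfunD v w : spfun E (fun b => v b + w b) X = spfun E v X + spfun E w X.
Proof.
rewrite -rmorphD; apply/esym/spfunE => b bE.
rewrite polyCD opprD addrACA.
by rewrite dvdp_add ?interpP.
Qed.

Lemma spfunM v w : spfun E (fun b => v b * w b) X = spfun E v X * spfun E w X.
Proof.
rewrite -rmorphM; apply/esym/spfunE => b bE.
rewrite polyCM (_ : _ - _ * _ = (interp E v - (v b)%:P) * interp E w
   + (v b)%:P * (interp E w - (w b)%:P)); last by ring.
by apply: dvdp_add; [apply: dvdp_mulr|apply: dvdp_mull]; rewrite interpP.
Qed.

Lemma spfun_cst a : spfun E (fun=> a) X = a%:M.
Proof. by rewrite -(@spfunE a%:P) ?horner_mx_C// => b bE; rewrite subrr dvdp0. Qed.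

Lemma spfunZ a v : spfun E (fun b => a * v b) X = a *: spfun E v X.
Proof. by rewrite spfunM spfun_cst -mulmxE mul_scalar_mx. Qed.

Lemma eq_spfun v w : {in E, v =1 w} -> spfun E v X = spfun E w X.
Proof. by move=> vw; apply: spfunE => b bE; rewrite -vw// interpP. Qed.

Definition spidem b : M := spfun E (fun x => (x == b)%:R) X.

Lemma spfun_sum v : spfun E v X = \sum_(b <- E) v b *: spidem b.
Proof.
under eq_bigr do rewrite -spfunZ.
suff H (s : seq K) : \sum_(b <- s) spfun E (fun x => v b * (x == b)%:R) X =
   spfun E (fun x => \sum_(b <- s) v b * (x == b)%:R) X.
  rewrite H; apply: eq_spfun => x xE.
  rewrite (bigD1_seq x)//= eqxx mulr1 big1 ?addr0// => b bx.
  by rewrite eq_sym (negPf bx) mulr0.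
elim: s => [|b s IH].
  rewrite big_nil -(@spfunE 0) ?rmorph0// => b _.
  by rewrite big_nil subrr dvdp0.
by rewrite big_cons IH -spfunD; apply: eq_spfun => x _; rewrite big_cons.
Qed.

Lemma spidem_sum : \sum_(b <- E) spidem b = 1.
Proof.
have <- : spfun E (fun=> 1) X = 1 by rewrite spfun_cst.
rewrite spfun_sum.
by apply: eq_bigr => b _; rewrite scale1r.
Qed.

Lemma spidem_idem b : spidem b * spidem b = spidem b.
Proof. by rewrite -spfunM; apply: eq_spfun => x _; case: eqP; rewrite ?mulr0 ?mulr1. Qed.

Lemma spidem_spfun v b : spfun E v X * spidem b = v b *: spidem b.
Proof.
rewrite -spfunM -spfunZ; apply: eq_spfun => x _; case: eqP => [->//|].
by rewrite !mulr0.
Qed.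

Lemma horner_spidem (f : {poly K}) b :
  b \in E -> ('X - b%:P) ^+ n.+1 %| f -> horner_mx X f * spidem b = 0.
Proof.
move=> bE bf; rewrite -rmorphM /=; apply: (horner_mx_dvd _ kX).
apply: dvdp_prod_XsubC_exp => // c cE.
have [->|cb] := eqVneq c b; first exact: dvdp_mulr.
rewrite dvdp_mull//; have := interpP (fun x => (x == b)%:R) uE cE.
by rewrite (negPf cb) subr0.
Qed.

Lemma spidem_comm b : GRing.comm X (spidem b).
Proof.
set p := interp E (fun x => (x == b)%:R).
transitivity (horner_mx X ('X * p)); first by rewrite rmorphM /= horner_mx_X.
by rewrite mulrC rmorphM /= horner_mx_X.
Qed.

Lemma spidem_nil b : b \in E -> ((X - b%:M) * spidem b) ^+ n.+1 = 0.
Proof.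
move=> bE; rewrite exprMn_comm; last first.
  apply: commr_sym; apply: commrB; first exact/commr_sym/spidem_comm.
  by rewrite /GRing.comm -!mulmxE scalar_mxC.
rewrite (_ : (X - b%:M) ^+ _ = horner_mx X (('X - b%:P) ^+ n.+1)); last first.
  by rewrite rmorphXn rmorphB /= horner_mx_X horner_mx_C.
by rewrite [spidem b ^+ _]exprS mulrA horner_spidem// mul0r.
Qed.

Lemma trace_spidem_spfun v b : b \in E ->
  \tr (X * spfun E v X * spidem b) = b * v b * \tr (spidem b).
Proof.
move=> bE; rewrite -mulrA spidem_spfun -scalerAr linearZ /= -{1}(subrK b%:M X).
rewrite mulrDl mxtraceD (nilp_trace (spidem_nil bE)) add0r -mulmxE mul_scalar_mx.
by rewrite linearZ /= mulrCA mulrA.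
Qed.

Lemma trace_mul_spfun v :
  \tr (X * spfun E v X) = \sum_(b <- E) b * v b * \tr (spidem b).
Proof.
rewrite -[LHS](congr1 _ (mulr1 _)) -spidem_sum mulr_sumr raddf_sum /= big_seq.
by rewrite [RHS]big_seq; apply: eq_bigr => b bE; exact: trace_spidem_spfun.
Qed.

End FunctionalCalculus.

(** In the full rank factorization of [e], idempotency forces the product of the two factors in the
    other order to be the identity, whose size is the rank. *)
Lemma trace_idem (F : fieldType) n (e : 'M[F]_n) : e *m e = e ->
  \tr e = (\rank e)%:R.
Proof.
move=> ee; have := ee; rewrite -{1 2 3}(mulmx_base e) -mulmxA => H.
have : row_base e *m col_base e = 1%:M.
  have := col_base_full e; have := row_base_free e.
  move: (row_base e) (col_base e) H => r c H /row_freeP[B RB] /row_fullP[C CC].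
  move: (congr1 (fun x => C *m x *m B) H).
  by rewrite /= !mulmxA CC !mul1mx -!mulmxA RB mulmx1.
move=> rc; transitivity (\tr (col_base e *m row_base e)); first by rewrite mulmx_base.
by rewrite mxtrace_mulC rc mxtrace1.
Qed.

Section NilpotenceCriteria.
Variables (K : numClosedFieldType) (n : nat).
Local Notation M := 'M[K]_n.+1.
Implicit Types (X : M) (E : seq K).

Lemma trace_spidem X E b : uniq E -> kills E X -> \tr (spidem E X b) = (\rank (spidem E X b))%:R.
Proof. by move=> uE kX; apply: trace_idem; rewrite mulmxE; exact: spidem_idem. Qed.

Lemma nilp_of_spidem X E : uniq E -> kills E X ->
  (forall b, b \in E -> b != 0 -> \tr (spidem E X b) = 0) -> X ^+ n.+1 = 0.
Proof.
move=> uE kX H.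
have e0 b : b \in E -> b != 0 -> spidem E X b = 0.
  move=> bE b0; have := H b bE b0; rewrite (trace_spidem _ uE kX) => /eqP.
  by rewrite pnatr_eq0 mxrank_eq0 => /eqP.
rewrite -[X ^+ _]mulr1 -(spidem_sum uE kX) mulr_sumr big_seq big1// => b bE.
have [b0|b0] := eqVneq b 0; last by rewrite e0// mulr0.
have := horner_spidem uE kX bE (dvdpp _).
by rewrite {1}b0 rmorphXn /= subr0 horner_mx_X.
Qed.

(** Cartan's argument: the trace is the sum of [b * th b] weighted by the ranks of the spectral
    projectors. Applying [th] once more makes it a sum of nonnegative rationals, so every term
    vanishes; choosing [th c = 1] removes the eigenvalue [c]. *)
Lemma nilp_of_theta X E : uniq E -> kills E X ->
  (forall th, rat_functional th -> \tr (X * spfun E th X) = 0) -> X ^+ n.+1 = 0.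
Proof.
move=> uE kX H; apply: (nilp_of_spidem uE kX) => c cE c0.
have [th [thD thZ thQ] thc] := rat_functional_exists c0.
have := H th (And3 thD thZ thQ); rewrite (trace_mul_spfun uE kX).
have th0 : th 0 = 0 by have := thZ 0 0; rewrite rmorph0 !mul0r.
move=> /(congr1 th); rewrite th0.
rewrite (big_morph th thD th0) => S0.
have trE x : exists k : nat, \tr (spidem E X x) = k%:R.
  by exists (\rank (spidem E X x)); exact: trace_spidem.
have thE x : th (x * th x * \tr (spidem E X x)) = th x ^+ 2 * \tr (spidem E X x).
  have [r thx] := thQ x; have [k ->] := trE x.
  rewrite thx -[k%:R](ratr_nat K) -mulrA mulrC -rmorphM /= thZ thx rmorphM /=; ring.
have thR x : 0 <= th x ^+ 2 * \tr (spidem E X x).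
  have [r ->] := thQ x; have [k ->] := trE x.
  by rewrite mulr_ge0// -rmorphXn /= ler0q sqr_ge0.
move: S0; under eq_bigr do rewrite thE.
move=> /eqP; rewrite psumr_eq0; last by move=> x _; exact: thR.
by move=> /allP/(_ _ cE); rewrite thc expr1n mul1r => /eqP.
Qed.

Lemma nilp_of_traces X : (forall k, \tr (X ^+ k.+1) = 0) -> X ^+ n.+1 = 0.
Proof.
move=> H; have [E uE [kX _]] := spectrum X.
(* The point 0 is added to the nodes so that the polynomial giving the projector of [c] has no
   constant term and involves only positive powers of [X]. *)
have kX' : kills (undup (0 :: E)) X.
  by apply: kills_sub kX => // b bE; rewrite mem_undup inE bE orbT.
apply: (nilp_of_spidem (undup_uniq _) kX') => c cE c0.
set p := interp n (undup (0 :: E)) (fun x => (x == c)%:R).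
have p0 : p`_0 = 0.
  have := interpP n (fun x => (x == c)%:R) (undup_uniq (0 :: E)).
  move=> /(_ 0); rewrite mem_undup mem_head eq_sym (negPf c0) subr0 => /(_ isT).
  rewrite -/p subr0 exprS => /dvdpP[q ->].
  by rewrite coefM big_ord1 coef0M coefX /= !mul0r mulr0.
rewrite /spidem /spfun -/p -[p]coefK poly_def rmorph_sum /= raddf_sum /=.
apply: big1 => -[[|i] /= ip] _; first by rewrite p0 scale0r rmorph0 mxtrace0.
by rewrite -mul_polyC rmorphM /= horner_mx_C rmorphXn /= horner_mx_X -mulmxE mul_scalar_mx linearZ /= H mulr0.
Qed.

End NilpotenceCriteria.

(** * Places on algebras of functions *)

Section Places.
Variables (K : closedFieldType) (I : Type).
Implicit Types (P : set ((I -> K) * K)) (u v w : I -> K).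

(* The graph of a ring morphism to [K], defined on a ring of functions containing
   the constants.  The maximal ones behave as places, see [limit_dichotomy]. *)
Definition limit_graph P : Prop :=
  [/\ forall a, P (fun=> a, a),
      forall u v a b, P (u, a) -> P (v, b) -> P (u \+ v, a + b),
      forall u v a b, P (u, a) -> P (v, b) -> P (u \* v, a * b) &
      forall a, P (fun=> 0, a) -> a = 0].

(** A polynomial over the domain of the morphism together with its image [r]. The uniform bound [d]
    makes evaluation a finite sum of members of the graph. *)
Definition poly_graph P (d : nat) (q : I -> {poly K}) (r : {poly K}) : Prop :=
  [/\ forall x, (size (q x) <= d)%N, (size r <= d)%N &
      forall i, P (fun x => (q x)`_i, r`_i)].

Section Graph.
Variable P : set ((I -> K) * K).
Hypothesis limP : limit_graph P.

Lemma limit_cst a : P (fun=> a, a). Proof. by case: limP. Qed.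
Lemma limitD u v a b : P (u, a) -> P (v, b) -> P (u \+ v, a + b).
Proof. by case: limP => _ + _ _; exact. Qed.
Lemma limitM u v a b : P (u, a) -> P (v, b) -> P (u \* v, a * b).
Proof. by case: limP => _ _ + _; exact. Qed.

Lemma limit_ext u v a b : P (u, a) -> u =1 v -> a = b -> P (v, b).
Proof. by move=> Pu /funext <- <-. Qed.

Lemma limitN u a : P (u, a) -> P (fun x => - u x, - a).
Proof.
move=> /(limitM (limit_cst (-1)))/limit_ext; apply; last by rewrite mulN1r.
by move=> x /=; rewrite mulN1r.
Qed.

Lemma limit_unique u a b : P (u, a) -> P (u, b) -> a = b.
Proof.
move=> Pa /limitN /(limitD Pa) /limit_ext H.
apply/eqP; rewrite -subr_eq0; apply/eqP.
case: limP => _ _ _; apply; apply: H => // x /=; exact: subrr.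
Qed.

Lemma limit_sum (J : Type) (s : seq J) (Q : pred J) (u : J -> I -> K) (a : J -> K) :
  (forall j, Q j -> P (u j, a j)) ->
  P (fun x => \sum_(j <- s | Q j) u j x, \sum_(j <- s | Q j) a j).
Proof.
move=> H; elim: s => [|j s IH].
  by apply: (limit_ext (limit_cst 0)) => [x|]; rewrite big_nil.
have [Qj|nQj] := boolP (Q j); last first.
  by apply: (limit_ext IH) => [x|]; rewrite big_cons (negPf nQj).
by apply: (limit_ext (limitD (H _ Qj) IH)) => [x|]; rewrite big_cons Qj.
Qed.

Lemma limitX u a k : P (u, a) -> P (fun x => u x ^+ k, a ^+ k).
Proof.
move=> Pu; elim: k => [|k IH]; first exact: limit_cst.
by apply: (limit_ext (limitM Pu IH)) => [x|] /=; rewrite exprS.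
Qed.

Lemma poly_graph_horner d q r u a : poly_graph P d q r -> P (u, a) ->
  P (fun x => (q x).[u x], r.[a]).
Proof.
move=> [sq sr Pq] Pu.
have H (i : 'I_d) : true -> P (fun x => (q x)`_i * u x ^+ i, r`_i * a ^+ i).
  by move=> _; apply: limitM (Pq i) (limitX _ Pu).
apply: (limit_ext (limit_sum (index_enum 'I_d) H)) => [x|];
  by rewrite (@horner_coef_wide _ d).
Qed.

Lemma limit0 a : P (fun=> 0, a) -> a = 0. Proof. by case: limP => _ _ _; exact. Qed.

Lemma limit_zero u a : (forall x, u x = 0) -> P (u, a) -> a = 0.
Proof. by move=> u0 Pu; apply/limit0/(limit_ext Pu). Qed.

End Graph.

Definition adjoin P u (a : K) : set ((I -> K) * K) :=
  [set z : (I -> K) * K | exists d q r, [/\ poly_graph P d q r, z.1 =1 (fun x => (q x).[u x]) & z.2 = r.[a]]].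

Section Adjoin.
Variable P : set ((I -> K) * K).
Hypothesis limP : limit_graph P.
Variables (u : I -> K) (a : K).

Lemma poly_graphC v b : P (v, b) -> poly_graph P 1 (fun x => (v x)%:P) b%:P.
Proof.
move=> Pv; split=> [x||i]; rewrite ?size_polyC_leq1// coefC.
case: i => [|i]; first by apply: (limit_ext Pv) => [x|]; rewrite ?coefC.
by apply: (limit_ext (limit_cst limP 0)) => [x|]; rewrite ?coefC.
Qed.

Lemma poly_graphD d q r d' q' r' : poly_graph P d q r -> poly_graph P d' q' r' ->
  poly_graph P (maxn d d') (fun x => q x + q' x) (r + r').
Proof.
move=> [sq sr Pq] [sq' sr' Pq']; split=> [x||i].
- by rewrite (leq_trans (size_polyD _ _))// geq_max !leq_max sq sq' orbT.
- by rewrite (leq_trans (size_polyD _ _))// geq_max !leq_max sr sr' orbT.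
- by apply: (limit_ext (limitD limP (Pq i) (Pq' i))) => [x|]; rewrite coefD.
Qed.

Lemma poly_graphM d q r d' q' r' : poly_graph P d q r -> poly_graph P d' q' r' ->
  poly_graph P (d + d') (fun x => q x * q' x) (r * r').
Proof.
move=> [sq sr Pq] [sq' sr' Pq']; split=> [x||i].
- rewrite (leq_trans (size_polyMleq _ _))// (leq_trans (leq_pred _))//.
  by rewrite leq_add.
- rewrite (leq_trans (size_polyMleq _ _))// (leq_trans (leq_pred _))//.
  by rewrite leq_add.
- have H (j : 'I_i.+1) : true -> P (fun x => (q x)`_j * (q' x)`_(i - j), r`_j * r'`_(i - j)).
    by move=> _; exact: (limitM limP (Pq j) (Pq' _)).
  by apply: (limit_ext (limit_sum limP (index_enum _) H)) => [x|]; rewrite coefM.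
Qed.

Lemma poly_graphX : poly_graph P 2 (fun=> 'X) 'X.
Proof.
split=> [x||i]; rewrite ?size_polyX//.
by apply: (limit_ext (limit_cst limP 'X`_i)).
Qed.

Lemma adjoin_limit : (forall d q r, poly_graph P d q r ->
   (forall x, (q x).[u x] = 0) -> r.[a] = 0) -> limit_graph (adjoin P u a).
Proof.
move=> H; split=> [b|v w b b'|v w b b'|b].
- exists 1%N, (fun=> b%:P), b%:P; split; first exact: (poly_graphC (limit_cst limP b)).
    by move=> x; rewrite hornerC.
  by rewrite hornerC.
- move=> [d [q [r [Pq vE bE]]]] [d' [q' [r' [Pq' wE bE']]]].
  exists (maxn d d'), (fun x => q x + q' x), (r + r'); split; first exact: poly_graphD.
    by move=> x /=; rewrite hornerD -vE -wE.
  by rewrite hornerD -bE -bE'.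
- move=> [d [q [r [Pq vE bE]]]] [d' [q' [r' [Pq' wE bE']]]].
  exists (d + d')%N, (fun x => q x * q' x), (r * r'); split; first exact: poly_graphM.
    by move=> x /=; rewrite hornerM -vE -wE.
  by rewrite hornerM -bE -bE'.
- move=> [d [q [r [Pq vE /= ->]]]]; apply: H Pq _ => x; exact/esym/vE.
Qed.

Lemma adjoin_sub : P `<=` adjoin P u a.
Proof.
move=> [v b] Pv; exists 1%N, (fun x => (v x)%:P), b%:P.
by split=> [|x|] /=; rewrite ?hornerC//; exact: poly_graphC.
Qed.

Lemma adjoin_mem : adjoin P u a (u, a).
Proof.
exists 2%N, (fun=> 'X), 'X; split=> [|x|] /=; rewrite ?hornerX//.
exact: poly_graphX.
Qed.

End Adjoin.

Definition maximal_graph P : Prop :=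
  limit_graph P /\ forall P', limit_graph P' -> P `<=` P' -> P' `<=` P.

Lemma maximal_graph_exists P0 : limit_graph P0 ->
  exists2 P, maximal_graph P & P0 `<=` P.
Proof.
move=> lim0; pose Pred P := P = set0 \/ (limit_graph P /\ P0 `<=` P).
have [F FP Ftot|P [[P_0|[lP sP]] Pmax]] := @Zorn_bigcup _ Pred.
- have [[X FX [x Xx]]|nX] := pselect (exists2 X, F X & X !=set0); last first.
    left; apply/seteqP; split=> // x [X FX Xx]; apply: nX; exists X => //.
    by exists x.
  have nz Y y : F Y -> Y y -> limit_graph Y /\ P0 `<=` Y.
    by move=> FY Yy; have [Y0|//] := FP _ FY; rewrite Y0 in Yy.
  have [lX sX] := nz _ _ FX Xx.
  have common y z : (\bigcup_(X in F) X) y -> (\bigcup_(X in F) X) z ->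
      exists Y, [/\ F Y, Y y, Y z & limit_graph Y].
    move=> [Y FY Yy] [Z FZ Zz]; have [YZ|ZY] := Ftot _ _ FY FZ.
      by exists Z; split=> //; [exact: YZ|have [] := nz _ _ FZ Zz].
    by exists Y; split=> //; [exact: ZY|have [] := nz _ _ FY Yy].
  right; split; last by move=> y P0y; exists X => //; exact: sX.
  split=> [a|u v a b Hu Hv|u v a b Hu Hv|a [Y FY Ya]].
  + by exists X => //; exact: limit_cst.
  + by have [Y [FY Yu Yv lY]] := common _ _ Hu Hv; exists Y => //; exact: (limitD lY).
  + by have [Y [FY Yu Yv lY]] := common _ _ Hu Hv; exists Y => //; exact: (limitM lY).
  + by have [lY _] := nz _ _ FY Ya; exact: (limit0 lY).
- exfalso; apply: (Pmax P0); last by right; split.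
  rewrite P_0; split=> // H; have : P0 (fun=> 0, 0) by exact: limit_cst.
  by move=> /H.
- exists P => //; split=> // P' lP' PP'; apply: contrapT => nP'P.
  by apply: (Pmax P'); [split|right; split=> // z /sP; exact: PP'].
Qed.

Section Maximal.
Variable P : set ((I -> K) * K).
Hypothesis maxP : maximal_graph P.
Let limP : limit_graph P := maxP.1.

(** The images of the relations satisfied by [u] form an ideal of [{poly K}]. If it is proper it has
    a zero [a], since [K] is algebraically closed; sending [u] to [a] extends the morphism, which is
    maximal. If it contains 1, the second alternative holds. *)
Lemma maximal_relation u : (exists a, P (u, a)) \/
  exists d q, poly_graph P d q 1 /\ forall x, (q x).[u x] = 0.
Proof.
pose c := [set r : {poly K} | exists d q, poly_graph P d q r /\ forall x, (q x).[u x] = 0].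
have [c1|nc1] := pselect (c 1).
  by right; have [d [q Hq]] := c1; exists d, q.
left.
have cM r s : c r -> c (s * r).
  move=> [d [q [Pq qu]]]; exists (size s + d)%N, (fun x => s * q x); split.
    apply: (poly_graphM limP) Pq; split=> // i.
    by apply: (limit_ext (limit_cst limP s`_i)).
  by move=> x; rewrite hornerM qu mulr0.
have cD r s : c r -> c s -> c (r + s).
  move=> [d [q [Pq qu]]] [d' [q' [Pq' qu']]]; exists (maxn d d'), (fun x => q x + q' x).
  by split=> [|x]; [exact: (poly_graphD limP)|rewrite hornerD qu qu' addr0].
have [a Ha] : exists a, forall r, c r -> r.[a] = 0.
  have [[r0 cr0 r00]|nr] := pselect (exists2 r, c r & r != 0); last first.
    exists 0 => r cr; have [->|r0] := eqVneq r 0; first by rewrite horner0.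
    by exfalso; apply: nr; exists r.
  pose Q d := `[< exists r, [/\ c r, r != 0 & size r = d] >].
  have exQ : exists d, Q d by exists (size r0); apply/asboolP; exists r0.
  have [d /asboolP[r [cr rn0 sr]] dmin] := ex_minnP exQ.
  have [r1|r1] := eqVneq (size r) 1.
    exfalso; apply: nc1; move/eqP: r1 => /size_poly1P[b b0 rE].
    have := cM r (b^-1)%:P cr.
    by rewrite rE -polyCM mulVf.
  have [a ra] := closed_rootP r r1.
  exists a => s cs; have rs : c (s %% r).
    have -> : s %% r = s + (- (s %/ r)) * r.
      by rewrite {2}(divp_eq s r) mulNr addrAC subrr add0r.
    by apply: cD => //; exact: cM.
  have s0 : s %% r = 0.
    apply: contrapT => /eqP sr0; have := dmin (size (s %% r)).
    rewrite leqNgt -sr ltn_modp rn0 => H; apply/notF/H/asboolP.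
    by exists (s %% r).
  by rewrite (divp_eq s r) s0 addr0 hornerM (rootP ra) mulr0.
exists a; apply: (maxP.2 (adjoin P u a)); last exact: (adjoin_mem limP).
- by apply: (adjoin_limit limP) => d q r Pq qu; apply: Ha; exists d, q.
- exact: (adjoin_sub limP).
Qed.

(** Functions on [I] have zero divisors, and an indicator function tells on which part of [I] the
    place lives. In the second case of [maximal_relation], the values of the relation at 0 and 1
    have product 0 everywhere but limit 1. *)
Lemma limit_idem e : (forall x, e x = 0 \/ e x = 1) -> P (e, 0) \/ P (e, 1).
Proof.
move=> e01; have [[a Pa]|[d [q [Pq qe]]]] := maximal_relation e.
  have : P (fun=> 0, a * a - a).
    apply: (limit_ext (limitD limP (limitM limP Pa Pa) (limitN limP Pa))) => // x /=.
    by have [->|->] := e01 x; rewrite ?mulr0 ?mulr1 subrr.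
  move=> /(limit0 limP)/eqP; rewrite -{3}(mulr1 a) -mulrBr mulf_eq0 subr_eq0.
  by move=> /orP[] /eqP aE; [left|right]; rewrite -aE.
exfalso; have H0 := poly_graph_horner limP Pq (limit_cst limP 0).
have H1 := poly_graph_horner limP Pq (limit_cst limP 1).
have := limitM limP H0 H1; rewrite !hornerC mulr1 => /(limit_zero limP) H.
case/eqP: (oner_neq0 K); apply: H => x /=.
by have := qe x; have [->|->] := e01 x => ->; rewrite ?mul0r ?mulr0.
Qed.

Lemma limit_null u e : (forall x, u x = u x * e x) -> P (e, 0) -> P (u, 0).
Proof.
move=> ue Pe; have [[a Pa]|[d [q [Pq qu]]]] := maximal_relation u.
  apply: (limit_ext Pa) => //.
  have := limit_ext (limitM limP Pa Pe) (fun x => esym (ue x)) erefl.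
  by move=> /(limit_unique limP Pa); rewrite mulr0.
exfalso; have [_ _ /(_ 0%N) Pq0] := Pq; rewrite coefC eqxx in Pq0.
have := limitM limP Pq0 (limitD limP (limit_cst limP 1) (limitN limP Pe)).
rewrite subr0 mulr1 => /(limit_zero limP) H.
case/eqP: (oner_neq0 K); apply: H => x /=.
have [->|e1] := eqVneq (e x) 1; first by rewrite subrr mulr0.
have ux : u x = 0.
  have /eqP : u x * (1 - e x) = 0 by rewrite mulrBr mulr1 -ue subrr.
  by rewrite mulf_eq0 subr_eq0 [_ == e x]eq_sym (negPf e1) orbF => /eqP.
by have := qu x; rewrite ux horner_coef0 => ->; rewrite mul0r.
Qed.

(** As [0^-1 = 0], the quotient of [u] by itself is the indicator of the points where [u] does not
    vanish. *)
Lemma indicator_inv u x : u x * (u x)^-1 = 0 \/ u x * (u x)^-1 = 1.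
Proof.
have [->|ux] := eqVneq (u x) 0; first by left; rewrite mul0r.
by right; rewrite divff.
Qed.

Let rel u d := exists q, poly_graph P d.+1 q 1 /\ forall x, (q x).[u x] = 0.

(** The descent by which maximal morphisms are shown to come from valuation rings. Multiplied by a
    power of [u], the relation of the inverse cancels the leading term of the relation of [u]. The
    constant coefficient still tends to 1, because the leading coefficient tends to 0. *)
Lemma rel_descent u l k : (l <= k)%N -> P (fun x => u x * (u x)^-1, 1) ->
  rel u k -> rel (fun x => (u x)^-1) l -> exists2 k', (k' < k)%N & rel u k'.
Proof.
move=> lk Pe [q [Pq qu]] [q' [Pq' qu']].
have Pq_ i : P (fun x => (q x)`_i, (i == 0%N)%:R).
  have [_ _ /(_ i)] := Pq; rewrite coefC; by case: (i == 0%N).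
have Pq'_ i : P (fun x => (q' x)`_i, (i == 0%N)%:R).
  have [_ _ /(_ i)] := Pq'; rewrite coefC; by case: (i == 0%N).
have sq x : (size (q x) <= k.+1)%N by case: Pq.
have sq' x : (size (q' x) <= l.+1)%N by case: Pq'.
case: k => [|k] in lk Pq sq *.
  have /(limit_zero limP) := Pq_ 0%N; rewrite eqxx => H; exfalso.
  case/eqP: (oner_neq0 K); apply: H => x /=.
  by have := qu x; rewrite (@horner_coef_wide _ 1)// big_ord1 expr0 mulr1.
exists k => //.
(* The last factor switches off the second term where [u] vanishes; there the constant coefficient
   of [q x] is already 0. *)
pose s x i := (q x)`_i * (q' x)`_0 - (q x)`_k.+1 * (q' x)`_(k.+1 - i) * (u x * (u x)^-1).
have Ps i : (i <= k)%N -> P (fun x => s x i, (i == 0%N)%:R).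
  move=> ik; have := limitM limP (limitM limP (Pq_ k.+1) (Pq'_ (k.+1 - i)%N)) Pe.
  move=> /(limitN limP)/(limitD limP (limitM limP (Pq_ i) (Pq'_ 0%N)))/limit_ext; apply=> //.
  by rewrite eqxx !mulr1 [(k.+1 == 0%N)%:R]/(0%:R) mul0r subr0.
exists (fun x => \poly_(i < k.+1) s x i); split.
  split=> [x||i]; rewrite ?size_poly// ?size_poly1//.
  rewrite coefC; have [ik|ki] := leqP i k.
    apply: (limit_ext (Ps i ik)) => [x|]; last by case: (i == 0%N).
    by rewrite coef_poly ltnS ik.
  rewrite gtn_eqF ?(leq_trans _ ki)//.
  by apply: (limit_ext (limit_cst limP 0)) => // x; rewrite coef_poly ltnS leqNgt ki.
move=> x; rewrite horner_poly.
have := qu x; have := qu' x; rewrite (@horner_coef_wide _ k.+2 (q' x)); last first.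
  exact: leq_trans (sq' x) _.
rewrite (@horner_coef_wide _ k.+2)//; set a := u x.
move=> S' S; have [a0|a0] := eqVneq a 0.
  rewrite big_ord_recl big1 => [|i _]; last by rewrite a0 expr0n mulr0.
  rewrite /s -/a a0 !mul0r mulr0 subr0 expr0 mulr1 addr0.
  have -> : (q x)`_(@ord0 k) = 0; last by rewrite mul0r.
  rewrite -[RHS]S big_ord_recl big1 => [|i _]; last by rewrite a0 expr0n mulr0.
  by rewrite expr0 mulr1 addr0.
have S2 : \sum_(i < k.+2) (q' x)`_(k.+1 - i) * a ^+ i = 0.
  rewrite (reindex_inj rev_ord_inj) /=.
  rewrite -[RHS](mulr0 (a ^+ k.+1)) -[in RHS]S' mulr_sumr; apply: eq_bigr => i _.
  rewrite subSS subKn -1?ltnS// mulrCA; congr (_ * _).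
  by rewrite exprVn -expfB_cond ?(negPf a0) ?add0n -1?ltnS// subSS.
have E1 : \sum_(i < k.+1) s x i * a ^+ i =
   \sum_(i < k.+2) (q x)`_i * a ^+ i * (q' x)`_0
   - (q x)`_k.+1 * \sum_(i < k.+2) (q' x)`_(k.+1 - i) * a ^+ i.
  rewrite !(big_ord_recr k.+1) /= subnn mulrDr opprD addrACA -[LHS]addr0; congr (_ + _); last first.
    by apply/esym/eqP; rewrite subr_eq0; apply/eqP; ring.
  rewrite mulr_sumr -sumrB; apply: eq_bigr => i _.
  by rewrite /s -/a divff// mulr1; ring.
by rewrite E1 S2 mulr0 subr0 -mulr_suml S mul0r.
Qed.

(** If [u] has no limit it satisfies a relation with image 1. If the inverse has a limit [b],
    dividing this relation by a power of [u] forces [b = 0]; if it has none, it satisfies such a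
    relation too, and [rel_descent] lowers the two degrees forever. *)
Lemma limit_dichotomy u : (exists a, P (u, a)) \/ P (fun x => (u x)^-1, 0).
Proof.
pose w x := (u x)^-1.
have uw x : u x = (w x)^-1 by rewrite invrK.
have e01 := indicator_inv u.
have [?|[d [q [Pq qu]]]] := maximal_relation u; first by left.
have [Pe|Pe] := limit_idem e01.
  left; exists 0; apply: limit_null Pe => x.
  by have [->|ux] := eqVneq (u x) 0; rewrite ?mul0r// divff ?mulr1.
have toRel v d' q' : poly_graph P d' q' 1 -> (forall x, (q' x).[v x] = 0) -> rel v d'.
  move=> [sq' _ Pq'] qv'; exists q'; split=> //; split=> // [x|].
    exact: leq_trans (sq' x) _.
  by rewrite size_poly1.
have [[b Pb]|[d' [q' [Pq' qu']]]] := maximal_relation w.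
  have [b0|b0] := eqVneq b 0; first by right; rewrite -b0.
  exfalso.
  have [sq sr Pq_] := Pq.
  have H (i : 'I_d) : true -> P (fun x => (q x)`_i * w x ^+ (d - i) * (u x * w x),
      (1 : {poly K})`_i * b ^+ (d - i) * 1).
    by move=> _; exact: (limitM limP (limitM limP (Pq_ i) (limitX limP (d - i) Pb)) Pe).
  have := limit_sum limP (index_enum 'I_d) H => /(limit_zero limP) Z.
  have d0 : (0 < d)%N by rewrite (leq_trans _ sr)// size_poly1.
  case: d => // k in Pq sq sr Pq_ H Z d0 *.
  have bd : b ^+ k.+1 != 0 by rewrite expf_neq0.
  case/eqP: bd; rewrite -[RHS]Z => [|x].
    rewrite big_ord_recl big1 => [|i _]; last by rewrite coefC /= !mul0r.
    by rewrite coefC /= mul1r mulr1 addr0.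
  have [ux0|ux0] := eqVneq (u x) 0.
    by rewrite big1// => i _; rewrite ux0 mul0r mulr0.
  rewrite -[RHS](mulr0 (w x ^+ k.+1)) -[in RHS](qu x) (@horner_coef_wide _ k.+1)//.
  rewrite mulr_sumr; apply: eq_bigr => i _; rewrite divff// mulr1 mulrCA; congr (_ * _).
  have E : (k.+1 = k.+1 - i + i)%N by rewrite subnK// ltnW.
  by rewrite [w x ^+ k.+1](congr1 (GRing.exp (w x)) E) exprD -mulrA -exprMn mulVf// expr1n mulr1.
exfalso.
have Pe' : P (fun x => w x * (w x)^-1, 1).
  by apply: (limit_ext Pe) => // x; rewrite invrK mulrC.
suff noRel : forall N k l, (k + l <= N)%N -> rel u k -> rel w l -> False.
  by apply: (noRel _ _ _ (leqnn _) (toRel _ _ _ Pq qu) (toRel _ _ _ Pq' qu')).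
elim=> [|N IH] k l kl ruk rwl.
  have [lk|/ltnW lk] := leqP l k.
    have [k' kk' _] := rel_descent lk Pe ruk rwl.
    by move: kl; rewrite leqn0 addn_eq0 => /andP[/eqP k0]; rewrite k0 in kk'.
  have ruk' : rel (fun x => (w x)^-1) k by move: ruk; rewrite (_ : u = fun x => (w x)^-1)//; apply/funext.
  have [k' kk' _] := rel_descent lk Pe' rwl ruk'.
  by move: kl; rewrite leqn0 addn_eq0 => /andP[_ /eqP k0]; rewrite k0 in kk'.
have [lk|/ltnW lk] := leqP l k.
  have [k' kk' ruk'] := rel_descent lk Pe ruk rwl.
  by apply: (IH k' l) => //; rewrite -ltnS (leq_trans _ kl)// ltn_add2r.
have ruk' : rel (fun x => (w x)^-1) k by move: ruk; rewrite (_ : u = fun x => (w x)^-1)//; apply/funext.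
have [l' ll' rwl'] := rel_descent lk Pe' rwl ruk'.
by apply: (IH k l') => //; rewrite -ltnS (leq_trans _ kl)// ltn_add2l.
Qed.

Lemma limit_ae e u v a : P (e, 1) -> (forall x, e x * u x = e x * v x) ->
  P (u, a) -> P (v, a).
Proof.
move=> Pe H Pu; have Pe' := limitD limP (limit_cst limP 1) (limitN limP Pe).
rewrite subrr in Pe'; have : P (fun x => v x - u x, 0).
  apply: limit_null Pe' => x /=.
  rewrite mulrDr mulr1 mulrN -[LHS]addr0; congr (_ + _); apply/esym/eqP.
  by rewrite oppr_eq0 mulrC mulrBr H subrr.
move=> /(limitD limP Pu)/limit_ext; apply; last by rewrite addr0.
by move=> x /=; rewrite addrC subrK.
Qed.

(** The quotient of [v] by [w] is finite at the place. The factor [e], of limit 1, hides a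
    negligible part of [I] on which [w] may vanish. *)
Let dominates v w := exists e t a,
  [/\ P (e, 1), P (t, a) & forall x, e x * v x = e x * (t x * w x)].

Let dominates_trans u v w : dominates u v -> dominates v w -> dominates u w.
Proof.
move=> [e [t [a [Pe Pt H]]]] [e' [t' [a' [Pe' Pt' H']]]].
exists (e \* e'), (t \* t'), (a * a'); split.
- by apply: (limit_ext (limitM limP Pe Pe')) => //; rewrite mulr1.
- exact: (limitM limP Pt Pt').
- move=> x /=; transitivity (e' x * (e x * u x)); first by ring.
  rewrite H; transitivity (e x * t x * (e' x * v x)); first by ring.
  by rewrite H'; ring.
Qed.

Let dominates_total v w : dominates v w \/ dominates w v.
Proof.
pose ind (f : I -> K) x := f x * (f x)^-1.
have zero f g : P (ind f, 0) -> dominates f g.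
  move=> Pf; exists (fun x => 1 - ind f x), (fun=> 0), 0; split.
  - have := limitD limP (limit_cst limP 1) (limitN limP Pf).
    by rewrite subr0.
  - exact: limit_cst.
  - move=> x; rewrite mul0r mulr0 mulrBl mul1r /ind.
    by have [->|fx] := eqVneq (f x) 0; rewrite ?mulr0 ?subr0// divff// mul1r subrr.
have quot f g a : P (ind g, 1) -> P (fun x => f x / g x, a) -> dominates f g.
  move=> Pg Pfg; exists (ind g), (fun x => f x / g x), a; split=> // x.
  rewrite /ind; have [->|gx] := eqVneq (g x) 0; first by rewrite !mul0r.
  by rewrite divfK.
have [Pw|Pw] := limit_idem (indicator_inv w); first by right; exact: zero.
have [Pv|Pv] := limit_idem (indicator_inv v); first by left; exact: zero.
have [[a Pa]|Pa] := limit_dichotomy (fun x => v x / w x).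
  by left; exact: quot Pa.
right; apply: (quot _ _ 0) => //; apply: (limit_ext Pa) => // x.
by rewrite invf_div.
Qed.

(** A coordinate that dominates all the others is chosen and divided out, as when homogeneous
    coordinates are reduced modulo a valuation. *)
Lemma limit_pivot (J : finType) (v : J -> I -> K) : (forall x, exists j, v j x != 0) ->
  exists2 k, P (fun x => v k x / v k x, 1) &
    forall j, exists a, P (fun x => v j x / v k x, a).
Proof.
move=> nz; have [k Hk] : exists k, forall j, dominates (v j) (v k).
  suff H (s : seq J) : s != [::] -> exists k, forall j, j \in s -> dominates (v j) (v k).
    have [|k Hk] := H (enum J).
      have [[x _]|nI] := pselect (exists x : I, True).
        have [j _] := nz x; apply: contraTneq (mem_enum J j) => ->.
        by rewrite inE.
      case/eqP: (oner_neq0 K); apply: (limit_zero limP _ (limit_cst limP 1)) => x.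
      by exfalso; apply: nI; exists x.
    by exists k => j; apply: Hk; rewrite mem_enum.
  elim: s => [//|j s IH] _.
  have refl u : dominates u u.
    exists (fun=> 1), (fun=> 1), 1; split; try exact: limit_cst.
    by move=> x; rewrite !mul1r.
  have [->|/IH[k Hk]] := eqVneq s [::]; first by exists j => i; rewrite inE => /eqP ->.
  have [jk|kj] := dominates_total (v j) (v k).
    by exists k => i; rewrite inE => /predU1P[->//|/Hk].
  exists j => i; rewrite inE => /predU1P[->//|/Hk ik].
  exact: dominates_trans kj.
have Pk : P (fun x => v k x / v k x, 1).
  have [P0|//] := limit_idem (indicator_inv (v k)); exfalso.
  have [e He] := choice Hk.
  have He1 j : j \in enum J -> true -> P (e j, 1) by have [t [a []]] := He j.
  have Pprod (s : seq J) : P (fun x => \prod_(j <- s) e j x, 1).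
    elim: s => [|j s IH].
      by apply: (limit_ext (limit_cst limP 1)) => // x; rewrite big_nil.
    have [t [a [Pe _ _]]] := He j.
    by apply: (limit_ext (limitM limP Pe IH)) => [x|]; rewrite ?big_cons// mulr1.
  have Pc := limitD limP (limit_cst limP 1) (limitN limP P0).
  have := limitM limP (Pprod (enum J)) Pc.
  rewrite subr0 mulr1 => /(limit_zero limP) H; case/eqP: (oner_neq0 K); apply: H => x /=.
  have [vk|vk] := eqVneq (v k x) 0; last by rewrite divff// subrr mulr0.
  have [j vj] := nz x; have [t [a [_ _ /(_ x)]]] := He j.
  rewrite vk mulr0 mulr0 => /eqP; rewrite mulf_eq0 (negPf vj) orbF => /eqP ej.
  by rewrite (big_rem j) ?mem_enum//= ej !mul0r.
exists k => // j; have [e [t [a [Pe Pt H]]]] := Hk j; exists a.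
have Pe1 : P (e \* (fun x => v k x / v k x), 1).
  by apply: (limit_ext (limitM limP Pe Pk)) => //; rewrite mulr1.
apply: (limit_ae Pe1) Pt => x /=.
have [->|vk] := eqVneq (v k x) 0; first by rewrite !mul0r mulr0 !mul0r.
by rewrite divff// !mulr1 mulrA H mulrA mulfK.
Qed.

Definition mxlimit p q (xi : I -> 'M[K]_(p, q)) (X : 'M[K]_(p, q)) : Prop :=
  forall i j, P (fun x => xi x i j, X i j).

Lemma mxlimit_cst p q (X : 'M[K]_(p, q)) : mxlimit (fun=> X) X.
Proof. by move=> i j; exact: limit_cst. Qed.

Lemma mxlimitD p q (xi xi' : I -> 'M[K]_(p, q)) X X' :
  mxlimit xi X -> mxlimit xi' X' -> mxlimit (fun x => xi x + xi' x) (X + X').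
Proof.
move=> H H' i j; apply: (limit_ext (limitD limP (H i j) (H' i j))) => [x|];
  by rewrite mxE.
Qed.

Lemma mxlimitZ p q u a (xi : I -> 'M[K]_(p, q)) X :
  P (u, a) -> mxlimit xi X -> mxlimit (fun x => u x *: xi x) (a *: X).
Proof.
move=> Pu H i j; apply: (limit_ext (limitM limP Pu (H i j))) => [x|];
  by rewrite mxE.
Qed.

Lemma mxlimitM p q r (xi : I -> 'M[K]_(p, q)) (xi' : I -> 'M[K]_(q, r)) X X' :
  mxlimit xi X -> mxlimit xi' X' -> mxlimit (fun x => xi x *m xi' x) (X *m X').
Proof.
move=> H H' i j.
have S k : true -> P (fun x => xi x i k * xi' x k j, X i k * X' k j).
  by move=> _; exact: (limitM limP (H i k) (H' k j)).
by apply: (limit_ext (limit_sum limP (index_enum _) S)) => [x|]; rewrite mxE.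
Qed.

Lemma mxlimitN p q (xi : I -> 'M[K]_(p, q)) X :
  mxlimit xi X -> mxlimit (fun x => - xi x) (- X).
Proof.
by move=> H i j; apply: (limit_ext (limitN limP (H i j))) => [x|]; rewrite mxE.
Qed.

Lemma mxlimitB p q (xi xi' : I -> 'M[K]_(p, q)) X X' :
  mxlimit xi X -> mxlimit xi' X' -> mxlimit (fun x => xi x - xi' x) (X - X').
Proof. by move=> H H'; apply: mxlimitD => //; exact: mxlimitN. Qed.

Lemma mxlimit_sum p q (J : Type) (s : seq J) (xi : J -> I -> 'M[K]_(p, q)) X :
  (forall j, mxlimit (xi j) (X j)) ->
  mxlimit (fun x => \sum_(j <- s) xi j x) (\sum_(j <- s) X j).
Proof.
move=> H i j; have S k : true -> P (fun x => xi k x i j, X k i j) by move=> _; exact: H.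
by apply: (limit_ext (limit_sum limP s S)) => [x|]; rewrite summxE.
Qed.

Lemma mxlimit_trace p (xi : I -> 'M[K]_p) X : mxlimit xi X ->
  P (fun x => \tr (xi x), \tr X).
Proof.
move=> H; have S k : true -> P (fun x => xi x k k, X k k) by move=> _; exact: H.
exact: (limit_sum limP (index_enum _) S).
Qed.

Lemma mxlimit_unique p q (xi : I -> 'M[K]_(p, q)) X X' :
  mxlimit xi X -> mxlimit xi X' -> X = X'.
Proof. by move=> H H'; apply/matrixP => i j; exact: (limit_unique limP (H i j)). Qed.

Lemma eq_mxlimit p q (xi xi' : I -> 'M[K]_(p, q)) X :
  xi =1 xi' -> mxlimit xi X -> mxlimit xi' X.
Proof. by move=> /funext ->. Qed.

Lemma limit_vspace p q (U : I -> {vspace 'M[K]_(p, q)}) :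
  exists W : {vspace 'M[K]_(p, q)}, forall X, X \in W <->
    exists2 xi, (forall x, xi x \in U x) & mxlimit xi X.
Proof.
apply: set_vspace; first by exists (fun=> 0) => [x|]; [exact: mem0v|exact: mxlimit_cst].
move=> a X Y [xi Uxi Lxi] [zeta Uzeta Lzeta].
exists (fun x => a *: xi x + zeta x) => [x|]; first by rewrite memvD// memvZ.
by apply: mxlimitD => //; apply: mxlimitZ => //; exact: limit_cst.
Qed.

(** Completeness of the Grassmannian. A vector of [U x] is scaled so that a pivot entry tends to 1.
    Its limit is not a limit of vectors whose pivot entry vanishes, and these form subspaces of
    dimension at least [d], to which the induction applies. *)
Lemma limit_vspace_dim p q d (U : I -> {vspace 'M[K]_(p, q)}) (W : {vspace 'M[K]_(p, q)}) :
  (forall xi X, (forall x, xi x \in U x) -> mxlimit xi X -> X \in W) ->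
  (forall x, d <= \dim (U x))%N -> (d <= \dim W)%N.
Proof.
elim: d U W => [//|d IH] U W UW dU.
pose v x := vpick (U x).
have v0 x : v x != 0 by rewrite vpick0 -dimv_eq0 -lt0n (leq_trans _ (dU x)).
have [|[i j] Pk Plim] := @limit_pivot ('I_p * 'I_q)%type (fun k x => v x k.1 k.2).
  move=> x; have [k vk] : exists k : 'I_p * 'I_q, v x k.1 k.2 != 0.
    apply/existsP; rewrite -negb_forall; apply: contra (v0 x) => /forallP H.
    by apply/eqP/matrixP => i j; rewrite mxE; have /eqP := H (i, j).
  by exists k.
have [w Hw] := choice Plim.
pose wm : 'M[K]_(p, q) := \matrix_(a, b) w (a, b).
have wW : wm \in W.
  apply: (UW (fun x => (v x i j)^-1 *: v x)) => [x|a b].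
    by rewrite memvZ// memv_pick.
  by apply: (limit_ext (Hw (a, b))) => [x|]; rewrite !mxE// mulrC.
have w1 : wm i j = 1.
  by rewrite mxE; exact: (limit_unique limP (Hw (i, j)) Pk).
pose f : {linear 'M[K]_(p, q) -> 'M[K]_1} :=
  (mulmxr (delta_mx j 0) \o mulmx (delta_mx 0 i)).
have fE X : f X = (X i j)%:M.
  rewrite /f /= -rowE -colE; apply/matrixP => a b.
  by rewrite !mxE !ord1 eqxx.
pose U' x := (U x :&: lker (linfun f))%VS.
have U'E x X : (X \in U' x) = (X \in U x) && (X i j == 0).
  rewrite memv_cap memv_ker lfunE fE; congr (_ && _).
  apply/eqP/eqP => [/matrixP/(_ 0 0)|->]; last by rewrite raddf0.
  by rewrite !mxE eqxx.
have dU' x : (d <= \dim (U' x))%N.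
  have f1 : (\dim (linfun f @: U x) <= 1)%N.
    by rewrite (leq_trans (dimvS (subvf _)))// dimvf.
  rewrite -ltnS; apply: leq_trans (dU x) _.
  have <- := limg_ker_dim (linfun f) (U x).
  by rewrite -(addn1 (\dim (U' x))) leq_add2l.
have [W' W'E] := limit_vspace U'.
have dW' : (d <= \dim W')%N.
  by apply: IH dU' => xi X Uxi Lxi; apply/W'E; exists xi.
have W'W : (W' <= W)%VS.
  apply/subvP => X /W'E[xi Uxi Lxi]; apply: (UW xi) => // x.
  by have := Uxi x; rewrite U'E => /andP[].
have wW' : wm \notin W'.
  apply/negP => /W'E[xi Uxi Lxi]; case/eqP: (oner_neq0 K); rewrite -w1.
  apply: (limit_zero limP _ (Lxi i j)) => x.
  by have := Uxi x; rewrite U'E => /andP[_ /eqP].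
apply: (@leq_trans (\dim W').+1) => //.
have sW : (W' + <[wm]> <= W)%VS by rewrite subv_add W'W -memvE.
apply: leq_trans (dimvS sW); rewrite ltn_neqAle dimvS ?addvSl// andbT.
apply/eqP => dE; have /eqP E : (W' == W' + <[wm]>)%VS.
  by rewrite eqEdim addvSl -dE leqnn.
by move/negP: wW'; apply; rewrite E (subvP (addvSr _ _))// memv_line.
Qed.

End Maximal.
End Places.

(** * Polynomial functions and their derivatives *)

Section FunctionAlgebra.
Variables (K : comNzRingType) (T J : Type) (y : J -> T -> K).
Implicit Types f g : T -> K.

(** Polynomial expressions in the [y j], kept as functions on [T]: closure properties and changes of
    variables go by induction on the derivation, for any index type [J]. *)
Inductive alg : (T -> K) -> Prop :=
| alg_cst a : alg (fun=> a)
| alg_gen j : alg (y j)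
| alg_add f g : alg f -> alg g -> alg (fun x => f x + g x)
| alg_mul f g : alg f -> alg g -> alg (fun x => f x * g x).

Lemma alg_ext f g : alg f -> f =1 g -> alg g.
Proof. by move=> H /funext <-. Qed.

Lemma alg_opp f : alg f -> alg (fun x => - f x).
Proof.
by move=> H; apply: (alg_ext (alg_mul (alg_cst (-1)) H)) => x; rewrite mulN1r.
Qed.

Lemma alg_sub f g : alg f -> alg g -> alg (fun x => f x - g x).
Proof. by move=> Hf Hg; exact: (alg_add Hf (alg_opp Hg)). Qed.

Lemma alg_sum (I : Type) (s : seq I) (P : pred I) (f : I -> T -> K) :
  (forall i, P i -> alg (f i)) -> alg (fun x => \sum_(i <- s | P i) f i x).
Proof.
move=> H; elim: s => [|i s IH].
  by apply: (alg_ext (alg_cst 0)) => x; rewrite big_nil.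
case Pi: (P i).
  by apply: (alg_ext (alg_add (H i Pi) IH)) => x; rewrite big_cons Pi.
by apply: (alg_ext IH) => x; rewrite big_cons Pi.
Qed.

Lemma alg_prod (I : Type) (s : seq I) (P : pred I) (f : I -> T -> K) :
  (forall i, P i -> alg (f i)) -> alg (fun x => \prod_(i <- s | P i) f i x).
Proof.
move=> H; elim: s => [|i s IH].
  by apply: (alg_ext (alg_cst 1)) => x; rewrite big_nil.
case Pi: (P i).
  by apply: (alg_ext (alg_mul (H i Pi) IH)) => x; rewrite big_cons Pi.
by apply: (alg_ext IH) => x; rewrite big_cons Pi.
Qed.

Lemma alg_exp f k : alg f -> alg (fun x => f x ^+ k).
Proof.
move=> H; elim: k => [|k IH]; first by apply: (alg_ext (alg_cst 1)) => x.
by apply: (alg_ext (alg_mul H IH)) => x; rewrite exprS.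
Qed.

End FunctionAlgebra.

Lemma alg_comp (K : comNzRingType) (T U J J' : Type) (y : J -> T -> K)
    (z : J' -> U -> K) (h : U -> T) f :
  (forall j, alg z (fun u => y j (h u))) -> alg y f -> alg z (fun u => f (h u)).
Proof.
move=> H; elim=> [a|j|f1 g1 _ H1 _ H2|f1 g1 _ H1 _ H2]; first exact: alg_cst.
- exact: H.
- exact: (alg_add H1 H2).
- exact: (alg_mul H1 H2).
Qed.

Section PolynomialFunctions.
Variables (K : numFieldType).

Lemma poly_fun_inj (P Q : {poly K}) : (forall t, P.[t] = Q.[t]) -> P = Q.
Proof.
move=> H; apply/eqP; rewrite -subr_eq0; apply/eqP.
pose s := [seq k%:R : K | k <- iota 0 (size (P - Q))].
apply: (@roots_geq_poly_eq0 _ _ s); last by rewrite size_map size_iota.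
  by apply/allP => x _; rewrite rootE !hornerE H subrr.
rewrite map_inj_in_uniq ?iota_uniq// => i j _ _ /eqP.
by rewrite eqr_nat => /eqP.
Qed.

Variables (p q : nat).
Local Notation M := 'M[K]_(p, q).
Implicit Types (f g : M -> K) (A X Y : M).

Definition mxentry (k : 'I_p * 'I_q) A : K := A k.1 k.2.
Definition polyf : (M -> K) -> Prop := alg mxentry.

(** The restriction of [f] to a line. It is unique because [K] is infinite, and its coefficient of
    degree 1 is the directional derivative [lder]. *)
Definition line_poly f A X : {poly K} :=
  xget 0 [set P : {poly K} | forall t, P.[t] = f (A + t *: X)].
Definition lder f A X : K := (line_poly f A X)`_1.

Lemma line_polyE f A X (P : {poly K}) : (forall t, P.[t] = f (A + t *: X)) ->
  line_poly f A X = P.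
Proof.
move=> H; rewrite /line_poly; case: xgetP => [Q _ HQ|/(_ P) nP]; last by case: nP.
by apply: poly_fun_inj => t; rewrite HQ H.
Qed.

Lemma line_polyP f A X : polyf f -> forall t, (line_poly f A X).[t] = f (A + t *: X).
Proof.
move=> pf; suff [P HP] : exists P : {poly K}, forall t, P.[t] = f (A + t *: X).
  by rewrite (line_polyE HP).
elim: pf => [a|[i j]|f1 g1 _ [P HP] _ [Q HQ]|f1 g1 _ [P HP] _ [Q HQ]].
- by exists a%:P => t; rewrite hornerC.
- exists ((A i j)%:P + (X i j)%:P * 'X) => t.
  by rewrite !hornerE /mxentry !mxE mulrC.
- by exists (P + Q) => t; rewrite hornerD HP HQ.
- by exists (P * Q) => t; rewrite hornerM HP HQ.
Qed.

Lemma line_poly0 f A X : polyf f -> (line_poly f A X)`_0 = f A.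
Proof. by move=> pf; rewrite -horner_coef0 line_polyP// scale0r addr0. Qed.

Lemma lder_cst a A X : lder (fun=> a) A X = 0.
Proof. by rewrite /lder (@line_polyE _ _ _ a%:P) ?coefC// => t; rewrite hornerC. Qed.

Lemma lder_entry k A X : lder (mxentry k) A X = mxentry k X.
Proof.
rewrite /lder (@line_polyE _ _ _ ((mxentry k A)%:P + (mxentry k X)%:P * 'X)).
  by rewrite coefD coefC coefMX coefC /= add0r.
by move=> t; rewrite !hornerE /mxentry !mxE mulrC.
Qed.

Lemma lderD f g A X : polyf f -> polyf g ->
  lder (fun B => f B + g B) A X = lder f A X + lder g A X.
Proof.
move=> pf pg; rewrite /lder (@line_polyE _ _ _ (line_poly f A X + line_poly g A X)).
  by rewrite coefD.
by move=> t; rewrite hornerD !line_polyP.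
Qed.

Lemma lderM f g A X : polyf f -> polyf g ->
  lder (fun B => f B * g B) A X = lder f A X * g A + f A * lder g A X.
Proof.
move=> pf pg; rewrite /lder (@line_polyE _ _ _ (line_poly f A X * line_poly g A X)).
  by rewrite coefM !big_ord_recl big_ord0 /= addr0 !line_poly0// addrC.
by move=> t; rewrite hornerM !line_polyP.
Qed.

Lemma lderN f A X : polyf f -> lder (fun B => - f B) A X = - lder f A X.
Proof.
move=> pf; rewrite /lder (@line_polyE _ _ _ (- line_poly f A X)) ?coefN// => t.
by rewrite hornerN line_polyP.
Qed.

Lemma lderB f g A X : polyf f -> polyf g ->
  lder (fun B => f B - g B) A X = lder f A X - lder g A X.
Proof. by move=> pf pg; rewrite lderD ?lderN//; exact: alg_opp. Qed.

Lemma lder_linear f A : polyf f -> linear_for *%R (lder f A).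
Proof.
elim=> [a|k|f1 g1 p1 IH1 p2 IH2|f1 g1 p1 IH1 p2 IH2] c X Y.
- by rewrite !lder_cst mulr0 addr0.
- by rewrite !lder_entry /mxentry !mxE.
- by rewrite !lderD// IH1 IH2; ring.
- by rewrite !lderM// IH1 IH2; ring.
Qed.

Lemma lder0 f A : polyf f -> lder f A 0 = 0.
Proof.
move=> pf; have := lder_linear A pf (-1) 0 0.
by rewrite scaler0 addr0 mulN1r addNr.
Qed.

Lemma lder_sum f A (I : Type) (s : seq I) (P : pred I) (a : I -> K) (X : I -> M) : polyf f ->
  lder f A (\sum_(i <- s | P i) a i *: X i) = \sum_(i <- s | P i) a i * lder f A (X i).
Proof.
move=> pf; elim: s => [|i s IH].
  by rewrite !big_nil lder0.
by rewrite !big_cons; case: (P i) => //; rewrite lder_linear// IH.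
Qed.

Lemma lder_gradient f A : polyf f -> exists C : M, forall X, lder f A X = \sum_i \sum_j C i j * X i j.
Proof.
move=> pf; exists (\matrix_(i, j) lder f A (delta_mx i j)) => X.
rewrite {1}(matrix_sum_delta X) pair_big lder_sum// pair_big.
by apply: eq_bigr => k _; rewrite mxE mulrC.
Qed.

Lemma polyf_linear (h : {linear M -> K^o}) : polyf h.
Proof.
have S : polyf (fun A => \sum_i \sum_j A i j * h (delta_mx i j)).
  apply: alg_sum => i _; apply: alg_sum => j _.
  by apply: alg_mul; [exact: (alg_gen _ (i, j))|exact: alg_cst].
apply: (alg_ext S) => A; rewrite {2}(matrix_sum_delta A) linear_sum /=.
by apply: eq_bigr => i _; rewrite linear_sum; apply: eq_bigr => j _; rewrite linearZ.
Qed.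

End PolynomialFunctions.

Arguments mxentry {K p q}.
Arguments polyf {K p q}.
Arguments lder {K p q}.

Section PolynomialMaps.
Variable K : numFieldType.

Definition mxalg (T J : Type) (y : J -> T -> K) p q (F : T -> 'M[K]_(p, q)) :=
  forall i j, alg y (fun x => F x i j).

Lemma mxalg_id p q : mxalg (@mxentry K p q) id.
Proof. by move=> i j; exact: (alg_gen _ (i, j)). Qed.

Section Maps.
Variables (T J : Type) (y : J -> T -> K).

Lemma mxalg_cst p q (A : 'M[K]_(p, q)) : mxalg y (fun=> A).
Proof. by move=> i j; exact: alg_cst. Qed.

Lemma mxalgM p q r (F : T -> 'M[K]_(p, q)) (G : T -> 'M[K]_(q, r)) :
  mxalg y F -> mxalg y G -> mxalg y (fun x => F x *m G x).
Proof.
move=> HF HG i j; apply: alg_ext (_ : alg y (fun x => \sum_k F x i k * G x k j)) _.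
  by apply: alg_sum => k _; exact: alg_mul.
by move=> x; rewrite mxE.
Qed.

Lemma mxalgB p q (F G : T -> 'M[K]_(p, q)) :
  mxalg y F -> mxalg y G -> mxalg y (fun x => F x - G x).
Proof.
by move=> HF HG i j; apply: (alg_ext (alg_sub (HF i j) (HG i j))) => x; rewrite !mxE.
Qed.

Lemma mxalg_trmx p q (F : T -> 'M[K]_(p, q)) : mxalg y F -> mxalg y (fun x => (F x)^T).
Proof. by move=> HF i j; apply: (alg_ext (HF j i)) => x; rewrite mxE. Qed.

Lemma polyf_mxalg p q (F : T -> 'M[K]_(p, q)) f :
  polyf f -> mxalg y F -> alg y (fun x => f (F x)).
Proof. by move=> pf HF; apply: alg_comp pf => -[i j]; exact: HF. Qed.

Lemma mxalg_lin p q r s (F : T -> 'M[K]_(p, q)) (h : {linear 'M[K]_(p, q) -> 'M[K]_(r, s)}) :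
  mxalg y F -> mxalg y (fun x => h (F x)).
Proof.
move=> HF i j.
have S : alg y (fun x => \sum_a \sum_b F x a b * h (delta_mx a b) i j).
  apply: alg_sum => a _; apply: alg_sum => b _.
  by apply: alg_mul => //; exact: alg_cst.
apply: (alg_ext S) => x; rewrite {2}(matrix_sum_delta (F x)) linear_sum summxE.
apply: eq_bigr => a _; rewrite linear_sum summxE; apply: eq_bigr => b _.
by rewrite linearZ mxE.
Qed.

End Maps.
End PolynomialMaps.

(** * Noetherian rings and the intersection theorem *)

Section Ideals.
Variable R : comNzRingType.

Definition ideal (J : set R) := J 0 /\ forall a x y, J x -> J y -> J (a * x + y).

Definition ideal_gen (A : set R) : set R :=
  [set x | forall J, ideal J -> A `<=` J -> J x].

Lemma idealD J x y : ideal J -> J x -> J y -> J (x + y).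
Proof. by move=> [_ H] Jx Jy; have := H 1 _ _ Jx Jy; rewrite mul1r. Qed.

Lemma idealM J a x : ideal J -> J x -> J (a * x).
Proof. by move=> [J0 H] Jx; have := H a _ _ Jx J0; rewrite addr0. Qed.

Lemma idealN J x : ideal J -> J x -> J (- x).
Proof. by move=> iJ Jx; rewrite -mulN1r; exact: idealM. Qed.

Lemma idealB J x y : ideal J -> J x -> J y -> J (x - y).
Proof. by move=> iJ Jx Jy; apply: idealD => //; exact: idealN. Qed.

Lemma ideal_sum J (I : Type) (s : seq I) (P : pred I) (f : I -> R) : ideal J ->
  (forall i, P i -> J (f i)) -> J (\sum_(i <- s | P i) f i).
Proof.
move=> iJ H; elim/big_ind: _ => [|x y|//]; first by case: iJ.
exact: idealD.
Qed.

Lemma ideal_genP A : ideal (ideal_gen A).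
Proof.
split=> [J [] //|a x y Jx Jy J iJ AJ]; have [_] := iJ; apply.
  exact: Jx.
exact: Jy.
Qed.

Lemma sub_ideal_gen A : A `<=` ideal_gen A.
Proof. by move=> x Ax J _; apply. Qed.

Definition noeth := forall s : nat -> R, exists e,
  ideal_gen [set s i | i in [set i | (i < e)%N]] (s e).

End Ideals.

Lemma noeth_field (F : fieldType) : noeth F.
Proof.
move=> s; have [s0|s0] := eqVneq (s 0%N) 0; first by exists 0%N; rewrite s0 => J [].
exists 1%N => J iJ H; rewrite -[s 1%N](divfK s0).
by apply: idealM => //; apply: H; exists 0%N.
Qed.

(** Hilbert's basis theorem. Elements [f k] of least degree outside the ideal of their predecessors
    are chosen in turn. Once the leading coefficient of [f e] depends on the earlier ones, its
    leading term can be cancelled, against minimality. *)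
Lemma noeth_poly (R : comNzRingType) : noeth R -> noeth {poly R}.
Proof.
move=> nR s; apply: contrapT => /forallNP nS.
pose G e : set {poly R} := ideal_gen [set s i | i in [set i | (i < e)%N]].
have Gmono e e' : (e <= e')%N -> G e `<=` G e'.
  move=> ee x Gx J iJ H; apply: Gx => // y [i /= ie <-]; apply: H.
  by exists i => //=; exact: leq_trans ie ee.
pose I := [set x | exists e, G e x].
have iI : ideal I.
  split; first by exists 0%N; have [] := ideal_genP [set s i | i in [set i | (i < 0)%N]].
  move=> a x y [e Gx] [e' Gy]; exists (maxn e e').
  have [_] := ideal_genP [set s i | i in [set i | (i < maxn e e')%N]]; apply.
    exact: Gmono (leq_maxl _ _) _ Gx.
  exact: Gmono (leq_maxr _ _) _ Gy.
pose L (l : seq {poly R}) := [set x | x \in l].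
have ex (l : seq {poly R}) : exists f, (forall x, x \in l -> I x) ->
    [/\ I f, ~ ideal_gen (L l) f &
      forall f', I f' -> ~ ideal_gen (L l) f' -> (size f <= size f')%N].
  have [lI|] := pselect (forall x, x \in l -> I x); last by exists 0.
  have [e le] : exists e, forall x, x \in l -> G e x.
    elim: l lI => [|x l IH] lI; first by exists 0%N.
    have [y yl|e He] := IH; first by apply: lI; rewrite inE yl orbT.
    have [e' Ge'] := lI x (mem_head _ _); exists (maxn e e') => y.
    rewrite inE => /predU1P[->|/He]; first exact: Gmono (leq_maxr _ _) _ Ge'.
    exact: Gmono (leq_maxl _ _) _.
  pose P d := `[< exists f, [/\ I f, ~ ideal_gen (L l) f & size f = d] >].
  have exP : exists d, P d.
    exists (size (s e)); apply/asboolP; exists (s e); split=> //.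
      by exists e.+1; apply: sub_ideal_gen; exists e => /=.
    move=> H; apply: (nS e) => J iJ HJ; apply: H => // x /le; exact.
  case: (ex_minnP exP) => d /asboolP[f [If nf sf]] dmin.
  exists f => _; split=> // f' If' nf'; rewrite sf; apply: dmin.
  by apply/asboolP; exists f'.
have [pick Hpick] := choice ex.
pose l := fix l k := if k is k'.+1 then rcons (l k') (pick (l k')) else [::].
pose f k := pick (l k).
have lI k x : x \in l k -> I x.
  elim: k x => [//|k IH] x /=; rewrite mem_rcons inE => /predU1P[->|/IH//].
  by have [] := Hpick (l k) IH.
have lmono i j x : (i <= j)%N -> x \in l i -> x \in l j.
  move=> ij; rewrite -(subnKC ij); elim: (j - i)%N => [|k IH]; first by rewrite addn0.
  by move=> /IH; rewrite addnS /= mem_rcons inE => ->; rewrite orbT.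
have fl i j : (i < j)%N -> f i \in l j.
  by move=> ij; apply: (lmono i.+1) => //=; rewrite mem_rcons mem_head.
have fP k : [/\ I (f k), ~ ideal_gen (L (l k)) (f k) &
    forall f', I f' -> ~ ideal_gen (L (l k)) f' -> (size (f k) <= size f')%N].
  exact: (Hpick (l k) (lI k)).
have szf i j : (i <= j)%N -> (size (f i) <= size (f j))%N.
  move=> ij; have [_ _] := fP i; apply; first by have [] := fP j.
  move=> H; have [_ + _] := fP j; apply=> J iJ HJ; apply: H => // x /= xl.
  by apply: HJ; exact: lmono ij xl.
have [e He] := nR (fun k => lead_coef (f k)).
have [Ife nfe mine] := fP e.
have fe0 : f e != 0.
  by apply/eqP => fe0; apply: nfe; rewrite fe0; have [] := ideal_genP (L (l e)).
set m := (size (f e)).-1.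
have mE : m.+1 = size (f e) by rewrite prednK// lt0n size_poly_eq0.
have iL := ideal_genP (L (l e)).
pose J := [set a | exists g, [/\ ideal_gen (L (l e)) g, (size g <= m.+1)%N & g`_m = a]].
have [g [Lg sg gm]] : J (lead_coef (f e)).
  apply: He.
    split; first by exists 0; rewrite size_poly0 coef0; have [] := iL.
    move=> a _ _ [g [Lg sg <-]] [g' [Lg' sg' <-]].
    exists (a%:P * g + g'); split.
    - exact: (iL.2 _ _ _ Lg Lg').
    - rewrite (leq_trans (size_polyD _ _))// geq_max sg' andbT mul_polyC.
      exact: leq_trans (size_scale_leq _ _) sg.
    - by rewrite coefD coefCM.
  move=> _ [i /= ie <-].
  have sfi := szf _ _ (ltnW ie).
  have fi0 : f i != 0.
    apply/eqP => fi0; have [_ + _] := fP i; apply; rewrite fi0.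
    by have [] := ideal_genP (L (l i)).
  exists ('X^(size (f e) - size (f i)) * f i); split.
  - exact: (idealM _ iL (@sub_ideal_gen _ (L (l e)) _ (fl _ _ ie))).
  - apply: leq_trans (size_polyMleq _ _) _; rewrite size_polyXn; move: mE sfi.
    by lia.
  - rewrite coefXnM; have : (0 < size (f i))%N by rewrite lt0n size_poly_eq0.
    move=> si; rewrite ifF; last by apply/negP; move: mE sfi si; lia.
    rewrite /lead_coef; congr (_`_ _); move: mE sfi si; lia.
have sd : (size (f e - g)%R <= m)%N.
  apply/leq_sizeP => j; rewrite leq_eqVlt => /predU1P[<-|mj].
    by rewrite coefB gm /lead_coef subrr.
  rewrite coefB !nth_default ?subrr//; first exact: leq_trans sg mj.
  by rewrite -mE.
have H : (m.+1 <= size (f e - g)%R)%N.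
  rewrite mE; apply: mine.
    by apply: idealB => //; apply: Lg => // x; exact: lI.
  by move=> H; apply: nfe; rewrite -[f e](subrK g); exact: (idealD iL).
by move: (leq_trans H sd); rewrite ltnn.
Qed.

Fixpoint ipoly (R : comNzRingType) n : comNzRingType :=
  if n is n'.+1 then {poly ipoly R n'} else R.

Lemma noeth_ipoly R n : noeth R -> noeth (ipoly R n).
Proof. by move=> nR; elim: n => [//|n IH]; exact: noeth_poly. Qed.

Section Evaluation.
Variables (R S : comNzRingType) (h : {rmorphism R -> S}) (y : nat -> S).

Fixpoint iev n : {rmorphism ipoly R n -> S} :=
  if n is n'.+1 then horner_eval (y n') \o map_poly (iev n') else h.

Lemma iev_ind n (P : S -> Prop) : (forall a, P (h a)) ->
  (forall k, (k < n)%N -> P (y k)) -> (forall u v, P u -> P v -> P (u + v)) ->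
  (forall u v, P u -> P v -> P (u * v)) -> forall p, P (iev n p).
Proof.
move=> Ph Py PD PM; elim: n Py => [|n IH] Py p; first exact: Ph.
have P0 : P 0 by rewrite -(rmorph0 h); exact: Ph.
have P1 : P 1 by rewrite -(rmorph1 h); exact: Ph.
rewrite /= horner_evalE horner_coef; elim/big_ind: _ => // i _.
rewrite coef_map; apply: (PM); first by apply: IH => k kn; apply: Py; exact: ltnW.
by elim: (i : nat) => [|k Hk]; rewrite ?expr0// exprS; apply: (PM) => //; exact: Py.
Qed.

Lemma iev_cst n a : exists p, iev n p = h a.
Proof.
elim: n => [|n [p Hp]]; first by exists a.
by exists p%:P; rewrite /= horner_evalE map_polyC hornerC.
Qed.

Lemma iev_gen n k : (k < n)%N -> exists p, iev n p = y k.
Proof.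
elim: n => [//|n IH]; rewrite ltnS leq_eqVlt => /predU1P[->|/IH[p Hp]].
  by exists 'X; rewrite /= horner_evalE map_polyX hornerX.
by exists p%:P; rewrite /= horner_evalE map_polyC hornerC.
Qed.

End Evaluation.

Section Krull.
Variables (S : comNzRingType) (N : nat) (y : nat -> S).
Hypothesis nS : noeth S.

(** The [k]-th power of the ideal generated by the first [N] of the [y i]. *)
Fixpoint ideal_pow k (x : S) : Prop :=
  if k is k'.+1 then exists2 z : nat -> S, (forall i, ideal_pow k' (z i)) &
    x = \sum_(i < N) y i * z i
  else True.

(** The Rees algebra, with ['X] marking the power of the ideal, is the image of a polynomial ring in
    [N] variables over [S], so chains in it can be controlled there. *)
Lemma rees k x : ideal_pow k x -> exists p : ipoly S N,
  iev (@polyC S) (fun i => (y i)%:P * 'X) N p = x%:P * 'X^k.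
Proof.
elim: k x => [|k IH] x /=.
  move=> _; have [p Hp] := iev_cst (@polyC S) (fun i => (y i)%:P * 'X) N x.
  by exists p; rewrite Hp mulr1.
move=> [z Hz ->].
have [p Hp] := choice (fun i => IH _ (Hz i)).
have H i : exists q, (i < N)%N -> iev (@polyC S) (fun i => (y i)%:P * 'X) N q = (y i)%:P * 'X.
  have [iN|iN] := ltnP i N; last by exists 0.
  by have [q Hq] := iev_gen (@polyC S) (fun i => (y i)%:P * 'X) iN; exists q.
have [q Hq] := choice H.
exists (\sum_(i < N) q i * p i); rewrite rmorph_sum /= rmorph_sum /= mulr_suml.
by apply: eq_bigr => i _; rewrite rmorphM /= Hq// Hp polyCM exprS; ring.
Qed.

(** Modulo [I], the elements [x * 'X^k] lie in the Rees algebra. Noetherianity expresses one of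
    them, of degree [e], by those of lower degree. Comparing coefficients in degree [e] gives the
    result, as coefficients of positive degree in the Rees algebra lie in the ideal of the [y i]. *)
Lemma krull (I : set S) x : ideal I ->
  (forall k, exists2 i, I i & ideal_pow k (x - i)) ->
  exists2 e, ideal_pow 1 e & I (x - e * x).
Proof.
move=> iI /(_ _)/cid2-/all_sig2[i Ii Hi].
have [p Hp] := choice (fun k => rees (Hi k)).
have iy : ideal (ideal_pow 1).
  split; first by exists (fun=> 0) => //; rewrite big1// => k _; rewrite mulr0.
  move=> a _ _ [z _ ->] [z' _ ->]; exists (fun k => a * z k + z' k) => //.
  rewrite mulr_sumr -big_split; apply: eq_bigr => k _ /=; ring.
pose ev := iev (@polyC S) (fun i => (y i)%:P * 'X) N.
have evy q a : (0 < a)%N -> ideal_pow 1 (ev q)`_a.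
  move: a; refine (@iev_ind S {poly S} (@polyC S) _ N (fun P : {poly S} => forall a, (0 < a)%N -> ideal_pow 1 P`_a) _ _ _ _ q).
  - by move=> b [//|a] _; rewrite coefC; have [] := iy.
  - move=> k kN a _; rewrite coefCM coefX mulrC; apply: (idealM _ iy).
    exists (fun j => (j == k)%:R) => //.
    rewrite (bigD1 (Ordinal kN))//= eqxx mulr1 big1 ?addr0// => j jk.
    rewrite (_ : (j == k :> nat) = false) ?mulr0//; exact: negbTE jk.
  - by move=> u v Hu Hv a a0; rewrite coefD; apply: (idealD iy); [exact: Hu|exact: Hv].
  - move=> u v Hu Hv a a0; rewrite coefM; apply: (ideal_sum _ iy) => -[b /= ba] _.
    case: b ba => [|b] ba; first by apply: (idealM _ iy); rewrite subn0; exact: Hv.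
    by rewrite mulrC; apply: (idealM _ iy); exact: Hu.
have [e He] := @noeth_ipoly S N nS p.
pose J := [set P | exists A B, [/\ ev P = A * x%:P + B, (forall j, I B`_j) & ideal_pow 1 A`_e]].
have [|_ [k /= ke <-]|A [B [EP IB Ae]]] := He J.
- split.
    exists 0, 0; rewrite rmorph0 mul0r addr0; split=> // [j|]; rewrite coef0; by [have [] := iI|have [] := iy].
  move=> q P P' [A [B [EP IB Ae]]] [A' [B' [EP' IB' Ae']]].
  exists (ev q * A + A'), (ev q * B + B'); split.
  - by rewrite rmorphD rmorphM /= -/ev EP EP'; ring.
  - move=> j; rewrite coefD; apply: idealD => //; rewrite coefM; apply: ideal_sum => // b _.
    exact: idealM.
  - rewrite coefD; apply: (idealD iy) => //; rewrite coefM; apply: (ideal_sum _ iy) => -[b /= be] _.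
    case: b be => [|b] be; first by apply: (idealM _ iy); rewrite subn0.
    by rewrite mulrC; apply: (idealM _ iy); exact: evy.
- exists 'X^k, (- (i k)%:P * 'X^k); split.
  - by rewrite /ev Hp polyCB; ring.
  - move=> j; rewrite -polyCN coefCM; rewrite mulrC; apply: idealM => //.
    exact: idealN.
  - by rewrite coefXn gtn_eqF//; have [] := iy.
exists A`_e => //; have := congr1 (fun P : {poly S} => P`_e) EP.
rewrite /ev Hp coefCM coefXn eqxx mulr1 coefD coefMC => E.
rewrite (_ : x - _ = i e + B`_e); first exact: idealD.
by rewrite -[X in X - _](subrK (i e)) E; ring.
Qed.

End Krull.

Lemma iev_alg (K : comNzRingType) (T J : Type) (y : J -> T -> K) (z : nat -> T -> K) n
    (p : ipoly K n) : (forall k, alg y (z k)) ->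
  alg y (fun x => iev (idfun : {rmorphism K -> K}) (fun k => z k x) n p).
Proof.
move=> az; elim: n p => [|n IH] p; first exact: alg_cst.
have S : alg y (fun x => \sum_(i < size p)
    iev (idfun : {rmorphism K -> K}) (fun k => z k x) n p`_i * z n x ^+ i).
  by apply: alg_sum => i _; apply: alg_mul; [exact: IH|exact: alg_exp].
apply: (alg_ext S) => x /=.
rewrite horner_evalE (@horner_coef_wide _ (size p)) ?size_poly//.
by apply: eq_bigr => i _; rewrite coef_map.
Qed.

Lemma alg_iev (K : comNzRingType) (T : Type) (J : finType) (y : J -> T -> K)
    (z : nat -> T -> K) n : (forall j, exists2 k, (k < n)%N & z k =1 y j) ->
  forall f, alg y f -> exists p : ipoly K n, forall x,
    iev (idfun : {rmorphism K -> K}) (fun k => z k x) n p = f x.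
Proof.
move=> zy f; elim=> [a|j|f1 g1 _ [p Hp] _ [q Hq]|f1 g1 _ [p Hp] _ [q Hq]].
- elim: {zy}n => [|n [p Hp]]; first by exists a.
  by exists p%:P => x; rewrite /= horner_evalE map_polyC hornerC; exact: Hp.
- have [k kn Ek] := zy j.
  suff [p Hp] : exists p : ipoly K n, forall x,
      iev (idfun : {rmorphism K -> K}) (fun k => z k x) n p = z k x.
    by exists p => x; rewrite Hp Ek.
  elim: n kn {zy} => [//|n IH].
  rewrite ltnS leq_eqVlt => /predU1P[->|/IH[p Hp]].
    by exists 'X => x; rewrite /= horner_evalE map_polyX hornerX.
  by exists p%:P => x; rewrite /= horner_evalE map_polyC hornerC; exact: Hp.
- by exists (p + q) => x; rewrite rmorphD /= Hp Hq.
- by exists (p * q) => x; rewrite rmorphM /= Hp Hq.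
Qed.

Section Separation.
Variables (K : fieldType) (p q : nat).
Local Notation M := 'M[K]_(p, q).

(* the coefficient matrix of a functional killing U but not X *)
Lemma vspace_separation (U : {vspace M}) (X : M) : X \notin U ->
  exists2 C : M, (forall Y, Y \in U -> \sum_i \sum_j C i j * Y i j = 0) &
    \sum_i \sum_j C i j * X i j != 0.
Proof.
move=> XU; pose f := (\1 - projv U)%VF.
have fU Y : Y \in U -> f Y = 0.
  by move=> YU; rewrite add_lfunE opp_lfunE id_lfunE projv_id// subrr.
have fX : f X != 0.
  apply: contra XU; rewrite add_lfunE opp_lfunE id_lfunE subr_eq0 => /eqP ->.
  exact: memv_proj.
have /existsP[k] : [exists k : 'I_p * 'I_q, f X k.1 k.2 != 0].
  rewrite -negb_forall; apply: contra fX => /forallP H.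
  by apply/eqP/matrixP => i j; rewrite mxE; have /eqP := H (i, j).
have fE Y : f Y k.1 k.2 = \sum_i \sum_j (\matrix_(i, j) f (delta_mx i j) k.1 k.2) i j * Y i j.
  rewrite {1}(matrix_sum_delta Y) linear_sum summxE; apply: eq_bigr => i _.
  rewrite linear_sum summxE; apply: eq_bigr => j _.
  by rewrite linearZ !mxE mulrC.
move=> fXk; exists (\matrix_(i, j) f (delta_mx i j) k.1 k.2) => [Y YU|].
  by rewrite -fE fU// mxE.
by rewrite -fE.
Qed.

End Separation.

(** * Invariant derivations and powers of the maximal ideal at 1 *)

Section Derivations.
Variables (K : numFieldType) (n : nat).
Local Notation M := 'M[K]_n.+1.
Implicit Types (f g : M -> K) (A X : M).

Lemma polyf_lder f (F : M -> M) : polyf f -> mxalg mxentry F ->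
  polyf (fun A => lder f A (F A)).
Proof.
move=> pf HF; elim: pf => [a|[i j]|f1 g1 p1 IH1 p2 IH2|f1 g1 p1 IH1 p2 IH2].
- by apply: (alg_ext (alg_cst _ 0)) => A; rewrite lder_cst.
- by apply: (alg_ext (HF i j)) => A; rewrite lder_entry.
- by apply: (alg_ext (alg_add IH1 IH2)) => A; rewrite lderD.
- by apply: (alg_ext (alg_add (alg_mul IH1 p2) (alg_mul p1 IH2))) => A; rewrite lderM.
Qed.

(** The left invariant vector field whose value at 1 is [X]. *)
Definition der X f A : K := lder f A (A *m X).

Lemma polyf_der X f : polyf f -> polyf (der X f).
Proof. by move=> pf; apply: polyf_lder => //; apply: mxalgM; [exact: mxalg_id|exact: mxalg_cst]. Qed.

Lemma derM X f g A : polyf f -> polyf g ->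
  der X (fun B => f B * g B) A = der X f A * g A + f A * der X g A.
Proof. exact: lderM. Qed.

Lemma lder_mul f (B : M) A X : lder (fun C => f (B *m C)) A X = lder f (B *m A) (B *m X).
Proof.
rewrite /lder /line_poly; suff -> : [set P : {poly K} | forall t, P.[t] = f (B *m (A + t *: X))] =
  [set P : {poly K} | forall t, P.[t] = f (B *m A + t *: (B *m X))] by [].
by apply/seteqP; split=> P /= H t; rewrite H mulmxDr scalemxAr.
Qed.

Lemma der_mul f (B : M) A X : der X (fun C => f (B *m C)) A = der X f (B *m A).
Proof. by rewrite /der lder_mul mulmxA. Qed.

Lemma polyf_mul f (B : M) : polyf f -> polyf (fun C => f (B *m C)).
Proof.
move=> pf; apply: (@polyf_mxalg _ _ _ _ _ _ (fun C : M => B *m C)) => //.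
by apply: mxalgM; [exact: mxalg_cst|exact: mxalg_id].
Qed.

Inductive iterder (L : set M) f : (M -> K) -> Prop :=
| iterder0 : iterder L f f
| iterderS g X : iterder L f g -> L X -> iterder L f (der X g).

Lemma polyf_iterder L f g : polyf f -> iterder L f g -> polyf g.
Proof. by move=> pf; elim=> // g' X _ pg _; exact: polyf_der. Qed.

Lemma iterder_trans L f g h : iterder L f g -> iterder L g h -> iterder L f h.
Proof. by move=> fg; elim=> // h' X _ IH LX; exact: iterderS. Qed.

Lemma iterder_mul L f (B : M) g : iterder L (fun C => f (B *m C)) g ->
  exists2 h, iterder L f h & forall A, g A = h (B *m A).
Proof.
elim=> [|g' X _ [h fh Hh] LX]; first by exists f => //; exact: iterder0.
exists (der X h) => [|A]; first exact: iterderS.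
by rewrite -der_mul; congr der; apply/funext.
Qed.

Definition centry (k : 'I_n.+1 * 'I_n.+1) A : K := mxentry k A - mxentry k 1.

Lemma polyf_centry k : polyf (centry k).
Proof. by apply: alg_sub; [exact: alg_gen|exact: alg_cst]. Qed.

(** The [k]-th power of the ideal of polynomial functions that vanish at the identity matrix. *)
Fixpoint mpow k f : Prop :=
  if k is k'.+1 then exists2 z : 'I_n.+1 * 'I_n.+1 -> M -> K, (forall j, mpow k' (z j)) &
    forall A, f A = \sum_j centry j A * z j A
  else polyf f.

Lemma mpow_ext k f g : mpow k f -> f =1 g -> mpow k g.
Proof. by move=> H /funext <-. Qed.

Lemma mpow_polyf k f : mpow k f -> polyf f.
Proof.
elim: k f => [//|k IH] f [z Hz Ef].
have S : polyf (fun A => \sum_j centry j A * z j A).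
  by apply: alg_sum => j _; apply: alg_mul; [exact: polyf_centry|exact/IH/Hz].
by apply: (alg_ext S) => A; rewrite Ef.
Qed.

Lemma mpowD k f g : mpow k f -> mpow k g -> mpow k (fun A => f A + g A).
Proof.
elim: k f g => [|k IH] f g; first exact: alg_add.
move=> [z Hz Ef] [w Hw Eg]; exists (fun j A => z j A + w j A) => [j|A]; first exact: (IH _ _ (Hz j) (Hw j)).
by rewrite Ef Eg -big_split; apply: eq_bigr => j _; rewrite mulrDr.
Qed.

Lemma mpowMl k f g : polyf f -> mpow k g -> mpow k (fun A => f A * g A).
Proof.
move=> pf; elim: k g => [|k IH] g; first exact: alg_mul.
move=> [z Hz Eg]; exists (fun j A => f A * z j A) => [j|A]; first exact: (IH _ (Hz j)).
by rewrite Eg mulr_sumr; apply: eq_bigr => j _; rewrite mulrCA.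
Qed.

Lemma mpow0 k : mpow k (fun=> 0).
Proof.
elim: k => [|k IH]; first exact: alg_cst.
by exists (fun _ _ => 0) => // A; rewrite big1// => j _; rewrite mulr0.
Qed.

Lemma mpowN k f : mpow k f -> mpow k (fun A => - f A).
Proof.
by move=> H; apply: (mpow_ext (mpowMl (alg_cst _ (-1)) H)) => A; rewrite mulN1r.
Qed.

Lemma mpow_sum k (I : Type) (s : seq I) (f : I -> M -> K) :
  (forall i, mpow k (f i)) -> mpow k (fun A => \sum_(i <- s) f i A).
Proof.
move=> H; elim: s => [|i s IH].
  by apply: (mpow_ext (mpow0 k)) => A; rewrite big_nil.
by apply: (mpow_ext (mpowD (H i) IH)) => A; rewrite big_cons.
Qed.

Lemma mpowM k l f g : mpow k f -> mpow l g -> mpow (k + l) (fun A => f A * g A).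
Proof.
move=> Hf Hg; elim: k f Hf => [|k IH] f Hf; first exact: mpowMl.
have [z Hz Ef] := Hf; exists (fun j A => z j A * g A) => [j|A]; first exact: (IH _ (Hz j)).
by rewrite Ef mulr_suml; apply: eq_bigr => j _; rewrite mulrA.
Qed.

Lemma mpow_centry k : mpow 1 (centry k).
Proof.
exists (fun j _ => (j == k)%:R) => [j|A]; first exact: alg_cst.
rewrite (bigD1 k)//= eqxx mulr1 big1 ?addr0// => j jk.
by rewrite (negPf jk) mulr0.
Qed.

Lemma mpow_lin f : polyf f -> mpow 1 (fun A => lder f 1 (A - 1)).
Proof.
move=> pf; have [C HC] := lder_gradient 1 pf.
have S : mpow 1 (fun A => \sum_k C k.1 k.2 * centry k A).
  apply: mpow_sum => k; apply: mpowMl; [exact: alg_cst|exact: mpow_centry].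
apply: (mpow_ext S) => A; rewrite HC pair_big; apply: eq_bigr => k _.
by rewrite /centry /mxentry [(A - 1) _ _]mxE [(- 1%R : M) _ _]mxE.
Qed.

Lemma taylor2 f : polyf f -> mpow 2 (fun A => f A - f 1 - lder f 1 (A - 1)).
Proof.
elim=> [a|k|f1 g1 p1 IH1 p2 IH2|f1 g1 p1 IH1 p2 IH2].
- by apply: (mpow_ext (mpow0 2)) => A; rewrite lder_cst subrr subr0.
- apply: (mpow_ext (mpow0 2)) => A; rewrite lder_entry /mxentry.
  by rewrite [(A - 1) _ _]mxE [(- 1%R : M) _ _]mxE subrr.
- by apply: (mpow_ext (mpowD IH1 IH2)) => A; rewrite lderD//; ring.
have T1 h : mpow 2 (fun A => h A - h 1 - lder h 1 (A - 1)) -> polyf h -> mpow 1 (fun A => h A - h 1).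
  move=> [z Hz Eh] ph; have H1 : mpow 1 (fun A => h A - h 1 - lder h 1 (A - 1)).
    by exists z => // j; exact: (@mpow_polyf 1).
  by apply: (mpow_ext (mpowD H1 (mpow_lin ph))) => A; rewrite subrK.
have S := mpowD (mpowM (T1 _ IH1 p1) (T1 _ IH2 p2))
  (mpowD (mpowMl (alg_cst _ (f1 1)) IH2) (mpowMl (alg_cst _ (g1 1)) IH1)).
by apply: (mpow_ext S) => A; rewrite lderM//; ring.
Qed.

Lemma mpow1 f : polyf f -> f 1 = 0 -> mpow 1 f.
Proof.
move=> pf f1; have [z Hz Ef] := taylor2 pf.
have H1 : mpow 1 (fun A => f A - f 1 - lder f 1 (A - 1)).
  by exists z => // j; exact: (@mpow_polyf 1).
by apply: (mpow_ext (mpowD H1 (mpow_lin pf))) => A; rewrite subrK f1 subr0.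
Qed.

Lemma mpow1_at1 f : mpow 1 f -> f 1 = 0.
Proof. by move=> [z _ ->]; rewrite big1// => j _; rewrite /centry subrr mul0r. Qed.

Let N := #|{: 'I_n.+1 * 'I_n.+1}|.
Let pr k : 'I_n.+1 * 'I_n.+1 := nth (ord0, ord0) (enum {: 'I_n.+1 * 'I_n.+1}) k.
Let ev A : {rmorphism ipoly K N -> K} :=
  iev (idfun : {rmorphism K -> K}) (fun k => mxentry (pr k) A) N.

Let prE (F : 'I_n.+1 * 'I_n.+1 -> K) : \sum_j F j = \sum_(i < N) F (pr i).
Proof.
transitivity (\sum_(j in {: 'I_n.+1 * 'I_n.+1}) F j); first by [].
rewrite big_enum_val; apply: eq_bigr => i _; congr F.
by apply: set_nth_default; rewrite -cardE.
Qed.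

Let ev_surj f : polyf f -> exists p, forall A, ev A p = f A.
Proof.
apply: alg_iev => j; exists (enum_rank j); first exact: ltn_ord.
move=> A; congr (mxentry _ A); rewrite -[RHS](enum_rankK j).
by apply: set_nth_default; rewrite -cardE.
Qed.

Lemma polyf_ideal (J : set (M -> K)) :
  (forall f, J f -> polyf f) -> J (fun=> 0) ->
  (forall f g, J f -> J g -> J (fun A => f A + g A)) ->
  (forall f g, polyf f -> J g -> J (fun A => f A * g A)) ->
  ideal [set p | J (fun A => ev A p)].
Proof.
move=> Jp J0 JD JM; split.
  by rewrite /= (_ : (fun A => _) = fun=> 0)//; apply/funext => A; rewrite rmorph0.
move=> a p q /= Hp Hq.
rewrite (_ : (fun A => _) = fun A => ev A a * ev A p + ev A q); last first.
  by apply/funext => A; rewrite rmorphD rmorphM.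
by apply: JD => //; apply: JM => //; apply: iev_alg => k; exact: alg_gen.
Qed.

(** Polynomial functions are given by a predicate and not as a ring, so the problem is lifted to
    iterated polynomials along the surjective evaluation [ev]. *)
Lemma krull_polyf (J : set (M -> K)) f :
  (forall f, J f -> polyf f) -> J (fun=> 0) ->
  (forall f g, J f -> J g -> J (fun A => f A + g A)) ->
  (forall f g, polyf f -> J g -> J (fun A => f A * g A)) ->
  polyf f -> (forall k, exists2 i, J i & mpow k (fun A => f A - i A)) ->
  exists2 e, mpow 1 e & J (fun A => f A - e A * f A).
Proof.
move=> Jp J0 JD JM pf Hf.
have [Y HY] := choice (fun k => ev_surj (polyf_centry k)).
have lift k g : mpow k g -> exists2 p, ideal_pow N (fun k => Y (pr k)) k p & forall A, ev A p = g A.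
  elim: k g => [|k IH] g; first by move=> /ev_surj[p Hp]; exists p.
  move=> [z Hz Eg].
  have /choice[q Hq] : forall j, exists q, ideal_pow N (fun k => Y (pr k)) k q /\ forall A, ev A q = z j A.
    by move=> j; have [q q1 q2] := IH _ (Hz j); exists q.
  exists (\sum_(i < N) Y (pr i) * q (pr i)).
    by exists (fun i => q (pr i)) => // i; have [] := Hq (pr i).
  move=> A; rewrite Eg prE rmorph_sum; apply: eq_bigr => i _.
  by rewrite rmorphM /= HY; have [_ ->] := Hq (pr i).
have [p Hp] := ev_surj pf.
have nS : noeth (ipoly K N) by apply: noeth_ipoly; exact: noeth_field.
have [|e He Ie] := krull nS (polyf_ideal Jp J0 JD JM) (x := p) (N := N) (y := fun k => Y (pr k)).
  move=> k; have [i Ji Hk] := Hf k; have [q Hq Eq] := lift _ _ Hk.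
  exists (p - q); last by rewrite subKr.
  by rewrite /= (_ : (fun A => _) = i)//; apply/funext => A; rewrite rmorphB /= Hp Eq subKr.
exists (fun A => ev A e).
  have [z _ ->] := He.
  exists (fun j A => ev A (z (enum_rank j))) => [j|A].
    by apply: iev_alg => k; exact: alg_gen.
  rewrite prE rmorph_sum; apply: eq_bigr => i _; rewrite rmorphM /= HY.
  congr (_ * ev A (z _)); rewrite -[LHS]/(nat_of_ord i) -{1}(enum_valK i).
  by congr (nat_of_ord (enum_rank _)); apply: set_nth_default; rewrite -cardE.
rewrite (_ : (fun A => _) = fun A => ev A (p - e * p)); first exact: Ie.
by apply/funext => A; rewrite rmorphB rmorphM /= Hp.
Qed.

End Derivations.

Arguments centry {K n}.
Arguments mpow_centry {K n}.

(** * Lie algebras and Taylor expansions *)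

Section TaylorPrinciple.
Variables (K : numFieldType) (n : nat) (G : groupType).
Local Notation M := 'M[K]_n.+1.
Variable s : G -> M.
Hypothesis sM : forall x y : G, s (x * y)%g = s x *m s y.
Hypothesis s1 : s 1%g = 1.
Implicit Types (H Z : set G) (f g : M -> K) (A X : M).

Definition vanish H f : Prop := polyf f /\ forall x, H x -> f (s x) = 0.

Definition zclosed Z : Prop :=
  forall x, (forall f, polyf f -> (forall z, Z z -> f (s z) = 0) -> f (s x) = 0) -> Z x.

Definition zconn H : Prop := forall Z1 Z2, zclosed Z1 -> zclosed Z2 ->
  H `<=` Z1 `|` Z2 -> (forall x, H x -> Z1 x -> Z2 x -> False) ->
  H `<=` Z1 \/ H `<=` Z2.

Lemma zclosed_locus (F : set (M -> K)) : (forall f, F f -> polyf f) ->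
  zclosed [set x | forall f, F f -> f (s x) = 0].
Proof. by move=> pF x Hx f Ff; apply: Hx => [|z /(_ f Ff)]; first exact: pF. Qed.

Lemma vanish0 H : vanish H (fun=> 0). Proof. by split=> //; exact: alg_cst. Qed.

Lemma vanishD H f g : vanish H f -> vanish H g -> vanish H (fun A => f A + g A).
Proof.
by move=> [pf Hf] [pg Hg]; split=> [|x Hx]; [exact: alg_add|rewrite Hf// Hg// addr0].
Qed.

Lemma vanishMl H f g : polyf f -> vanish H g -> vanish H (fun A => f A * g A).
Proof. by move=> pf [pg Hg]; split=> [|x Hx]; [exact: alg_mul|rewrite Hg// mulr0]. Qed.

Lemma vanishN H f : vanish H f -> vanish H (fun A => - f A).
Proof. by move=> [pf Hf]; split=> [|x Hx]; [exact: alg_opp|rewrite Hf// oppr0]. Qed.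

Lemma lie_exists H : exists U : {vspace M}, forall X, X \in U <->
  forall f, vanish H f -> lder f 1 X = 0.
Proof.
apply: set_vspace => [f [pf _]|a u v Hu Hv f Hf].
  exact: lder0.
by have [pf _] := Hf; rewrite lder_linear// Hu// Hv// mulr0 addr0.
Qed.

(** The Zariski tangent space at 1 of the closure of [H]. *)
Definition lie H : {vspace M} := projT1 (cid (lie_exists H)).

Lemma lieP H X : X \in lie H <-> forall f, vanish H f -> lder f 1 X = 0.
Proof. exact: (projT2 (cid (lie_exists H))). Qed.

Lemma lieS H H' : H `<=` H' -> (lie H <= lie H')%VS.
Proof.
move=> HH'; apply/subvP => X /lieP HX; apply/lieP => f [pf Hf]; apply: HX.
by split=> // x /HH'/Hf.
Qed.

Section Subgroup.
Variable H : set G.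
Hypothesis sgH : subgroup H.

Let H1 : H 1%g. Proof. by case: sgH. Qed.
Let HM x y : H x -> H y -> H (x * y)%g.
Proof.
have [_ HV] := sgH => Hx Hy; have := HV _ _ Hx (HV _ _ H1 Hy).
by rewrite mul1g invgK.
Qed.
Let HV x : H x -> H (x^-1)%g.
Proof. by have [_ HV] := sgH => Hx; have := HV _ _ H1 Hx; rewrite mul1g. Qed.

Lemma vanish_mul f h : H h -> vanish H f -> vanish H (fun A => f (s h *m A)).
Proof.
move=> Hh [pf Hf]; split=> [|x Hx]; first exact: polyf_mul.
by rewrite -sM; apply: Hf; exact: HM.
Qed.

Lemma vanish_lder f (F : M -> M) : mxalg mxentry F -> (forall A, F A \in lie H) ->
  vanish H f -> vanish H (fun A => lder f A (A *m F A)).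
Proof.
move=> aF FL vf; have [pf Hf] := vf; split=> [|x Hx].
  by apply: polyf_lder => //; apply: mxalgM => //; exact: mxalg_id.
rewrite -[X in lder f X](mulmx1 (s x)) -lder_mul.
by have /lieP := FL (s x); apply; exact: vanish_mul.
Qed.

Lemma vanish_der f X : X \in lie H -> vanish H f -> vanish H (der X f).
Proof. by move=> XL; apply: vanish_lder => //; exact: mxalg_cst. Qed.

(** Vanishing of order [k] at 1 along [H]. *)
Let Im k f := exists2 i, vanish H i & mpow k (fun A => f A - i A).

Let ImD k f g : Im k f -> Im k g -> Im k (fun A => f A + g A).
Proof.
move=> [i vi mi] [j vj mj]; exists (fun A => i A + j A); first exact: vanishD.
by apply: (mpow_ext (mpowD mi mj)) => A; ring.
Qed.

Let Im_mpow k f : mpow k f -> Im k f.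
Proof.
by move=> mf; exists (fun=> 0); [exact: vanish0|apply: (mpow_ext mf) => A; rewrite subr0].
Qed.

Let Im_vanish k f : vanish H f -> Im k f.
Proof. by move=> vf; exists f => //; apply: (mpow_ext (mpow0 _ _ k)) => A; rewrite subrr. Qed.

Let Im_ext k f g : Im k f -> f =1 g -> Im k g.
Proof. by move=> mf /funext <-. Qed.

Let ImM a b f g : mpow a f -> Im b g -> Im (a + b) (fun A => f A * g A).
Proof.
move=> mf [i vi mi]; exists (fun A => f A * i A).
  by apply: vanishMl => //; exact: mpow_polyf mf.
by apply: (mpow_ext (mpowM mf mi)) => A; rewrite mulrBr.
Qed.

Let ImN k f : Im k f -> Im k (fun A => - f A).
Proof.
move=> mf; apply: (Im_ext (ImM (_ : mpow 0 (fun=> -1)) mf)) => [|A]; first exact: alg_cst.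
by rewrite mulN1r.
Qed.

Let Im_sum k (I : Type) (r : seq I) (f : I -> M -> K) :
  (forall i, Im k (f i)) -> Im k (fun A => \sum_(i <- r) f i A).
Proof.
move=> Hf; elim: r => [|i r IH].
  by apply: (Im_ext (Im_mpow (mpow0 _ _ k))) => A; rewrite big_nil.
by apply: (Im_ext (ImD (Hf i) IH)) => A; rewrite big_cons.
Qed.

(** Biduality in finite dimension: a form outside the space of differentials of functions vanishing
    on [H] would be separated from it by some [X], and such an [X] is tangent to [H]. *)
Lemma cotangent (C : M) : (forall X, X \in lie H -> \sum_i \sum_j C i j * X i j = 0) ->
  exists2 p, vanish H p & forall X, lder p 1 X = \sum_i \sum_j C i j * X i j.
Proof.
move=> HC; pose S := [set D : M | exists2 p, vanish H p &
  forall X, lder p 1 X = \sum_i \sum_j D i j * X i j].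
have [|a C1 C2 [p1 v1 E1] [p2 v2 E2]|U HU] := @set_vspace _ M S.
- exists (fun=> 0) => [|X]; first exact: vanish0.
  by rewrite lder_cst big1// => i _; rewrite big1// => j _; rewrite mxE mul0r.
- exists (fun A => a * p1 A + p2 A).
    by apply: vanishD => //; apply: vanishMl => //; exact: alg_cst.
  have [pp1 _] := v1; have [pp2 _] := v2.
  move=> X; rewrite lderD//; last by apply: alg_mul => //; exact: alg_cst.
  rewrite lderM//; last exact: alg_cst.
  rewrite lder_cst mul0r add0r E1 E2 mulr_sumr -big_split; apply: eq_bigr => i _ /=.
  rewrite mulr_sumr -big_split; apply: eq_bigr => j _ /=.
  by rewrite !mxE mulrDl mulrA.
apply/HU/negPn/negP => /vspace_separation[X XU].
have comm D Y : \sum_i \sum_j D i j * Y i j = \sum_i \sum_j Y i j * D i j :> K.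
  by apply: eq_bigr => i _; apply: eq_bigr => j _; rewrite mulrC.
rewrite comm HC ?eqxx//; apply/lieP => f vf.
have [D HD] := lder_gradient 1 vf.1.
by rewrite HD comm XU//; apply/HU; exists f.
Qed.

Let pi : 'End(M) := projv (lie H).
(** An Euler vector field tangent to [H]: it vanishes at 1 and, modulo functions vanishing on [H],
    multiplies the leading part of order [k] by [k] ([eul_mpow]). *)
Let eul f A : K := lder f A (A *m pi (A - 1)).

Let mpi : mxalg mxentry (fun A => pi (A - 1)).
Proof.
apply: mxalg_lin; apply: mxalgB; [exact: mxalg_id|exact: mxalg_cst].
Qed.

Let peul f : polyf f -> polyf (eul f).
Proof.
by move=> pf; apply: polyf_lder => //; apply: mxalgM => //; exact: mxalg_id.
Qed.

Let xi j A : K := coord (vbasis (lie H)) j (pi (A - 1)).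

Let mxi j : mpow 1 (xi j).
Proof.
pose h : {linear M -> K^o} := coord (vbasis (lie H)) j \o pi.
have ph : polyf (xi j).
  apply: (alg_ext (alg_sub (polyf_linear h) (alg_cst _ (h 1)))) => A.
  by rewrite /xi linearB /= linearB.
by apply: mpow1 => //; rewrite /xi subrr !linear0.
Qed.

Let eulE f A : polyf f -> eul f A = \sum_j xi j A * der (vbasis (lie H))`_j f A.
Proof.
move=> pf; rewrite /eul {1}(coord_vbasis (memv_proj (lie H) (A - 1))) mulmx_sumr.
rewrite -lder_sum//; congr lder; apply: eq_bigr => j _.
by rewrite scalemxAr.
Qed.

(** The difference is a quadratic term plus the form [l]. The latter kills [lie H], so by
    [cotangent] it is the differential of a function vanishing on [H]. *)
Let eul_gen k (y := centry k) : Im 2 (fun A => eul y A - y A).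
Proof.
have py : polyf y := @polyf_centry K n k.
have eulyE A : eul y A = mxentry k (A *m pi (A - 1)).
  by rewrite /eul lderB ?lder_entry ?lder_cst ?subr0//; [exact: alg_gen|exact: alg_cst].
pose h : 'End(M) := (pi - \1)%VF; pose l X := mxentry k (h X).
have lE A : l A = mxentry k (pi A - A).
  by rewrite /l add_lfunE opp_lfunE id_lfunE.
have [p vp Ep] : exists2 p, vanish H p & forall X, lder p 1 X = l X.
  pose C := \matrix_(i, j) l (delta_mx i j).
  have lC X : l X = \sum_i \sum_j C i j * X i j.
    rewrite {1}(matrix_sum_delta X) /l linear_sum /mxentry summxE; apply: eq_bigr => i _.
    rewrite linear_sum summxE; apply: eq_bigr => j _.
    by rewrite linearZ !mxE mulrC.
  have [|p vp Ep] := @cotangent C.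
    by move=> X XL; rewrite -lC lE projv_id// subrr /mxentry mxE.
  by exists p => // X; rewrite Ep lC.
have p1 : p 1 = 0 by rewrite -s1; exact: vp.2.
have I1 : Im 2 (fun A => l (A - 1)).
  exists p => //; apply: (mpow_ext (mpowN (taylor2 vp.1))) => A.
  by rewrite Ep p1; ring.
have I2 : mpow 2 (fun A => mxentry k ((A - 1) *m pi (A - 1))).
  have S i j : mpow 1 (fun A : M => (A - 1) i j).
    apply: (mpow_ext (mpow_centry (i, j))) => A.
    by rewrite /centry /mxentry [(A - 1) _ _]mxE [(- 1%R : M) _ _]mxE.
  have S' i j : mpow 1 (fun A : M => pi (A - 1) i j).
    by apply: mpow1 => //; rewrite subrr linear0 mxE.
  have S2 : mpow 2 (fun A => \sum_j (A - 1) k.1 j * pi (A - 1) j k.2).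
    by apply: mpow_sum => j; exact: (mpowM (S _ _) (S' _ _)).
  by apply: (mpow_ext S2) => A; rewrite /mxentry mxE.
apply: (Im_ext (ImD I1 (Im_mpow I2))) => A.
rewrite eulyE lE mulmxBl mul1mx /y /centry /mxentry !mxE; ring.
Qed.

Let eul_mpow k f : mpow k f -> Im k.+1 (fun A => eul f A - k%:R * f A).
Proof.
elim: k f => [|k IH] f.
  move=> pf; apply: Im_mpow; apply: mpow1; last first.
    by rewrite /eul subrr linear0 mulmx0 mul0r subr0 lder0.
  apply: alg_sub; first exact: peul.
  by apply: alg_mul => //; exact: alg_cst.
move=> mf; have pf := mpow_polyf mf; have [z mz Ef] := mf.
pose y (k : 'I_n.+1 * 'I_n.+1) (A : M) := centry k A.
have py j : polyf (y j) := @polyf_centry K n j.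
have pz j := mpow_polyf (mz j).
have S : Im k.+2 (fun A => \sum_j ((eul (y j) A - y j A) * z j A +
    y j A * (eul (z j) A - k%:R * z j A))).
  apply: Im_sum => j; apply: ImD; last exact: (ImM (mpow_centry j) (IH _ (mz j))).
  rewrite -addn2 -[(k + 2)%N]/(k + 2)%N.
  by apply: (Im_ext (ImM (mz j) (eul_gen j))) => A; rewrite mulrC.
apply: (Im_ext S) => A.
have -> : eul f A = \sum_j (eul (y j) A * z j A + y j A * eul (z j) A).
  rewrite (_ : f = fun A => \sum_j y j A * z j A); last exact/funext.
  elim: (index_enum _) => [|j r IHr].
    rewrite big_nil /eul (_ : (fun _ => _) = fun=> 0) ?lder_cst//.
    by apply/funext => B; rewrite big_nil.
  rewrite big_cons -IHr /eul -lderM// -lderD.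
  - by congr lder; apply/funext => B; rewrite big_cons.
  - exact: (alg_mul (py j) (pz j)).
  - by apply: alg_sum => i _; exact: (alg_mul (py i) (pz i)).
rewrite Ef mulr_sumr -sumrB; apply: eq_bigr => j _; rewrite -/(y j A) -natr1; ring.
Qed.

(** Let [f - i] have order [k] with [i] vanishing on [H]. The derivatives of [f] satisfy the same
    hypothesis, so [eul f] has order [k.+1] along [H]; it is also [k] times [f] modulo that order.
    Dividing by [k] raises the order of [f], and Krull's theorem concludes. *)
Lemma taylor_local f : polyf f -> (forall g, iterder [set` lie H] f g -> g 1 = 0) ->
  exists2 q, polyf q & q 1 = 1 /\ vanish H (fun A => q A * f A).
Proof.
move=> pf Hf.
have H0 k : Im k f.
  elim: k f pf Hf => [|k IH] f pf Hf.
    by apply: Im_mpow; exact: pf.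
  have [->|k0] := posnP k.
    by apply: Im_mpow; apply: mpow1 => //; apply: Hf; exact: iterder0.
  have [i vi mi] := IH f pf Hf; have pi' := vi.1.
  have pfi : polyf (fun A => f A - i A) by exact: mpow_polyf mi.
  have I1 : Im k.+1 (eul f).
    apply: (@Im_ext _ (fun A => \sum_j xi j A * der (vbasis (lie H))`_j f A)) => [|A]; last by rewrite eulE.
    apply: Im_sum => j; apply: (ImM (mxi j)); apply: IH; first exact: polyf_der.
    move=> g Hg; apply: Hf; apply: iterder_trans Hg; apply: iterderS; first exact: iterder0.
    by apply/vbasis_mem/memt_nth.
  have I2 := Im_vanish k.+1 (vanish_lder mpi (fun A => memv_proj _ _) vi).
  have I3 := eul_mpow mi.
  have I4 := Im_vanish k.+1 (vanishMl (alg_cst _ k%:R) vi).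
  have S := ImD I4 (ImD I1 (ImN (ImD I2 I3))).
  have kk : k%:R != 0 :> K by rewrite pnatr_eq0 -lt0n.
  apply: (Im_ext (ImM (_ : mpow 0 (fun=> k%:R^-1)) S)) => [|A]; first exact: alg_cst.
  rewrite /eul lderB//; apply: (mulfI kk); rewrite mulVKf//; ring.
have [e me Ve] := krull_polyf (J := vanish H) (fun f vf => vf.1) (vanish0 H) (@vanishD H) (@vanishMl H) pf H0.
exists (fun A => 1 - e A).
  by apply: alg_sub; [exact: alg_cst|exact: mpow_polyf me].
split; first by rewrite (mpow1_at1 me) subr0.
by rewrite (_ : (fun A => _) = fun A => f A - e A * f A)//; apply/funext => A; ring.
Qed.

(** Vanishing near 1 passes to derivatives: if [r * h] vanishes on [H], then so does [r * r] times a
    derivative of [h]. *)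
Lemma germ_iterder f q g : polyf f -> polyf q -> q 1 <> 0 ->
  vanish H (fun A => q A * f A) -> iterder [set` lie H] f g -> g 1 = 0.
Proof.
move=> pf pq q1 vq Hg.
suff : exists2 q, polyf q & q 1 <> 0 /\ vanish H (fun A => q A * g A).
  move=> [r _ [rx [_ /(_ _ H1)/eqP]]]; rewrite s1 mulf_eq0 => /orP[] /eqP //.
elim: Hg => [|h X fh [r pr [rx vr]] XL]; first by exists q.
have ph := polyf_iterder pf fh.
exists (fun A => r A * r A); first exact: alg_mul.
split; first by move=> /eqP; rewrite mulf_eq0 => /orP[] /eqP.
have V1 := vanishMl pr (vanish_der XL vr).
have V2 := vanishMl (polyf_der X pr) vr.
have := vanishD V1 (vanishN V2); congr vanish; apply/funext => A.
rewrite derM//; ring.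
Qed.

Hypothesis cH : zconn H.

(* The Euler operator shows that, modulo the functions vanishing on [H], [f] lies in
   every power of the maximal ideal at [1]; so [q * f] vanishes on [H] for some [q]
   with [q 1 = 1].  By translation the points where all the derivatives vanish form
   a set which is both open and closed in [H]. *)
Lemma taylor_principle f : polyf f ->
  (forall g, iterder [set` lie H] f g -> g 1 = 0) -> vanish H f.
Proof.
move=> pf Hf.
pose Z1 := [set x | forall g, iterder [set` lie H] f g -> g (s x) = 0].
pose Z2 := [set x | forall q, polyf q -> vanish H (fun A => q A * f A) -> q (s x) = 0].
have loc x : H x -> Z1 x -> exists2 q, polyf q & q (s x) = 1 /\ vanish H (fun A => q A * f A).
  move=> Hx Zx.
  have [|g Hg|q pq [q1 vq]] := @taylor_local (fun A => f (s x *m A)).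
  - exact: polyf_mul.
  - by have [h Hh ->] := iterder_mul Hg; rewrite mulmx1; exact: Zx.
  exists (fun A => q (s x^-1%g *m A)); first exact: polyf_mul.
  rewrite -sM mulVg s1 q1; split=> //.
  have := vanish_mul (HV Hx) vq; congr vanish; apply/funext => A.
  by rewrite mulmxA -sM mulgV s1 mul1mx.
have glob x : H x -> (exists q, [/\ polyf q, vanish H (fun A => q A * f A) & q (s x) <> 0]) -> Z1 x.
  move=> Hx [q [pq vq qx]] g Hg.
  have Hg' : iterder [set` lie H] (fun A => f (s x *m A)) (fun A => g (s x *m A)).
    elim: Hg => [|h X _ IHg XL]; first exact: iterder0.
    have := iterderS IHg XL; congr iterder.
    by apply/funext => A; rewrite der_mul.
  rewrite -[s x]mulmx1; apply: (germ_iterder (polyf_mul (s x) pf) (polyf_mul (s x) pq) _ _ Hg').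
    by rewrite mulmx1.
  exact: vanish_mul vq.
have [||x Hx|x Hx Z1x Z2x|HZ1|HZ2] := cH (Z1 := Z1) (Z2 := Z2).
- by apply: zclosed_locus => g; exact: polyf_iterder.
- have := @zclosed_locus [set q | polyf q /\ vanish H (fun A => q A * f A)].
  rewrite (_ : [set x | _] = Z2); first by apply=> q [].
  apply/seteqP; split=> x /= Hx; first by move=> q pq vq; apply: Hx.
  by move=> q [pq vq]; exact: Hx.
- have [Zx|nZx] := pselect (Z2 x); [by right|left; apply: glob => //].
  move/existsNP: nZx => [q /not_implyP[pq /not_implyP[vq qx]]].
  by exists q.
- have [q pq [qx vq]] := loc x Hx Z1x.
  by have /eqP := Z2x q pq vq; rewrite qx oner_eq0.
- by split=> // x /HZ1; apply; exact: iterder0.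
- exfalso; have [|q pq [qx vq]] := loc 1%g H1.
    by move=> g Hg; rewrite s1; exact: Hf.
  by have /eqP := HZ2 _ H1 q pq vq; rewrite qx oner_eq0.
Qed.

End Subgroup.
End TaylorPrinciple.

(** * Linear groups *)

Section LderMore.
Variables (K : numFieldType) (n : nat).
Local Notation M := 'M[K]_n.+1.
Implicit Types (f g : M -> K) (A X : M).

Lemma lder_linmap f (h : {linear M -> M}) A X :
  lder (fun C => f (h C)) A X = lder f (h A) (h X).
Proof.
rewrite /lder /line_poly; suff -> : [set P : {poly K} | forall t, P.[t] = f (h (A + t *: X))] =
  [set P : {poly K} | forall t, P.[t] = f (h A + t *: h X)] by [].
by apply/seteqP; split=> P /= H t; rewrite H linearD linearZ.
Qed.

Lemma lder_poly f A X (P : {poly K}) : (forall t, P.[t] = f (A + t *: X)) ->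
  lder f A X = P`_1.
Proof. by move=> H; rewrite /lder (line_polyE H). Qed.

Lemma lder_quadratic f A X a b c : (forall t, f (A + t *: X) = a + t * b + t * t * c) ->
  lder f A X = b.
Proof.
move=> H; rewrite (@lder_poly _ _ _ (a%:P + b *: 'X + c *: ('X * 'X))).
  by rewrite !coefD coefC !coefZ coefX coefMX coefX /= mulr0 addr0 add0r mulr1.
by move=> t; rewrite H !(hornerD, hornerZ, hornerC, hornerX, hornerM); ring.
Qed.

Definition mxform (C X : M) : K := \sum_i \sum_j C i j * X i j.

Lemma mxform_linear C : linear_for *%R (mxform C).
Proof.
move=> a X Y; rewrite /mxform mulr_sumr -big_split; apply: eq_bigr => i _ /=.
by rewrite mulr_sumr -big_split; apply: eq_bigr => j _ /=; rewrite !mxE; ring.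
Qed.

Lemma mxformD C X Y : mxform C (X + Y) = mxform C X + mxform C Y.
Proof. by have := mxform_linear C 1 X Y; rewrite scale1r mul1r. Qed.

Lemma mxform0 C : mxform C 0 = 0.
Proof. by rewrite /mxform big1// => i _; rewrite big1// => j _; rewrite mxE mulr0. Qed.

Lemma mxformZ C a X : mxform C (a *: X) = a * mxform C X.
Proof. by have := mxform_linear C a X 0; rewrite addr0 mxform0 addr0. Qed.

Lemma alg_mxform (T J : Type) (y : J -> T -> K) C (F : T -> M) : mxalg y F ->
  alg y (fun x => mxform C (F x)).
Proof.
move=> HF; apply: alg_sum => i _; apply: alg_sum => j _.
by apply: alg_mul => //; exact: alg_cst.
Qed.

(** Membership in a subspace becomes the vanishing of linear forms, to which the results on
    polynomial functions apply. *)
Lemma mem_vspace_form (U : {vspace M}) X :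
  (forall C, (forall Y, Y \in U -> mxform C Y = 0) -> mxform C X = 0) -> X \in U.
Proof.
move=> H; apply/negPn/negP => /vspace_separation[C CU].
by rewrite -/(mxform C X) H ?eqxx.
Qed.

End LderMore.

Lemma mxaxpy (R : pzRingType) p q (A B : 'M[R]_(p, q)) t i j :
  (A + t *: B) i j = A i j + t * B i j.
Proof. by rewrite !mxE. Qed.

(* The involution [J] makes inversion a linear map: [linearization] represents [x]
   by the diagonal blocks [S x] and [(S x^-1)^T], which [J] exchanges. *)
Record linear_group (K : numFieldType) n (G : groupType) (s : G -> 'M[K]_n.+1)
    (J : 'M[K]_n.+1) : Prop := LinearGroup {
  lgM : forall x y : G, s (x * y)%g = s x *m s y;
  lg1 : s 1%g = 1;
  lgJ : J *m J = 1;
  lgV : forall x, s x^-1%g = J *m (s x)^T *m J;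
  lg_inj : injective s;
  lg_closed : forall A, (forall f, vanish s setT f -> f A = 0) -> exists x, s x = A
}.

Section LinearGroup.
Variables (K : numFieldType) (n : nat) (G : groupType).
Local Notation M := 'M[K]_n.+1.
Variables (s : G -> M) (J : M).
Hypothesis lgs : linear_group s J.
Implicit Types (H Z : set G) (f g : M -> K) (A X Y : M) (U : {vspace M}).

Let sM := lgM lgs.
Let s1 := lg1 lgs.
Let sV := lgV lgs.
Let JJ := lgJ lgs.

(** The linear antiautomorphism that sends [s x] to [s x^-1]; it makes [Ad x] polynomial in
    [s x]. *)
Definition tau A : M := J *m A^T *m J.

Lemma tauD A B : tau (A + B) = tau A + tau B.
Proof. by rewrite /tau linearD mulmxDr mulmxDl. Qed.
Lemma tauZ a A : tau (a *: A) = a *: tau A.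
Proof. by rewrite /tau linearZ -scalemxAr -scalemxAl. Qed.
Lemma tauM A B : tau (A *m B) = tau B *m tau A.
Proof. by rewrite /tau trmx_mul -!mulmxA (mulmxA J J) JJ mul1mx. Qed.

Lemma mxalg_tau (T I : Type) (y : I -> T -> K) F : mxalg y F -> mxalg y (fun x => tau (F x)).
Proof.
move=> HF; apply: mxalgM; last exact: mxalg_cst.
by apply: mxalgM; [exact: mxalg_cst|exact: mxalg_trmx].
Qed.

Definition Ad x X : M := s x *m X *m s x^-1%g.

Lemma AdE x X : Ad x X = s x *m X *m tau (s x).
Proof. by rewrite /Ad sV. Qed.
Lemma Ad_linear x : linear (Ad x).
Proof. by move=> a X Y; rewrite /Ad mulmxDr mulmxDl -scalemxAr -scalemxAl. Qed.
HB.instance Definition _ x := GRing.isLinear.Build K M M *:%R (Ad x) (Ad_linear x).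

Lemma sVl x : s x^-1%g *m s x = 1. Proof. by rewrite -sM mulVg s1. Qed.
Lemma sVr x : s x *m s x^-1%g = 1. Proof. by rewrite -sM mulgV s1. Qed.

Lemma AdM x X Y : Ad x (X *m Y) = Ad x X *m Ad x Y.
Proof. by rewrite /Ad !mulmxA -(mulmxA _ (s x^-1%g) (s x)) sVl mulmx1. Qed.
Lemma Ad_comp x y X : Ad (x * y)%g X = Ad x (Ad y X).
Proof. by rewrite /Ad invgM !sM !mulmxA. Qed.
Lemma Ad_id X : Ad 1%g X = X.
Proof. by rewrite /Ad invg1 s1 mulmx1 mul1mx. Qed.
Lemma AdK x X : Ad x^-1%g (Ad x X) = X.
Proof. by rewrite -Ad_comp mulVg Ad_id. Qed.
Lemma AdVK x X : Ad x (Ad x^-1%g X) = X.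
Proof. by rewrite -Ad_comp mulgV Ad_id. Qed.
Lemma Ad_trace x X : \tr (Ad x X) = \tr X.
Proof. by rewrite /Ad mxtrace_mulC mulmxA sVl mul1mx. Qed.
Lemma Ad_exp x X k : Ad x (X ^+ k) = Ad x X ^+ k.
Proof.
elim: k => [|k IH]; first by rewrite !expr0 /Ad mulmx1 sVr.
by rewrite !exprS -!mulmxE AdM IH.
Qed.

Definition zcl H : set G := [set x | forall f, vanish s H f -> f (s x) = 0].

Lemma sub_zcl H : H `<=` zcl H. Proof. by move=> x Hx f [_]; exact. Qed.

Lemma zcl_closed H : zclosed s (zcl H).
Proof. by apply: zclosed_locus => f []. Qed.

Lemma zcl_min H Z : zclosed s Z -> H `<=` Z -> zcl H `<=` Z.
Proof.
by move=> cZ HZ x Hx; apply: cZ => f pf Hf; apply: Hx; split=> // y /HZ; exact: Hf.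
Qed.

Lemma zclosed_preim (F : M -> M) (t : G -> G) Z : (forall x, s (t x) = F (s x)) ->
  mxalg mxentry F -> zclosed s Z -> zclosed s [set x | Z (t x)].
Proof.
move=> tF aF cZ x Hx; apply: cZ => f pf Hf; rewrite tF.
apply: (Hx (fun A => f (F A))); first exact: polyf_mxalg.
by move=> z; rewrite -tF; exact: Hf.
Qed.

Lemma zclosed_bigI (I : Type) (Z : I -> set G) : (forall i, zclosed s (Z i)) ->
  zclosed s [set x | forall i, Z i x].
Proof.
by move=> cZ x Hx i; apply: cZ => f pf Hf; apply: Hx => // z /(_ i); exact: Hf.
Qed.

Lemma zclosed_vspace (F : M -> M) U : mxalg mxentry F -> zclosed s [set x | F (s x) \in U].
Proof.
move=> aF x Hx; apply: mem_vspace_form => C HC.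
by apply: (Hx (fun A => mxform C (F A))) => [|z /HC//]; exact: alg_mxform.
Qed.

Lemma mulmx_expand A X B A' X' t : (A + t *: X) *m B *m (A' + t *: X') =
  A *m B *m A' + t *: (X *m B *m A' + A *m B *m X') + (t * t) *: (X *m B *m X').
Proof.
rewrite mulmxDr !mulmxDl -!scalemxAl -!scalemxAr scalerA scalerDr !addrA.
by congr (_ + _); rewrite -!addrA; congr (_ + _); rewrite addrC.
Qed.

Lemma lder_conj C A X B : lder (fun A => mxform C (A *m B *m tau A)) A X =
  mxform C (X *m B *m tau A + A *m B *m tau X).
Proof.
apply: (@lder_quadratic _ _ _ _ _ (mxform C (A *m B *m tau A)) _
  (mxform C (X *m B *m tau X))) => t.
by rewrite tauD tauZ mulmx_expand !mxformD !mxformZ mxformD.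
Qed.

(** Derivative at 1 of the equation [A *m tau A = 1], valid on the group. *)
Lemma lie_tau H X : X \in lie s H -> tau X = - X.
Proof.
move=> /lieP HX; suff : X + tau X = 0 by move/eqP; rewrite addrC addr_eq0 => /eqP.
apply/matrixP => i j; rewrite [RHS]mxE.
pose f A := (A *m tau A) i j - (1%:M : M) i j.
rewrite -(HX f).
  apply/esym/(@lder_quadratic _ _ _ _ _ 0 _ ((X *m tau X) i j)) => t.
  have t1 : tau 1 = 1 by rewrite /tau trmx1 mulmx1 JJ.
  have E : (1 + t *: X) *m tau (1 + t *: X) - 1 = t *: (X + tau X) + (t * t) *: (X *m tau X).
    rewrite tauD tauZ t1 mulmxDl mul1mx mulmxDr mulmx1 -scalemxAl -scalemxAr scalerA.
    rewrite (addrC 1) -(addrA (t *: tau X)) (addrC 1) addrA addrK.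
    by rewrite scalerDr addrA (addrC (t *: tau X)).
  rewrite /f; have := congr1 (fun Z : M => Z i j) E.
  by rewrite /= [(_ - 1 : M) i j]mxE [(- 1 : M) i j]mxE => ->; rewrite !mxE; ring.
split.
  apply: alg_sub; last exact: alg_cst.
  by apply: mxalgM; [exact: mxalg_id|apply: mxalg_tau; exact: mxalg_id].
by move=> x _; rewrite /f /tau -sV sVr subrr.
Qed.

Lemma lie_Ad H h : (forall x, H x -> H (h^-1 * x * h)%g) -> forall X, X \in lie s H -> Ad h^-1%g X \in lie s H.
Proof.
move=> nH X /lieP HX; apply/lieP => f [pf Hf].
have A1 : Ad h^-1%g (1 : M) = 1 by rewrite /Ad mulmx1 sVr.
rewrite -{1}A1 -lder_linmap; apply: HX; split.
  by apply: polyf_mxalg pf _; apply: mxalg_lin; exact: mxalg_id.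
move=> x /nH/Hf; rewrite !sM -{2}[h]invgK; exact.
Qed.

Section Subgroup.
Variable H : set G.
Hypothesis sgH : subgroup H.

Lemma subgroup1 : H 1%g. Proof. by case: sgH. Qed.
Lemma subgroupV x : H x -> H x^-1%g.
Proof. by move=> Hx; rewrite -[x^-1%g]mul1g; apply: sgH.2 => //; exact: subgroup1. Qed.
Lemma subgroupM x y : H x -> H y -> H (x * y)%g.
Proof. by move=> Hx Hy; rewrite -[y]invgK; apply: sgH.2 => //; exact: subgroupV. Qed.

Lemma lie_Ad_sub h X : H h -> X \in lie s H -> Ad h X \in lie s H.
Proof.
move=> Hh XL; rewrite -[h]invgK; apply: lie_Ad XL => x Hx; rewrite invgK.
by apply: subgroupM; [exact: subgroupM|exact: subgroupV].
Qed.

(** The derivative at 1 of [Ad] in the direction [X] is the bracket with [X]; forms vanishing on [U]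
    are differentiated along [H]. *)
Lemma lie_stable_bracket U X Y : (forall h (Z : M), H h -> Z \in U -> Ad h Z \in U) ->
  X \in lie s H -> Y \in U -> X *m Y - Y *m X \in U.
Proof.
move=> HU XL YU; apply: mem_vspace_form => C HC.
have /lieP/(_ (fun A => mxform C (A *m Y *m tau A))) := XL.
have t1 : tau 1 = 1 by rewrite /tau trmx1 mulmx1 JJ.
rewrite lder_conj t1 (lie_tau XL) mulmx1 mul1mx mulmxN; apply; split.
  apply: alg_mxform; apply: mxalgM; last by apply: mxalg_tau; exact: mxalg_id.
  by apply: mxalgM; [exact: mxalg_id|exact: mxalg_cst].
by move=> x Hx; rewrite -AdE; apply/HC/HU.
Qed.

Lemma lie_bracket X Y : X \in lie s H -> Y \in lie s H -> X *m Y - Y *m X \in lie s H.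
Proof. by apply: lie_stable_bracket => h Z Hh; exact: lie_Ad_sub. Qed.

Lemma lie_stable_row (W : {vspace 'rV[K]_n.+1}) X w :
  (forall h v, H h -> v \in W -> v *m s h \in W) ->
  X \in lie s H -> w \in W -> w *m X \in W.
Proof.
move=> HW /lieP HX wW; apply/negPn/negP => /vspace_separation[C CW] /eqP; apply.
transitivity (lder (fun A => \sum_i \sum_j C i j * (w *m A) i j) 1 X).
  apply/esym/(@lder_quadratic _ _ _ _ _ (\sum_i \sum_j C i j * w i j) _ 0) => t.
  rewrite mulr0 addr0 mulr_sumr -big_split; apply: eq_bigr => i _ /=.
  rewrite mulr_sumr -big_split; apply: eq_bigr => j _ /=.
  by rewrite mulmxDr mulmx1 -scalemxAr !mxE; ring.
apply: HX; split=> [|x Hx]; last by apply: CW; exact: HW.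
apply: alg_sum => i _; apply: alg_sum => j _; apply: alg_mul; first exact: alg_cst.
by apply: mxalgM; [exact: mxalg_cst|exact: mxalg_id].
Qed.

Hypothesis cH : zconn s H.

(** Taylor's principle for a whole family stable under derivation, so that iterated derivatives do
    not have to be computed. *)
Lemma taylor_family (F : set (M -> K)) f : (forall g, F g -> polyf g) ->
  (forall g X, F g -> X \in lie s H -> F (der X g)) -> (forall g, F g -> g 1 = 0) ->
  F f -> forall x, H x -> f (s x) = 0.
Proof.
move=> pF dF F1 Ff; have pf := pF f Ff.
have [|_ //] := taylor_principle sM s1 sgH cH pf.
by move=> g fg; apply: F1; elim: fg => // h X _ IH XL; exact: dF.
Qed.

Lemma vanish_germ f q : polyf f -> polyf q -> q 1 <> 0 ->
  vanish s H (fun A => q A * f A) -> vanish s H f.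
Proof.
move=> pf pq q1 vq; apply: (taylor_principle sM s1 sgH cH pf) => g.
exact: (germ_iterder sM s1 sgH pf pq q1 vq).
Qed.

(** A connected group is irreducible: if [f] is nonzero at [x], the translate of [g] by [x] vanishes
    near 1, hence on all of [H]. *)
Lemma vanish_prime f g : polyf f -> polyf g -> vanish s H (fun A => f A * g A) ->
  vanish s H f \/ vanish s H g.
Proof.
move=> pf pg vfg; have [vf|nvf] := pselect (vanish s H f); [by left|right].
have [x Hx fx] : exists2 x, H x & f (s x) <> 0.
  apply: contrapT => nx; apply: nvf; split=> // x Hx; apply: contrapT => fx.
  by apply: nx; exists x.
have v : vanish s H (fun A => g (s x *m A)).
  apply: (@vanish_germ _ (fun A => f (s x *m A))); try exact: polyf_mul.
    by rewrite mulmx1.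
  exact: (vanish_mul sM sgH Hx vfg).
have := vanish_mul sM sgH (subgroupV Hx) v; congr vanish; apply/funext => A.
by rewrite mulmxA sVr mul1mx.
Qed.

(** The functions [A |-> C (Ad A Z)] with [Z] in [U] form a family stable under derivation, since
    deriving along [X] replaces [Z] by its bracket with [X]. *)
Lemma Ad_stable U : (forall X Y, X \in lie s H -> Y \in U -> X *m Y - Y *m X \in U) ->
  forall x Y, H x -> Y \in U -> Ad x Y \in U.
Proof.
move=> HU x Y Hx YU; apply: mem_vspace_form => C HC; rewrite AdE.
pose F := [set g : M -> K | exists2 Z : M, Z \in U & g = fun A => mxform C (A *m Z *m tau A)].
have t1 : tau 1 = 1 by rewrite /tau trmx1 mulmx1 JJ.
apply: (@taylor_family F (fun A => mxform C (A *m Y *m tau A))) => //.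
- move=> _ [B _ ->].
  apply: alg_mxform; apply: mxalgM; last by apply: mxalg_tau; exact: mxalg_id.
  by apply: mxalgM; [exact: mxalg_id|exact: mxalg_cst].
- move=> _ X [B HB ->] XL; exists (X *m B - B *m X); first exact: HU.
  apply/funext => A.
  rewrite /der lder_conj tauM (lie_tau XL); congr mxform.
  by rewrite mulNmx mulmxN mulmxBr mulmxBl !mulmxA.
- by move=> _ [B HB ->]; rewrite t1 mulmx1 mul1mx; exact: HC.
- by exists Y.
Qed.

Lemma lie_commutes Y : (forall X, X \in lie s H -> Y *m X = X *m Y) ->
  forall x, H x -> Y *m s x = s x *m Y.
Proof.
move=> HY x Hx; apply/eqP; rewrite -subr_eq0 -memv0; apply: mem_vspace_form => C HC.
pose F := [set g : M -> K | exists B, g = fun A => mxform C ((Y *m A - A *m Y) *m B)].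
apply: (@taylor_family F (fun A => mxform C (Y *m A - A *m Y))) => //.
- move=> _ [B ->]; apply: alg_mxform; apply: mxalgM; last exact: mxalg_cst.
  by apply: mxalgB; apply: mxalgM; by [exact: mxalg_id|exact: mxalg_cst].
- move=> _ X [B ->] XL; exists (X *m B); apply/funext => A.
  apply: (@lder_quadratic _ _ _ _ _ (mxform C ((Y *m A - A *m Y) *m B)) _ 0) => t.
  rewrite mulr0 addr0 -!mxformZ -!mxformD; congr mxform.
  have -> : Y *m (A + t *: (A *m X)) - (A + t *: (A *m X)) *m Y =
      Y *m A - A *m Y + t *: ((Y *m A - A *m Y) *m X).
    rewrite (mulmxDr Y) (mulmxDl A) -scalemxAl -scalemxAr opprD addrACA; congr (_ + _).
    by rewrite -scalerBr mulmxBl -!mulmxA (HY X XL).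
  by rewrite mulmxDl -scalemxAl mulmxA.
- by move=> _ [B ->]; rewrite mulmx1 mul1mx subrr mul0mx mxform0.
- by exists 1; apply/funext => A; rewrite mulmx1.
Qed.

(** The ideal of [H'] is itself stable under the derivations coming from [lie s H], and its members
    vanish at 1; Taylor's principle makes them vanish on [H]. *)
Lemma lie_eq_sub H' : subgroup H' -> zclosed s H' -> (lie s H <= lie s H')%VS -> H `<=` H'.
Proof.
move=> sgH' cH' LL x Hx; apply: cH' => f pf Hf.
apply: (@taylor_family (vanish s H') f) => // [g []//|g X vg XL|g [_ Hg]].
- by apply: (vanish_der sM sgH') => //; exact: (subvP LL).
- by rewrite -(lg1 lgs); apply: Hg; case: sgH'.
Qed.

End Subgroup.
End LinearGroup.

(** * Replicas and exponentials *)

Section Weights.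
Variables (K : numFieldType) (n : nat).
Local Notation M := 'M[K]_n.+1.
Variable X : M.
Implicit Types (f g : M -> K) (A B : M) (w : K).

Definition shift_der w f A : K := der X f A - w * f A.

Lemma polyf_shift w f : polyf f -> polyf (shift_der w f).
Proof.
by move=> pf; apply: alg_sub; [exact: polyf_der|apply: alg_mul => //; exact: alg_cst].
Qed.

Lemma shift_derD w f g : polyf f -> polyf g ->
  shift_der w (fun A => f A + g A) = fun A => shift_der w f A + shift_der w g A.
Proof. by move=> pf pg; apply/funext => A; rewrite /shift_der /der lderD//; ring. Qed.

Lemma shift_derM u v f g : polyf f -> polyf g ->
  shift_der (u + v) (fun A => f A * g A) =
  fun A => shift_der u f A * g A + f A * shift_der v g A.
Proof. by move=> pf pg; apply/funext => A; rewrite /shift_der derM//; ring. Qed.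

Lemma shift_derC u v f : polyf f -> shift_der u (shift_der v f) = shift_der v (shift_der u f).
Proof.
move=> pf; apply/funext => A; have pd := polyf_der X pf.
have E w : der X (shift_der w f) A = der X (der X f) A - w * der X f A.
  rewrite /der lderB//; last by apply: alg_mul => //; exact: alg_cst.
  by rewrite lderM ?lder_cst ?mul0r ?add0r//; exact: alg_cst.
by rewrite {1}/shift_der [RHS]/shift_der !E /shift_der; ring.
Qed.

Fixpoint gweight k w f : Prop :=
  if k is k'.+1 then gweight k' w (shift_der w f) else forall A, f A = 0.

Lemma gweight_ext k w f g : gweight k w f -> f =1 g -> gweight k w g.
Proof. by move=> H /funext <-. Qed.

Lemma shift_der0 w : shift_der w (fun=> 0) = fun=> 0.
Proof. by apply/funext => A; rewrite /shift_der /der lder_cst mulr0 subr0. Qed.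

Lemma gweight0 k w f : (forall A, f A = 0) -> gweight k w f.
Proof.
elim: k f => [//|k IH] f f0; apply: IH => A.
by rewrite (_ : f = fun=> 0) ?shift_der0//; apply/funext.
Qed.

Lemma gweightS k w f : gweight k w f -> gweight k.+1 w f.
Proof.
by elim: k f => [|k IH] f; [exact: (@gweight0 1)|exact: IH].
Qed.

Lemma gweight_le k l w f : (k <= l)%N -> gweight k w f -> gweight l w f.
Proof.
by move=> /subnKC <-; elim: (l - k)%N => [|d IH]; rewrite ?addn0// addnS => /IH/gweightS.
Qed.

Lemma gweightD k w f g : polyf f -> polyf g -> gweight k w f -> gweight k w g ->
  gweight k w (fun A => f A + g A).
Proof.
elim: k f g => [|k IH] f g pf pg /=; first by move=> f0 g0 A; rewrite f0 g0 addr0.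
by move=> Hf Hg; rewrite shift_derD//; apply: IH => //; exact: polyf_shift.
Qed.

Lemma gweight_sum k w (I : Type) (r : seq I) (P : pred I) (f : I -> M -> K) :
  (forall i, polyf (f i)) -> (forall i, P i -> gweight k w (f i)) ->
  gweight k w (fun A => \sum_(i <- r | P i) f i A).
Proof.
move=> pf Hf; elim: r => [|i r IH]; first by apply: gweight0 => A; rewrite big_nil.
case Pi: (P i); last by apply: (gweight_ext IH) => A; rewrite big_cons Pi.
apply: (gweight_ext (gweightD (pf i) _ (Hf i Pi) IH)).
  by apply: alg_sum => j _; exact: pf.
by move=> A; rewrite big_cons Pi.
Qed.

(** By the product rule, one shifted derivation replaces the product by two products of smaller
    total order. *)
Lemma gweightM k l u v f g : polyf f -> polyf g -> gweight k u f -> gweight l v g ->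
  gweight (k + l) (u + v) (fun A => f A * g A).
Proof.
move=> pf pg.
have [m] := ubnP (k + l)%N; elim: m k l f g pf pg => [//|m IH] [|k] [|l] f g pf pg klm Hf Hg.
- by apply: gweight0 => A; rewrite Hf mul0r.
- by apply: gweight0 => A; rewrite Hf mul0r.
- by apply: gweight0 => A; rewrite Hg mulr0.
- rewrite addSn /= shift_derM//.
  have ps w h := @polyf_shift w h.
  apply: gweightD.
  + by apply: alg_mul => //; exact: ps.
  + by apply: alg_mul => //; exact: ps.
  + by apply: (IH k l.+1) => //; exact: ps.
  + rewrite addnS -addSn; apply: (IH k.+1 l) => //; first exact: ps.
    by move: klm; rewrite addnS.
Qed.

Section Split.
Variable I : set (M -> K).
Hypotheses (I0 : I (fun=> 0)) (ID : forall f g, I f -> I g -> I (fun A => f A + g A))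
  (IZ : forall a f, I f -> I (fun A => a * f A)) (Ider : forall f, I f -> I (der X f)).

Let IB f g : I f -> I g -> I (fun A => f A - g A).
Proof.
move=> If Ig; have := ID If (IZ (-1) Ig).
by congr I; apply/funext => A; rewrite mulN1r.
Qed.

Let Ishift w f : I f -> I (shift_der w f).
Proof. by move=> If; apply: IB; [exact: Ider|exact: IZ]. Qed.

Let split1 k w w0 f : w != w0 -> polyf f -> gweight k w f -> I (shift_der w0 f) -> I f.
Proof.
move=> ww0; elim: k f => [|k IH] f pf.
  by move=> f0 _; rewrite (_ : f = fun=> 0)//; exact/funext.
move=> /= Hf I0f; have Iwf : I (shift_der w f).
  by apply: IH => //; [exact: polyf_shift|rewrite shift_derC//; exact: Ishift].
have w0' : w0 - w != 0 by rewrite subr_eq0 eq_sym.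
have := IZ (w0 - w)^-1 (IB Iwf I0f); congr I; apply/funext => A.
by rewrite /shift_der; field.
Qed.

(** A space stable under the derivation contains the weight components of its members. Repeated
    shifts by [w0] kill the component of [w0], and [split1] undoes their effect on the other
    components. *)
Lemma gweight_split k (W : seq K) (P : K -> M -> K) : uniq W ->
  (forall w, w \in W -> polyf (P w) /\ gweight k w (P w)) ->
  I (fun A => \sum_(w <- W) P w A) -> forall w, w \in W -> I (P w).
Proof.
elim: W P => [//|w0 W IH] P /= /andP[w0W uW] HP IP.
have pP w : w \in w0 :: W -> polyf (P w) by move=> /HP[].
have IW w : w \in W -> I (P w).
  have H d (Q : K -> M -> K) : gweight d w0 (Q w0) ->
      (forall w, w \in w0 :: W -> polyf (Q w) /\ (w \in W -> gweight k w (Q w))) ->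
      I (fun A => \sum_(w <- w0 :: W) Q w A) -> forall w, w \in W -> I (Q w).
    elim: d Q => [|d IHd] Q Q0 HQ IQ u uW'.
      apply: IH uW' => //.
        by move=> v vW; have [|? H] := HQ v; [rewrite inE vW orbT|split=> //; exact: H].
      by move: IQ; congr I; apply/funext => A; rewrite big_cons Q0 add0r.
    have [|pQ /(_ uW') gQ] := HQ u; first by rewrite inE uW' orbT.
    apply: (split1 (w0 := w0) _ pQ gQ).
      by apply: contraNneq w0W => <-.
    apply: (IHd (fun v => shift_der w0 (Q v))) => //.
      move=> v vW; have [pv gv] := HQ v vW; split; first exact: polyf_shift.
      move=> /gv; elim: (k) (Q v) pv => [|k' IHk] q pq /=.
        by move=> q0 A; rewrite (_ : q = fun=> 0) ?shift_der0//; apply/funext.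
      by rewrite shift_derC// => /IHk; apply; exact: polyf_shift.
    have := Ishift w0 IQ; congr I.
    have {}pQ v : v \in w0 :: W -> polyf (Q v) by move=> /HQ[].
    elim: (w0 :: W) pQ => [|v r IHr] pQ.
      rewrite (_ : (fun A => _) = fun=> 0) ?shift_der0; last by apply/funext => A; rewrite big_nil.
      by apply/funext => A; rewrite big_nil.
    have pr : polyf (fun A => \sum_(w <- r) Q w A).
      elim: r pQ {IHr} => [|v' r IHr'] pQ.
        by apply: (alg_ext (alg_cst _ 0)) => A; rewrite big_nil.
      have S : polyf (fun A => Q v' A + \sum_(w <- r) Q w A).
        apply: alg_add; first by apply: pQ; rewrite !inE eqxx orbT.
        apply: IHr' => v'' ; rewrite inE => /predU1P[->|vr]; apply: pQ.
          by rewrite inE eqxx.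
        by rewrite !inE vr !orbT.
      by apply: (alg_ext S) => A; rewrite big_cons.
    rewrite (_ : (fun A => _) = fun A => Q v A + \sum_(w <- r) Q w A); last first.
      by apply/funext => A; rewrite big_cons.
    rewrite shift_derD//; last by apply: pQ; rewrite mem_head.
    rewrite IHr; last by move=> v' vr; apply: pQ; rewrite inE vr orbT.
    by apply/funext => A; rewrite big_cons.
  apply: (H k P) => //; first by have [] := HP _ (mem_head _ _).
  move=> v vW; have [pv gv] := HP v vW; by split.
move=> w; rewrite inE => /predU1P[->|/IW//].
have IS (r : seq K) : {subset r <= W} -> I (fun A => \sum_(w <- r) P w A).
  elim: r => [|v r IHr] rW.
    by rewrite (_ : (fun A => _) = fun=> 0)//; apply/funext => A; rewrite big_nil.
  have Iv : I (P v) by apply: IW; rewrite rW ?mem_head.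
  have /(ID Iv) : I (fun A => \sum_(w <- r) P w A).
    by apply: IHr => u ur; apply: rW; rewrite inE ur orbT.
  by congr I; apply/funext => A; rewrite big_cons.
have := IB IP (IS W (fun _ => id)); congr I; apply/funext => A.
by rewrite big_cons addrK.
Qed.

End Split.
End Weights.

Lemma der_entry_mul (K : numFieldType) n (Y B : 'M[K]_n.+1) i j (A : 'M[K]_n.+1) :
  der Y (fun A : 'M[K]_n.+1 => (A *m B) i j) A = (A *m Y *m B) i j.
Proof.
apply: (@lder_quadratic _ _ _ _ _ ((A *m B) i j) _ 0) => t.
by rewrite mulmxDl -scalemxAl mxaxpy mulr0 addr0.
Qed.

Section Replicas.
Variables (K : numClosedFieldType) (n : nat) (G : groupType).
Local Notation M := 'M[K]_n.+1.
Variables (s : G -> M) (J : M).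
Hypothesis lgs : linear_group s J.
Variable H : set G.
Hypothesis sgH : subgroup H.
Variables (X : M) (E : seq K).
Hypotheses (XL : X \in lie s H) (uE : uniq E) (kX : kills E X).

Let shift_entry w (B : M) i j : shift_der X w (fun A : M => (A *m B) i j) =
  fun A : M => (A *m ((X - w%:M) *m B)) i j.
Proof.
apply/funext => A; rewrite /shift_der der_entry_mul mulmxBl mulmxBr mul_scalar_mx.
by rewrite -scalemxAr mulmxA -scaleNr mxaxpy mulNr.
Qed.

Let gweight_entry b i j : b \in E ->
  gweight X n.+1 b (fun A : M => (A *m spidem E X b) i j).
Proof.
move=> bE.
have gE k (B : M) : (X - b%:M) ^+ k * B = 0 -> gweight X k b (fun A : M => (A *m B) i j).
  elim: k B => [|k IH] B.
    by rewrite expr0 mul1r => -> A; rewrite mulmx0 mxE.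
  by rewrite /= shift_entry exprSr -mulrA => /IH.
apply: gE; rewrite (_ : (X - b%:M) ^+ _ = horner_mx X (('X - b%:P) ^+ n.+1)); last first.
  by rewrite rmorphXn rmorphB /= horner_mx_X horner_mx_C.
exact: (horner_spidem uE kX bE (dvdpp _)).
Qed.

Variable R : K -> (M -> K) -> Prop.
Hypotheses (R0 : forall w, R w (fun=> 0)) (Rc : forall c, R 0 (fun=> c))
  (RD : forall w f g, R w f -> R w g -> R w (fun A => f A + g A))
  (RM : forall u v f g, R u f -> R v g -> R (u + v) (fun A => f A * g A))
  (Rg : forall b i j, b \in E -> R b (fun A : M => (A *m spidem E X b) i j)).

(** The entries of [A *m spidem E X b] have weight [b], weights add under products, and these
    entries generate all polynomial functions. [R] is any property compatible with this grading; it
    is carried to the components, which vanish on [H] by [gweight_split]. *)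
Lemma weight_decomposition p : vanish s H p -> exists (W : seq K) (P : K -> M -> K),
  (forall w, w \in W -> vanish s H (P w) /\ R w (P w)) /\
  forall A, p A = \sum_(w <- W) P w A.
Proof.
move=> vp; have pp := vp.1.
have [I [w [q [k [Hq Ep]]]]] : exists (I : finType) (w : I -> K) (q : I -> M -> K) k,
    (forall i, [/\ polyf (q i), gweight X k (w i) (q i) & R (w i) (q i)]) /\
    forall A, p A = \sum_i q i A.
  elim: pp => [a|[i j]|f g pf [I [w [q [k [Hq Ep]]]]] pg [I' [w' [q' [k' [Hq' Ep']]]]]
                      |f g pf [I [w [q [k [Hq Ep]]]]] pg [I' [w' [q' [k' [Hq' Ep']]]]]].
  - exists unit, (fun=> 0), (fun _ _ => a), 1%N; split=> [_|A]; last first.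
      by rewrite (big_pred1 tt)// => -[].
    split=> //; first exact: alg_cst.
    by move=> A; rewrite /shift_der /der lder_cst mul0r subrr.
  - exists 'I_(size E), (fun k : 'I_(size E) => E`_k), (fun (k : 'I_(size E)) A => (A *m spidem E X E`_k) i j), n.+1.
    split=> [k|A]; last first.
      rewrite -(big_mkord xpredT (fun k => (A *m spidem E X E`_k) i j)).
      rewrite -(big_nth 0 xpredT (fun b => (A *m spidem E X b) i j)).
      by rewrite -summxE -mulmx_sumr (spidem_sum uE kX) mulmx1.
    have bE : E`_k \in E by rewrite mem_nth.
    split; [|exact: gweight_entry|exact: Rg].
    by apply: mxalgM; [exact: mxalg_id|exact: mxalg_cst].
  - pose u (x : I + I') := match x with inl i => w i | inr i => w' i end.
    pose r (x : I + I') := match x with inl i => q i | inr i => q' i end.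
    exists (I + I')%type, u, r, (k + k')%N; split=> [[i|i]|A]; last first.
    + by rewrite big_sumType /= Ep Ep'.
    + have [pi gi Ri] := Hq' i; split=> //; apply: gweight_le gi; exact: leq_addl.
    + have [pi gi Ri] := Hq i; split=> //; apply: gweight_le gi; exact: leq_addr.
  - exists (I * I')%type, (fun x => w x.1 + w' x.2), (fun x A => q x.1 A * q' x.2 A), (k + k')%N.
    split=> [[i i']|A] /=; last first.
      by rewrite Ep Ep' big_distrlr pair_big.
    have [pi gi Ri] := Hq i; have [pi' gi' Ri'] := Hq' i'.
    by split; [exact: alg_mul|exact: gweightM|exact: RM].
pose W := undup [seq w i | i <- enum I].
pose P u A := \sum_(i | w i == u) q i A.
have EP A : p A = \sum_(u <- W) P u A.
  rewrite Ep /P; under [RHS]eq_bigr do rewrite big_mkcond.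
  rewrite exchange_big; apply: eq_bigr => i _ /=.
  have wW : w i \in W by rewrite mem_undup; apply: map_f; rewrite mem_enum.
  rewrite (bigD1_seq (w i)) ?undup_uniq//= eqxx big1 ?addr0// => u /negPf.
  by rewrite eq_sym => ->.
have pP u : polyf (P u) by apply: alg_sum => i _; have [] := Hq i.
exists W, P; split=> // u uW; split.
  apply: (@gweight_split _ _ X (vanish s H) _ _ _ _ k W P) => //.
  - exact: vanish0.
  - exact: vanishD.
  - by move=> a f vf; apply: vanishMl => //; exact: alg_cst.
  - by move=> f; exact: (vanish_der (lgM lgs) sgH).
  - exact: undup_uniq.
  - move=> v vW; split=> //; apply: gweight_sum => [i|i /eqP <-]; by have [] := Hq i.
  - by move: vp; congr vanish; apply/funext.
rewrite /P; elim: (index_enum I) => [|i r IHr].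
  by rewrite (_ : (fun A => _) = fun=> 0)//; apply/funext => A; rewrite big_nil.
case Pi: (w i == u); last first.
  by move: IHr; congr R; apply/funext => A; rewrite big_cons Pi.
have Ri : R u (q i) by rewrite -(eqP Pi); have [] := Hq i.
by have := RD Ri IHr; congr R; apply/funext => A; rewrite big_cons Pi.
Qed.

End Replicas.

Section ReplicaConsequences.
Variables (K : numClosedFieldType) (n : nat) (G : groupType).
Local Notation M := 'M[K]_n.+1.
Variables (s : G -> M) (J : M).
Hypothesis lgs : linear_group s J.
Variable H : set G.
Hypothesis sgH : subgroup H.

(* Functions vanishing on [H] are sums of generalized weight vectors of the
   derivation defined by [X], on which its replica acts by the scalar [th w]. *)
Lemma lie_replica X E (th : K -> K) : X \in lie s H -> uniq E -> kills E X ->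
  {morph th : x y / x + y} -> spfun E th X \in lie s H.
Proof.
move=> XL uE kX thD; apply/lieP => p vp.
have th0 : th 0 = 0 by apply: (addrI (th 0)); rewrite -thD !addr0.
pose Y := spfun E th X.
have [|||||W [P [HP Ep]]] := @weight_decomposition K n G s J lgs H sgH X E XL uE kX
  (fun w q => polyf q /\ forall A, der Y q A = th w * q A) _ _ _ _ _ p vp.
- by move=> w; split=> [|A]; [exact: alg_cst|rewrite /der lder_cst mulr0].
- by move=> c; split=> [|A]; [exact: alg_cst|rewrite /der lder_cst th0 mul0r].
- move=> w f g [pf Hf] [pg Hg]; split=> [|A]; first exact: alg_add.
  by rewrite /der lderD// -!/(der _ _ _) Hf Hg mulrDr.
- move=> u v f g [pf Hf] [pg Hg]; split=> [|A]; first exact: alg_mul.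
  by rewrite derM// Hf Hg thD; ring.
- move=> b i j bE; split=> [|A].
    by apply: mxalgM; [exact: mxalg_id|exact: mxalg_cst].
  rewrite der_entry_mul -mulmxA [Y *m _](spidem_spfun uE kX) -scalemxAr.
  by rewrite [(_ *: (_ : 'M_ _)) i j]mxE.
have -> : lder p 1 Y = der Y p 1 by rewrite /der mul1mx.
have -> : p = fun A => \sum_(w <- W) P w A by apply/funext.
have : forall w, w \in W -> vanish s H (P w) /\ forall A, der Y (P w) A = th w * P w A.
  by move=> w /HP[vw [_ Hw]].
elim: (W) => [|w r IH] Hr.
  rewrite (_ : (fun A => _) = fun=> 0) ?/der ?lder_cst//.
  by apply/funext => A; rewrite big_nil.
have [vw Hw] := Hr w (mem_head _ _).
rewrite (_ : (fun A => _) = fun A => P w A + \sum_(u <- r) P u A); last first.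
  by apply/funext => A; rewrite big_cons.
have Hr' u : u \in r -> vanish s H (P u) /\ forall A, der Y (P u) A = th u * P u A.
  by move=> ur; apply: Hr; rewrite inE ur orbT.
have pr : polyf (fun A => \sum_(u <- r) P u A).
  elim: (r) Hr' => [|v r' IHr] Hr'.
    by apply: (alg_ext (alg_cst _ 0)) => A; rewrite big_nil.
  have [[pv _] _] := Hr' v (mem_head _ _).
  apply: (alg_ext (alg_add pv (IHr _))) => [u ur|A]; last by rewrite big_cons.
  by apply: Hr'; rewrite inE ur orbT.
rewrite /der lderD//; last exact: vw.1.
rewrite -!/(der _ _ _) IH// Hw addr0 -(lg1 lgs) vw.2 ?mulr0//.
by case: sgH.
Qed.

(** Multiplication by the torus element scales the component of weight [w] by [t ^ k] with
    [th w = k]. The component vanishes at 1, hence at the torus element. *)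
Lemma lie_torus X E (th : K -> K) (m : K -> int) t : X \in lie s H -> uniq E -> kills E X ->
  {morph th : x y / x + y} -> (forall b, b \in E -> th b = (m b)%:~R) -> t != 0 ->
  forall p, vanish s H p -> p (spfun E (fun b => t ^ m b) X) = 0.
Proof.
move=> XL uE kX thD thm t0 p vp.
have th0 : th 0 = 0 by apply: (addrI (th 0)); rewrite -thD !addr0.
pose L := spfun E (fun b => t ^ m b) X.
(* The alternative of a zero function serves the weights at which [th] is not an integer. *)
have [|||||W [P [HP Ep]]] := @weight_decomposition K n G s J lgs H sgH X E XL uE kX
  (fun w q => (forall A, q A = 0) \/ exists2 k : int, th w = k%:~R & forall A, q (A *m L) = t ^ k * q A)
  _ _ _ _ _ p vp.
- by move=> w; left.
- by move=> c; right; exists 0; rewrite ?th0// => A; rewrite expr0z mul1r.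
- move=> w f g [f0|[k thk Hf]] [g0|[l thl Hg]].
  + by left=> A; rewrite f0 g0 addr0.
  + by right; exists l => // A; rewrite !f0 !add0r.
  + by right; exists k => // A; rewrite !g0 !addr0.
  + right; exists k => // A; rewrite Hf Hg mulrDr; congr (_ + t ^ _ * _).
    by apply/eqP; rewrite -(eqr_int K) -thk -thl.
- move=> u v f g [f0|[k thk Hf]] [g0|[l thl Hg]]; try by left=> A; rewrite ?f0 ?g0 ?mul0r ?mulr0.
  right; exists (k + l) => [|A]; first by rewrite thD thk thl rmorphD.
  by rewrite Hf Hg expfzDr//; ring.
- move=> b i j bE; right; exists (m b); first exact: thm.
  move=> A; rewrite -mulmxA [L *m _](spidem_spfun uE kX) -scalemxAr.
  by rewrite [(_ *: (_ : 'M_ _)) i j]mxE.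
rewrite -[spfun _ _ _]mul1mx Ep big_seq big1// => w /HP[vw [->//|[k _ ->]]].
have E1 : s 1%g = 1%:M := lg1 lgs.
by rewrite -E1 vw.2 ?mulr0//; case: sgH.
Qed.

(** The exponential series cut after degree [n]; it is used for matrices with [X ^+ n.+1 = 0], where
    nothing is lost. *)
Definition expm (X : M) : M := \sum_(k < n.+1) (k`!)%:R^-1 *: X ^+ k.

Lemma expm0 : expm 0 = 1.
Proof.
rewrite /expm big_ord_recl big1 => [|k _]; last by rewrite expr0n /= scaler0.
by rewrite fact0 invr1 scale1r addr0 expr0.
Qed.

Lemma expm_curve X p : X ^+ n.+1 = 0 -> polyf p -> exists F : {poly K},
  (forall t, F.[t] = p (expm (t *: X))) /\ (forall t, F^`().[t] = der X p (expm (t *: X))).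
Proof.
move=> Xn; elim=> [a|[i j]|f g pf [F [EF DF]] pg [Q [EQ DQ]]|f g pf [F [EF DF]] pg [Q [EQ DQ]]].
- by exists a%:P; split=> t; rewrite ?derivC ?hornerC// /der lder_cst.
- pose F := \poly_(k < n.+1) ((k`!)%:R^-1 * (X ^+ k) i j).
  exists F; split=> t.
    rewrite horner_poly /mxentry /expm summxE; apply: eq_bigr => k _.
    by rewrite exprZn scalerA mxE mulrAC.
  rewrite /der lder_entry /mxentry /= mulmx_suml summxE.
  rewrite (_ : F^`() = \poly_(k < n) ((k`!)%:R^-1 * (X ^+ k.+1) i j)).
    rewrite horner_poly [RHS]big_ord_recr /= exprZn -!scalemxAl mulmxE -exprSr Xn !scaler0 mxE addr0.
    by apply: eq_bigr => k _; rewrite exprZn -!scalerAl -exprSr scalerA mxE mulrAC.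
  apply/polyP => k; rewrite coef_deriv !coef_poly ltnS; case: ifP => kn; last by rewrite mul0rn.
  rewrite -mulrnAl factS natrM invfM -mulr_natl; congr (_ * _).
  by rewrite mulrA divff ?mul1r// pnatr_eq0.
- exists (F + Q); split=> t; first by rewrite hornerD EF EQ.
  by rewrite derivD hornerD DF DQ /der lderD.
- exists (F * Q); split=> t; first by rewrite hornerM EF EQ.
  by rewrite derivM hornerD !hornerM DF DQ EF EQ derM.
Qed.

(** The derivatives of [F] at 0 are the values at 1 of iterated invariant derivatives of [p], which
    vanish on [H]; a polynomial with zero derivatives at 0 is zero. *)
Lemma lie_expm X t : X \in lie s H -> X ^+ n.+1 = 0 ->
  forall p, vanish s H p -> p (expm (t *: X)) = 0.
Proof.
move=> XL Xn p vp; have [F [EF _]] := expm_curve Xn vp.1.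
suff F0 : F = 0 by rewrite -EF F0 horner0.
have H1 : H 1%g by case: sgH.
have D0 k : forall p F, vanish s H p -> (forall t, F.[t] = p (expm (t *: X))) ->
    (F^`(k)).[0] = 0.
  elim: k => [|k IH] {vp EF}p {}F vp EF.
    by rewrite derivn0 EF scale0r expm0 -(lg1 lgs); exact: vp.2.
  rewrite derivSn; have [F' [EF' DF]] := expm_curve Xn vp.1.
  apply: (IH (der X p)); first exact: (vanish_der (lgM lgs) sgH).
  by move=> u; rewrite -DF; congr (_^`().[_]); apply: poly_fun_inj => v; rewrite EF EF'.
apply/polyP => k; rewrite coef0; have := D0 k p F vp EF.
rewrite horner_coef0 coef_derivn addn0 => /eqP.
by rewrite mulrn_eq0 -[_ == 0%N]negbK -lt0n ffact_gt0 leqnn => /eqP.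
Qed.

Lemma expm_inj X : X ^+ n.+1 = 0 -> (forall t, expm (t *: X) = 1) -> X = 0.
Proof.
move=> Xn H1; apply/matrixP => i j; rewrite mxE.
have [F [EF DF]] := expm_curve Xn (alg_gen mxentry (i, j)).
have : F = ((1 : M) i j)%:P by apply: poly_fun_inj => t; rewrite EF H1 hornerC.
move=> FC; have := DF 0; rewrite FC derivC horner0 scale0r expm0 /der lder_entry mul1mx.
exact: esym.
Qed.

End ReplicaConsequences.

(** * Flags, Engel and connected solvable groups *)

Section Engel.
Variables (K : fieldType) (n : nat).
Local Notation M := 'M[K]_n.
Implicit Types (L : {vspace M}) (x y : M).

Definition lie_closed L := forall x y, x \in L -> y \in L -> x *m y - y *m x \in L.

Lemma vspace_line_decomp (vT : vectType K) (U : {vspace vT}) (x z : vT) :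
  z \in (U + <[x]>)%VS -> exists a u, u \in U /\ z = u + a *: x.
Proof. by move=> /memv_addP[u uU [_ /vlineP[a ->] ->]]; exists a, u. Qed.

(** Engel's theorem for an action [a] on [W2] modulo [W1]. The sign [e] is 1 for the adjoint action,
    on which the induction relies, and -1 for the right action on row vectors. *)
Lemma engel L (Z : vectType K) (a : M -> Z -> Z) (e : K) (W1 W2 : {vspace Z}) :
  lie_closed L ->
  (forall x, linear (a x)) -> (forall z, linear (a ^~ z)) ->
  (forall x y z, x \in L -> y \in L ->
     a x (a y z) - a y (a x z) = e *: a (x *m y - y *m x) z) ->
  (forall x z, x \in L -> exists k, iter k (a x) z = 0) ->
  (forall x, x \in L -> exists k, forall y, iter k (fun y => x *m y - y *m x) y = 0) ->
  (forall x z, x \in L -> z \in W1 -> a x z \in W1) ->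
  (forall x z, x \in L -> z \in W2 -> a x z \in W2) ->
  (W1 <= W2)%VS -> W1 != W2 ->
  exists z, [/\ z \in W2, z \notin W1 & forall x, x \in L -> a x z \in W1].
Proof.
have [d] := ubnP (\dim L); elim: d L Z a e W1 W2 => [//|d IH] L Z a e W1 W2 dL.
move=> cL lz lx Hb nil adnil st1 st2 sW nW.
have exz : exists z, z \in W2 /\ z \notin W1.
  apply: contrapT => nz; case/eqP: nW; apply/eqP; rewrite eqEsubv sW /=.
  apply/subvP => z zW; apply: contrapT => zW1; apply: nz; exists z; split=> //.
  exact/negP.
have [L0|[h0 [h0L h00]]] : (forall x, x \in L -> x = 0) \/ exists x, x \in L /\ x != 0.
- have [|nx] := pselect (exists x, x \in L /\ x != 0); first by right.
  by left=> x xL; apply/eqP/negPn/negP => x0; apply: nx; exists x.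
- have [z [zW2 zW1]] := exz; exists z; split=> // x /L0 ->.
  by have := lx z (-1) 0 0; rewrite scaler0 addr0 scaleN1r addNr => ->; rewrite mem0v.
(* A maximal proper subalgebra [h]. By induction its adjoint action on [L] modulo [h] kills some
   [x], which therefore normalizes [h]; by maximality [L] is the sum of [h] and the line of [x]. *)
pose P k := `[< exists2 h : {vspace M}, lie_closed h & [/\ (h <= L)%VS, h != L & \dim h = k] >].
have exP : exists k, P k.
  exists 0%N; apply/asboolP; exists 0%VS => [x y|].
    by rewrite !memv0 => /eqP -> /eqP ->; rewrite mulmx0 subrr.
  rewrite sub0v dimv0; split=> //.
  by apply: contra_neq h00 => L0; move: h0L; rewrite -L0 memv0 => /eqP.
have ubP k : P k -> (k <= \dim L)%N by move=> /asboolP[h _ [hL _ <-]]; exact: dimvS.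
case: (ex_maxnP exP ubP) => k /asboolP[h ch [hL nhL dh]] kmax.
have dhd : (\dim h < d)%N.
  rewrite -ltnS; apply: leq_trans dL; rewrite ltnS ltn_neqAle dimvS// andbT.
  by apply: contra nhL; rewrite eqEdim hL => /eqP ->; rewrite leqnn.
have [|||||||||x [xL xh xad]] := IH h M (fun x y => x *m y - y *m x) 1 h L dhd ch.
- by move=> x b y z; rewrite mulmxDr mulmxDl -scalemxAr -scalemxAl opprD addrACA -scalerBr.
- by move=> x b y z; rewrite mulmxDr mulmxDl -scalemxAr -scalemxAl opprD addrACA -scalerBr.
- move=> x y z _ _; rewrite scale1r !mulmxBr !mulmxBl !mulmxA.
  move: (x *m y *m z) (x *m z *m y) (y *m z *m x) (z *m y *m x) (y *m x *m z) (z *m x *m y).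
  by move=> A1 A2 A3 A4 A5 A6; apply/matrixP => i j; rewrite !mxE; ring.
- by move=> x z xh; have [|k0 Hk] := adnil x; [exact: (subvP hL)|exists k0].
- by move=> x xh; apply: adnil; exact: (subvP hL).
- by move=> x z; exact: ch.
- by move=> x z xh zL; apply: cL => //; exact: (subvP hL).
- by [].
- by [].
have Lhx : L = (h + <[x]>)%VS.
  apply/eqP; rewrite eq_sym; apply: contrapT => /negP nL.
  have : P (\dim (h + <[x]>)%VS).
    apply/asboolP; exists (h + <[x]>)%VS; last by split=> //; rewrite subv_add hL -memvE.
    move=> y z /vspace_line_decomp[b [u [uh ->]]] /vspace_line_decomp[c [v [vh ->]]].
    have -> : (u + b *: x) *m (v + c *: x) - (v + c *: x) *m (u + b *: x) =
        (u *m v - v *m u) + (c *: (u *m x - x *m u) - b *: (v *m x - x *m v)).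
      rewrite !mulmxDl !mulmxDr -!scalemxAl -!scalemxAr.
      move: (u *m v) (u *m x) (x *m v) (x *m x) (v *m u) (v *m x) (x *m u).
      by move=> A1 A2 A3 A4 A5 A6 A7; apply/matrixP => i j; rewrite !mxE; ring.
    apply: memvD; first by apply: (subvP (addvSl _ _)); exact: ch.
    apply: (subvP (addvSl _ _)); apply: memvB; apply: memvZ; exact: xad.
  move=> /kmax; rewrite leqNgt -dh => /negP; apply.
  rewrite ltn_neqAle dimvS ?addvSl// andbT; apply/eqP => dE.
  have /eqP hE : (h == h + <[x]>)%VS by rewrite eqEdim addvSl -dE leqnn.
  by move/negP: xh; apply; rewrite hE (subvP (addvSr _ _))// memv_line.
have a0 y : a y 0 = 0 by have := lz y (-1) 0 0; rewrite scaler0 addr0 scaleN1r addNr.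
have [|||||z [zW2 zW1 hz]] := IH h Z a e W1 W2 dhd ch lz lx _ _ _ _ _ sW nW.
- by move=> y z v yh zh; apply: Hb; exact: (subvP hL).
- by move=> y z yh; apply: nil; exact: (subvP hL).
- by move=> y yh; apply: adnil; exact: (subvP hL).
- by move=> y z yh; apply: st1; exact: (subvP hL).
- by move=> y z yh; apply: st2; exact: (subvP hL).
(* Since [x] normalizes [h], the iterates of [z] under [x] are still killed by [h] modulo [W1]; the
   last iterate outside [W1] is killed by all of [L]. *)
have Hk i : iter i (a x) z \in W2 /\ forall y, y \in h -> a y (iter i (a x) z) \in W1.
  elim: i => [|i [IH1 IH2]] //=; split; first exact: st2.
  move=> y yh; have yL := subvP hL _ yh.
  rewrite -[a y _](subrK (a x (a y (iter i (a x) z)))) Hb//.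
  apply: memvD; last by apply: st1 => //; exact: IH2.
  by apply: memvZ; apply: IH2; exact: xad.
have [i ix] := nil x z xL.
have exi : exists i, iter i (a x) z \in W1 by exists i; rewrite ix mem0v.
case: (ex_minnP exi) => -[|j] jW jmin; first by rewrite jW in zW1.
have [j2 jh] := Hk j.
exists (iter j (a x) z); split=> //.
  by apply/negP => /jmin; rewrite ltnn.
move=> y; rewrite Lhx => /vspace_line_decomp[b [u [uh ->]]].
have := lx (iter j (a x) z) b x u; rewrite /= (addrC u) => ->.
by apply: memvD; [exact: memvZ|exact: jh].
Qed.

End Engel.

Section AdNilp.
Variables (K : fieldType) (n : nat).
Local Notation M := 'M[K]_n.+1.
Implicit Types (x y : M).

Lemma iter_adB k x y z : iter k (fun y => x *m y - y *m x) (y - z) =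
  iter k (fun y => x *m y - y *m x) y - iter k (fun y => x *m y - y *m x) z.
Proof.
elim: k => [//|k IH] /=; rewrite IH mulmxBr mulmxBl !opprB.
by rewrite addrACA [RHS]addrACA; congr (_ + _); rewrite addrC.
Qed.

Lemma ad_nilp x N : x ^+ N = 0 -> forall y, iter (N + N) (fun y => x *m y - y *m x) y = 0.
Proof.
move=> xN.
suff H k a b y : ((N - a) + (N - b) <= k)%N ->
    iter k (fun y => x *m y - y *m x) (x ^+ a * y * x ^+ b) = 0.
  by move=> y; rewrite -(H (N + N)%N 0%N 0%N y) ?subn0// expr0 mul1r mulr1.
have i0 k' : iter k' (fun y => x *m y - y *m x) 0 = 0.
  by elim: k' => [//|k' IH] /=; rewrite IH mulmx0 mul0mx subrr.
have x0 c : (N <= c)%N -> x ^+ c = 0.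
  by move=> Nc; rewrite -(subnKC Nc) exprD xN mul0r.
elim: k a b => [|k IH] a b.
  by rewrite leqn0 addn_eq0 subn_eq0 => /andP[/x0 -> _]; rewrite !mul0r.
have [Na|aN] := leqP N a; first by rewrite (x0 a)// !mul0r i0.
have [Nb|bN] := leqP N b; first by rewrite (x0 b)// mulr0 i0.
move=> Hk; rewrite iterSr.
have -> : x *m (x ^+ a * y * x ^+ b) - (x ^+ a * y * x ^+ b) *m x =
    x ^+ a.+1 * y * x ^+ b - x ^+ a * y * x ^+ b.+1.
  by rewrite !mulmxE exprS exprSr !mulrA.
by rewrite iter_adB !IH ?subrr//; move: Hk aN bN; lia.
Qed.

End AdNilp.

Section Flags.
Variables (K : numClosedFieldType) (n : nat) (G : groupType).
Local Notation M := 'M[K]_n.+1.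
Local Notation V := 'rV[K]_n.+1.
Variables (s : G -> M) (J : M).
Hypothesis lgs : linear_group s J.
Implicit Types (H Z : set G) (W : nat -> {vspace V}).

(** Steps may be trivial, so a flag can be obtained by iterating a choice function until it becomes
    stationary. *)
Definition flag W := [/\ W 0%N = 0%VS,
  (forall i, (W i <= W i.+1)%VS /\ exists v, (W i.+1 <= W i + <[v]>)%VS) &
  exists N, W N = fullv].

Definition stabilizes (U : {vspace V}) (A : M) := forall v, v \in U -> v *m A \in U.

Definition flag_stab W : set G := [set x | forall i, stabilizes (W i) (s x)].

Lemma flag_build (S : set M) :
  (forall U : {vspace V}, U != fullv -> (forall A, S A -> stabilizes U A) ->
     exists e, e \notin U /\ forall A, S A -> stabilizes (U + <[e]>)%VS A) ->
  exists2 W, flag W & forall A, S A -> forall i, stabilizes (W i) A.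
Proof.
move=> HS.
pose ok (U : {vspace V}) := forall A, S A -> stabilizes U A.
have /choice[nxt Hn] : forall U : {vspace V}, exists U' : {vspace V}, ok U ->
    [/\ ok U', (U <= U')%VS, exists v, (U' <= U + <[v]>)%VS &
      U = fullv \/ (\dim U < \dim U')%N].
  move=> U; have [okU|nU] := pselect (ok U); last by exists U.
  have [UT|UT] := eqVneq U fullv.
    exists U => _; split=> //; last by left.
    by exists 0; exact: addvSl.
  have [e [eU He]] := HS U UT okU; exists (U + <[e]>)%VS => _; split=> //.
  - exact: addvSl.
  - by exists e.
  - right; rewrite ltn_neqAle dimvS ?addvSl// andbT; apply/eqP => dE.
    have /eqP UE : (U == U + <[e]>)%VS by rewrite eqEdim addvSl -dE leqnn.
    by move/negP: eU; apply; rewrite UE (subvP (addvSr _ _))// memv_line.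
pose W i := iter i nxt 0%VS.
have okW i : ok (W i).
  elim: i => [|i IH]; last by have [] := Hn _ IH.
  by move=> A SA v; rewrite /= memv0 => /eqP ->; rewrite mul0mx mem0v.
exists W; last by move=> A SA i; exact: okW.
split=> //; first by move=> i; have [_ H1 H2 _] := Hn _ (okW i).
have Hd i : W i = fullv \/ (i <= \dim (W i))%N.
  elim: i => [|i [IH|IH]]; first by right.
    have [_ H1 _ _] := Hn _ (okW i); left; apply/eqP; rewrite eqEsubv subvf /=.
    by move: H1; rewrite IH.
  have [_ H1 _ [WT|dW]] := Hn _ (okW i); last by right; exact: leq_ltn_trans dW.
  left; apply/eqP; rewrite eqEsubv subvf /=.
  by move: H1; rewrite WT.
exists (\dim {:V}); have [//|H] := Hd (\dim {:V}).
by apply/eqP; rewrite eqEdim subvf.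
Qed.

Lemma stabilizesM U A B : stabilizes U A -> stabilizes U B -> stabilizes U (A *m B).
Proof. by move=> HA HB v vU; rewrite mulmxA; apply/HB/HA. Qed.

Lemma stabilizesD U A B : stabilizes U A -> stabilizes U B -> stabilizes U (A + B).
Proof. by move=> HA HB v vU; rewrite mulmxDr memvD//; [exact: HA|exact: HB]. Qed.

Lemma stabilizesZ U a A : stabilizes U A -> stabilizes U (a *: A).
Proof. by move=> HA v vU; rewrite -scalemxAr memvZ//; exact: HA. Qed.

Lemma stabilizes1 U : stabilizes U 1.
Proof. by move=> v vU; rewrite mulmx1. Qed.

Lemma stabilizes_exp U A k : stabilizes U A -> stabilizes U (A ^+ k).
Proof.
move=> HA; elim: k => [|k IH]; first by rewrite expr0; exact: stabilizes1.
by rewrite exprS -mulmxE; exact: stabilizesM.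
Qed.

Lemma stabilizes_sum U (I : Type) (r : seq I) (P : pred I) (F : I -> M) :
  (forall i, P i -> stabilizes U (F i)) -> stabilizes U (\sum_(i <- r | P i) F i).
Proof.
move=> HF; elim/big_ind: _ => //; last exact: stabilizesD.
by move=> v _; rewrite mulmx0 mem0v.
Qed.

Lemma stabilizes_expm U A : stabilizes U A -> stabilizes U (expm A).
Proof. by move=> HA; apply: stabilizes_sum => k _; apply: stabilizesZ; exact: stabilizes_exp. Qed.

Lemma stabilizes_horner U A (p : {poly K}) : stabilizes U A -> stabilizes U (horner_mx A p).
Proof.
move=> HA; rewrite -[p]coefK poly_def rmorph_sum; apply: stabilizes_sum => k _ /=.
by rewrite linearZ /= rmorphXn /= horner_mx_X; apply: stabilizesZ; exact: stabilizes_exp.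
Qed.

Lemma stabilizes_inv U x : stabilizes U (s x) -> stabilizes U (s x^-1%g).
Proof.
move=> HU v vU; pose f : 'End(V) := linfun (mulmxr (s x)).
have fE w : f w = w *m s x by rewrite lfunE.
have : (f @: U)%VS = U.
  apply/eqP; rewrite eqEdim; apply/andP; split.
    by apply/subvP => w /memv_imgP[u uU ->]; rewrite fE; exact: HU.
  rewrite limg_dim_eq//; apply/eqP; rewrite -subv0; apply/subvP => w.
  rewrite memv_cap memv_ker fE => /andP[_ /eqP wx]; rewrite memv0; apply/eqP.
  have -> : w = w *m s x *m s x^-1%g by rewrite -mulmxA (sVr lgs) mulmx1.
  by rewrite wx mul0mx.
move=> fU; move: vU; rewrite -{1}fU => /memv_imgP[u uU ->].
by rewrite fE -mulmxA (sVr lgs) mulmx1.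
Qed.

Lemma flag_stab_subgroup W : subgroup (flag_stab W).
Proof.
split=> [i|x y Hx Hy i]; first by rewrite (lg1 lgs); exact: stabilizes1.
by rewrite (lgM lgs); apply: stabilizesM => //; exact: stabilizes_inv.
Qed.

Lemma zclosed_row (F : M -> M) (U : {vspace V}) v : mxalg mxentry F ->
  zclosed s [set x | v *m F (s x) \in U].
Proof.
move=> aF x Hx; apply/negPn/negP => /vspace_separation[C CU] /eqP; apply.
apply: (Hx (fun A => \sum_i \sum_j C i j * (v *m F A) i j)) => [|z /= /CU//].
apply: alg_sum => i _; apply: alg_sum => j _; apply: alg_mul; first exact: alg_cst.
by apply: mxalgM => //; exact: mxalg_cst.
Qed.

Lemma flag_stab_closed W : zclosed s (flag_stab W).
Proof.
apply: zclosed_bigI => i x Hx v vW.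
apply: (@zclosed_row id (W i) v (@mxalg_id _ _ _) x) => f pf Hf.
by apply: Hx => // z Hz; apply: Hf; exact: Hz.
Qed.

Lemma generated_sub (S : set G) H : subgroup H -> S `<=` H -> generated S `<=` H.
Proof. by move=> sH SH x; apply. Qed.

Lemma generated_subgroup (S : set G) : subgroup (generated S).
Proof.
split=> [H [] //|x y Hx Hy H sH SH]; apply: sH.2; [exact: Hx|exact: Hy].
Qed.

Lemma sub_generated (S : set G) : S `<=` generated S.
Proof. by move=> x Sx H _; exact. Qed.

Lemma derived_subgroup H k : subgroup H -> subgroup (derived_series H k) /\ derived_series H k `<=` H.
Proof.
move=> sH; elim: k => [|k [IH1 IH2]]; first by split.
split; first exact: generated_subgroup.
apply: generated_sub => // _ [x /IH2 Hx [y /IH2 Hy <-]].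
by rewrite /commg /conjg; repeat (apply: (subgroupM sH) => //); exact: (subgroupV sH).
Qed.

Lemma flag_scalar W A i : flag W -> (forall i, stabilizes (W i) A) ->
  exists c, forall v, v \in W i.+1 -> v *m A - c *: v \in W i.
Proof.
move=> [_ WS _] HA; have [_ [e We]] := WS i.
have [eW|eW] := boolP (e \in W i.+1); last first.
  (* Here [W i.+1 = W i], so any scalar will do. *)
  exists 0 => w wW; rewrite scale0r subr0; apply: HA.
  have /vspace_line_decomp[a [u [uW ew]]] := subvP We _ wW.
  have [a0|a0] := eqVneq a 0; first by rewrite ew a0 scale0r addr0.
  move/negP: eW; case; rewrite -[e](scalerK a0) memvZ//.
  have -> : a *: e = w - u by rewrite ew addrC addKr.
  by rewrite memvB// (subvP (WS i).1).
have /vspace_line_decomp[c [u [uW eA]]] := subvP We _ (HA _ _ eW).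
exists c => w wW; have /vspace_line_decomp[a [u' [uW' ->]]] := subvP We _ wW.
have -> : (u' + a *: e) *m A - c *: (u' + a *: e) = u' *m A + a *: u - c *: u'.
  rewrite mulmxDl -scalemxAl eA; move: (u' *m A) => z.
  by apply/matrixP => i0 j0; rewrite !mxE; ring.
by rewrite memvB ?memvZ// memvD ?memvZ//; exact: HA.
Qed.

(** Elements of the [k]-th derived group are 1 plus an operator lowering the flag by [k]. This holds
    for [k = 1] because scalars on the successive quotients commute, and afterwards because a
    commutator only involves products of two such operators. *)
Lemma flag_solvable W H : flag W -> subgroup H -> H `<=` flag_stab W -> solvable_group H.
Proof.
move=> [W0 WS [N WN]] sH HW.
have Wmono i j : (i <= j)%N -> (W i <= W j)%VS.
  move=> /subnKC <-; elim: (j - i)%N => [|k IH]; first by rewrite addn0.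
  by rewrite addnS; apply: subv_trans IH _; have [] := WS (i + k)%N.
pose D k := [set x | flag_stab W x /\ forall i v, v \in W (i + k)%N -> v *m (s x - 1) \in W i].
have sD k : subgroup (D k).
  have DV x : D k x -> D k x^-1%g.
    move=> [sx Hx]; have sx' i : stabilizes (W i) (s x^-1%g) by apply: stabilizes_inv.
    split=> // i v vW; rewrite (_ : s x^-1%g - 1 = - ((s x - 1) *m s x^-1%g)); last first.
      by rewrite mulmxBl (sVr lgs) mul1mx opprB.
    by rewrite mulmxN memvN mulmxA; apply/sx'/Hx.
  split=> [|x y Dx /DV [sy Hy]]; first by split=> [|i v _]; [exact: (flag_stab_subgroup W).1|rewrite (lg1 lgs) subrr mulmx0 mem0v].
  have [sx Hx] := Dx; split.
    by move=> i; rewrite (lgM lgs); exact: stabilizesM.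
  move=> i v vW; rewrite (lgM lgs) (_ : _ - 1 = (s x - 1) *m s y^-1%g + (s y^-1%g - 1)).
    by rewrite mulmxDr memvD//; [rewrite mulmxA; apply/sy/Hx|exact: Hy].
  by rewrite mulmxBl mul1mx addrA subrK.
have comm x y : s [~ x, y]%g - 1 = s x^-1%g *m s y^-1%g *m (s x *m s y - s y *m s x).
  rewrite commgEl /conjg !(lgM lgs) mulmxBr !mulmxA; congr (_ - _).
  by rewrite -(mulmxA (s x^-1%g)) (sVl lgs) mulmx1 (sVl lgs).
have D1 : derived_series H 1 `<=` D 1%N.
  apply: generated_sub => // _ [x Hx [y Hy <-]]; have sx := HW x Hx; have sy := HW y Hy.
  have sxV i := stabilizes_inv (sx i); have syV i := stabilizes_inv (sy i).
  split.
    by move=> i; rewrite commgEl /conjg !(lgM lgs); do !apply: stabilizesM.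
  move=> i v; rewrite addn1 comm => vW; rewrite mulmxA.
  have {vW} : v *m (s x^-1%g *m s y^-1%g) \in W i.+1 by rewrite mulmxA; apply/syV/sxV.
  move: (v *m _) => {v}v vW.
  have sc A := @flag_scalar W A i (And3 W0 WS (ex_intro _ N WN)).
  have [a Ha] := sc _ sx; have [b Hb] := sc _ sy.
  rewrite mulmxBr !mulmxA.
  rewrite (_ : _ - _ = (v *m s x - a *: v) *m s y - (v *m s y - b *: v) *m s x
     + (a *: (v *m s y - b *: v) - b *: (v *m s x - a *: v))).
    rewrite memvD ?memvB ?memvZ ?Ha ?Hb//; [apply: sy|apply: sx]; by rewrite ?Ha ?Hb.
  rewrite !mulmxBl -!scalemxAl; move: (v *m s x *m s y) (v *m s y *m s x) (v *m s x) (v *m s y).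
  by move=> z1 z2 z3 z4; apply/matrixP => i0 j0; rewrite !mxE; ring.
have DS k : derived_series H k.+1 `<=` D k.+1.
  elim: k => [//|k IH].
  apply: generated_sub => // _ [x /IH [sx Hx] [y /IH [sy Hy] <-]].
  have sxV i := stabilizes_inv (sx i); have syV i := stabilizes_inv (sy i).
  split.
    by move=> i; rewrite commgEl /conjg !(lgM lgs); do !apply: stabilizesM.
  move=> i v vW; rewrite comm mulmxA.
  have {vW} : v *m (s x^-1%g *m s y^-1%g) \in W (i + k.+2)%N by rewrite mulmxA; apply/syV/sxV.
  move: (v *m _) => {v}v vW.
  have -> : s x *m s y - s y *m s x = (s x - 1) *m (s y - 1) - (s y - 1) *m (s x - 1).
    rewrite !mulmxBl !mulmxBr !mul1mx !mulmx1.
    move: (s x *m s y) (s y *m s x) (s x) (s y) => z1 z2 z3 z4.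
    by apply/matrixP => i0 j0; rewrite !mxE; ring.
  rewrite mulmxBr !mulmxA; apply: memvB.
    by apply: Hy; apply: Hx; apply: (subvP (Wmono _ _ _) _ vW); lia.
  by apply: Hx; apply: Hy; apply: (subvP (Wmono _ _ _) _ vW); lia.
exists N.+1; apply/seteqP; split=> [x /DS [_ Hx]|_ ->]; last exact: (derived_subgroup N.+1 sH).1.1.
apply: (lg_inj lgs); rewrite (lg1 lgs); apply/row_matrixP => i.
apply/eqP; rewrite -subr_eq0 -linearB /= rowE -memv0 -W0; apply: Hx.
by rewrite add0n; apply: (subvP (Wmono N _ _)); rewrite ?leqnSn// WN memvf.
Qed.

End Flags.

(** * Connected sets and the groups they generate *)

Section Connectedness.
Variables (K : numClosedFieldType) (n : nat) (G : groupType).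
Local Notation M := 'M[K]_n.+1.
Variables (s : G -> M) (J : M).
Hypothesis lgs : linear_group s J.
Implicit Types (H Z S C : set G).

Lemma zconn_image S (t : G -> G) (F : M -> M) : (forall x, s (t x) = F (s x)) ->
  mxalg mxentry F -> zconn s S -> zconn s [set t x | x in S].
Proof.
move=> tF aF cS Z1 Z2 cZ1 cZ2 HS HZ.
have [||x Sx|x Sx|H1|H2] := cS [set x | Z1 (t x)] [set x | Z2 (t x)].
- exact: (zclosed_preim tF).
- exact: (zclosed_preim tF).
- by apply: HS; exists x.
- by apply: HZ; exists x.
- by left=> _ [x Sx <-]; exact: H1.
- by right=> _ [x Sx <-]; exact: H2.
Qed.

Lemma zconn_bigU (I : Type) (S : I -> set G) x0 : (forall i, S i x0) ->
  (forall i, zconn s (S i)) -> zconn s [set x | exists i, S i x].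
Proof.
move=> S0 cS Z1 Z2 cZ1 cZ2 HS HZ.
have Hi i : S i `<=` Z1 \/ S i `<=` Z2.
  apply: cS => // [x Six|x Six]; first by apply: HS; exists i.
  by apply: HZ; exists i.
have [[i0]|nI] := pselect (exists i : I, True); last by left=> x [i _]; exfalso; apply: nI; exists i.
have [Z10|nZ10] := pselect (Z1 x0).
  left=> x [i Six]; have [H1|H2] := Hi i; first exact: H1.
  by exfalso; apply: (HZ x0) => //; [exists i|exact: H2].
right=> x [i Six]; have [H1|H2] := Hi i; last exact: H2.
by exfalso; apply: nZ10; exact: H1.
Qed.

Lemma zconn_zcl S : zconn s S -> zconn s (zcl s S).
Proof.
move=> cS Z1 Z2 cZ1 cZ2 HS HZ.
have [||H1|H2] := cS Z1 Z2 cZ1 cZ2.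
- by move=> x /(@sub_zcl _ _ _ s)/HS.
- by move=> x /(@sub_zcl _ _ _ s); exact: HZ.
- by left; exact: zcl_min.
- by right; exact: zcl_min.
Qed.

Lemma zconn_mull S g : zconn s S -> zconn s [set (g * x)%g | x in S].
Proof.
move=> cS; apply: (@zconn_image _ _ (fun A => s g *m A)) => //.
  by move=> x; rewrite (lgM lgs).
by apply: mxalgM; [exact: mxalg_cst|exact: mxalg_id].
Qed.

Lemma zconn_inv S : zconn s S -> zconn s [set x^-1%g | x in S].
Proof.
move=> cS; apply: (@zconn_image _ _ (fun A => tau J A)) => //.
  by move=> x; rewrite (lgV lgs).
by apply: mxalg_tau; exact: mxalg_id.
Qed.

(** The elements joined to 1 by a connected part of the generated group form a subgroup: for a
    product, the two parts are glued at [x] after inversion and translation. *)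
Lemma zconn_generated S : (forall x, S x -> exists2 C, zconn s C & [/\ C `<=` generated S, C 1%g & C x]) ->
  zconn s (generated S).
Proof.
move=> HS; pose T := [set x | exists2 C, zconn s C & [/\ C `<=` generated S, C 1%g & C x]].
have sg := generated_subgroup S.
have Tg : T = generated S.
  apply/seteqP; split=> [x [C _ [CS _ Cx]]|]; first exact: CS.
  apply: generated_sub => //; split.
    exists [set 1%g]; last by split=> // x ->; exact: sg.1.
    move=> Z1 Z2 _ _ H1 _; have [Z|Z] := H1 1%g erefl; [left|right]; by move=> x ->.
  have TV x : T x -> T x^-1%g.
    move=> [C cC [CS C1 Cx]]; exists [set y^-1%g | y in C]; first exact: zconn_inv.
    split; [|by exists 1%g => //; exact: invg1|by exists x].
    by move=> _ [y Cy <-]; apply: (subgroupV sg); exact: CS.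
  move=> x y [C cC [CS C1 Cx]] /TV [C' cC' [CS' C1' Cy]].
  pose D (b : bool) := if b then C else [set (x * z)%g | z in C'].
  exists [set z | exists b, D b z].
    apply: (@zconn_bigU bool D x) => -[] /=; first exact: Cx.
    - by exists 1%g; rewrite ?mulg1.
    - exact: cC.
    - exact: zconn_mull.
  split.
  - move=> z [[] /=]; first exact: CS.
    by move=> [w Cw <-]; apply: (subgroupM sg); [exact: CS|exact: CS'].
  - by exists true.
  - by exists false, y^-1%g.
rewrite -Tg; pose I := {C | zconn s C /\ [/\ C `<=` generated S & C 1%g]}.
have := @zconn_bigU I (fun C : I => projT1 C) 1%g; rewrite (_ : [set x | exists i : I, projT1 i x] = T).
  by apply=> -[C [cC [CS C1]]].
apply/seteqP; split=> [x [[C [cC [CS C1]]] /= Cx]|x [C cC [CS C1 Cx]]]; first by exists C.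
by exists (exist _ C (conj cC (conj CS C1))).
Qed.

(** The line minus finitely many points is irreducible. Only the zeros of [F] have to match those of
    [f], so negative powers of [t] may be cleared. *)
Lemma zconn_curve (c : K -> G) (d : {poly K}) : d != 0 ->
  (forall f, polyf f -> exists F : {poly K}, forall t, d.[t] != 0 ->
    (F.[t] == 0) = (f (s (c t)) == 0)) ->
  zconn s [set c t | t in [set t | d.[t] != 0]].
Proof.
move=> d0 Hc Z1 Z2 cZ1 cZ2 HS HZ; apply: contrapT => /not_orP[N1 N2].
have sep Z : zclosed s Z -> ~ [set c t | t in [set t | d.[t] != 0]] `<=` Z ->
    exists2 F : {poly K}, F != 0 & forall t, d.[t] != 0 -> Z (c t) -> F.[t] = 0.
  move=> cZ N; apply: contrapT => nF; apply: N => _ [t dt <-]; apply: cZ => f pf Hf.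
  have [F HF] := Hc f pf; apply: contrapT => fx; apply: nF; exists F.
    by apply/eqP => F0; move: (HF t dt); rewrite F0 horner0 eqxx => /esym/eqP.
  by move=> u du Zu; apply/eqP; rewrite HF// Hf.
have [F1 F10 H1] := sep _ cZ1 N1; have [F2 F20 H2] := sep _ cZ2 N2.
have : d * F1 * F2 = 0.
  apply: poly_fun_inj => t; rewrite horner0 !hornerM.
  have [->|dt] := eqVneq d.[t] 0; first by rewrite !mul0r.
  have [Z1t|Z2t] := HS (c t) (ex_intro2 _ _ t dt erefl).
    by rewrite H1// mulr0 mul0r.
  by rewrite H2// mulr0.
by move=> /eqP; rewrite !mulf_eq0 (negPf d0) (negPf F10) (negPf F20).
Qed.

Lemma zconn_finite_values H f (vals : seq K) x0 : zconn s H -> polyf f -> H x0 ->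
  (forall x, H x -> f (s x) \in vals) -> forall x, H x -> f (s x) = f (s x0).
Proof.
move=> cH pf H0 Hv.
pose g A := \prod_(v <- vals | v != f (s x0)) (f A - v).
have pg : polyf g by apply: alg_prod => v _; apply: alg_sub => //; exact: alg_cst.
have g0 A : (g A == 0) = (f A \in [seq v <- vals | v != f (s x0)]).
  rewrite /g; elim: (vals) => [|v r IH]; first by rewrite big_nil oner_eq0.
  rewrite big_cons /=; case: (v != f (s x0)) => /=; last exact: IH.
  by rewrite mulf_eq0 IH inE subr_eq0.
have [||x Hx|x Hx|H1|H2] := cH [set x | f (s x) - f (s x0) = 0] [set x | g (s x) = 0].
- have := @zclosed_locus K n G s [set (fun A => f A - f (s x0))].
  rewrite (_ : [set x | forall f0, _] = [set x | f (s x) - f (s x0) = 0]).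
    by apply=> _ ->; apply: alg_sub => //; exact: alg_cst.
  by apply/seteqP; split=> x /=; [move=> /(_ _ erefl)|move=> ? _ ->].
- have := @zclosed_locus K n G s [set g].
  rewrite (_ : [set x | forall f0, _] = [set x | g (s x) = 0]); first by apply=> _ ->.
  by apply/seteqP; split=> x /=; [move=> /(_ _ erefl)|move=> ? _ ->].
- have := Hv x Hx; have [fx|ne] := eqVneq (f (s x)) (f (s x0)); first by left; rewrite /= fx subrr.
  by move=> fv; right; apply/eqP; rewrite g0 mem_filter ne.
- by move=> /eqP; rewrite subr_eq0 => /eqP fx /eqP; rewrite g0 mem_filter fx eqxx.
- by move=> x /H1/eqP; rewrite subr_eq0 => /eqP.
- by have /eqP := H2 x0 H0; rewrite g0 mem_filter eqxx.
Qed.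

End Connectedness.

(** * The theorem of Lie and Kolchin *)

Section QuotientSpectrum.
Variable K : numClosedFieldType.

Lemma row_annihilating_roots m (A : 'M[K]_m) : exists r : seq K, forall v : 'rV_m,
  foldl (fun v l => v *m A - l *: v) v r = 0.
Proof.
case: m A => [|m] A; first by exists [::] => v; rewrite thinmx0.
have [r Er] := closed_field_poly_normal (char_poly A).
exists r => v; have CH := Cayley_Hamilton A.
move: CH; rewrite Er (monicP (char_poly_monic A)) scale1r => CH.
suff -> : foldl (fun v l => v *m A - l *: v) v r =
    v *m horner_mx A (\prod_(z <- r) ('X - z%:P)) by rewrite CH mulmx0.
elim: r v {Er CH} => [|l r IH] v /=; first by rewrite big_nil rmorph1 mulmx1.
rewrite IH big_cons rmorphM -mulmxE mulmxA; congr (_ *m _).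
by rewrite rmorphB /= horner_mx_X horner_mx_C mulmxBr mul_mx_scalar.
Qed.

Variable Z : vectType K.
Implicit Types (T : 'End(Z)) (U W : {vspace Z}).

Lemma annihilating_roots T : exists r : seq K, forall z,
  foldl (fun z l => T z - l *: z) z r = 0.
Proof.
pose b := vbasis {:Z}.
pose A : 'M_(\dim {:Z}) := \matrix_(i, j) coord b j (T b`_i).
pose rho z : 'rV_(\dim {:Z}) := \row_i coord b i z.
have rhoT z : rho (T z) = rho z *m A.
  apply/rowP => j; rewrite !mxE {1}(coord_vbasis (memvf z)) !linear_sum.
  by apply: eq_bigr => i _; rewrite !mxE !linearZ.
have [r Hr] := row_annihilating_roots A; exists r => z.
suff H z' : rho (foldl (fun z l => T z - l *: z) z' r) =
    foldl (fun v l => v *m A - l *: v) (rho z') r.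
  rewrite (coord_vbasis (memvf (foldl _ _ _))) big1// => i _.
  by move: (H z); rewrite Hr => /rowP/(_ i); rewrite !mxE => ->; rewrite scale0r.
elim: r z' {Hr} => [//|l r IH] z' /=.
rewrite IH -rhoT; congr foldl; apply/rowP => i.
by rewrite !mxE linearB linearZ.
Qed.

Lemma quotient_eigenvector T W U : (forall z, z \in W -> T z \in W) ->
  (forall z, z \in U -> T z \in U) -> (W <= U)%VS -> W != U ->
  exists l e, [/\ e \in U, e \notin W & T e - l *: e \in W].
Proof.
move=> TW TU WU nWU; have [r Hr] := annihilating_roots T.
have [e0 [e0U e0W]] : exists z, z \in U /\ z \notin W.
  apply: contrapT => nz; case/eqP: nWU; apply/eqP; rewrite eqEsubv WU /=.
  apply/subvP => z zU; apply: contrapT => zW; apply: nz; exists z; split=> //.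
  exact/negP.
have : foldl (fun z l => T z - l *: z) e0 r \in W by rewrite Hr mem0v.
elim: r e0 e0U e0W {Hr} => [|l r IH] e eU eW /=; first by rewrite (negPf eW).
have [H1 _|H1] := boolP (T e - l *: e \in W); first by exists l, e.
by apply: IH => //; rewrite memvB ?memvZ// TU.
Qed.

(** A single finite list serves all stable subspaces [W]. This is what shows that certain functions
    on a connected group take finitely many values and are thus constant. *)
Lemma quotient_spectrum T : exists r : seq K, forall W, (forall z, z \in W -> T z \in W) ->
  forall l e, e \notin W -> T e - l *: e \in W -> l \in r.
Proof.
have [r Hr] := annihilating_roots T; exists r => W TW l e eW He.
have H (q : seq K) z a : z - a *: e \in W ->
    foldl (fun z l => T z - l *: z) z q - (a * \prod_(b <- q) (l - b)) *: e \in W.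
  elim: q z a => [|b q IH] z a /= Hz; first by rewrite big_nil mulr1.
  rewrite big_cons mulrA; apply: IH.
  rewrite (_ : _ - _ = T (z - a *: e) + a *: (T e - l *: e) - b *: (z - a *: e)).
    by rewrite memvB ?memvZ// memvD ?memvZ// TW.
  have -> : T (z - a *: e) + a *: (T e - l *: e) = T z - (a * l) *: e.
    by rewrite linearB linearZ /= scalerBr scalerA addrA subrK.
  rewrite mulrBr scalerBl scalerBr scalerA (mulrC b a) !opprD !opprK !addrA.
  by rewrite (addrAC (T z)).
have := H r e 1; rewrite scale1r subrr mem0v => /(_ isT); rewrite Hr mul1r sub0r memvN => Hm.
have : \prod_(b <- r) (l - b) == 0.
  by apply: contraNT eW => nz; rewrite -[e](scalerK nz) memvZ.
by rewrite prodf_seq_eq0 => /hasP[b br]; rewrite /= subr_eq0 => /eqP ->.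
Qed.

Lemma minimal_vspace (P : {vspace Z} -> Prop) W2 : P W2 ->
  exists2 U, P U /\ (U <= W2)%VS & forall U', P U' -> (U' <= U)%VS -> U' = U.
Proof.
move=> PW; pose Q d := `[< exists2 U, P U /\ (U <= W2)%VS & \dim U = d >].
have exQ : exists d, Q d by exists (\dim W2); apply/asboolP; exists W2.
case: (ex_minnP exQ) => d /asboolP[U [PU UW] dU] dmin; exists U => // U' PU' UU.
apply/eqP; rewrite eqEdim UU dU; apply: dmin; apply/asboolP; exists U' => //.
by split=> //; exact: subv_trans UW.
Qed.

Lemma quotient_functional W e : e \notin W ->
  exists2 phi : {linear Z -> K^o}, (forall w, w \in W -> phi w = 0) & phi e = 1.
Proof.
move=> eW; pose f := (\1 - projv W)%VF.
have fW w : w \in W -> f w = 0.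
  by move=> wW; rewrite add_lfunE opp_lfunE id_lfunE projv_id// subrr.
have fe : f e != 0.
  apply: contra eW; rewrite add_lfunE opp_lfunE id_lfunE subr_eq0 => /eqP ->.
  exact: memv_proj.
pose b := vbasis {:Z}.
have /existsP[i bi] : [exists i, coord b i (f e) != 0].
  rewrite -negb_forall; apply: contra fe => /forallP H.
  by rewrite (coord_vbasis (memvf (f e))) big1// => i _; rewrite (eqP (H i)) scale0r.
pose f' := ((coord b i (f e))^-1 *: f)%VF.
exists (coord b i \o f' : {linear Z -> K^o}) => [w wW|] /=; rewrite scale_lfunE.
  by rewrite linearZ /= (fW _ wW) linear0; exact: mulr0.
by rewrite linearZ /= mulVf.
Qed.

End QuotientSpectrum.

Section LieKolchin.
Variables (K : numClosedFieldType) (n : nat) (G : groupType).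
Local Notation M := 'M[K]_n.+1.
Variables (s : G -> M) (J : M).
Hypothesis lgs : linear_group s J.
Variable H : set G.
Hypotheses (sH : subgroup H) (cH : zconn s H).

Lemma derived_zconn k : zconn s (derived_series H k).
Proof.
elim: k => [//|k IH]; have [sD _] := derived_subgroup k sH.
apply: (zconn_generated lgs) => _ [x Dx [y Dy <-]].
exists [set [~ x, z]%g | z in derived_series H k].
  apply: (@zconn_image _ _ _ s _ _ (fun A => s x^-1%g *m (tau J A *m (s x *m A)))) => //.
    by move=> z; rewrite commgEl /conjg !(lgM lgs) (lgV lgs z).
  have Hid : mxalg mxentry (id : M -> M) by exact: mxalg_id.
  apply: mxalgM; first exact: mxalg_cst.
  by apply: mxalgM; [exact: mxalg_tau|apply: mxalgM; [exact: mxalg_cst|]].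
split; last by exists y.
- by move=> _ [z Dz <-]; apply: sub_generated; exists x => //; exists z.
- exists 1%g; first exact: sD.1.
  by rewrite commgEl /conjg invg1 mul1g mulg1 mulVg.
Qed.

Lemma generated_conj (S : set G) h : (forall x, S x -> S (h^-1 * x * h)%g) ->
  forall x, generated S x -> generated S (h^-1 * x * h)%g.
Proof.
move=> HS x gx; have sg := generated_subgroup S.
suff : [set x | generated S (h^-1 * x * h)%g] x by [].
apply: gx; last by move=> y Sy; apply: sub_generated; exact: HS.
split; first by rewrite /= mulg1 mulVg; exact: sg.1.
move=> y z gy gz /=; have := sg.2 _ _ gy gz.
by rewrite !invgM invgK !mulgA mulgK.
Qed.

Lemma derived_conj k h x : H h -> derived_series H k x ->
  derived_series H k (h^-1 * x * h)%g.
Proof.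
move=> Hh; elim: k x => [|k IH] x.
  by move=> Hx; apply: (subgroupM sH) => //; apply: (subgroupM sH) => //; exact: (subgroupV sH).
apply: generated_conj => _ [y Dy [z Dz <-]].
exists (h^-1 * y * h)%g; first exact: IH.
exists (h^-1 * z * h)%g; first exact: IH.
by rewrite !commgEl /conjg !invgM !invgK !mulgA !mulgK.
Qed.

Variables (Z : vectType K) (act : G -> 'End(Z)).
Hypotheses (act1 : forall z, act 1%g z = z)
  (actM : forall x y z, act (x * y)%g z = act x (act y z))
  (act_reg : forall (phi : {linear Z -> K^o}) z, exists2 f : M -> K, polyf f &
     forall x, f (s x) = phi (act x z)).
Variables W1 W2 : {vspace Z}.
Hypotheses (W12 : (W1 <= W2)%VS) (nW12 : W1 != W2).
Hypotheses (stW1 : forall x z, H x -> z \in W1 -> act x z \in W1)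
  (stW2 : forall x z, H x -> z \in W2 -> act x z \in W2) (solH : solvable_group H).

Let notin x z : H x -> z \notin W1 -> act x z \notin W1.
Proof.
move=> Hx; apply: contra => xz; rewrite -(act1 z) -(mulVg x) actM.
by apply: stW1 => //; exact: (subgroupV sH).
Qed.

(** Stated for a regular action on [W2] modulo [W1], to serve both row vectors and the adjoint
    action. On a minimal stable [U], the terms of the derived series are shown to act by scalars,
    from the trivial one up to [H] itself. *)
Lemma lie_kolchin : exists e, [/\ e \in W2, e \notin W1 &
  forall x, H x -> exists c, act x e - c *: e \in W1].
Proof.
pose P U := [/\ (W1 <= U)%VS, W1 != U & forall x z, H x -> z \in U -> act x z \in U].
have [U [[WU nWU stU] UW2] Umin] := @minimal_vspace K Z P W2 (And3 W12 nW12 stW2).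
have [m Dm] := solH.
have DH k : derived_series H k `<=` H by have [] := derived_subgroup k sH.
have sD k : subgroup (derived_series H k) by have [] := derived_subgroup k sH.
suff sc k : (k <= m)%N -> forall d, derived_series H (m - k) d ->
    exists c, forall u, u \in U -> act d u - c *: u \in W1.
  have [e [eU eW]] : exists z, z \in U /\ z \notin W1.
    apply: contrapT => nz; case/eqP: nWU; apply/eqP; rewrite eqEsubv WU /=.
    apply/subvP => z zU; apply: contrapT => zW; apply: nz; exists z; split=> //.
    exact/negP.
  exists e; split=> //; first exact: (subvP UW2).
  move=> x Hx; have [|c Hc] := sc m (leqnn m) x; first by rewrite subnn.
  by exists c; exact: Hc.
elim: k => [|k IH] km d.
  rewrite subn0 Dm => ->; exists 1 => u _; by rewrite act1 scale1r subrr mem0v.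
have {IH}sc1 := IH (ltnW km).
set D := derived_series H (m - k.+1).
have DS : derived_series H (m - k) = generated [set [~ x, y]%g | x in D & y in D].
  by rewrite -(subnSK km).
(* If [[~ x, z]] acts by [c], then [act z e] is an eigenvector of [x] for [c * mu]. So [c] takes
   finitely many values on the connected [D] and equals its value 1 at [z = 1]. *)
have comm x y : D x -> D y -> forall u, u \in U -> act [~ x, y]%g u - u \in W1.
  move=> Dx Dy.
  have sc' z : D z -> exists c, forall u, u \in U -> act [~ x, z]%g u - c *: u \in W1.
    by move=> Dz; apply: sc1; rewrite DS; apply: sub_generated; exists x => //; exists z.
  have Hx := DH _ _ Dx.
  have [mu [e [eU eW He]]] := quotient_eigenvector (fun z => @stW1 _ z Hx) (fun z => stU _ z Hx) WU nWU.
  have [phi phiW phie] := quotient_functional eW.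
  have phic z c : z - c *: e \in W1 -> phi z = c.
    by move=> /phiW; rewrite linearB linearZ /= phie => /eqP; rewrite subr_eq0 => /eqP ->; exact: mulr1.
  have mu0 : mu != 0.
    apply: contraNneq (notin Hx eW) => mu0; move: He; by rewrite mu0 scale0r subr0.
  have [r Hr] := quotient_spectrum (act x).
  have [f pf Ef] := act_reg phi e.
  pose F A := f (s x^-1%g *m (tau J A *m (s x *m A))).
  have Hid : mxalg mxentry (id : M -> M) by exact: mxalg_id.
  have pF : polyf F.
    apply: polyf_mxalg => //; apply: mxalgM; first exact: mxalg_cst.
    by apply: mxalgM; [exact: mxalg_tau|apply: mxalgM; [exact: mxalg_cst|]].
  have FE z : F (s z) = phi (act [~ x, z]%g e).
    by rewrite /F -Ef commgEl /conjg !(lgM lgs) (lgV lgs z).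
  have Fval z : D z -> F (s z) \in [seq l / mu | l <- r].
    move=> Dz; have [c Hc] := sc' z Dz; rewrite FE (phic _ c (Hc e eU)).
    apply/mapP; exists (c * mu); last by rewrite mulfK.
    have Hz := DH _ _ Dz.
    apply: (Hr W1 (fun z => @stW1 _ z Hx) _ (act z e) (notin Hz eW)).
    have -> : act x (act z e) = act z (act x (act [~ x, z]%g e)).
      by rewrite -!actM commgEl /conjg; congr (act _ e); rewrite !mulgA mulgK mulgV mul1g.
    set v := act [~ x, z]%g e.
    have -> : act z (act x v) - (c * mu) *: act z e =
        act z (act x (v - c *: e) + c *: (act x e - mu *: e)).
      rewrite -[_ *: act z e]linearZ -linearB; congr (act z _).
      have E : act x (v - c *: e) = act x v - c *: act x e by rewrite linearB linearZ.
      by rewrite E scalerBr scalerA addrA subrK.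
    apply: stW1 => //; rewrite memvD ?memvZ//; apply: stW1 => //; exact: Hc.
  have := zconn_finite_values (@derived_zconn (m - k.+1)%N) pF (sD _).1 Fval Dy.
  have [c Hc] := sc' y Dy.
  rewrite !FE (phic _ c (Hc e eU)) commgEl /conjg invg1 mul1g mulg1 mulVg act1 phie => c1 u uU.
  by have := Hc u uU; rewrite c1 scale1r.
have Dcomm x y u : D x -> D y -> u \in U -> act x (act y u) - act y (act x u) \in W1.
  move=> Dx Dy uU; have -> : act x (act y u) = act y (act x (act [~ x, y]%g u)).
    by rewrite -!actM commgEl /conjg; congr (act _ u); rewrite !mulgA mulgK mulgV mul1g.
  rewrite -linearB -linearB.
  by apply: stW1; [exact: DH Dy|apply: stW1; [exact: DH Dx|exact: comm]].
(* [D] now acts by commuting operators, so on a minimal [D]-stable [V] each of them is a scalar by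
   Schur's argument. *)
pose PD V := [/\ (W1 <= V)%VS, W1 != V & forall x z, D x -> z \in V -> act x z \in V].
have [|V [[WV nWV stV] VU] Vmin] := @minimal_vspace K Z PD U.
  by split=> // x z /DH; exact: stU.
have VE x : D x -> exists c, forall z, z \in V -> act x z - c *: z \in W1.
  move=> Dx; have Hx := DH _ _ Dx.
  have [mu [e [eV eW He]]] := quotient_eigenvector (fun z => @stW1 _ z Hx) (fun z => stV _ z Dx) WV nWV.
  have [||V' HV'] := @set_vspace _ Z [set z | z \in V /\ act x z - mu *: z \in W1].
  - by rewrite /= mem0v linear0 scaler0 subrr mem0v.
  - move=> a u v [uV Hu] [vV Hv]; split; first by rewrite memvD// memvZ.
    rewrite linearP scalerDr opprD addrACA memvD// scalerA mulrC -scalerA -scalerBr.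
    exact: memvZ.
  have VV : V' = V.
    apply: Vmin; last by apply/subvP => z /HV'[].
    split.
    - apply/subvP => z zW; apply/HV'; split; first exact: (subvP WV).
      by rewrite memvB ?memvZ// stW1.
    - by apply: contraNneq eW => ->; apply/HV'.
    - move=> y z Dy /HV'[zV Hz]; apply/HV'; split; first exact: stV.
      have -> : act x (act y z) - mu *: act y z =
          (act x (act y z) - act y (act x z)) + act y (act x z - mu *: z).
        have E : act y (act x z - mu *: z) = act y (act x z) - mu *: act y z.
          by rewrite linearB linearZ.
        by rewrite E addrA subrK.
      apply: memvD; first by apply: Dcomm => //; exact: (subvP VU).
      by apply: stW1 => //; exact: DH Dy.
  by exists mu => z; rewrite -VV => /HV'[].
have [chi Hchi] : exists chi : G -> K, forall x, D x -> forall z, z \in V -> act x z - chi x *: z \in W1.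
  have /choice[chi Hchi] : forall x, exists c, D x -> forall z, z \in V -> act x z - c *: z \in W1.
    by move=> x; have [/VE[c Hc]|nD] := pselect (D x); [exists c|exists 0].
  by exists chi.
have [e [eV eW]] : exists z, z \in V /\ z \notin W1.
  apply: contrapT => nz; case/eqP: nWV; apply/eqP; rewrite eqEsubv WV /=.
  apply/subvP => z zU; apply: contrapT => zW; apply: nz; exists z; split=> //.
  exact/negP.
have [phi phiW phie] := quotient_functional eW.
have phic z c : z - c *: e \in W1 -> phi z = c.
  by move=> /phiW; rewrite linearB linearZ /= phie => /eqP; rewrite subr_eq0 => /eqP ->; exact: mulr1.
have [f pf Ef] := act_reg phi e.
(* The values of [chi] at conjugates of [x] are eigenvalues of [x], hence finite in number, and [H]
   is connected. *)
have chi_conj x h : D x -> H h -> chi (h^-1 * x * h)%g = chi x.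
  move=> Dx Hh; have Hx := DH _ _ Dx.
  have [r Hr] := quotient_spectrum (act x).
  pose F A := f (tau J A *m (s x *m A)).
  have Hid : mxalg mxentry (id : M -> M) by exact: mxalg_id.
  have pF : polyf F.
    apply: polyf_mxalg => //.
    by apply: mxalgM; [exact: mxalg_tau|apply: mxalgM; [exact: mxalg_cst|]].
  have FE z : H z -> F (s z) = chi (z^-1 * x * z)%g.
    move=> Hz; rewrite -(phic _ _ (Hchi _ (derived_conj Hz Dx) e eV)) -Ef /F.
    by rewrite !(lgM lgs) (lgV lgs z) mulmxA.
  have Fval z : H z -> F (s z) \in r.
    move=> Hz; rewrite FE//.
    apply: (Hr W1 (fun z => @stW1 _ z Hx) _ (act z e) (notin Hz eW)).
    have -> : act x (act z e) = act z (act (z^-1 * x * z)%g e).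
      by rewrite -!actM !mulgA mulgV mul1g.
    rewrite -linearZ -linearB; apply: stW1 => //.
    by apply: Hchi => //; exact: derived_conj.
  have := zconn_finite_values cH pF sH.1 Fval Hh.
  rewrite !FE//; last exact: sH.1.
  by rewrite invg1 mul1g mulg1.
(* The weight space of the invariant character [chi] is stable under [H], so it is all of [U] by
   minimality. *)
have [||F HF] := @set_vspace _ Z [set z | z \in U /\ forall x, D x -> act x z - chi x *: z \in W1].
- by split=> [|x _]; rewrite ?mem0v// linear0 scaler0 subrr mem0v.
- move=> a u v [uV Hu] [vV Hv]; split=> [|x Dx]; first by rewrite memvD// memvZ.
  rewrite linearP scalerDr opprD addrACA memvD ?Hv// scalerA mulrC -scalerA -scalerBr.
  by apply: memvZ; exact: Hu.
have FU : F = U.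
  apply: Umin; last by apply/subvP => z /HF[].
  split.
  - apply/subvP => z zW; apply/HF; split; first exact: (subvP WU).
    by move=> x Dx; rewrite memvB ?memvZ// stW1//; exact: DH Dx.
  - apply: contraNneq eW => ->; apply/HF; split; first exact: (subvP VU).
    by move=> x Dx; exact: Hchi.
  - move=> h z Hh /HF[zU Hz]; apply/HF; split; first exact: stU.
    move=> x Dx; have -> : act x (act h z) = act h (act (h^-1 * x * h)%g z).
      by rewrite -!actM !mulgA mulgV mul1g.
    rewrite -linearZ -linearB -(chi_conj x h)//; apply: stW1 => //.
    by apply: Hz; exact: derived_conj.
move=> Dd; exists (chi d) => u; rewrite -FU => /HF[_]; exact.
Qed.

End LieKolchin.

(** * The trace form and Borel subgroups *)

Section Auxiliary.
Variables (K : numClosedFieldType) (n : nat).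
Local Notation M := 'M[K]_n.+1.

Lemma dim_row d : \dim {:'rV[K]_d} = d.
Proof. by rewrite dimvf dim_matrix; exact: mul1n. Qed.

Lemma nilp_bound (N : M) k : N ^+ k = 0 -> N ^+ n.+1 = 0.
Proof.
move=> Nk; apply: nilp_of_traces => j; apply: (@nilp_trace _ _ _ k).
by rewrite -exprM mulnC exprM Nk expr0n.
Qed.

Lemma common_denominator (th : K -> K) (E : seq K) :
  (forall x, exists r : rat, th x = ratr r) -> exists N : nat, (0 < N)%N /\
  exists m : K -> int, forall b, b \in E -> N%:R * th b = (m b)%:~R.
Proof.
move=> thQ; suff [N [N0 HN]] : exists N : nat, (0 < N)%N /\
    forall b, b \in E -> exists z : int, N%:R * th b = z%:~R.
  exists N; split=> //.
  have /choice[m Hm] : forall b, exists z : int, b \in E -> N%:R * th b = z%:~R.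
    by move=> b; have [/HN[z Hz]|_] := boolP (b \in E); [exists z|exists 0].
  by exists m.
elim: E => [|a E [N [N0 HN]]]; first by exists 1%N.
have [r thr] := thQ a; exists (N * `|denq r|)%N.
split; first by rewrite muln_gt0 N0 absz_gt0 denq_neq0.
have dE : (`|denq r|%N%:R : K) = (denq r)%:~R.
  by rewrite pmulrn absz_denq.
move=> b; rewrite inE => /predU1P[->|/HN[z Hz]].
  exists (N%:Z * numq r); rewrite natrM dE thr -mulrA [_%:~R * ratr _]mulrC.
  rewrite /ratr divfK ?intr_eq0 ?denq_neq0// rmorphM /=; by [].
exists (z * denq r); rewrite natrM dE mulrAC Hz rmorphM /=; by [].
Qed.

Lemma nowhere_zero_poly (F : {poly K}) : (forall t, F.[t] != 0) -> exists c, F = c%:P.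
Proof.
move=> HF; have [/eqP/size_poly1P[c _ ->]|sF] := eqVneq (size F) 1%N; first by exists c.
by have /closed_rootP[x /rootP] := sF; move/eqP; rewrite (negPf (HF x)).
Qed.

(** The factor [t ^+ N] clears the negative powers of [t]; the derivative at 1 computes the velocity
    of the torus there, namely the replica with eigenvalues [m b]. *)
Lemma torus_curve (X : M) E (m : K -> int) (p : M -> K) : uniq E -> kills E X -> polyf p ->
  exists (N : nat) (F : {poly K}), (forall t, t != 0 ->
    F.[t] = t ^+ N * p (spfun E (fun b => t ^ m b) X)) /\
  F^`().[1] = N%:R * p 1 + lder p 1 (spfun E (fun b => (m b)%:~R) X).
Proof.
move=> uE kX; have L1 : spfun E (fun b => (1 : K) ^ m b) X = 1.
  rewrite (@eq_spfun _ _ E X uE kX _ (fun=> 1)) ?spfun_cst// => b _.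
  by rewrite exp1rz.
elim=> [a|[i j]|f g pf [N [F [EF DF]]] pg [N' [F' [EF' DF']]]
  |f g pf [N [F [EF DF]]] pg [N' [F' [EF' DF']]]].
- exists 0%N, a%:P; split=> [t _|]; first by rewrite hornerC mul1r.
  by rewrite derivC horner0 mul0r lder_cst addr0.
- pose N := (\sum_(b <- E) `|m b|)%N.
  have Nm b : b \in E -> m b + N%:Z = (absz (m b + N%:Z))%:Z.
    move=> bE; rewrite gez0_abs// /N (big_rem b bE) /= PoszD.
    have : 0 <= m b + `|m b|%N%:Z by rewrite abszE; lia.
    by move=> H; rewrite addrA addr_ge0.
  pose F := \sum_(b <- E) (spidem E X b i j) *: 'X^(absz (m b + N%:Z)).
  exists N, F; split=> [t t0|].
    rewrite /F horner_sum /mxentry (spfun_sum uE kX) summxE mulr_sumr.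
    rewrite big_seq [RHS]big_seq; apply: eq_bigr => b bE.
    rewrite hornerZ hornerXn mxE mulrA mulrC; congr (_ * _).
    by rewrite [LHS]exprnP -Nm// expfzDr// mulrC.
  rewrite /F /mxentry lder_entry /mxentry (spfun_sum uE kX) summxE.
  have -> : (1 : M) i j = \sum_(b <- E) spidem E X b i j by rewrite -summxE (spidem_sum uE kX).
  rewrite linear_sum horner_sum mulr_sumr -big_split [LHS]big_seq [RHS]big_seq /=.
  apply: eq_bigr => b bE; rewrite derivZ derivXn hornerZ hornerMn hornerXn expr1n.
  rewrite [(_ *: spidem _ _ _) i j]mxE -mulrDl mulrC; congr (_ * _).
  by rewrite pmulrn -Nm// rmorphD /= addrC.
- exists (N + N')%N, ('X^N' * F + 'X^N * F'); split=> [t t0|].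
    by rewrite hornerD !hornerM !hornerXn EF// EF'// exprD; ring.
  rewrite derivD !derivM !hornerD !hornerM !derivXn !hornerMn !hornerXn !expr1n DF DF'.
  have := EF 1 (oner_neq0 _); have := EF' 1 (oner_neq0 _).
  rewrite !expr1n !mul1r L1 lderD// natrD => -> ->; ring.
- exists (N + N')%N, (F * F'); split=> [t t0|].
    by rewrite hornerM EF// EF'// exprD; ring.
  rewrite derivM hornerD !hornerM DF DF'.
  have := EF 1 (oner_neq0 _); have := EF' 1 (oner_neq0 _).
  rewrite !expr1n !mul1r L1 lderM// natrD => -> ->; ring.
Qed.

End Auxiliary.

(** * Groups generated by exponentials, and nil ideals *)

Section Structure.
Variables (K : numClosedFieldType) (n : nat) (G : groupType).
Local Notation M := 'M[K]_n.+1.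
Local Notation V := 'rV[K]_n.+1.
Variables (s : G -> M) (J : M).
Hypothesis lgs : linear_group s J.
Implicit Types (H B : set G) (U L : {vspace M}) (W : nat -> {vspace V}).

Definition conn_solv H := [/\ subgroup H, zclosed s H, zconn s H & solvable_group H].

Lemma zcl_subgroup H : subgroup H -> subgroup (zcl s H).
Proof.
move=> sH; have Hid : mxalg mxentry (id : M -> M) by exact: mxalg_id.
have zV x : zcl s H x -> zcl s H x^-1%g.
  suff : zcl s H `<=` [set x | zcl s H x^-1%g] by apply.
  apply: zcl_min => [|y Hy]; last by apply: sub_zcl; exact: (subgroupV sH).
  apply: (@zclosed_preim _ _ _ s (tau J) (fun x => x^-1%g)); last exact: zcl_closed.
    by move=> z; rewrite (lgV lgs).
  exact: mxalg_tau.
have zl h : H h -> forall x, zcl s H x -> zcl s H (h * x)%g.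
  move=> Hh x; suff : zcl s H `<=` [set x | zcl s H (h * x)%g] by apply.
  apply: zcl_min => [|y Hy]; last by apply: sub_zcl; exact: (subgroupM sH).
  apply: (@zclosed_preim _ _ _ s (fun A => s h *m A) (fun x => (h * x)%g)); last exact: zcl_closed.
    by move=> z; rewrite (lgM lgs).
  by apply: mxalgM => //; exact: mxalg_cst.
split; first by apply: sub_zcl; exact: sH.1.
move=> x y zx /zV zy.
suff : zcl s H `<=` [set x | zcl s H (x * y^-1)%g] by apply.
apply: zcl_min => [|h Hh]; last exact: zl.
apply: (@zclosed_preim _ _ _ s (fun A => A *m s y^-1%g) (fun x => (x * y^-1)%g)); last exact: zcl_closed.
  by move=> z; rewrite (lgM lgs).
by apply: mxalgM => //; exact: mxalg_cst.
Qed.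

Lemma flag_group W (S : set G) : flag W -> S `<=` flag_stab s W ->
  (forall x, S x -> exists2 C, zconn s C & [/\ C `<=` generated S, C 1%g & C x]) ->
  conn_solv (zcl s (generated S)).
Proof.
move=> fW SW cS; have sg : subgroup (zcl s (generated S)).
  by apply: zcl_subgroup; exact: generated_subgroup.
split=> //; first exact: zcl_closed.
  by apply: zconn_zcl; exact: (zconn_generated lgs).
apply: (flag_solvable lgs fW sg); apply: zcl_min; first exact: flag_stab_closed.
by apply: generated_sub => //; exact: (flag_stab_subgroup lgs).
Qed.

Lemma lie_expm_mem H x : subgroup H -> x \in lie s H -> x ^+ n.+1 = 0 ->
  exists c : K -> G, forall t, s (c t) = expm (t *: x) /\ zcl s H (c t).
Proof.
move=> sH xL xn; have HP t := lie_expm lgs sH t xL xn.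
have /choice[c Hc] : forall t, exists y, s y = expm (t *: x).
  move=> t; apply: (lg_closed lgs) => f [pf Hf]; apply: HP.
  by split=> // z _; exact: Hf.
by exists c => t; split=> // p vp; rewrite Hc; exact: HP.
Qed.

Lemma expm_zconn x (c : K -> G) : x ^+ n.+1 = 0 -> (forall t, s (c t) = expm (t *: x)) ->
  zconn s [set c t | t in [set t | (1%:P : {poly K}).[t] != 0]].
Proof.
move=> xn Hc; apply: zconn_curve => [|f pf]; first exact: oner_neq0.
by have [F [EF _]] := expm_curve xn pf; exists F => t _; rewrite EF Hc.
Qed.

Lemma flag_nilp W x i : flag W -> (forall i, stabilizes (W i) x) -> x ^+ n.+1 = 0 ->
  forall v, v \in W i.+1 -> v *m x \in W i.
Proof.
move=> fW Wx xn v vW; have [c Hc] := flag_scalar i fW Wx.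
have [c0|c0] := eqVneq c 0; first by have := Hc v vW; rewrite c0 scale0r subr0.
suff : v \in W i by exact: Wx.
have H k : v *m x ^+ k - c ^+ k *: v \in W i.
  elim: k => [|k IH]; first by rewrite !expr0 mulmx1 scale1r subrr mem0v.
  rewrite exprSr -mulmxE mulmxA (_ : _ - _ = (v *m x ^+ k - c ^+ k *: v) *m x + c ^+ k *: (v *m x - c *: v)).
    by rewrite memvD ?memvZ ?Hc//; exact: Wx.
  by rewrite mulmxBl -scalemxAl scalerBr scalerA exprSr addrA subrK.
have := H n.+1; rewrite xn mulmx0 sub0r memvN => Hm.
by rewrite -[v](scalerK (expf_neq0 n.+1 c0)) memvZ.
Qed.

Lemma flag_strict W x : flag W -> (forall i v, v \in W i.+1 -> v *m x \in W i) -> x ^+ n.+1 = 0.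
Proof.
move=> [W0 _ [N WN]] Hx; apply: (@nilp_bound _ _ _ N).
have H k j v : v \in W (j + k)%N -> v *m x ^+ k \in W j.
  elim: k v => [|k IH] v; first by rewrite addn0 expr0 mulmx1.
  by rewrite addnS exprS -mulmxE mulmxA => /Hx/IH.
apply/row_matrixP => i; apply/eqP; rewrite rowE row0 -memv0 -W0; apply: H.
by rewrite add0n WN memvf.
Qed.

Lemma flag_trace0 W x y : flag W -> (forall i, stabilizes (W i) x) ->
  (forall i, stabilizes (W i) y) -> x ^+ n.+1 = 0 -> \tr (x *m y) = 0.
Proof.
move=> fW Wx Wy xn; apply: (@nilp_trace _ _ _ n.+1).
apply: (flag_strict fW) => i v vW; rewrite mulmxA; apply: Wy.
exact: flag_nilp.
Qed.

Lemma nil_flag L : lie_closed L -> (forall x, x \in L -> x ^+ n.+1 = 0) ->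
  exists2 W, flag W & forall x, x \in L -> forall i, stabilizes (W i) x.
Proof.
move=> cL nL; apply: (@flag_build _ _ [set x | x \in L]) => U UT HU.
have [|||||||||e [_ eU He]] := @engel K n.+1 L V (fun x v => v *m x) (-1) U fullv cL.
- by move=> x a u v; rewrite mulmxDl -scalemxAl.
- by move=> v a x y; rewrite mulmxDr -scalemxAr.
- by move=> x y v _ _; rewrite scaleN1r mulmxBr !mulmxA opprB.
- move=> x v xL; exists n.+1.
  suff H k : iter k (fun v => v *m x) v = v *m x ^+ k by rewrite H nL// mulmx0.
  by elim: k => [|k IH] /=; rewrite ?expr0 ?mulmx1// IH exprSr -mulmxE mulmxA.
- by move=> x xL; exists (n.+1 + n.+1)%N => y; apply: ad_nilp; exact: nL.
- by move=> x v xL; exact: HU.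
- by move=> x v _ _; exact: memvf.
- exact: subvf.
- by [].
exists e; split=> // x xL v /vspace_line_decomp[a [u [uU ->]]].
rewrite mulmxDl -scalemxAl; apply: (subvP (addvSl _ _)).
by rewrite memvD ?memvZ ?He//; exact: HU.
Qed.

Lemma nil_group L : L != 0%VS -> (L <= lie s setT)%VS -> lie_closed L ->
  (forall x, x \in L -> x ^+ n.+1 = 0) ->
  exists2 S : set G, conn_solv (zcl s (generated S)) &
    (forall x, S x <-> exists2 N, N \in L & s x = expm N).
Proof.
move=> _ Lg cL nL; have [W fW LW] := nil_flag cL nL.
pose S := [set x | exists2 N, N \in L & s x = expm N]; exists S => //.
apply: (flag_group fW).
  by move=> x [N NL sx] i; rewrite sx; apply: stabilizes_expm; exact: LW.
have sT : subgroup [set: G] by [].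
move=> x [N NL sx]; have [c Hc] := lie_expm_mem sT (subvP Lg _ NL) (nL _ NL).
exists [set c t | t in [set t | (1%:P : {poly K}).[t] != 0]].
  by apply: (expm_zconn (nL _ NL)) => t; have [] := Hc t.
have d1 t : (1%:P : {poly K}).[t] != 0 by rewrite hornerC oner_neq0.
split.
- move=> _ [t _ <-]; apply: sub_generated; exists (t *: N); first by rewrite memvZ.
  by have [] := Hc t.
- exists 0; first exact: d1.
  by apply: (lg_inj lgs); have [-> _] := Hc 0; rewrite scale0r expm0 (lg1 lgs).
- exists 1; first exact: d1.
  by apply: (lg_inj lgs); have [-> _] := Hc 1; rewrite scale1r.
Qed.

Lemma Ad_expm g x : Ad s g (expm x) = expm (Ad s g x).
Proof.
rewrite /expm linear_sum; apply: eq_bigr => k _.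
by rewrite linearZ /= (Ad_exp lgs).
Qed.

Hypothesis cG : zconn s setT.
(** The [chr i] stand for the coordinates of an isomorphism from the radical to a torus, extended to
    polynomial functions of matrices. *)
Variables (Rad : set G) (rk : nat) (chr : 'I_rk -> M -> K).
Hypotheses (RadP : forall H, conn_solv H -> normal H -> H `<=` Rad)
  (pchr : forall i, polyf (chr i)) (chr_neq0 : forall x i, Rad x -> chr i (s x) != 0)
  (chr_inj : forall x y, Rad x -> Rad y -> (forall i, chr i (s x) = chr i (s y)) -> x = y).

Local Notation g := (lie s setT).
Let sT : subgroup [set: G]. Proof. by []. Qed.

(* The exponentials of [L] generate a subgroup of the radical.  A character of the
   radical is a polynomial without zeros along [t |-> expm (t *: x)], hence constant. *)
Lemma no_nil_ideal L : (L <= g)%VS -> lie_closed L -> (forall x, x \in L -> x ^+ n.+1 = 0) ->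
  (forall a x, x \in L -> Ad s a x \in L) -> L = 0%VS.
Proof.
move=> Lg cL nL AdL; apply/eqP; case: eqVneq => // L0; exfalso.
have [S csS SP] := nil_group L0 Lg cL nL.
have nS : normal (zcl s (generated S)).
  move=> x y; suff : zcl s (generated S) `<=` [set x | zcl s (generated S) (x ^ y)%g] by apply.
  apply: zcl_min.
    apply: (@zclosed_preim _ _ _ s (fun A => s y^-1%g *m A *m s y)).
    - by move=> z; rewrite /conjg !(lgM lgs) mulmxA.
    - apply: mxalgM; last exact: mxalg_cst.
      by apply: mxalgM; [exact: mxalg_cst|exact: mxalg_id].
    - exact: zcl_closed.
  move=> z gz; apply: sub_zcl; rewrite /conjg mulgA.
  apply: generated_conj gz => w /SP[N NL sw]; apply/SP; exists (Ad s y^-1%g N); first exact: AdL.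
  by rewrite -Ad_expm -sw /Ad invgK !(lgM lgs).
have RS := RadP csS nS.
have [N NL N0] : exists2 N, N \in L & N != 0 by exists (vpick L); rewrite ?memv_pick ?vpick0.
have Nn := nL _ NL; have [c Hc] := lie_expm_mem sT (subvP Lg _ NL) Nn.
have Rc t : Rad (c t).
  apply: RS; apply: sub_zcl; apply: sub_generated; apply/SP.
  by exists (t *: N); [rewrite memvZ|have [] := Hc t].
have c1 t : c t = c 0.
  apply: chr_inj => // i; have [F [EF _]] := expm_curve Nn (pchr i).
  have [|a Fa] := @nowhere_zero_poly _ F.
    by move=> u; rewrite EF -(Hc u).1; exact: chr_neq0.
  by rewrite !(Hc _).1 -!EF Fa !hornerC.
case/eqP: N0; apply: (expm_inj Nn) => t.
by rewrite -(Hc t).1 c1 (Hc 0).1 scale0r expm0.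
Qed.

End Structure.

(** Triviality of the unipotent radical in terms of the Lie algebra; reductivity is used in this
    form from here on. *)
Definition reductive_lie (K : numClosedFieldType) n (G : groupType) (s : G -> 'M[K]_n.+1) :=
  forall L : {vspace 'M[K]_n.+1}, (L <= lie s setT)%VS -> lie_closed L ->
  (forall x, x \in L -> x ^+ n.+1 = 0) -> (forall a x, x \in L -> Ad s a x \in L) ->
  L = 0%VS.

Section Reductive.
Variables (K : numClosedFieldType) (n : nat) (G : groupType).
Local Notation M := 'M[K]_n.+1.
Local Notation V := 'rV[K]_n.+1.
Variables (s : G -> M) (J : M).
Hypotheses (lgs : linear_group s J) (red : reductive_lie s).
Implicit Types (H B : set G) (U L : {vspace M}) (W : nat -> {vspace V}).
Local Notation g := (lie s setT).
Local Notation conn_solv := (conn_solv s).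
Let sT : subgroup [set: G]. Proof. by []. Qed.

Lemma perp_exists U : exists P : {vspace M}, forall x, x \in P <->
  x \in g /\ forall y, y \in U -> \tr (x *m y) = 0.
Proof.
apply: set_vspace => [|a x y [xg Hx] [yg Hy]].
  by split=> [|y _]; rewrite ?mem0v// mul0mx mxtrace0.
split=> [|z zU]; first by rewrite memvD ?memvZ.
by rewrite mulmxDl -scalemxAl mxtraceD mxtraceZ Hx// Hy// mulr0 addr0.
Qed.

Definition perp U : {vspace M} := projT1 (cid (perp_exists U)).

Lemma perpP U x : x \in perp U <-> x \in g /\ forall y, y \in U -> \tr (x *m y) = 0.
Proof. exact: (projT2 (cid (perp_exists U))). Qed.

Lemma Ad_g a x : x \in g -> Ad s a x \in g.
Proof. exact: (lie_Ad_sub lgs sT). Qed.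

Lemma perp_Ad U a : (forall x, x \in U -> Ad s a^-1%g x \in U) ->
  forall x, x \in perp U -> Ad s a x \in perp U.
Proof.
move=> AU x /perpP[xg Hx]; apply/perpP; split=> [|y yU]; first exact: Ad_g.
by rewrite -[y](AdVK lgs a) -(AdM lgs) (Ad_trace lgs) Hx// AU.
Qed.

Lemma replica_trace0_nilp x : x \in g ->
  (forall E th, uniq E -> kills E x -> rat_functional th -> \tr (x *m spfun E th x) = 0) ->
  x ^+ n.+1 = 0.
Proof.
move=> xg Hx; have [E uE [kX _]] := spectrum x.
by apply: (nilp_of_theta uE kX) => th thR; exact: Hx.
Qed.

(** The orthogonal of [g] is an invariant subalgebra. Each of its elements is orthogonal to its own
    replicas, because these lie in [g] by [lie_replica]; Cartan's criterion makes it nilpotent, so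
    there is none but 0. *)
Lemma perp_g : perp g = 0%VS.
Proof.
apply: red.
- by apply/subvP => x /perpP[].
- move=> x y /perpP[xg Hx] /perpP[yg _]; apply/perpP; split=> [|z zg].
    exact: (lie_bracket lgs sT).
  rewrite mulmxBl raddfB /= -!mulmxA [\tr (y *m _)]mxtrace_mulC -mulmxA -raddfB -mulmxBr /=.
  by apply: Hx; exact: (lie_bracket lgs sT).
- move=> x /perpP[xg Hx]; apply: (replica_trace0_nilp xg) => E th uE kX [thD _ _].
  by apply: Hx; exact: (lie_replica lgs sT).
- by move=> a; apply: perp_Ad => x; exact: Ad_g.
Qed.

Lemma trace_represent (phi : {linear M -> K^o}) :
  exists2 X, X \in g & forall y, y \in g -> \tr (X *m y) = phi y.
Proof.
pose b := vbasis g; pose T x : 'rV[K]_(\dim g) := \row_j \tr (x *m b`_j).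
have Tlin : linear T.
  by move=> a x y; apply/rowP => j; rewrite !mxE mulmxDl -scalemxAl mxtraceD mxtraceZ.
pose Tl : {linear M -> 'rV[K]_(\dim g)} := HB.pack T (GRing.isLinear.Build _ _ _ _ T Tlin).
have TE x : linfun Tl x = T x by rewrite lfunE.
have bas y (z : M) : y \in g -> \tr (z *m y) = \sum_j coord b j y * T z 0 j.
  move=> yg; rewrite {1}(coord_vbasis yg) mulmx_sumr raddf_sum.
  by apply: eq_bigr => j _; rewrite -scalemxAr /= mxtraceZ mxE.
have Tfull : (linfun Tl @: g)%VS = fullv.
  apply/eqP; rewrite eqEdim subvf /= dim_row limg_dim_eq//.
  apply/eqP; rewrite -subv0 -perp_g; apply/subvP => x; rewrite memv_cap memv_ker TE.
  move=> /andP[xg /eqP Tx]; apply/perpP; split=> // y yg.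
  by rewrite bas// Tx big1// => j _; rewrite mxE mulr0.
have : (\row_j phi b`_j : 'rV_(\dim g)) \in (linfun Tl @: g)%VS by rewrite Tfull memvf.
move=> /memv_imgP[X Xg EX]; exists X => // y yg.
rewrite bas// -TE -EX {2}(coord_vbasis yg) linear_sum /=.
by apply: eq_bigr => j _; rewrite mxE linearZ.
Qed.

Lemma perp_perp U x : (U <= g)%VS -> x \in g ->
  (forall y, y \in perp U -> \tr (x *m y) = 0) -> x \in U.
Proof.
move=> Ug xg Hx; apply/negPn/negP => /quotient_functional[phi phi0 phi1].
have [X Xg EX] := trace_represent phi.
have /eqP : \tr (x *m X) = 0.
  by apply: Hx; apply/perpP; split=> // y yU; rewrite EX ?phi0//; exact: (subvP Ug).
by rewrite mxtrace_mulC EX// phi1 oner_eq0.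
Qed.

Lemma perp_dim U : (U <= g)%VS -> (\dim (perp U) + \dim U = \dim g)%N.
Proof.
move=> Ug; pose b := vbasis U; pose T x : 'rV[K]_(\dim U) := \row_j \tr (x *m b`_j).
have Tlin : linear T.
  by move=> a x y; apply/rowP => j; rewrite !mxE mulmxDl -scalemxAl mxtraceD mxtraceZ.
pose Tl : {linear M -> 'rV[K]_(\dim U)} := HB.pack T (GRing.isLinear.Build _ _ _ _ T Tlin).
have TE x : linfun Tl x = T x by rewrite lfunE.
have Tfull : (linfun Tl @: g)%VS = fullv.
  apply/eqP; rewrite eqEsubv subvf /=; apply/subvP => v _.
  pose phi y : K^o := \sum_j v 0 j * coord b j (projv U y).
  have philin : linear phi.
    move=> a x y; rewrite /phi scaler_sumr -big_split; apply: eq_bigr => j _ /=.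
    by rewrite !linearP mulrDr mulrCA.
  pose phil : {linear M -> K^o} := HB.pack phi (GRing.isLinear.Build _ _ _ _ phi philin).
  have [X Xg EX] := trace_represent phil.
  apply/memv_imgP; exists X => //; rewrite TE; apply/rowP => j; rewrite mxE.
  have bU : b`_j \in U by apply/vbasis_mem/memt_nth.
  rewrite EX ?(subvP Ug)//= /phi projv_id// (bigD1 j)//= coord_free ?(basis_free (vbasisP U))//.
  rewrite eqxx mulr1 big1 ?addr0// => i ij.
  by rewrite coord_free ?(basis_free (vbasisP U))// eq_sym (negPf ij) mulr0.
have <- : (g :&: lker (linfun Tl))%VS = perp U.
  apply/vspaceP => x; rewrite memv_cap memv_ker TE; apply/andP/idP.
    move=> [xg /eqP Tx]; apply/perpP; split=> // y yU.
    rewrite (coord_vbasis yU) mulmx_sumr raddf_sum big1// => j _.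
    by rewrite -scalemxAr /= mxtraceZ; move/rowP: Tx => /(_ j); rewrite !mxE => ->; rewrite mulr0.
  move=> /perpP[xg Hx]; split=> //; apply/eqP/rowP => j; rewrite !mxE.
  by apply: Hx; apply/vbasis_mem/memt_nth.
have := limg_ker_dim (linfun Tl) g; rewrite Tfull dim_row; exact.
Qed.

(** The inverse turns the right multiplication of row vectors into a left action. *)
Definition row_act (x : G) : 'End(V) := linfun (mulmxr (s x^-1%g)).
Definition Ad_act (x : G) : 'End(M) := linfun (Ad s x).

Lemma row_actE x v : row_act x v = v *m s x^-1%g. Proof. by rewrite lfunE. Qed.
Lemma Ad_actE x A : Ad_act x A = Ad s x A. Proof. by rewrite lfunE. Qed.

Lemma mxalg_scalar (T I : Type) (y : I -> T -> K) p q (phi : {linear 'M[K]_(p, q) -> K^o}) F :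
  mxalg y F -> alg y (fun x => phi (F x)).
Proof.
move=> HF; have S : alg y (fun x => \sum_i \sum_j F x i j * phi (delta_mx i j)).
  apply: alg_sum => i _; apply: alg_sum => j _.
  by apply: alg_mul => //; exact: alg_cst.
apply: (alg_ext S) => x; rewrite {2}(matrix_sum_delta (F x)) linear_sum.
apply: eq_bigr => i _; rewrite linear_sum; apply: eq_bigr => j _.
by rewrite linearZ.
Qed.

Lemma row_act_reg (phi : {linear V -> K^o}) v : exists2 f : M -> K, polyf f &
  forall x, f (s x) = phi (row_act x v).
Proof.
exists (fun A => phi (v *m tau J A)) => [|x]; last by rewrite row_actE (lgV lgs).
apply: mxalg_scalar; apply: mxalgM; first exact: mxalg_cst.
by apply: mxalg_tau; exact: mxalg_id.
Qed.

Lemma Ad_act_reg (phi : {linear M -> K^o}) A : exists2 f : M -> K, polyf f &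
  forall x, f (s x) = phi (Ad_act x A).
Proof.
exists (fun C : M => phi (C *m A *m tau J C)) => [|x]; last by rewrite Ad_actE (AdE lgs).
apply: mxalg_scalar; apply: mxalgM; last by apply: mxalg_tau; exact: mxalg_id.
by apply: mxalgM; [exact: mxalg_id|exact: mxalg_cst].
Qed.

Lemma row_kolchin B (W1 W2 : {vspace V}) : conn_solv B -> (W1 <= W2)%VS -> W1 != W2 ->
  (forall b, B b -> stabilizes W1 (s b)) -> (forall b, B b -> stabilizes W2 (s b)) ->
  exists e, [/\ e \in W2, e \notin W1 &
    forall b, B b -> exists c, e *m s b - c *: e \in W1].
Proof.
move=> [sB _ cB slB] W12 nW12 st1 st2.
have [|||||e [eW2 eW1 He]] := @lie_kolchin K n G s J lgs B sB cB V row_act _ _ row_act_reg W1 W2 W12 nW12.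
- by move=> v; rewrite row_actE invg1 (lg1 lgs) mulmx1.
- by move=> x y v; rewrite !row_actE invgM (lgM lgs) mulmxA.
- by move=> x v Bx; rewrite row_actE; apply: st1; exact: (subgroupV sB).
- by move=> x v Bx; rewrite row_actE; apply: st2; exact: (subgroupV sB).
- exact: slB.
exists e; split=> // b Bb; have [c] := He _ (subgroupV sB Bb).
by rewrite row_actE invgK; exists c.
Qed.

Lemma kolchin_flag B : conn_solv B -> exists2 W, flag W & B `<=` flag_stab s W.
Proof.
move=> csB; have [|W fW HW] := @flag_build K n [set s b | b in B].
  move=> U UT HU.
  have [||||e [_ eU He]] := @row_kolchin B U fullv csB.
  - exact: subvf.
  - by [].
  - by move=> b Bb; apply: HU; exists b.
  - by move=> b Bb v _; exact: memvf.
  exists e; split=> // _ [b Bb <-] v /vspace_line_decomp[a [u [uU ->]]].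
  have [c Hc] := He b Bb; rewrite mulmxDl -scalemxAl -[e *m s b](subrK (c *: e)).
  rewrite scalerDr addrA memvD//; last by rewrite !memvZ// (subvP (addvSr _ _))// memv_line.
  by apply: (subvP (addvSl _ _)); rewrite memvD ?memvZ//; apply: HU => //; exists b.
by exists W => // b Bb i; apply: HW; exists b.
Qed.

Lemma lie_flag B W : subgroup B -> B `<=` flag_stab s W ->
  forall x, x \in lie s B -> forall i, stabilizes (W i) x.
Proof.
move=> sB BW x xB i v vW; apply: (lie_stable_row _ xB vW) => b w Bb.
exact: BW.
Qed.

Lemma lie_nilp_perp B x y : conn_solv B -> x \in lie s B -> y \in lie s B ->
  x ^+ n.+1 = 0 -> \tr (x *m y) = 0.
Proof.
move=> csB xB yB xn; have [W fW BW] := kolchin_flag csB; have [sB _ _ _] := csB.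
by apply: (flag_trace0 fW) => //; exact: (lie_flag sB BW).
Qed.

Section Borel.
Variable B : set G.
Hypotheses (csB : conn_solv B) (maxB : forall B', conn_solv B' -> B `<=` B' -> B' = B).

Let sB : subgroup B. Proof. by case: csB. Qed.
Let bg : (lie s B <= g)%VS. Proof. exact: lieS. Qed.

(** The curve passes through 1 and stabilizes a flag stabilized by [B], so with [B] it generates a
    connected solvable group, equal to [B] by maximality. *)
Lemma borel_absorbs W (c : K -> G) (d : {poly K}) t1 : flag W -> B `<=` flag_stab s W ->
  zconn s [set c t | t in [set t | d.[t] != 0]] -> d.[t1] != 0 -> c t1 = 1%g ->
  (forall t, d.[t] != 0 -> flag_stab s W (c t)) -> forall t, d.[t] != 0 -> B (c t).
Proof.
move=> fW BW cc d1 c1 cW t dt; pose C := [set c t | t in [set t | d.[t] != 0]].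
pose S := B `|` C.
have csS : conn_solv (zcl s (generated S)).
  apply: (flag_group lgs fW).
    by move=> x [/BW//|[u du <-]]; exact: cW.
  have [_ _ cB _] := csB.
  move=> x [Bx|Cx].
    exists B => //; split=> //; last exact: sB.1.
    by move=> y By; apply: sub_generated; left.
  exists C => //; split=> //; last by exists t1.
  by move=> y Cy; apply: sub_generated; right.
rewrite -(maxB csS).
  by apply: sub_zcl; apply: sub_generated; right; exists t.
by move=> y By; apply: sub_zcl; apply: sub_generated; left.
Qed.

(** For a flag stabilized by [B], the nilpotent elements of the Lie algebra are those that lower it,
    which is a linear condition. *)
Let nb_exists : exists N : {vspace M}, forall x, x \in N <->
  x \in lie s B /\ x ^+ n.+1 = 0.
Proof.
have [W fW BW] := kolchin_flag csB.
have E x : x \in lie s B -> x ^+ n.+1 = 0 <-> forall i v, v \in W i.+1 -> v *m x \in W i.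
  move=> xB; split; last exact: flag_strict.
  by move=> xn i v; apply: flag_nilp => //; exact: (lie_flag sB BW).
have [|a x y [xB Hx] [yB Hy]|N HN] := @set_vspace _ M
    [set x | x \in lie s B /\ forall i v, v \in W i.+1 -> v *m x \in W i].
- by split=> [|i v _]; rewrite ?mulmx0 mem0v.
- split=> [|i v vW]; first by rewrite memvD ?memvZ.
  by rewrite mulmxDr -scalemxAr memvD ?memvZ ?Hx ?Hy.
exists N => x; split=> [/HN[xB Hx]|[xB xn]]; first by split=> //; apply/E.
by apply/HN; split=> //; apply/E.
Qed.

(* An orthogonal element outside the nilradical would, by Lie-Kolchin, share a flag
   with [B]; the tori of its rational replicas then lie in [B], so that it is
   orthogonal to these replicas, hence nilpotent, and its exponentials lie in [B]. *)
Lemma borel_perp x0 : x0 \in perp (lie s B) -> x0 \in lie s B /\ x0 ^+ n.+1 = 0.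
Proof.
have [N HN] := nb_exists; move=> x0P; apply/HN/negPn/negP => x0N.
set b := lie s B in x0P *.
have Nb x : x \in N -> x \in b by move=> /HN[].
have NP : (N <= perp b)%VS.
  apply/subvP => x /HN[xB xn]; apply/perpP; split=> [|y yB]; first exact: (subvP bg).
  exact: (lie_nilp_perp csB).
have AdN h x : B h -> x \in N -> Ad s h x \in N.
  move=> Bh /HN[xB xn]; apply/HN; split; first exact: (lie_Ad_sub lgs sB).
  by rewrite -(Ad_exp lgs) xn linear0.
have AdP h x : B h -> x \in perp b -> Ad s h x \in perp b.
  move=> Bh; apply: perp_Ad => y; apply: (lie_Ad_sub lgs sB).
  exact: (subgroupV sB).
have [_ _ cB slB] := csB.
have [||||||x [xP xN Hx]] := @lie_kolchin K n G s J lgs B sB cB M Ad_act _ _ Ad_act_reg N (perp b) NP.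
- by move=> A; rewrite Ad_actE (Ad_id lgs).
- by move=> y z A; rewrite !Ad_actE (Ad_comp lgs).
- by apply: contraNneq x0N => ->.
- by move=> y A By; rewrite Ad_actE; exact: AdN.
- by move=> y A By; rewrite Ad_actE; exact: AdP.
- exact: slB.
have xg : x \in g by have /perpP[] := xP.
have brac y : y \in b -> y *m x - x *m y \in (N + <[x]>)%VS.
  move=> yb; apply: (lie_stable_bracket lgs _ yb); last first.
    by rewrite (subvP (addvSr _ _))// memv_line.
  move=> h z Bh /vspace_line_decomp[a [u [uN ->]]]; rewrite linearD linearZ /=.
  have [c Hc] := Hx h Bh; rewrite Ad_actE in Hc.
  rewrite -[Ad s h x](subrK (c *: x)) scalerDr addrA memvD//.
    by apply: (subvP (addvSl _ _)); rewrite memvD ?memvZ ?AdN.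
  by rewrite !memvZ// (subvP (addvSr _ _))// memv_line.
have clN : lie_closed N.
  move=> y z yN zN; have [W fW BW] := kolchin_flag csB.
  have yb := Nb _ yN; have zb := Nb _ zN; apply/HN; split; first exact: (lie_bracket lgs sB).
  have [_ yn] := (HN y).1 yN; have [_ zn] := (HN z).1 zN.
  apply: (flag_strict fW) => i v vW.
  have ys := lie_flag sB BW yb; have zs := lie_flag sB BW zb.
  rewrite mulmxBr !mulmxA memvB//; [apply: zs; exact: flag_nilp|apply: ys; exact: flag_nilp].
(* If [y] acted on [x] modulo [N] by a nonzero scalar [c], the iterated brackets of [y] with [x]
   would never vanish, although [y] is nilpotent. *)
have bracN y : y \in N -> y *m x - x *m y \in N.
  move=> yN; have /vspace_line_decomp[c [u [uN E]]] := brac y (Nb _ yN).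
  have [c0|c0] := eqVneq c 0; first by rewrite E c0 scale0r addr0.
  exfalso; have [_ yn] := (HN y).1 yN.
  have H k : iter k (fun z => y *m z - z *m y) x - c ^+ k *: x \in N.
    elim: k => [|k IH] /=; first by rewrite expr0 scale1r subrr mem0v.
    set z := iter k _ x in IH *.
    rewrite (_ : _ - _ = (y *m (z - c ^+ k *: x) - (z - c ^+ k *: x) *m y) + c ^+ k *: u).
      by rewrite memvD ?memvZ//; exact: clN.
    rewrite exprS mulrC -scalerA (_ : u = y *m x - x *m y - c *: x); last by rewrite E addrK.
    rewrite mulmxBr mulmxBl -scalemxAr -scalemxAl.
    move: (y *m z) (z *m y) (y *m x) (x *m y) => A1 A2 A3 A4.
    by apply/matrixP => i j; rewrite !mxE; ring.
  have := H (n.+1 + n.+1)%N; rewrite (ad_nilp yn) sub0r memvN => Hm.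
  by move/negP: xN; apply; rewrite -[x](scalerK (expf_neq0 (n.+1 + n.+1) c0)) memvZ.
pose S := [set s h | h in B] `|` [set x].
(* A common eigenvector of [B] and [x] modulo [U] is found in two steps: Engel's theorem gives the
   nontrivial space [Z] of vectors sent into [U] by [N], and an eigenspace [E] of [x] in [Z] modulo
   [U] is shown to be stable under [B]. *)
have [|W fW HW] := @flag_build K n S.
  move=> U UT HU.
  have UB h : B h -> stabilizes U (s h) by move=> Bh; apply: HU; left; exists h.
  have Ux : stabilizes U x by apply: HU; right.
  have UN y : y \in N -> stabilizes U y.
    move=> yN v vU; apply: (lie_stable_row _ (Nb _ yN) vU) => h w Bh.
    exact: UB.
  have [||Z HZ] := @set_vspace _ V [set v | forall y, y \in N -> v *m y \in U].
  - by move=> y _; rewrite mul0mx mem0v.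
  - move=> a v w Hv Hw y yN; rewrite mulmxDl -scalemxAl memvD ?memvZ//; [exact: Hv|exact: Hw].
  have UZ : (U <= Z)%VS by apply/subvP => v vU; apply/HZ => y yN; exact: UN.
  have nUZ : U != Z.
    have [|||||||||e [_ eU He]] := @engel K n.+1 N V (fun x v => v *m x) (-1) U fullv clN.
    - by move=> y a u v; rewrite mulmxDl -scalemxAl.
    - by move=> v a y z; rewrite mulmxDr -scalemxAr.
    - by move=> y z v _ _; rewrite scaleN1r mulmxBr !mulmxA opprB.
    - move=> y v yN; exists n.+1; have [_ yn] := (HN y).1 yN.
      suff H k : iter k (fun v => v *m y) v = v *m y ^+ k by rewrite H yn mulmx0.
      by elim: k => [|k IH] /=; rewrite ?expr0 ?mulmx1// IH exprSr -mulmxE mulmxA.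
    - move=> y yN; exists (n.+1 + n.+1)%N => z; apply: ad_nilp.
      by have [] := (HN y).1 yN.
    - by move=> y v yN; exact: UN.
    - by move=> y v _ _; exact: memvf.
    - exact: subvf.
    - by [].
    by apply: contraNneq eU => ->; apply/HZ.
  have ZB h : B h -> stabilizes Z (s h).
    move=> Bh v /HZ Hv; apply/HZ => y yN.
    have -> : v *m s h *m y = v *m Ad s h y *m s h.
      by rewrite /Ad !mulmxA -!(mulmxA _ (s h^-1%g)) (sVl lgs) mulmx1.
    by apply: UB => //; apply: Hv; exact: AdN.
  have Zx : stabilizes Z x.
    move=> v /HZ Hv; apply/HZ => y yN.
    have -> : v *m x *m y = v *m y *m x - v *m (y *m x - x *m y).
      by rewrite mulmxBr !mulmxA opprB addrC subrK.
    by rewrite memvB//; [apply: Ux; exact: Hv|apply: Hv; exact: bracN].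
  pose T : 'End(V) := linfun (mulmxr x).
  have TE v : T v = v *m x by rewrite lfunE.
  have [||||l [e [eZ eU He]]] := @quotient_eigenvector K V T U Z.
  - by move=> v; rewrite TE; exact: Ux.
  - by move=> v; rewrite TE; exact: Zx.
  - exact: UZ.
  - exact: nUZ.
  rewrite TE in He.
  have [||E HE] := @set_vspace _ V [set v | v \in Z /\ v *m x - l *: v \in U].
  - by rewrite /= mem0v mul0mx scaler0 subrr mem0v.
  - move=> a v w [vZ Hv] [wZ Hw]; split; first by rewrite memvD// memvZ.
    rewrite mulmxDl -scalemxAl scalerDr opprD addrACA memvD// scalerA mulrC -scalerA -scalerBr.
    exact: memvZ.
  have conj v h : v *m s h *m x = v *m Ad s h x *m s h.
    by rewrite /Ad !mulmxA -!(mulmxA _ (s h^-1%g)) (sVl lgs) mulmx1.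
  have mv v h c : B h -> v \in Z -> v *m x - l *: v \in U -> Ad s h x - c *: x \in N ->
      v *m s h *m x - (c * l) *: (v *m s h) \in U.
    move=> Bh vZ Hv Hc; rewrite conj.
    rewrite (_ : _ - _ = (v *m (Ad s h x - c *: x) + c *: (v *m x - l *: v)) *m s h).
      apply: UB => //; rewrite memvD ?memvZ//.
      by move/HZ: vZ; apply.
    rewrite mulmxDl -scalemxAl mulmxBr -scalemxAr !mulmxBl -!scalemxAl scalerBr scalerA.
    by rewrite addrA subrK.
  have EB h : B h -> stabilizes E (s h).
    move=> Bh v /HE[vZ Hv]; apply/HE; split; first exact: ZB.
    have [c Hc] := Hx h Bh; rewrite Ad_actE in Hc.
    have := mv v h c Bh vZ Hv Hc; have [->|l0] := eqVneq l 0; first by rewrite mulr0.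
    (* Multiplied by [l], the scalar by which [h] acts on [x] modulo [N] is again an eigenvalue of
       [x]. It takes finitely many values on the connected [B], and is 1 at the identity. *)
    suff -> : c = 1 by rewrite mul1r.
    have [phi phi0 phi1] := quotient_functional xN.
    have phic A a : A - a *: x \in N -> phi A = a.
      move=> /phi0; rewrite linearB linearZ /= phi1 => /eqP; rewrite subr_eq0 => /eqP ->.
      exact: mulr1.
    have [f pf Ef] := Ad_act_reg phi x.
    have [r Hr] := quotient_spectrum T.
    have Fval z : B z -> f (s z) \in [seq a / l | a <- r].
      move=> Bz; have [a Ha] := Hx z Bz; rewrite Ef (phic _ _ Ha).
      rewrite Ad_actE in Ha.
      apply/mapP; exists (a * l); last by rewrite mulfK.
      apply: (Hr U _ _ (e *m s z)) => [v'||].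
      - by rewrite TE; exact: Ux.
      - apply: contra eU => Hz; rewrite -[e]mulmx1.
        have -> : (1%:M : M) = s z *m s z^-1%g by rewrite (sVr lgs).
        by rewrite mulmxA; apply: UB => //; exact: (subgroupV sB).
      - by rewrite TE; exact: mv.
    have := zconn_finite_values cB pf sB.1 Fval Bh.
    rewrite !Ef Ad_actE (phic _ _ Hc) Ad_actE (Ad_id lgs) phi1; exact.
  have [||||e' [eE eU' He']] := @row_kolchin B U E csB.
  - apply/subvP => v vU; apply/HE; split; first exact: (subvP UZ).
    by rewrite memvB ?memvZ//; exact: Ux.
  - by apply: contraNneq eU => ->; apply/HE.
  - exact: UB.
  - exact: EB.
  have line A c : stabilizes U A -> e' *m A - c *: e' \in U -> stabilizes (U + <[e']>)%VS A.
    move=> UA HA v /vspace_line_decomp[a [u [uU ->]]].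
    rewrite mulmxDl -scalemxAl -[e' *m A](subrK (c *: e')).
    rewrite scalerDr addrA memvD//; last by rewrite !memvZ// (subvP (addvSr _ _))// memv_line.
    by apply: (subvP (addvSl _ _)); rewrite memvD ?memvZ//; exact: UA.
  exists e'; split=> // _ [[h Bh <-]|->]; first by have [c Hc] := He' h Bh; apply: (line _ c) => //; exact: UB.
  by apply: (line _ l) => //; have /HE[] := eE.
have BW : B `<=` flag_stab s W by move=> h Bh i; apply: HW; left; exists h.
have Wx i : stabilizes (W i) x by apply: HW; right.
have xn : x ^+ n.+1 = 0.
  apply: (replica_trace0_nilp xg) => E th uE kX [thD _ thQ].
  have [D [D0 [m Hm]]] := common_denominator E thQ.
  have DD : {morph (fun a => D%:R * th a) : a b / a + b} by move=> a c; rewrite thD mulrDr.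
  have /choice[c Hc] : forall t, exists y, t != 0 -> s y = spfun E (fun b => t ^ m b) x.
    move=> t; have [->|t0] := eqVneq t 0; first by exists 1%g.
    have [|y Hy] := lg_closed lgs (A := spfun E (fun b => t ^ m b) x).
      by move=> f vf; exact: (lie_torus lgs sT xg uE kX DD Hm t0 vf).
    by exists y => _.
  have X0 t : (('X : {poly K}).[t] != 0) = (t != 0) by rewrite hornerX.
  have Bc t : t != 0 -> B (c t).
    rewrite -X0; move: t; apply: (@borel_absorbs W c 'X 1 fW BW).
    - apply: zconn_curve => [|f pf]; first by rewrite polyX_eq0.
      have [k0 [F [EF _]]] := torus_curve m uE kX pf.
      exists F => t; rewrite X0 => t0; rewrite EF// Hc//.
      by rewrite mulf_eq0 expf_eq0 (negPf t0) andbF.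
    - by rewrite X0 oner_neq0.
    - apply: (lg_inj lgs); rewrite Hc ?oner_neq0// (lg1 lgs).
      by rewrite (@eq_spfun _ _ E x uE kX _ (fun=> 1)) ?spfun_cst// => z _; rewrite exp1rz.
    - move=> t; rewrite X0 => t0 i; rewrite Hc//; exact: stabilizes_horner.
  (* This is the velocity at 1 of the torus [c], which lies in [B]. *)
  have Yb : spfun E (fun a => (m a)%:~R) x \in b.
    apply/lieP => p vp; have [k0 [F [EF DF]]] := torus_curve m uE kX vp.1.
    have p1 : p 1 = 0 by rewrite -(lg1 lgs); apply: vp.2; exact: sB.1.
    have F0 : F = 0.
      have : 'X * F = 0.
        apply: poly_fun_inj => t; rewrite hornerM hornerX horner0.
        have [->|t0] := eqVneq t 0; first by rewrite mul0r.
        by rewrite EF// -Hc// vp.2 ?mulr0//; exact: Bc.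
      by move=> /eqP; rewrite mulf_eq0 polyX_eq0 => /eqP.
    by move: DF; rewrite F0 deriv0 horner0 p1 mulr0 add0r => <-.
  have /perpP[_ /(_ _ Yb)] := xP.
  rewrite (@eq_spfun _ _ E x uE kX _ (fun a => D%:R * th a)); last by move=> a /Hm.
  rewrite (spfunZ uE kX) -scalemxAr mxtraceZ => /eqP.
  by rewrite mulf_eq0 pnatr_eq0 -leqn0 leqNgt D0 => /eqP.
move/negP: xN; apply; apply/HN; split=> //.
have [c Hc] := lie_expm_mem lgs sT xg xn.
have d1 t : (1%:P : {poly K}).[t] != 0 by rewrite hornerC oner_neq0.
have Bc t : B (c t).
  apply: (@borel_absorbs W c 1%:P 0 fW BW) => //.
  - by apply: (expm_zconn xn) => u; have [] := Hc u.
  - by apply: (lg_inj lgs); have [-> _] := Hc 0; rewrite scale0r expm0 (lg1 lgs).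
  - by move=> u _ i; have [-> _] := Hc u; apply: stabilizes_expm; exact: stabilizesZ.
apply/lieP => p vp; have [F [EF DF]] := expm_curve xn vp.1.
have F0 : F = 0 by apply: poly_fun_inj => t; rewrite EF -(Hc t).1 horner0; apply: vp.2; exact: Bc.
by have := DF 0; rewrite F0 deriv0 horner0 scale0r expm0 /der mul1mx => <-.
Qed.

End Borel.

(** Maximality is measured by the dimension of the Lie algebra, which is bounded; by [lie_eq_sub] a
    larger group with the same Lie algebra is the same group. *)
Lemma borel_exists H : conn_solv H -> exists B, [/\ conn_solv B, H `<=` B &
  forall B', conn_solv B' -> B `<=` B' -> B' = B].
Proof.
move=> csH; pose P d := `[< exists B, [/\ conn_solv B, H `<=` B & \dim (lie s B) = d] >].
have exP : exists d, P d by exists (\dim (lie s H)); apply/asboolP; exists H; split.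
have ubP d : P d -> (d <= \dim g)%N.
  by move=> /asboolP[B [_ _ <-]]; apply: dimvS; exact: lieS.
case: (ex_maxnP exP ubP) => d /asboolP[B [csB HB dB]] dmax.
exists B; split=> // B' csB' BB'; apply/seteqP; split=> //.
have [sB clB _ _] := csB; have [sB' _ cB' _] := csB'.
apply: (lie_eq_sub lgs sB' cB' sB clB).
have LL : (lie s B <= lie s B')%VS by exact: lieS.
suff /eqP -> : lie s B == lie s B' by [].
rewrite eqEdim LL /= dB; apply: dmax; apply/asboolP; exists B'; split=> //.
by move=> x /HB/BB'.
Qed.

End Reductive.

(** * Parabolic subgroups and degenerations *)

Section GeneratedSpace.
Variables (K : fieldType) (vT : vectType K).

Lemma gen_vspace_exists (S : set vT) : exists W : {vspace vT}, forall v, v \in W <->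
  forall U : {vspace vT}, (forall x, S x -> x \in U) -> v \in U.
Proof.
apply: set_vspace => [U _|a u v Hu Hv U SU]; first exact: mem0v.
by rewrite memvD ?memvZ ?Hu ?Hv.
Qed.

Definition gen_vspace S : {vspace vT} := projT1 (cid (gen_vspace_exists S)).

Lemma gen_vspace_sub S x : S x -> x \in gen_vspace S.
Proof. by move=> Sx; apply/(projT2 (cid (gen_vspace_exists S))) => U; exact. Qed.

Lemma gen_vspace_min S (U : {vspace vT}) : (forall x, S x -> x \in U) -> (gen_vspace S <= U)%VS.
Proof.
by move=> SU; apply/subvP => v /(projT2 (cid (gen_vspace_exists S))); apply.
Qed.

Lemma gen_vspace_ind S (P : vT -> Prop) : P 0 -> (forall a u v, P u -> P v -> P (a *: u + v)) ->
  (forall x, S x -> P x) -> forall v, v \in gen_vspace S -> P v.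
Proof.
move=> P0 Plin PS v vS; have [U HU] := set_vspace P0 Plin.
by apply/HU; apply: (subvP (gen_vspace_min _) _ vS) => x /PS/HU.
Qed.

End GeneratedSpace.

Section GoodPairs.
Variables (K : numClosedFieldType) (n : nat) (G : groupType).
Local Notation M := 'M[K]_n.+1.
Local Notation V := 'rV[K]_n.+1.
Variables (s : G -> M) (J : M).
Hypotheses (lgs : linear_group s J) (red : reductive_lie s) (cG : zconn s setT).
Implicit Types (A B P : set G) (u p : {vspace M}).
Local Notation g := (lie s setT).
Local Notation perp := (perp s).
Let sT : subgroup [set: G]. Proof. by []. Qed.

(* [p] is a parabolic subalgebra with nilradical [u]. *)
Definition good u p := [/\ [/\ (u <= p)%VS, (p <= g)%VS & u != 0%VS],
  forall x y, x \in u -> y \in p -> \tr (x *m y) = 0,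
  (\dim g <= \dim u + \dim p)%N,
  forall y x, y \in p -> x \in u -> y *m x - x *m y \in u &
  forall x, x \in u -> x ^+ n.+1 = 0].

Definition normalizes u (a : G) := forall x, x \in u -> Ad s a x \in u.

Definition bad A := exists u p, good u p /\ forall a, A a -> normalizes u a.

Lemma normalizesV u a : normalizes u a -> normalizes u a^-1%g.
Proof.
move=> Ha x xu; pose f : 'End(M) := linfun (Ad s a).
have fE w : f w = Ad s a w by rewrite lfunE.
have : (f @: u)%VS = u.
  apply/eqP; rewrite eqEdim; apply/andP; split.
    by apply/subvP => w /memv_imgP[z zu ->]; rewrite fE; exact: Ha.
  rewrite limg_dim_eq//; apply/eqP; rewrite -subv0; apply/subvP => w.
  rewrite memv_cap memv_ker fE => /andP[_ /eqP wx]; rewrite memv0; apply/eqP.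
  by rewrite -(AdK lgs a w) wx linear0.
move=> fU; move: xu; rewrite -{1}fU => /memv_imgP[z zu ->].
by rewrite fE (AdK lgs).
Qed.

Lemma normalizer_subgroup u : subgroup [set a | normalizes u a].
Proof.
split=> [x xu|a b Ha Hb x xu]; first by rewrite (Ad_id lgs).
by rewrite (Ad_comp lgs); apply: Ha; exact: normalizesV.
Qed.

Lemma normalizer_closed u : zclosed s [set a | normalizes u a].
Proof.
move=> a Ha x xu.
rewrite (AdE lgs); refine (@zclosed_vspace K n G s (fun B : M => B *m x *m tau J B) u _ a _) => [|f pf Hf].
  apply: mxalgM; last by apply: mxalg_tau; exact: mxalg_id.
  by apply: mxalgM; [exact: mxalg_id|exact: mxalg_cst].
by apply: Ha => // z Hz; apply: Hf; rewrite /= -(AdE lgs); exact: Hz.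
Qed.

Section Good.
Variables (u p : {vspace M}).
Hypothesis gup : good u p.

Lemma good_perp : p = perp u.
Proof.
have [[upp pg _] tr0 du _ _] := gup; apply/eqP; rewrite eqEdim; apply/andP; split.
  apply/subvP => y yp; apply/perpP; split=> [|x xu]; first exact: (subvP pg).
  by rewrite mxtrace_mulC tr0.
have := perp_dim lgs red (subv_trans upp pg).
by move: du; set d := \dim g; lia.
Qed.

Lemma good_lie : lie_closed u.
Proof.
by have [[upp _ _] _ _ H _] := gup => x y xu yu; apply: H => //; exact: (subvP upp).
Qed.

Lemma good_mem x : x \in g -> (forall y, y \in p -> \tr (x *m y) = 0) -> x \in u.
Proof.
have [[upp pg _] _ _ _ _] := gup; move=> xg Hx.
by apply: (perp_perp lgs red (subv_trans upp pg) xg) => y; rewrite -good_perp; exact: Hx.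
Qed.

End Good.

Lemma curve_lie B x : (forall t, exists2 y, B y & s y = expm (t *: x)) -> x ^+ n.+1 = 0 ->
  x \in lie s B.
Proof.
move=> HB xn; apply/lieP => f vf; have [F [EF DF]] := expm_curve xn vf.1.
have F0 : F = 0.
  by apply: poly_fun_inj => t; have [y By sy] := HB t; rewrite EF -sy horner0; exact: vf.2.
by have := DF 0; rewrite F0 deriv0 horner0 scale0r expm0 /der mul1mx => <-.
Qed.

Definition borel_group B := conn_solv s B /\
  forall B', conn_solv s B' -> B `<=` B' -> B' = B.

(** The parabolic subgroup is the normalizer of [u], proper since [u] would otherwise be a nil
    ideal. Take a Borel subgroup [B] containing the exponentials of [u]: nilpotent elements of its
    Lie algebra are orthogonal to it, so this algebra lies in [p] and normalizes [u], and the
    connected [B] does too. *)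
Lemma bad_parabolic A : bad A -> exists P, [/\ subgroup P, zclosed s P, A `<=` P, P <> setT &
  exists2 B, borel_group B & B `<=` P].
Proof.
move=> [u [p [gup Hu]]]; exists [set a | normalizes u a]; split.
- exact: normalizer_subgroup.
- exact: normalizer_closed.
- by move=> a /Hu.
- move=> NT; have [[upp pg /eqP u0] _ _ _ nu] := gup; apply: u0; apply: red.
  + exact: subv_trans pg.
  + exact: (good_lie gup).
  + exact: nu.
  + move=> a x; have : [set: G] a by [].
    by rewrite -NT; exact.
have [[upp pg u0] _ _ H nu] := gup; have ug := subv_trans upp pg.
have [S csS SP] := nil_group lgs u0 ug (good_lie gup) nu.
have [B [csB SB maxB]] := borel_exists lgs csS.
exists B => //; have [sB _ cB _] := csB.
have uB x : x \in u -> x \in lie s B.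
  move=> xu; apply: curve_lie; last exact: nu.
  move=> t; have [c Hc] := lie_expm_mem lgs sT (subvP ug _ xu) (nu _ xu).
  exists (c t); last by have [] := Hc t.
  apply: SB; apply: sub_zcl; apply: sub_generated; apply/SP.
  by exists (t *: x); [rewrite memvZ|have [] := Hc t].
have st y x : y \in lie s B -> x \in u -> y *m x - x *m y \in u.
  move=> yB xu; apply: H => //.
  rewrite (good_perp gup); apply/perpP; split=> [|z zu].
    have bg : (lie s B <= g)%VS by exact: lieS.
    exact: (subvP bg _ yB).
  by rewrite mxtrace_mulC; apply: (lie_nilp_perp lgs csB) => //; [exact: uB|exact: nu].
by move=> b Bb x xu; exact: (Ad_stable lgs sB cB st Bb xu).
Qed.

(** Orthogonality reverses inclusions, so the orthogonal of the Lie algebra of [P] consists of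
    nilpotent elements of that of [B], by [borel_perp]. It is nonzero because [P] is proper and [G]
    connected. *)
Lemma parabolic_bad A P B : subgroup P -> zclosed s P -> A `<=` P -> P <> setT ->
  borel_group B -> B `<=` P -> bad A.
Proof.
move=> sP clP AP PT [csB maxB] BP; exists (perp (lie s P)), (lie s P).
have pg : (lie s P <= g)%VS by exact: lieS.
have bp : (lie s B <= lie s P)%VS by exact: lieS.
have ub x : x \in perp (lie s P) -> x \in lie s B /\ x ^+ n.+1 = 0.
  move=> /perpP[xg Hx]; apply: (borel_perp lgs csB maxB); apply/perpP; split=> // y yB.
  by apply: Hx; exact: (subvP bp).
split; last first.
  move=> a Aa x; apply: (perp_Ad lgs) => y; apply: (lie_Ad_sub lgs sP).
  by apply: (subgroupV sP); exact: AP.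
split.
- split=> //; first by apply/subvP => x /ub[xB _]; exact: (subvP bp).
  apply/eqP => u0; apply: PT; apply/seteqP; split=> //.
  apply: (lie_eq_sub lgs sT cG sP clP).
  have := perp_dim lgs red pg; rewrite u0 dimv0 add0n => dE.
  by have /eqP <- : lie s P == g by rewrite eqEdim pg dE leqnn.
- by move=> x y /perpP[_]; exact.
- by rewrite (perp_dim lgs red pg).
- move=> y x yP xu; apply: (lie_stable_bracket lgs _ yP xu) => h z Ph.
  apply: (perp_Ad lgs) => w; apply: (lie_Ad_sub lgs sP); exact: (subgroupV sP).
- by move=> x /ub[].
Qed.

Section Grading.
Variables (u p : {vspace M}).
Hypothesis gup : good u p.

(* the spaces [V u^i] *)
Fixpoint Wf i : {vspace V} := if i is i'.+1 then
  gen_vspace [set w | exists v x, [/\ v \in Wf i', x \in u & w = v *m x]] else fullv.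

Lemma Wf_step i v x : v \in Wf i -> x \in u -> v *m x \in Wf i.+1.
Proof. by move=> vW xu; apply: gen_vspace_sub; exists v, x. Qed.

Lemma Wf_le i : (Wf i.+1 <= Wf i)%VS.
Proof.
elim: i => [|i IH]; first exact: subvf.
by apply: gen_vspace_min => _ [v [x [vW xu ->]]]; apply: Wf_step => //; exact: (subvP IH).
Qed.

Lemma Wf_mono i j : (i <= j)%N -> (Wf j <= Wf i)%VS.
Proof.
move=> /subnKC <-; elim: (j - i)%N => [|k IH]; first by rewrite addn0.
by rewrite addnS; apply: subv_trans IH; exact: Wf_le.
Qed.

Lemma Wf_zero : exists L, Wf L = 0%VS.
Proof.
have [_ _ _ _ nu] := gup; have [F fF uF] := nil_flag (good_lie gup) nu.
have [F0 _ [N FN]] := fF; exists N; apply/eqP; rewrite -subv0 -F0.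
suff H i j : (i + j = N)%N -> (Wf i <= F j)%VS by apply: H; rewrite addn0.
elim: i j => [|i IH] j ij; first by rewrite add0n in ij; rewrite ij FN subvf.
apply: gen_vspace_min => _ [v [x [vW xu ->]]].
apply: (flag_nilp fF (uF _ xu) (nu _ xu)).
by apply: (subvP (IH j.+1 _) _ vW); rewrite addnS.
Qed.

Definition raises r (A : M) := forall i v, v \in Wf i -> v *m A \in Wf (i + r)%N.
Definition lowers r (A : M) := forall i v, v \in Wf (i + r)%N -> v *m A \in Wf i.

Lemma raises_trace (A : M) : raises 1 A -> \tr A = 0.
Proof.
move=> rA; have [L WL] := Wf_zero; apply: (@nilp_trace _ _ _ L).
have H k v : v *m A ^+ k \in Wf k.
  elim: k v => [|k IH] v; first by rewrite memvf.
  by rewrite exprSr -mulmxE mulmxA -(addn1 k); apply: rA; exact: IH.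
apply/row_matrixP => i; apply/eqP; rewrite rowE row0 -memv0 -WL; exact: H.
Qed.

Lemma lowers_raises r (A C : M) : lowers r A -> raises r.+1 C -> raises 1 (A *m C).
Proof.
move=> lA rC i v vW; rewrite mulmxA addn1; have [ri|ir] := leqP r i.
  have := rC _ _ (lA (i - r)%N v _); rewrite subnK// => /(_ vW).
  by rewrite addnS subnK.
apply: (subvP (Wf_mono _) _ (rC 0%N (v *m A) (memvf _))).
by rewrite add0n; exact: ltnW.
Qed.

(** A vector of [Wf i] is fixed by the projections to the first [i] spaces, from [Wf 1] to [Wf i],
    and sent into [Wf i.+1] by the others; the sum of all projections grades the filtration. *)
Lemma grading_element : exists D : M, forall i v, v \in Wf i -> v *m D - i%:R *: v \in Wf i.+1.
Proof.
have [L WL] := Wf_zero.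
pose D := \sum_(k < L) lin1_mx (projv (Wf k.+1)); exists D => i v vW.
rewrite mulmx_sumr; under eq_bigr do rewrite mul_rV_lin1.
have [Li|iL] := leqP L i.
  have v0 : v = 0 by apply/eqP; rewrite -memv0 -WL; exact: (subvP (Wf_mono Li)).
  by rewrite v0 scaler0 subr0 big1 ?mem0v// => k _; rewrite linear0.
rewrite -(big_mkord xpredT (fun k => projv (Wf k.+1) v)) (big_cat_nat (n := i))//=; last exact: ltnW.
rewrite (@eq_big_nat _ _ _ 0 i _ (fun=> v)); last first.
  by move=> k /andP[_ ki]; rewrite projv_id//; exact: (subvP (Wf_mono ki)).
rewrite sumr_const_nat subn0 scaler_nat addrC addrK big_nat memv_suml// => k /andP[ik _].
have ik1 : (i.+1 <= k.+1)%N by [].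
exact: (subvP (Wf_mono ik1) _ (memv_proj (Wf k.+1) v)).
Qed.

(* the lower central series of [u] *)
Fixpoint us j : {vspace M} := if j is j'.+1 then
  gen_vspace [set w | exists x z, [/\ x \in u, z \in us j' & w = x *m z - z *m x]] else u.

Lemma us_step j x z : x \in u -> z \in us j -> x *m z - z *m x \in us j.+1.
Proof. by move=> xu zU; apply: gen_vspace_sub; exists x, z. Qed.

Lemma us_u j : (us j <= u)%VS.
Proof.
elim: j => [|j IH] //=.
by apply: gen_vspace_min => _ [x [z [xu zu ->]]]; apply: (good_lie gup) => //; exact: (subvP IH).
Qed.

Lemma us_raises j z : z \in us j -> raises j.+1 z.
Proof.
elim: j z => [|j IH] z; first by move=> zu i v vW; rewrite addn1; exact: Wf_step.
move: z; apply: gen_vspace_ind.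
- by move=> i v _; rewrite mulmx0 mem0v.
- by move=> a y z ry rz i v vW; rewrite mulmxDr -scalemxAr memvD ?memvZ ?ry ?rz.
move=> _ [x [z [xu zu ->]]] i v vW; rewrite mulmxBr !mulmxA memvB//.
  by rewrite addnS -addSn; apply: (IH z zu); exact: Wf_step.
by rewrite addnS; apply: Wf_step => //; exact: (IH z zu).
Qed.

Lemma us_zero : exists L, us L = 0%VS.
Proof.
have [L WL] := Wf_zero; exists L; apply/eqP; rewrite -subv0; apply/subvP => z zu.
rewrite memv0; apply/eqP/row_matrixP => i; apply/eqP; rewrite rowE row0 -memv0 -WL.
have w0 : (delta_mx 0 i : V) \in Wf 0 by exact: memvf.
by have := us_raises zu w0; rewrite add0n; exact: (subvP (Wf_le _)).
Qed.

Let ug : (u <= g)%VS. Proof. by have [[upp pg _] _ _ _ _] := gup; exact: subv_trans pg. Qed.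

(** By invariance of the trace form, the bracket with [u] sends the orthogonal of [us j.+1] into
    that of [us j]; moving [y] past the factors from [u] gives the induction. *)
Lemma perp_us_lowers j y : y \in perp (us j) -> lowers j y.
Proof.
elim: j y => [|j IH] y yP i.
  have yp : y \in p by rewrite (good_perp gup).
  elim: i => [|i IHi] v; first by move=> _; exact: memvf.
  rewrite addn0; move: v; apply: gen_vspace_ind.
  - by rewrite mul0mx mem0v.
  - by move=> a v w; rewrite mulmxDl -scalemxAl => Hv Hw; rewrite memvD ?memvZ.
  move=> _ [v [x [vW xu ->]]]; have [_ _ _ H _] := gup.
  have -> : v *m x *m y = v *m y *m x - v *m (y *m x - x *m y).
    by rewrite mulmxBr !mulmxA opprB addrC subrK.
  rewrite memvB//; apply: Wf_step => //; last exact: H.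
  by apply: IHi; rewrite addn0.
have brac x : x \in u -> x *m y - y *m x \in perp (us j).
  move=> xu; have /perpP[yg Hy] := yP; apply/perpP; split.
    by apply: (lie_bracket lgs sT) => //; exact: (subvP ug).
  move=> z zu; have := Hy _ (us_step xu zu).
  rewrite mulmxBl mulmxBr !raddfB /= !mulmxA => H.
  have E : \tr (x *m y *m z) = \tr (y *m z *m x) by rewrite -mulmxA mxtrace_mulC.
  by rewrite E -opprB H oppr0.
elim: i => [|i IHi] v; first by move=> _; exact: memvf.
rewrite addSn; move: v; apply: gen_vspace_ind.
- by rewrite mul0mx mem0v.
- by move=> a v w; rewrite mulmxDl -scalemxAl => Hv Hw; rewrite memvD ?memvZ.
move=> _ [v [x [vW xu ->]]].
have -> : v *m x *m y = v *m y *m x + v *m (x *m y - y *m x).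
  by rewrite mulmxBr !mulmxA addrC subrK.
rewrite memvD//; first by apply: Wf_step => //; exact: IHi.
by apply: (IH _ (brac x xu)); rewrite addSnnS.
Qed.

Lemma normalizes_Wf a i : normalizes u a -> stabilizes (Wf i) (s a).
Proof.
move=> Na; elim: i => [|i IH] v; first by move=> _; exact: memvf.
move: v; apply: gen_vspace_ind.
- by rewrite mul0mx mem0v.
- by move=> b v w; rewrite mulmxDl -scalemxAl => Hv Hw; rewrite memvD ?memvZ.
move=> _ [v [x [vW xu ->]]].
have -> : v *m x *m s a = v *m s a *m Ad s a^-1%g x.
  by rewrite /Ad invgK !mulmxA -(mulmxA v (s a)) (sVr lgs) mulmx1.
by apply: Wf_step; [exact: IH|exact: normalizesV].
Qed.

(* The trace form represents [y |-> - \tr (y *m D)], where [D] grades the spaces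
   [V u^i]; the representing element acts by [j.+1] on the [j]-th quotient of the
   lower central series. *)
Lemma grading_lie : exists X, [/\ X \in g,
  forall j z, z \in us j -> X *m z - z *m X - j.+1%:R *: z \in us j.+1 &
  forall a, normalizes u a -> Ad s a X - X \in u].
Proof.
have [D HD] := grading_element.
pose phi (y : M) : K^o := - \tr (y *m D).
have philin : linear phi.
  by move=> a x y; rewrite /phi mulmxDl -scalemxAl mxtraceD mxtraceZ opprD -mulrN.
pose phil : {linear M -> K^o} := HB.pack phi (GRing.isLinear.Build _ _ _ _ phi philin).
have [X Xg EX] := trace_represent lgs red phil.
have {}EX y : y \in g -> \tr (X *m y) = - \tr (y *m D) by exact: EX.
exists X; split=> //.
  move=> j z zj; have zg : z \in g by apply: (subvP ug); exact: (subvP (us_u j)).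
  have usg : (us j.+1 <= g)%VS by apply: subv_trans ug; exact: us_u.
  apply: (perp_perp lgs red usg).
    by rewrite memvB ?memvZ//; exact: (lie_bracket lgs sT).
  move=> y yP; have /perpP[yg _] := yP.
  (* [D] satisfies the wanted relation, up to sign and up to operators raising by [j.+2]. Multiplied
     by [y], which lowers by at most [j.+1], these have trace zero, and the trace form transfers the
     relation to [X]. *)
  pose E := D *m z - z *m D + j.+1%:R *: z.
  have rE : raises j.+2 E.
    move=> i v vW; have rz := us_raises zj vW.
    have H1 := us_raises zj (HD i v vW); have H2 := HD _ _ rz.
    rewrite (_ : v *m E = (v *m D - i%:R *: v) *m z - (v *m z *m D - (i + j.+1)%:R *: (v *m z))).
      have -> : (i + j.+2 = (i + j.+1).+1)%N by rewrite addnS.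
      exact: (memvB H1 H2).
    rewrite /E mulmxDr mulmxBr mulmxBl -scalemxAl -scalemxAr !mulmxA natrD.
    move: (v *m D *m z) (v *m z *m D) (v *m z) => A1 A2 A3.
    by apply/matrixP => i0 j0; rewrite !mxE; ring.
  have := raises_trace (lowers_raises (perp_us_lowers yP) rE).
  rewrite /E mulmxDr mulmxBr -scalemxAr mxtraceD raddfB /= mxtraceZ => E0.
  rewrite mulmxBl mulmxBl raddfB /= raddfB /= -scalemxAl mxtraceZ.
  have E1 : \tr (X *m z *m y) - \tr (z *m X *m y) = - (\tr (y *m (D *m z)) - \tr (y *m (z *m D))).
    have -> : \tr (z *m X *m y) = \tr (X *m (y *m z)) by rewrite -mulmxA mxtrace_mulC mulmxA.
    rewrite -mulmxA -raddfB -mulmxBr /= EX; last exact: (lie_bracket lgs sT).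
    rewrite mulmxBl raddfB /= -(mulmxA y z D).
    have -> : \tr (z *m y *m D) = \tr (y *m (D *m z)) by rewrite -mulmxA mxtrace_mulC !mulmxA.
    by [].
  by rewrite E1 (mxtrace_mulC z y) -opprD E0 oppr0.
move=> a Na; have [[upp pg _] _ _ _ _] := gup.
apply: (good_mem gup).
  by rewrite memvB//; exact: (lie_Ad_sub lgs sT).
move=> y yp; have yg := subvP pg _ yp; rewrite mulmxBl raddfB /=.
have -> : \tr (Ad s a X *m y) = \tr (X *m Ad s a^-1%g y).
  by rewrite -[y in LHS](AdVK lgs a) -(AdM lgs) (Ad_trace lgs).
rewrite !EX//; last exact: (lie_Ad_sub lgs sT).
have -> : \tr (Ad s a^-1%g y *m D) = \tr (y *m Ad s a D).
  by rewrite -[D in LHS](AdK lgs a) -(AdM lgs) (Ad_trace lgs).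
rewrite opprK addrC -raddfB -mulmxBr /=.
apply: raises_trace; apply: (@lowers_raises 0).
  by apply: perp_us_lowers; rewrite -(good_perp gup).
move=> i v vW; have sa := normalizes_Wf (i := i) Na.
have sa' := normalizes_Wf (i := i.+1) (normalizesV Na).
rewrite addn1 mulmxBr (_ : _ - _ = (v *m D - i%:R *: v) - (v *m s a *m D - i%:R *: (v *m s a)) *m s a^-1%g).
  by rewrite memvB ?HD//; apply: sa'; apply: HD; exact: sa.
have vE : v *m s a *m s a^-1%g = v by rewrite -mulmxA (sVr lgs) mulmx1.
by rewrite mulmxBl -scalemxAl vE /Ad !mulmxA opprB addrA subrK.
Qed.

End Grading.
End GoodPairs.

(** * Blocks of a matrix with respect to the eigenvalues of [X] *)

Section Spectral.
Variables (K : numClosedFieldType) (n : nat).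
Local Notation M := 'M[K]_n.+1.
Variables (X : M) (E : seq K).
Hypotheses (uE : uniq E) (kX : kills E X).
Local Notation e := (spidem E X).

Lemma spidem_orth b c : b != c -> e b * e c = 0.
Proof.
move=> bc; rewrite -(spfunM uE kX) (@eq_spfun _ _ _ _ uE kX _ (fun=> 0)).
  by rewrite (spfun_cst uE kX) raddf0.
by move=> x _; case: eqP => [->|]; rewrite ?mul0r// (negPf bc) mulr0.
Qed.

Lemma spidem_nilp b : b \in E -> (X - b%:M) ^+ n.+1 * e b = 0.
Proof.
move=> bE; rewrite (_ : (X - b%:M) ^+ _ = horner_mx X (('X - b%:P) ^+ n.+1)); last first.
  by rewrite rmorphXn rmorphB /= horner_mx_X horner_mx_C.
exact: (horner_spidem uE kX bE (dvdpp _)).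
Qed.

Lemma spidem_commr b : e b * X = X * e b.
Proof. exact/esym/(spidem_comm E X). Qed.

(** On the block of [b] and [c], the only eigenvalue of the bracket with [X] is [b - c]: left
    multiplication by [X - b] and right multiplication by [X - c] are commuting nilpotent operators
    there. *)
Lemma component_zero b c l (y : M) : b \in E -> c \in E -> e b * y = y -> y * e c = y ->
  X * y - y * X = l *: y -> l != b - c -> y = 0.
Proof.
move=> bE cE eb ec br lbc.
pose A := X - b%:M; pose C := X - c%:M; pose N := n.+1.
have Ay : A ^+ N * y = 0 by rewrite -eb mulrA spidem_nilp// mul0r.
have cC : C * e c = e c * C.
  by rewrite mulrBl mulrBr spidem_commr -!mulmxE mul_scalar_mx mul_mx_scalar.
have comC k : C ^+ k * e c = e c * C ^+ k.
  elim: k => [|k IHk]; first by rewrite !expr0 mul1r mulr1.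
  by rewrite exprSr -mulrA cC mulrA IHk -mulrA.
have yC : y * C ^+ N = 0 by rewrite -ec -mulrA -comC spidem_nilp// mulr0.
have mu0 : l - b + c != 0 by rewrite (_ : l - b + c = l - (b - c)) ?subr_eq0// opprB addrA addrAC.
have E1 : (l - b + c) *: y = A * y - y * C.
  rewrite mulrBl mulrBr -!mulmxE mul_scalar_mx mul_mx_scalar !mulmxE.
  rewrite scalerDl scalerBl -br opprB addrA addrAC; congr (_ + _).
  by rewrite addrAC.
suff H k i j : ((N - i) + (N - j) <= k)%N -> A ^+ i * y * C ^+ j = 0.
  by have := H (N + N)%N 0%N 0%N; rewrite !subn0 leqnn !expr0 mul1r mulr1; apply.
elim: k i j => [|k IH] i j.
  rewrite leqn0 addn_eq0 subn_eq0 => /andP[/subnK <- _].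
  by rewrite exprD -(mulrA (A ^+ (i - N))) Ay mulr0 mul0r.
have [Ni _|iN] := leqP N i.
  by rewrite -(subnK Ni) exprD -(mulrA _ _ y) Ay mulr0 mul0r.
have [Nj _|jN Hk] := leqP N j.
  by rewrite -(subnKC Nj) exprD mulrA -(mulrA _ y) yC mulr0 mul0r.
have : (l - b + c) *: (A ^+ i * y * C ^+ j) = 0.
  rewrite scalerAl scalerAr E1 mulrBr mulrBl !mulrA -exprSr -(mulrA _ C) -exprS.
  by rewrite !IH ?subrr//; move: Hk iN jN; lia.
by move=> /eqP; rewrite scaler_eq0 (negPf mu0) => /eqP.
Qed.

Lemma component_sum (A : M) : A = \sum_(b <- E) \sum_(c <- E) e b * A * e c.
Proof.
under eq_bigr do rewrite -mulr_sumr (spidem_sum uE kX) mulr1.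
by rewrite -mulr_suml (spidem_sum uE kX) mul1r.
Qed.

Lemma component_bracket b c (A : M) :
  X * (e b * A * e c) - (e b * A * e c) * X = e b * (X * A - A * X) * e c.
Proof.
rewrite mulrBr mulrBl !mulrA spidem_commr; congr (_ - _).
by rewrite -!mulrA spidem_commr.
Qed.

Lemma torus_conj (m : K -> int) t (A : M) : t != 0 ->
  spfun E (fun b => t ^ m b) X * A * spfun E (fun b => t ^ (- m b)) X =
  \sum_(b <- E) \sum_(c <- E) t ^ (m b - m c) *: (e b * A * e c).
Proof.
move=> t0; rewrite !(spfun_sum uE kX) mulr_suml mulr_suml; apply: eq_bigr => b _.
rewrite mulr_sumr; apply: eq_bigr => c _.
by rewrite -!scalerAl -!scalerAr scalerA expfzDr// mulrC.
Qed.

End Spectral.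

(** * Degeneration of a bad representation along a torus *)

Section Degeneration.
Variables (K : numClosedFieldType) (n : nat) (G Gamma : groupType).
Local Notation M := 'M[K]_n.+1.
Variables (s : G -> M) (J : M).
Hypotheses (lgs : linear_group s J) (red : reductive_lie s) (cG : zconn s setT).
Local Notation g := (lie s setT).
Let sT : subgroup [set: G]. Proof. by []. Qed.

Definition path_eval (Q : 'M[{poly K}]_n.+1) (t : K) : M := map_mx (fun P => P.[t]) Q.

Lemma polyf_path f (Q : 'M[{poly K}]_n.+1) : polyf f ->
  exists F : {poly K}, forall t, F.[t] = f (path_eval Q t).
Proof.
elim=> [a|[i j]|f1 g1 _ [P HP] _ [R HR]|f1 g1 _ [P HP] _ [R HR]].
- by exists a%:P => t; rewrite hornerC.
- by exists (Q i j) => t; rewrite /mxentry mxE.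
- by exists (P + R) => t; rewrite hornerD HP HR.
- by exists (P * R) => t; rewrite hornerM HP HR.
Qed.

Lemma poly_punctured (F : {poly K}) : (forall t, t != 0 -> F.[t] = 0) -> F = 0.
Proof.
move=> HF; have : 'X * F = 0.
  apply: poly_fun_inj => t; rewrite hornerM hornerX horner0.
  by have [->|t0] := eqVneq t 0; rewrite ?mul0r// HF// mulr0.
by move=> /eqP; rewrite mulf_eq0 polyX_eq0 => /eqP.
Qed.

Variables (u p : {vspace M}).
Hypothesis gup : good s u p.

(** The torus comes from a replica of the grading element [X]. An element normalizing [u] has only
    blocks where the eigenvalue difference is a natural number, so its conjugates involve
    nonnegative powers of [t], and their limit keeps the blocks of exponent 0. The form [phi] reads
    off a block of [x] in [u], showing that the torus is infinite modulo the center. *)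
Lemma degeneration : exists (c : K -> G) (phi : {linear M -> K^o}) (x : M) (k : nat),
  [/\ x \in g, (0 < k)%N, forall t, t != 0 -> phi (Ad s (c t) x) = t ^+ k &
  forall a, normalizes s u a -> exists b (Q : 'M[{poly K}]_n.+1),
   [/\ forall t, t != 0 -> path_eval Q t = s (c t * a * (c t)^-1)%g,
       path_eval Q 0 = s b & forall t, t != 0 -> (c t * b * (c t)^-1)%g = b]].
Proof.
have [X [Xg HX NX]] := grading_lie lgs red gup.
have [E uE [kX _]] := spectrum X.
(* As [th 1 = 1], an eigenvalue difference that is a natural number [i] gives the exponent
   [D * i]. *)
have [th [thD thZ thQ] th1] := rat_functional_exists (oner_neq0 K).
have [D [D0 [m Hm]]] := common_denominator E thQ.
have DD : {morph (fun a => D%:R * th a) : a b / a + b} by move=> a b; rewrite thD mulrDr.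
have thB a b : th (a - b) = th a - th b.
  by apply: (addIr (th b)); rewrite -thD !subrK.
have mB b c i : b \in E -> c \in E -> b - c = i%:R -> m b - m c = (D * i)%N%:Z.
  move=> bE cE bc; apply/eqP; rewrite -(eqr_int K) rmorphB /= -!Hm// -mulrBr -thB bc.
  have -> : th i%:R = i%:R by rewrite -[i%:R]mulr1 -[X in th (X * _)](ratr_nat K) thZ th1 ratr_nat.
  by rewrite -natrM.
pose Lam t := spfun E (fun b => t ^ m b) X.
have /choice[c Hc] : forall t, exists y, t != 0 -> s y = Lam t.
  move=> t; have [->|t0] := eqVneq t 0; first by exists 1%g.
  have [|y Hy] := lg_closed lgs (A := Lam t).
    by move=> f vf; exact: (lie_torus lgs sT Xg uE kX DD Hm t0 vf).
  by exists y => _.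
have HcV t : t != 0 -> s (c t)^-1%g = spfun E (fun b => t ^ (- m b)) X.
  move=> t0; have H1 : Lam t * spfun E (fun b => t ^ (- m b)) X = 1.
    rewrite -(spfunM uE kX) (@eq_spfun _ _ _ _ uE kX _ (fun=> 1)) ?(spfun_cst uE kX)//.
    by move=> b _; rewrite -expfzDr// subrr.
  rewrite -[LHS]mulr1 -H1 mulrA -(Hc t t0) -mulmxE.
  have -> : s (c t)^-1%g *m s (c t) = 1 by exact: (sVl lgs).
  by rewrite mul1mx.
have conjE t A : t != 0 -> s (c t) *m A *m s (c t)^-1%g =
    \sum_(b <- E) \sum_(d <- E) t ^ (m b - m d) *: (spidem E X b * A * spidem E X d).
  by move=> t0; rewrite HcV// Hc// !mulmxE; exact: (torus_conj uE kX).
have [L uL] := us_zero gup.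
(* Elements of [u] only have blocks with [b - d] a positive integer: this goes down the lower
   central series, on whose quotients the bracket with [X] is a positive integer. *)
have usz j z b d : z \in us u j -> b \in E -> d \in E -> (forall i : nat, b - d <> i.+1%:R) ->
    spidem E X b * z * spidem E X d = 0.
  have [k Hk] : exists k, (L <= j + k)%N by exists L; exact: leq_addl.
  elim: k j z Hk => [|k IH] j z Hk zj bE dE nbd.
    have z0 : z = 0.
      apply/eqP; rewrite -memv0 -uL; move: zj.
      have usm i i' : (i <= i')%N -> (us u i' <= us u i)%VS.
        move=> /subnKC <-; elim: (i' - i)%N => [|k' IHk]; first by rewrite addn0.
        rewrite addnS; apply: subv_trans IHk.
        elim: (i + k')%N => [|j' IHj]; first exact: (us_u gup 1).
        apply: gen_vspace_min => _ [x [w [xu wu ->]]]; apply: us_step => //.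
        exact: (subvP IHj).
      by rewrite addn0 in Hk; exact: (subvP (usm _ _ Hk)).
    by rewrite z0 mulr0 mul0r.
  apply: (@component_zero _ _ X E uE kX b d j.+1%:R) => //.
  - by rewrite !mulrA (spidem_idem uE kX).
  - by rewrite -!mulrA (spidem_idem uE kX).
  - rewrite component_bracket -[X * z - z * X](subrK (j.+1%:R *: z)).
    rewrite mulrDr mulrDl (IH j.+1 (X * z - z * X - j.+1%:R *: z)) ?add0r//.
    + by rewrite -scalerAr -scalerAl.
    + by rewrite addSnnS.
    + exact: HX.
  - by apply/eqP => jbd; apply: (nbd j).
(* The bracket of [X] with [s a] is [- (u' * s a)] with [u'] in [u]. By the previous fact [u'] leads
   from [b] only to eigenvalues smaller by a positive integer, so one inducts on their number. *)
have norm a b d : normalizes s u a -> b \in E -> d \in E -> (forall i : nat, b - d <> i%:R) ->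
    spidem E X b * s a * spidem E X d = 0.
  move=> Na; set u' := Ad s a X - X.
  have u'u : u' \in u by exact: NX.
  have br : X * s a - s a * X = - (u' * s a).
    rewrite /u' mulrBl -!mulmxE /Ad -[_ *m s a^-1%g *m s a]mulmxA.
    have -> : s a^-1%g *m s a = 1 by exact: (sVl lgs).
    by rewrite mulmx1 opprB.
  pose below b' := count (fun f => `[< exists i : nat, b' - f = i.+1%:R >]) E.
  have [k] := ubnP (below b); elim: k b => [//|k IH] b bk bE dE nbd.
  apply: (@component_zero _ _ X E uE kX b d 0) => //.
  - by rewrite !mulrA (spidem_idem uE kX).
  - by rewrite -!mulrA (spidem_idem uE kX).
  - rewrite component_bracket br scale0r mulrN mulNr.
    rewrite (_ : spidem E X b * _ * _ = 0) ?oppr0//.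
    rewrite -[u']mulr1 -(spidem_sum uE kX) mulr_sumr !(mulr_suml, mulr_sumr) big_seq.
    rewrite big1// => f fE.
    have [[i bf]|nbf] := pselect (exists i : nat, b - f = i.+1%:R).
      have -> : spidem E X b * (u' * spidem E X f * s a) * spidem E X d =
          (spidem E X b * u') * (spidem E X f * s a * spidem E X d) by rewrite !mulrA.
      rewrite IH ?mulr0//.
      + apply: leq_trans (_ : below f < below b)%N _; last by rewrite -ltnS.
        have sub : forall h, h \in E -> `[< exists i : nat, f - h = i.+1%:R >] ->
            `[< exists i : nat, b - h = i.+1%:R >].
          move=> h _ /asboolP[i' fh]; apply/asboolP; exists (i + i'.+1)%N.
          have -> : b - h = (b - f) + (f - h) by rewrite addrA subrK.
          by rewrite bf fh -natrD addSn.
        rewrite /below -!size_filter.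
        have uf : uniq (f :: [seq h <- E | `[< exists i : nat, f - h = i.+1%:R >]]).
          rewrite /= filter_uniq// andbT mem_filter negb_and; apply/orP; left.
          apply/asboolP => -[i' /eqP]; rewrite subrr eq_sym; apply/negP.
          by rewrite pnatr_eq0.
        apply: (uniq_leq_size uf) => h; rewrite inE => /predU1P[->|].
          by rewrite mem_filter fE andbT; apply/asboolP; exists i.
        rewrite !mem_filter => /andP[Ph hE]; rewrite hE andbT.
        exact: sub hE Ph.
      + move=> i' fd; apply: (nbd (i.+1 + i')%N).
        have -> : b - d = (b - f) + (f - d) by rewrite addrA subrK.
        by rewrite bf fd -natrD.
    have -> : spidem E X b * (u' * spidem E X f * s a) * spidem E X d =
        (spidem E X b * u' * spidem E X f) * (s a * spidem E X d) by rewrite !mulrA.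
    by rewrite (usz 0%N) ?mul0r// => i bf; apply: nbf; exists i.
  - by apply/eqP => H0; apply: (nbd 0%N); rewrite -H0.
have [[upp pg u0] _ _ _ _] := gup.
pose x := vpick u; have xu : x \in u by exact: memv_pick.
have x0 : x != 0 by rewrite vpick0.
have [b [d [bE dE y0]]] : exists b d, [/\ b \in E, d \in E & spidem E X b * x * spidem E X d != 0].
  apply: contrapT => ny; case/eqP: x0; rewrite (component_sum uE kX x) big_seq big1// => b bE.
  rewrite big_seq big1// => d dE; apply/eqP/negPn/negP => y0; apply: ny.
  by exists b, d.
have [i bd] : exists i : nat, b - d = i.+1%:R.
  apply: contrapT => ni; case/eqP: y0; apply: (usz 0%N) => // i bd; apply: ni.
  by exists i.
set y := spidem E X b * x * spidem E X d in y0.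
have /existsP[kl ykl] : [exists kl : 'I_n.+1 * 'I_n.+1, y kl.1 kl.2 != 0].
  rewrite -negb_forall; apply: contra y0 => /forallP H.
  by apply/eqP/matrixP => a1 a2; rewrite [RHS]mxE; have /eqP := H (a1, a2).
pose phi A : K^o := (spidem E X b * A * spidem E X d) kl.1 kl.2 / y kl.1 kl.2.
have philin : linear phi.
  move=> a A A'; rewrite /phi mulrDr mulrDl -scalerAr -scalerAl !mxE mulrDl.
  by rewrite -mulrA.
pose phil : {linear M -> K^o} := HB.pack phi (GRing.isLinear.Build _ _ _ _ phi philin).
have compE (A : K -> K -> K) B b' d' : b' \in E -> d' \in E ->
    spidem E X b' * (\sum_(b <- E) \sum_(d <- E) A b d *: (spidem E X b * B * spidem E X d))
      * spidem E X d' = A b' d' *: (spidem E X b' * B * spidem E X d').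
  move=> bE' dE'; rewrite mulr_sumr mulr_suml (bigD1_seq b')//= [X in _ + X]big1 ?addr0; last first.
    move=> f fb; rewrite mulr_sumr mulr_suml big1// => h _.
    by rewrite -scalerAr !mulrA (spidem_orth uE kX) ?mul0r ?scaler0 ?mul0r// eq_sym.
  rewrite mulr_sumr mulr_suml (bigD1_seq d')//= [X in _ + X]big1 ?addr0; last first.
    move=> f fd; rewrite -scalerAr -scalerAl -!mulrA (spidem_orth uE kX)// !mulr0.
    by rewrite scaler0.
  by rewrite -scalerAr -scalerAl !mulrA (spidem_idem uE kX) -!mulrA (spidem_idem uE kX).
exists c, phil, x, (D * i.+1)%N; split.
- by apply: (subvP pg); exact: (subvP upp).
- by rewrite muln_gt0 D0.
- move=> t t0; rewrite /= /phi /Ad conjE// compE// (mB b d i.+1)// -/y.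
  by rewrite mxE mulfK.
move=> a Na.
pose Q : 'M[{poly K}]_n.+1 := \matrix_(k, l) \sum_(b <- E) \sum_(d <- E)
  ((spidem E X b * s a * spidem E X d) k l) *: 'X^(absz (m b - m d)).
have QE t : path_eval Q t = \sum_(b <- E) \sum_(d <- E)
    t ^+ absz (m b - m d) *: (spidem E X b * s a * spidem E X d).
  apply/matrixP => k l; rewrite !mxE horner_sum summxE; apply: eq_bigr => b' _.
  rewrite horner_sum summxE; apply: eq_bigr => d' _.
  by rewrite hornerZ hornerXn [RHS]mxE mulrC.
have Qt t : t != 0 -> path_eval Q t = s (c t * a * (c t)^-1)%g.
  move=> t0; rewrite !(lgM lgs) conjE// QE big_seq [RHS]big_seq; apply: eq_bigr => b' bE'.
  rewrite big_seq [RHS]big_seq; apply: eq_bigr => d' dE'.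
  have [[i' bd']|ni] := pselect (exists i : nat, b' - d' = i%:R).
    by rewrite (mB b' d' i').
  by rewrite norm// ?scaler0// => i' bd'; apply: ni; exists i'.
have [b0 Hb0] : exists b0, s b0 = path_eval Q 0.
  apply: (lg_closed lgs) => f [pf vf]; have [F EF] := polyf_path Q pf.
  by rewrite -EF (@poly_punctured F) ?horner0// => t t0; rewrite EF Qt// vf.
exists b0, Q; split=> // t t0.
apply: (lg_inj lgs); rewrite !(lgM lgs) conjE// Hb0 QE big_seq [RHS]big_seq.
apply: eq_bigr => b' bE'; rewrite big_seq [RHS]big_seq; apply: eq_bigr => d' dE'.
rewrite compE// scalerA; have [mm|mm] := eqVneq (m b' - m d') 0.
  by rewrite mm expr0z mul1r.
by rewrite expr0n absz_eq0 (negPf mm) mulr0 scale0r.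
Qed.

End Degeneration.

(** * Limits of conjugates *)

Section LimitTools.
Variables (K : numClosedFieldType) (I : Type) (n : nat) (P : set ((I -> K) * K)).
Local Notation M := 'M[K]_n.+1.
Hypothesis maxP : maximal_graph P.
Let limP : limit_graph P := maxP.1.

Lemma limit_polyf f (xi : I -> M) X : polyf f -> mxlimit P xi X ->
  P (fun i => f (xi i), f X).
Proof.
move=> pf LX; elim: pf => [a|j|g h _ Lg _ Lh|g h _ Lg _ Lh].
- exact: limit_cst.
- exact: LX.
- exact: (limitD limP Lg Lh).
- exact: (limitM limP Lg Lh).
Qed.

Lemma mxlimit_mem (U : {vspace M}) (xi : I -> M) X :
  (forall i, xi i \in U) -> mxlimit P xi X -> X \in U.
Proof.
move=> xiU LX; apply: mem_vspace_form => C HC.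
have pC : polyf (mxform C : M -> K) by apply: alg_mxform; exact: mxalg_id.
apply: (limit_zero limP _ (limit_polyf pC LX)) => i; exact: HC.
Qed.

Lemma mxlimit_trmx p q (xi : I -> 'M[K]_(p, q)) X : mxlimit P xi X ->
  mxlimit P (fun i => (xi i)^T) X^T.
Proof. by move=> LX i j; apply: (limit_ext (LX j i)) => [x|]; rewrite mxE. Qed.

Lemma mxlimit_apply (U : {vspace M}) (h : I -> {linear M -> M}) (xi : I -> M) :
  (forall x, x \in U -> exists y, mxlimit P (fun i => h i x) y) ->
  (forall i, xi i \in U) -> mxlimit P xi 0 -> mxlimit P (fun i => h i (xi i)) 0.
Proof.
move=> hU xiU L0; pose b := vbasis U; pose d : nat := \dim U.
have [y Hy] : exists y : 'I_d -> M, forall j : 'I_d, mxlimit P (fun i => h i b`_j) (y j).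
  suff /choice[f Hf] : forall j : 'I_d, exists y, mxlimit P (fun i => h i b`_j) y by exists f.
  by move=> j; apply: hU; apply: vbasis_mem; rewrite mem_nth// size_tuple.
have Lc (j : 'I_d) : P (fun i => coord b j (xi i), 0).
  have := limit_polyf (polyf_linear (coord b j)) L0.
  by rewrite linear0.
have L : mxlimit P (fun i => \sum_(j < d) coord b j (xi i) *: h i b`_j) (\sum_(j < d) 0 *: y j).
  by apply: (mxlimit_sum maxP) => j; apply: (mxlimitZ maxP) => //; exact: Hy.
rewrite big1 in L => [|j _]; last by rewrite scale0r.
apply: eq_mxlimit L => i; rewrite [in RHS](coord_vbasis (xiU i)) linear_sum.
by apply: eq_bigr => j _; rewrite linearZ.
Qed.

(** If the images of some [x] diverge, dividing [x] by their dominant entry gives elements tending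
    to 0 whose images have a nonzero limit. *)
Lemma finite_or_blowup (U : {vspace M}) (h : I -> {linear M -> M}) :
  (forall x, x \in U -> exists y, mxlimit P (fun i => h i x) y) \/
  exists xi y, [/\ forall i, xi i \in U, mxlimit P xi 0, y != 0 &
    mxlimit P (fun i => h i (xi i)) y].
Proof.
have [|/existsNP[x /not_implyP[xU nx]]] := pselect (forall x, x \in U -> exists y, mxlimit P (fun i => h i x) y).
  by left.
(* The constant 1 is included so that the family has no common zero; were it the pivot, the images
   of [x] would converge. *)
right; pose v (k : option ('I_n.+1 * 'I_n.+1)) i := if k is Some k then h i x k.1 k.2 else 1.
have [|k Pk Hk] := @limit_pivot K I P maxP (option ('I_n.+1 * 'I_n.+1)) v.
  by move=> i; exists None; rewrite oner_eq0.
have [a Ha] := choice Hk.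
have [[b Pb]|P0] := limit_dichotomy maxP (v k).
  case: nx; exists (\matrix_(i, j) (a (Some (i, j)) * b)) => i j; rewrite mxE.
  apply: (limit_ae maxP Pk _ (limitM limP (Ha (Some (i, j))) Pb)) => y /=.
  by have [->|vk] := eqVneq (v k y) 0; rewrite ?mul0r// divfK.
exists (fun i => (v k i)^-1 *: x), (\matrix_(i, j) a (Some (i, j))).
have LY : mxlimit P (fun i => h i ((v k i)^-1 *: x)) (\matrix_(i, j) a (Some (i, j))).
  move=> i j; apply: (limit_ext (Ha (Some (i, j)))) => [y|]; last by rewrite mxE.
  by rewrite linearZ mxE mulrC.
split=> //.
- by move=> i; rewrite memvZ.
- have := mxlimitZ maxP P0 (mxlimit_cst maxP x).
  by rewrite scale0r.
- case: k => [[i j]|] in Pk {Hk} Ha P0 {LY} *; last first.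
    exfalso; have := limit_unique limP P0 (limit_cst limP 1^-1).
    by rewrite invr1 => /esym/eqP; rewrite oner_eq0.
  apply/eqP => /matrixP/(_ i j); rewrite !mxE => a0.
  have := limit_unique limP (Ha (Some (i, j))) Pk; rewrite a0 => /esym/eqP.
  by rewrite oner_eq0.
Qed.

End LimitTools.

Section Degeneration.
Variables (K : numClosedFieldType) (n : nat) (G : groupType).
Local Notation M := 'M[K]_n.+1.
Variables (s : G -> M) (J : M).
Hypotheses (lgs : linear_group s J) (red : reductive_lie s) (cG : zconn s setT).
Local Notation g := (lie s setT).
Let sT : subgroup [set: G]. Proof. by []. Qed.

Let Ad_g a x : x \in g -> Ad s a x \in g.
Proof. by move=> xg; apply: (lie_Ad_sub lgs sT). Qed.

Section HilbertMumford.
Variables (I : Type) (P : set ((I -> K) * K)) (maxP : maximal_graph P).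
Let limP : limit_graph P := maxP.1.
Variables (T : Type) (r z : T -> G) (gm : I -> G).
Hypothesis Lrz : forall k, mxlimit P (fun i => s (gm i * r k * (gm i)^-1)%g) (s (z k)).

(** The limit of the graphs of [Ad (gm i)] on [g]: a linear correspondence that inherits
    compatibility with brackets and traces but need not be a graph. *)
Let W (x y : M) := exists xi : I -> M, [/\ forall i, xi i \in g, mxlimit P xi x &
  mxlimit P (fun i => Ad s (gm i) (xi i)) y].

Let W0 : W 0 0.
Proof.
exists (fun=> 0); split=> [i||]; first exact: mem0v.
  exact: (mxlimit_cst maxP).
by apply: eq_mxlimit (mxlimit_cst maxP 0) => i; rewrite linear0.
Qed.

Let Wlin a x y x' y' : W x y -> W x' y' -> W (a *: x + x') (a *: y + y').
Proof.
move=> [xi [xig Lx Ly]] [xi' [xig' Lx' Ly']].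
exists (fun i => a *: xi i + xi' i); split=> [i||].
- by rewrite memvD ?memvZ.
- by apply: (mxlimitD maxP) => //; apply: (mxlimitZ maxP) => //; exact: (limit_cst limP).
- have L := mxlimitD maxP (mxlimitZ maxP (limit_cst limP a) Ly) Ly'.
  by apply: eq_mxlimit L => i; rewrite linearP.
Qed.

Let W_g x y : W x y -> x \in g /\ y \in g.
Proof.
move=> [xi [xig Lx Ly]]; split; first exact: (mxlimit_mem maxP xig).
by apply: (mxlimit_mem maxP _ Ly) => i; exact: Ad_g.
Qed.

Let W_trace x y x' y' : W x y -> W x' y' -> \tr (x *m x') = \tr (y *m y').
Proof.
move=> [xi [_ Lx Ly]] [xi' [_ Lx' Ly']].
apply: (limit_unique limP (mxlimit_trace maxP (mxlimitM maxP Lx Lx'))).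
apply: (limit_ext (mxlimit_trace maxP (mxlimitM maxP Ly Ly'))) => // i.
by rewrite -(AdM lgs) (Ad_trace lgs).
Qed.

Let W_bracket x y x' y' : W x y -> W x' y' -> W (x *m x' - x' *m x) (y *m y' - y' *m y).
Proof.
move=> [xi [xig Lx Ly]] [xi' [xig' Lx' Ly']].
exists (fun i => xi i *m xi' i - xi' i *m xi i); split=> [i||].
- exact: (lie_bracket lgs sT).
- by apply: (mxlimitB maxP); exact: (mxlimitM maxP).
- have L := mxlimitB maxP (mxlimitM maxP Ly Ly') (mxlimitM maxP Ly' Ly).
  by apply: eq_mxlimit L => i; rewrite linearB /= !(AdM lgs).
Qed.

Let W_nilp x : W x 0 -> x ^+ n.+1 = 0.
Proof.
move=> [xi [_ Lx L0]]; apply: nilp_of_traces => k.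
have Lpow (zeta : I -> M) Z j : mxlimit P zeta Z -> mxlimit P (fun i => zeta i ^+ j) (Z ^+ j).
  move=> LZ; elim: j => [|j IH]; first exact: (mxlimit_cst maxP).
  rewrite exprS; apply: eq_mxlimit (mxlimitM maxP LZ IH) => i; by rewrite exprS.
have Lk := mxlimit_trace maxP (Lpow _ _ k.+1 Lx).
have L0k := mxlimit_trace maxP (Lpow _ _ k.+1 L0).
rewrite expr0n mxtrace0 in L0k.
apply: (limit_unique limP Lk); apply: (limit_ext L0k) => // i.
by rewrite -(Ad_exp lgs) (Ad_trace lgs).
Qed.

Let W_norm k x : W x 0 -> W (Ad s (r k) x) 0.
Proof.
move=> [xi [xig Lx L0]]; exists (fun i => Ad s (r k) (xi i)); split=> [i||].
- exact: Ad_g.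
- apply: (mxlimitM maxP); last exact: (mxlimit_cst maxP).
  by apply: (mxlimitM maxP) => //; exact: (mxlimit_cst maxP).
- have Lz := Lrz k.
  have LzV : mxlimit P (fun i => tau J (s (gm i * r k * (gm i)^-1)%g)) (tau J (s (z k))).
    apply: (mxlimitM maxP); last exact: (mxlimit_cst maxP).
    by apply: (mxlimitM maxP); [exact: (mxlimit_cst maxP)|exact: mxlimit_trmx].
  have := mxlimitM maxP (mxlimitM maxP Lz L0) LzV; rewrite mulmx0 mul0mx.
  apply: eq_mxlimit => i; rewrite -(AdE lgs) -!(Ad_comp lgs); congr (Ad s _ _).
  by rewrite -!mulgA mulVg mulg1.
Qed.

Local Notation D := (n.+1 * n.+1)%N.
Let pr1 : {linear 'rV[K]_(D + D) -> M} := vec_mx \o lsubmx.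
Let pr2 : {linear 'rV[K]_(D + D) -> M} := vec_mx \o rsubmx.
Let gr_fun i (x : M) : 'rV[K]_(D + D) := row_mx (mxvec x) (mxvec (Ad s (gm i) x)).
Let gr_lin i : linear (gr_fun i).
Proof. by move=> a x y; rewrite /gr_fun !linearP /= scale_row_mx add_row_mx. Qed.
Let grl i : {linear M -> 'rV[K]_(D + D)} :=
  HB.pack (gr_fun i) (GRing.isLinear.Build _ _ _ _ (gr_fun i) (gr_lin i)).
Let gr i : {vspace 'rV[K]_(D + D)} := (linfun (grl i) @: g)%VS.

Let gr_dim i : \dim (gr i) = \dim g.
Proof.
apply: limg_dim_eq; apply/eqP; rewrite -subv0; apply/subvP => x.
rewrite memv_cap memv_ker memv0 lfunE /= => /andP[_ /eqP].
rewrite /gr_fun -[RHS]row_mx0 => /eq_row_mx[/(congr1 vec_mx)]; rewrite mxvecK linear0.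
by move=> -> _.
Qed.

Let graph_limit : exists Wv : {vspace 'rV[K]_(D + D)}, (forall v, v \in Wv -> W (pr1 v) (pr2 v)) /\
  (\dim g <= \dim Wv)%N.
Proof.
have [Wv HW] := limit_vspace maxP gr; exists Wv; split.
  move=> v /HW[xi gxi Lxi]; exists (fun i => pr1 (xi i)).
  have L1 : mxlimit P (fun i => pr1 (xi i)) (pr1 v).
    by move=> i j; apply: (limit_ext (Lxi ord0 (lshift D (mxvec_index i j)))) => [x|]; rewrite /= !mxE.
  have L2 : mxlimit P (fun i => pr2 (xi i)) (pr2 v).
    by move=> i j; apply: (limit_ext (Lxi ord0 (rshift D (mxvec_index i j)))) => [x|]; rewrite /= !mxE.
  split=> // [i|].
    have /memv_imgP[x xg ->] := gxi i; by rewrite lfunE /= /gr_fun row_mxKl mxvecK.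
  apply: eq_mxlimit L2 => i; have /memv_imgP[x xg ->] := gxi i.
  by rewrite lfunE /= /gr_fun row_mxKl row_mxKr !mxvecK.
apply: (limit_vspace_dim maxP (U := gr)); last by move=> i; rewrite gr_dim.
by move=> xi X gxi LX; apply/HW; exists xi.
Qed.

Let kernel_dim (U : {vspace 'rV[K]_(D + D)}) (f h : {linear 'rV[K]_(D + D) -> M}) (A B : {vspace M}) :
  (forall v, v \in U -> f v \in A) -> (forall v, v \in U -> f v = 0 -> h v \in B) ->
  (forall v, f v = 0 -> h v = 0 -> v = 0) -> (\dim U <= \dim A + \dim B)%N.
Proof.
move=> fA hB inj; rewrite -(limg_ker_dim (linfun f) U) addnC; apply: leq_add.
  by apply/dimvS/subvP => _ /memv_imgP[v vU ->]; rewrite lfunE; exact: fA.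
have inj' : ((U :&: lker (linfun f)) :&: lker (linfun h) = 0)%VS.
  apply/eqP; rewrite -subv0; apply/subvP => v; rewrite !memv_cap !memv_ker !lfunE memv0.
  by move=> /andP[/andP[_ /eqP fv] /eqP hv]; apply/eqP; exact: inj.
rewrite -(limg_dim_eq inj'); apply/dimvS/subvP => _ /memv_imgP[v + ->].
by rewrite memv_cap memv_ker !lfunE => /andP[vU /eqP]; exact: hB.
Qed.

(** For the correspondence [W], these are the kernel [u], the domain [p], the indeterminacy [u'] and
    the image [p']. *)
Let graph_limit_dims : exists u p u' p' : {vspace M},
  [/\ forall x, x \in u <-> W x 0, forall x, x \in p <-> exists y, W x y,
      forall y, y \in u' <-> W 0 y, forall y, y \in p' <-> exists x, W x y &
      (\dim g <= \dim p + \dim u')%N /\ (\dim g <= \dim p' + \dim u)%N].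
Proof.
have [u Hu] : exists u : {vspace M}, forall x, x \in u <-> W x 0.
  apply: set_vspace => // a x y Wx Wy.
  by have := Wlin a Wx Wy; rewrite scaler0 addr0.
have [u' Hu'] : exists u : {vspace M}, forall x, x \in u <-> W 0 x.
  apply: set_vspace => // a x y Wx Wy.
  by have := Wlin a Wx Wy; rewrite scaler0 addr0.
have [p Hp] : exists u : {vspace M}, forall x, x \in u <-> exists y, W x y.
  apply: (@set_vspace _ _ (fun x => exists y, W x y)) => [|a x y [x' Wx] [y' Wy]].
    by exists 0.
  by exists (a *: x' + y'); exact: Wlin.
have [p' Hp'] : exists u : {vspace M}, forall y, y \in u <-> exists x, W x y.
  apply: (@set_vspace _ _ (fun y => exists x, W x y)) => [|a x y [x' Wx] [y' Wy]].
    by exists 0.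
  by exists (a *: x' + y'); exact: Wlin.
have [Wv [HW dW]] := graph_limit.
have inj v : pr1 v = 0 -> pr2 v = 0 -> v = 0.
  move=> /= v1 v2; rewrite -[v]hsubmxK -[lsubmx v]vec_mxK v1 -[rsubmx v]vec_mxK v2.
  by rewrite !linear0 row_mx0.
exists u, p, u', p'; split=> //; split; apply: leq_trans dW _.
- apply: (kernel_dim (f := pr1) (h := pr2)) => // v /HW Wv'; first by apply/Hp; exists (pr2 v).
  by move=> v0; apply/Hu'; rewrite -v0.
- apply: (kernel_dim (f := pr2) (h := pr1)) => [v /HW Wv'|v /HW Wv' v0|v v2 v1].
  + by apply/Hp'; exists (pr1 v).
  + by apply/Hu; rewrite -v0.
  + exact: inj.
Qed.

(** Since [u'] and [p'] are orthogonal, their dimensions add up to at most that of [g]; with the two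
    bounds on the graph, [u] and [p] form a good pair unless [u = 0]. Then also [u' = 0], and a
    blow-up of [Ad (gm i)] or of its inverse would give a nonzero element of [u'] or [u]. *)
Lemma conjugators_finite : ~ bad s (range r) -> forall x, x \in g ->
  (exists y, mxlimit P (fun i => Ad s (gm i) x) y) /\
  (exists y, mxlimit P (fun i => Ad s (gm i)^-1%g x) y).
Proof.
move=> nbad; have [u [p [u' [p' [Hu Hp Hu' Hp' [d1 d2]]]]]] := graph_limit_dims.
have u'g : (u' <= g)%VS by apply/subvP => y /Hu' /W_g[].
have dp' : (\dim u' + \dim p' <= \dim g)%N.
  apply: leq_trans (_ : \dim u' + \dim (perp s u') <= _)%N; last by rewrite addnC (perp_dim lgs red u'g).
  rewrite leq_add2l; apply/dimvS/subvP => y /Hp'[x Wxy].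
  apply/perpP; split=> [|w /Hu' Wz]; first by case/W_g: Wxy.
  by rewrite -(W_trace Wxy Wz) mulmx0 mxtrace0.
have u0 : u = 0%VS.
  apply: contrapT => /eqP un0; apply: nbad; exists u, p; split.
    split.
    - split=> //; first by apply/subvP => x /Hu Wx; apply/Hp; exists 0.
      by apply/subvP => x /Hp[y /W_g[]].
    - by move=> x y /Hu Wx /Hp[w Wy]; rewrite (W_trace Wx Wy) mul0mx mxtrace0.
    - by move: d1 d2 dp'; set d := \dim g; lia.
    - move=> y x /Hp[w Wy] /Hu Wx; apply/Hu.
      by have := W_bracket Wy Wx; rewrite mulmx0 mul0mx subr0.
    - by move=> x /Hu/W_nilp.
  by move=> _ [k _ <-] x /Hu Wx; apply/Hu; exact: W_norm.
have u'0 : u' = 0%VS.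
  by apply/eqP; rewrite -dimv_eq0; move: d1 d2 dp'; rewrite u0 dimv0; set d := \dim g; lia.
pose h1 i : {linear M -> M} := Ad s (gm i); pose h2 i : {linear M -> M} := Ad s (gm i)^-1%g.
move=> x xg; split.
  have [/(_ x xg)//|[xi [y [xig L0 y0 Ly]]]] := finite_or_blowup maxP g h1.
  case/eqP: y0; apply/eqP; rewrite -memv0 -u'0; apply/Hu'; by exists xi.
have [/(_ x xg)//|[xi [y [xig L0 y0 Ly]]]] := finite_or_blowup maxP g h2.
case/eqP: y0; apply/eqP; rewrite -memv0 -u0; apply/Hu.
exists (fun i => Ad s (gm i)^-1%g (xi i)); split=> // [i|]; first exact: Ad_g.
by apply: eq_mxlimit L0 => i; rewrite (AdVK lgs).
Qed.

(** The matrices on which both families converge form a subspace containing 1 and stable under left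
    multiplication by [g]; Taylor's principle puts all of [s a] in it. *)
Lemma conjugators_finite_group : ~ bad s (range r) -> forall a : G,
  (exists y, mxlimit P (fun i => Ad s (gm i) (s a)) y) /\
  (exists y, mxlimit P (fun i => Ad s (gm i)^-1%g (s a)) y).
Proof.
move=> nbad a.
have [U HU] : exists U : {vspace M}, forall x, x \in U <->
  (exists y, mxlimit P (fun i => Ad s (gm i) x) y) /\
  (exists y, mxlimit P (fun i => Ad s (gm i)^-1%g x) y).
  apply: (@set_vspace _ _ (fun x => (exists y, mxlimit P (fun i => Ad s (gm i) x) y) /\
      (exists y, mxlimit P (fun i => Ad s (gm i)^-1%g x) y))).
    by split; exists 0; apply: eq_mxlimit (mxlimit_cst maxP 0) => i; rewrite linear0.
  move=> b x x' [[y Ly] [w Lz]] [[y' Ly'] [w' Lz']]; split.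
    exists (b *: y + y').
    have L := mxlimitD maxP (mxlimitZ maxP (limit_cst limP b) Ly) Ly'.
    by apply: eq_mxlimit L => i; rewrite linearP.
  exists (b *: w + w').
  have L := mxlimitD maxP (mxlimitZ maxP (limit_cst limP b) Lz) Lz'.
  by apply: eq_mxlimit L => i; rewrite linearP.
have UM x b : x \in g -> b \in U -> x *m b \in U.
  move=> /(conjugators_finite nbad)[[y Ly] [w Lz]] /HU[[y' Ly'] [w' Lz']]; apply/HU; split.
    by exists (y *m y'); apply: eq_mxlimit (mxlimitM maxP Ly Ly') => i; rewrite (AdM lgs).
  by exists (w *m w'); apply: eq_mxlimit (mxlimitM maxP Lz Lz') => i; rewrite (AdM lgs).
have U1 : 1 \in U.
  have AdU b : Ad s b (1 : M) = 1%:M by rewrite /Ad mulmx1 -(lgM lgs) mulgV (lg1 lgs).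
  by apply/HU; split; exists 1%:M; apply: eq_mxlimit (mxlimit_cst maxP _) => i; rewrite AdU.
apply/HU; apply: mem_vspace_form => C HC.
pose F := [set f : M -> K | exists2 b, b \in U & f = fun A => mxform C (A *m b)].
have := @taylor_family _ _ _ s J lgs setT sT cG F (fun A => mxform C (A *m 1%:M)).
move=> /(_ _ _ _ _ a Logic.I); rewrite mulmx1; apply.
- move=> _ [b _ ->]; apply: alg_mxform; apply: mxalgM; [exact: mxalg_id|exact: mxalg_cst].
- move=> _ x [b bU ->] xg; exists (x *m b); first exact: UM.
  apply/funext => A; rewrite /der mulmxA; apply: (lder_quadratic (c := 0)) => t.
  by rewrite mulmxDl mxformD -scalemxAl mxformZ mulr0 addr0.
- by move=> _ [b bU ->]; rewrite mul1mx; exact: HC.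
- by exists 1%:M.
Qed.

(** The difference between [s (z k)] and the conjugates tends to 0, and the inverse conjugations are
    finite on the span of the group, so they preserve this limit. *)
Lemma conjugators_inverse : ~ bad s (range r) -> forall k,
  mxlimit P (fun i => s ((gm i)^-1 * z k * gm i)%g) (s (r k)).
Proof.
move=> nbad k; pose U : {vspace M} := gen_vspace (range s).
have HU x : x \in U -> exists y, mxlimit P (fun i => Ad s (gm i)^-1%g x) y.
  move: x; apply: gen_vspace_ind.
  - by exists 0; apply: eq_mxlimit (mxlimit_cst maxP 0) => i; rewrite linear0.
  - move=> b x x' [y Ly] [y' Ly']; exists (b *: y + y').
    have L := mxlimitD maxP (mxlimitZ maxP (limit_cst limP b) Ly) Ly'.
    by apply: eq_mxlimit L => i; rewrite linearP.
  - by move=> _ [a _ <-]; have [] := conjugators_finite_group nbad a.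
have sU a : s a \in U by apply: gen_vspace_sub; exists a.
have L0 : mxlimit P (fun i => s (z k) - s (gm i * r k * (gm i)^-1)%g) 0.
  have := mxlimitB maxP (mxlimit_cst maxP (s (z k))) (Lrz k).
  by rewrite subrr.
have := @mxlimit_apply _ _ _ _ maxP U (fun i => Ad s (gm i)^-1%g) _ HU _ L0.
move=> /(_ (fun i => memvB (sU _) (sU _))) L.
have := mxlimitD maxP (mxlimit_cst maxP (s (r k))) L; rewrite addr0.
apply: eq_mxlimit => i; rewrite linearB /= /Ad -!(lgM lgs) !mulgA invgK mulVg mul1g.
by rewrite -!mulgA mulVg mulg1 addrC subrK !mulgA.
Qed.

End HilbertMumford.
End Degeneration.

(** * Tuples of group elements *)

Lemma finite_set_family (K X : Type) (S : set X) (I : eqType) (v : I -> X -> K) (l : seq I) :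
  (forall i, i \in l -> finite_set (v i @` S)) ->
  finite_set ((fun x => [seq v i x | i <- l]) @` S).
Proof.
elim: l => [|i l IH] H.
  by apply: (sub_finite_set (B := [set [::]])) => [_ [x _ <-]//|]; exact: finite_set1.
have F1 : finite_set (v i @` S) by apply: H; rewrite inE eqxx.
have F2 : finite_set ((fun x => [seq v j x | j <- l]) @` S).
    by apply: IH => j jl; apply: H; rewrite inE jl orbT.
apply: sub_finite_set (finite_image2 cons F1 F2) => _ [x Sx <-].
by exists (v i x); [exists x|exists [seq v j x | j <- l] => //; exists x].
Qed.

Section Tuples.
Variables (K : numClosedFieldType) (n : nat) (G : groupType) (T : finType).
Local Notation M := 'M[K]_n.+1.
Variables (s : G -> M) (J : M).
Hypotheses (lgs : linear_group s J) (red : reductive_lie s) (cG : zconn s setT).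
Local Notation g := (lie s setT).
Let sT : subgroup [set: G]. Proof. by []. Qed.
Implicit Types (r z : T -> G) (A : set (T -> G)).

Definition tentry (k : T * ('I_n.+1 * 'I_n.+1)) r : K := s (r k.1) k.2.1 k.2.2.

Definition tpoly : ((T -> G) -> K) -> Prop := alg tentry.

Definition tconj (a : G) r : T -> G := fun k => (a * r k * a^-1)%g.

Definition tclosure A : set (T -> G) := [set z | forall f, tpoly f ->
  (forall r, A r -> f r = 0) -> f z = 0].

Lemma tpoly_conj a f : tpoly f -> tpoly (fun r => f (tconj a r)).
Proof.
apply: alg_comp => k.
have H : mxalg tentry (fun r => s a *m s (r k.1) *m s a^-1%g).
  apply: mxalgM; last exact: mxalg_cst.
  by apply: mxalgM; [exact: mxalg_cst|move=> i j; exact: (alg_gen tentry (k.1, (i, j)))].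
apply: alg_ext (H k.2.1 k.2.2) _ => r.
by rewrite /tentry /tconj !(lgM lgs).
Qed.

Lemma tpoly_limit (I : Type) (P : set ((I -> K) * K)) (rho : I -> T -> G) z f :
  limit_graph P -> (forall k, mxlimit P (fun i => s (rho i k)) (s (z k))) -> tpoly f ->
  P (fun i => f (rho i), f z).
Proof.
move=> limP L; elim=> [a|j|p q _ Lp _ Lq|p q _ Lp _ Lq].
- exact: limit_cst.
- exact: L.
- exact: (limitD limP Lp Lq).
- exact: (limitM limP Lp Lq).
Qed.

(** Evaluation at [z] is well defined on the restrictions to [A] of polynomial functions, exactly
    because [z] lies in the closure; a maximal extension is a place centred at [z]. *)
Lemma tclosure_limit A z : tclosure A z -> exists (P : set (({r | A r} -> K) * K)),
  maximal_graph P /\ forall k, mxlimit P (fun i => s (proj1_sig i k)) (s (z k)).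
Proof.
move=> Az; pose P0 : set (({r | A r} -> K) * K) := [set w |
  exists f, [/\ tpoly f, w.1 = fun i => f (proj1_sig i) & w.2 = f z]].
have [|P maxP P0P] := @maximal_graph_exists _ _ P0.
  split=> [a|u v a b [f [pf /= -> ->]] [h [ph /= -> ->]]|u v a b [f [pf /= -> ->]] [h [ph /= -> ->]]|a].
  - by exists (fun=> a); split=> //; exact: alg_cst.
  - by exists (fun r => f r + h r); split=> //; exact: alg_add.
  - by exists (fun r => f r * h r); split=> //; exact: alg_mul.
  - move=> [f [pf /= E ->]]; apply: Az => // r Ar.
    by have := congr1 (fun u => u (exist _ r Ar)) E.
exists P; split=> // k i j; apply: P0P; exists (tentry (k, (i, j))).
by split=> //; exact: alg_gen.
Qed.

Lemma tpoly_orbit r z : ~ bad s (range r) -> tclosure (range (tconj^~ r)) z ->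
  forall f, tpoly f -> (forall a, f (tconj a r) = 0) <-> (forall a, f (tconj a z) = 0).
Proof.
move=> nbad Oz f pf; split=> [H a|H a].
  apply: (Oz (fun t => f (tconj a t))) => [|_ [b _ <-]]; first exact: tpoly_conj.
  rewrite (_ : tconj a (tconj b r) = tconj (a * b)%g r) ?H//.
  by apply/funext => k; rewrite /tconj invgM !mulgA.
have [P [maxP L]] := tclosure_limit Oz.
have [gm Hgm] : exists gm : {t | range (tconj^~ r) t} -> G, forall i, tconj (gm i) r = proj1_sig i.
  suff /choice[h Hh] : forall i : {t | range (tconj^~ r) t}, exists a, tconj a r = proj1_sig i by exists h.
  by move=> [t Ht]; have [b _ bt] := Ht; exists b.
have L' k : mxlimit P (fun i => s (gm i * r k * (gm i)^-1)%g) (s (z k)).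
  by apply: eq_mxlimit (L k) => i; rewrite -Hgm.
have L2 := conjugators_inverse lgs red cG maxP L' nbad.
have L3 k : mxlimit P (fun i => s (tconj (gm i)^-1%g z k)) (s (r k)).
  by apply: eq_mxlimit (L2 k) => i; rewrite /tconj invgK.
have pfa := tpoly_conj a pf.
apply: (limit_zero maxP.1 _ (tpoly_limit maxP.1 L3 pfa)) => i.
rewrite (_ : tconj a _ = tconj (a * (gm i)^-1)%g z) ?H//.
by apply/funext => k; rewrite /tconj !invgM invgK !mulgA.
Qed.

Lemma tstabilizer_finite r : ~ bad s (range r) ->
  exists Phi : G -> seq K, finite_set (Phi @` [set a | tconj a r = r]) /\
    forall x y, Phi x = Phi y -> center G (x^-1 * y)%g.
Proof.
move=> nbad; pose b := vbasis g.
pose v (k : 'I_(\dim g) * ('I_n.+1 * 'I_n.+1)) x := Ad s x b`_k.1 k.2.1 k.2.2.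
exists (fun x => [seq v k x | k <- enum [set: 'I_(\dim g) * ('I_n.+1 * 'I_n.+1)]%SET]); split.
  apply: finite_set_family => k _; apply: contrapT => inf.
  pose S := [set a | tconj a r = r /\ v k a != 0].
  have infS : ~ finite_set ((fun x => (v k x)^-1) @` S).
    move=> F; apply: inf; apply: (sub_finite_set (B := [set 0] `|` (fun a => a^-1) @` ((fun x => (v k x)^-1) @` S))).
      move=> _ [x xr <-]; have [v0|v0] := eqVneq (v k x) 0; first by left.
      by right; exists (v k x)^-1; [exists x|rewrite invrK].
    by rewrite finite_setU; split; [exact: finite_set1|exact: finite_image].
  pose w (i : {a | S a}) := (v k (proj1_sig i))^-1.
  (* The inverse entry [w] takes infinitely many values, so a polynomial in [w] determines its
     coefficients and sending [w] to 0 is well defined. *)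
  pose P0 : set (({a | S a} -> K) * K) := [set z | exists q : {poly K}, z.1 = (fun i => q.[w i]) /\ z.2 = q.[0]].
  have [|P maxP P0P] := @maximal_graph_exists _ _ P0.
    split=> [a|u u' a a' [q [/= -> ->]] [q' [/= -> ->]]|u u' a a' [q [/= -> ->]] [q' [/= -> ->]]|a].
    - by exists a%:P; split; [apply/funext => i /=|]; rewrite hornerC.
    - by exists (q + q'); split; [apply/funext => i /=|]; rewrite hornerD.
    - by exists (q * q'); split; [apply/funext => i /=|]; rewrite hornerM.
    - move=> [q [/= E ->]]; have [->|q0] := eqVneq q 0; first by rewrite horner0.
    exfalso; apply: infS.
      have [rs qE] := closed_field_poly_normal q.
      apply: (sub_finite_set (B := [set` rs])); last exact: finite_seq.
      move=> _ [x Sx <-] /=; rewrite -root_prod_XsubC -(rootZ _ _ (_ : lead_coef q != 0)) ?lead_coef_eq0//.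
      by rewrite -qE; apply/rootP; have := congr1 (fun u => u (exist _ x Sx)) E.
  have limP := maxP.1.
  have Pw : P (w, 0).
    by apply: P0P; exists 'X; split; [apply/funext => i /=|]; rewrite hornerX.
  have L k' : mxlimit P (fun i : {a | S a} => s (proj1_sig i * r k' * (proj1_sig i)^-1)%g) (s (r k')).
    apply: eq_mxlimit (mxlimit_cst maxP _) => -[a [ar va]] /=.
    by have := congr1 (fun t => t k') ar; rewrite /tconj => ->.
  have bg : b`_k.1 \in g by apply: vbasis_mem; rewrite mem_nth// size_tuple.
  have [[y Ly] _] := conjugators_finite lgs red maxP L nbad bg.
  have /(limit_unique limP (limit_cst limP 1)) : P (fun=> 1, 0 * y k.2.1 k.2.2).
    apply: (limit_ext (limitM limP Pw (Ly k.2.1 k.2.2))) => // -[a [ar va]] /=.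
    by rewrite /w /= mulVf.
  by rewrite mul0r => /eqP; rewrite oner_eq0.
move=> x y /eq_in_map Exy.
have E X : X \in g -> Ad s x X = Ad s y X.
  move=> Xg; rewrite (coord_vbasis Xg) !linear_sum; apply: eq_bigr => j _.
  rewrite !linearZ; congr (_ *: _); apply/matrixP => i i'.
  by apply: (Exy (j, (i, i'))); rewrite mem_enum inE.
have C X : X \in g -> s (x^-1 * y)%g *m X = X *m s (x^-1 * y)%g.
  move=> Xg; have A : Ad s (x^-1 * y)%g X = X by rewrite (Ad_comp lgs) -(E X Xg) (AdK lgs).
  by rewrite -{2}A /Ad -(mulmxA _ (s _^-1%g)) (sVl lgs) mulmx1.
have Cs := lie_commutes lgs sT cG C.
by move=> a; apply: (lg_inj lgs); rewrite (lgM lgs _ a) (lgM lgs a) Cs.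
Qed.

(** With the dimension of [u] fixed, the lower bounds on the dimensions of [u] and [p] both pass to
    the limit and still add up to that of [g]. *)
Let bad_dim d : set (T -> G) := [set r | exists u p, [/\ good s u p, \dim u = d & forall k, normalizes s u (r k)]].

Lemma bad_dim_closed d z : tclosure (bad_dim d) z -> bad s (range z).
Proof.
move=> Bz; have [P [maxP L]] := tclosure_limit Bz; have limP := maxP.1.
have [up Hup] : exists up : {r | bad_dim d r} -> {vspace M} * {vspace M}, forall i,
    [/\ good s (up i).1 (up i).2, \dim (up i).1 = d & forall k, normalizes s (up i).1 (proj1_sig i k)].
  suff /choice[h Hh] : forall i : {r | bad_dim d r}, exists w : {vspace M} * {vspace M},
      [/\ good s w.1 w.2, \dim w.1 = d & forall k, normalizes s w.1 (proj1_sig i k)] by exists h.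
  by move=> [r [u [p H]]]; exists (u, p).
have [u Hu] := limit_vspace maxP (fun i => (up i).1).
have [p Hp] := limit_vspace maxP (fun i => (up i).2).
have du : (d <= \dim u)%N.
  apply: (limit_vspace_dim maxP (U := fun i => (up i).1)) => [xi X Uxi LX|i].
    by apply/Hu; exists xi.
  by have [_ -> _] := Hup i.
have dp : (\dim g - d <= \dim p)%N.
  apply: (limit_vspace_dim maxP (U := fun i => (up i).2)) => [xi X Uxi LX|i].
    by apply/Hp; exists xi.
  by have [[_ _ dg _ _] ud _] := Hup i; rewrite leq_subLR -ud.
have [[r0 Br0]|nI] := pselect (exists r, bad_dim d r); last first.
  exfalso; case/eqP: (oner_neq0 K).
  apply: (limit_zero limP _ (limit_cst limP 1)) => -[r Br].
  by exfalso; apply: nI; exists r.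
have d0 : (0 < d)%N.
  by have [u' [p' [[[_ _ u'0] _ _ _ _] <- _]]] := Br0; rewrite lt0n dimv_eq0.
exists u, p; split; last first.
  move=> _ [k _ <-] x /Hu[xi uxi Lxi]; apply/Hu.
  exists (fun i => Ad s (proj1_sig i k) (xi i)) => [i|]; first by have [_ _ H] := Hup i; apply: H.
  have Lt : mxlimit P (fun i : {r | bad_dim d r} => tau J (s (proj1_sig i k))) (tau J (s (z k))).
    apply: (mxlimitM maxP); last exact: (mxlimit_cst maxP).
    by apply: (mxlimitM maxP); [exact: (mxlimit_cst maxP)|exact: mxlimit_trmx].
  have := mxlimitM maxP (mxlimitM maxP (L k) Lxi) Lt.
  by rewrite -(AdE lgs); apply: eq_mxlimit => i; rewrite -(AdE lgs).
split; [split| | | |].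
- apply/subvP => x /Hu[xi uxi Lxi]; apply/Hp; exists xi => // i.
  by have [[[up' _ _] _ _ _ _] _ _] := Hup i; exact: (subvP up').
- apply/subvP => x /Hp[xi pxi Lxi]; apply: (mxlimit_mem maxP _ Lxi) => i.
  by have [[[_ pg _] _ _ _ _] _ _] := Hup i; exact: (subvP pg).
- by rewrite -dimv_eq0 -lt0n (leq_trans d0).
- move=> x y /Hu[xi uxi Lx] /Hp[zi pzi Ly].
  apply: (limit_zero limP _ (mxlimit_trace maxP (mxlimitM maxP Lx Ly))) => i.
  by have [[_ H _ _ _] _ _] := Hup i; exact: H.
- by rewrite -leq_subLR (leq_trans _ dp)// leq_sub2l.
- move=> y x /Hp[zi pzi Ly] /Hu[xi uxi Lx]; apply/Hu.
  exists (fun i => zi i *m xi i - xi i *m zi i) => [i|].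
    by have [[_ _ _ H _] _ _] := Hup i; exact: H.
  by apply: (mxlimitB maxP); exact: (mxlimitM maxP).
- move=> x /Hu[xi uxi Lx].
  have Lpow j : mxlimit P (fun i => xi i ^+ j) (x ^+ j).
    elim: j => [|j IH]; first exact: (mxlimit_cst maxP).
    rewrite exprS; apply: eq_mxlimit (mxlimitM maxP Lx IH) => i; by rewrite exprS.
  apply: (mxlimit_unique maxP (Lpow n.+1)); apply: eq_mxlimit (mxlimit_cst maxP 0) => i.
  by have [[_ _ _ _ H] _ _] := Hup i; rewrite H.
Qed.

Lemma bad_closed z : tclosure [set r | bad s (range r)] z -> bad s (range z).
Proof.
move=> Bz; apply: contrapT => nbad.
pose N := (\dim {:M}).+1.
have /choice[f Hf] d : exists f, tpoly f /\ (forall r, bad_dim d r -> f r = 0) /\ f z <> 0.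
  apply: contrapT => nf; apply/nbad/(@bad_dim_closed d) => f pf Hf.
  by apply: contrapT => fz; apply: nf; exists f.
have /eqP : \prod_(d < N) f d z = 0.
  apply: (Bz (fun r => \prod_(d < N) f d r)) => [|r [u [p [gup Hr]]]].
    by apply: alg_prod => d _; have [] := Hf d.
  have dN : (\dim u < N)%N by rewrite ltnS dimvS// subvf.
  rewrite (bigD1 (Ordinal dN))//=.
  have [_ [Hu _]] := Hf (\dim u); rewrite Hu ?mul0r//.
  by exists u, p; split=> // k; apply: Hr; exists k.
by rewrite prodf_seq_eq0 => /hasP[d _ /= /eqP]; have [_ [_]] := Hf d.
Qed.

End Tuples.

(** * Generic specializations *)

Section FiniteExtension.
Variables (K : numClosedFieldType) (X : Type).

Definition coordf (J : Type) (j : J) (v : J -> K) : K := v j.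

(** The point [y] lies in the closure of the image of [X] under the functions [w j]. *)
Definition consistent (J : Type) (w : J -> X -> K) (y : J -> K) := forall F,
  alg (@coordf J) F -> (forall g, F (fun j => w j g) = 0) -> F y = 0.

Lemma alg_option (J : Type) F : alg (@coordf (option J)) F ->
  exists d (c : nat -> (J -> K) -> K), (forall i, alg (@coordf J) (c i)) /\
    forall v, F v = \sum_(i < d) c i (fun j => v (Some j)) * v None ^+ i.
Proof.
suff H : alg (@coordf (option J)) F -> exists d (Q : (J -> K) -> {poly K}),
    [/\ forall v, (size (Q v) <= d)%N, forall i, alg (@coordf J) (fun v => (Q v)`_i) &
      forall v, F v = (Q (fun j => v (Some j))).[v None]].
  move=> /H[d [Q [sQ aQ FQ]]]; exists d, (fun i v => (Q v)`_i); split=> // v.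
  by rewrite FQ (@horner_coef_wide _ d).
have cst a i : alg (@coordf J) (fun=> (a%:P)`_i) by exact: alg_cst.
elim=> [a|[j|]|p q _ [d [P [sP aP pP]]] _ [e [Q [sQ aQ qQ]]]|p q _ [d [P [sP aP pP]]] _ [e [Q [sQ aQ qQ]]]].
- by exists 1%N, (fun=> a%:P); split=> // v; rewrite ?size_polyC_leq1 ?hornerC.
- exists 1%N, (fun v => (v j)%:P); split=> [v|[|i]|v]; rewrite ?size_polyC_leq1 ?hornerC//.
    by apply: alg_ext (alg_gen (@coordf J) j) _ => v; rewrite coefC.
  by apply: alg_ext (alg_cst (@coordf J) 0) _ => v; rewrite coefC.
- exists 2%N, (fun=> 'X); split=> [v|i|v]; rewrite ?size_polyX ?hornerX//.
  exact: (alg_cst (@coordf J) ('X`_i)).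
- exists (maxn d e), (fun v => P v + Q v); split=> [v|i|v].
  + by rewrite (leq_trans (size_polyD _ _))// geq_max !leq_max sP sQ orbT.
  + by apply: alg_ext (alg_add (aP i) (aQ i)) _ => v; rewrite coefD.
  + by rewrite hornerD pP qQ.
- exists (d + e)%N, (fun v => P v * Q v); split=> [v|i|v].
  + rewrite (leq_trans (size_polyMleq _ _))// (leq_trans (leq_pred _))//.
    by rewrite leq_add.
  + have S (j : 'I_i.+1) : true -> alg (@coordf J) (fun v => (P v)`_j * (Q v)`_(i - j)).
      by move=> _; exact: alg_mul (aP j) (aQ _).
    by apply: alg_ext (alg_sum (index_enum _) S) _ => v; rewrite coefM.
  + by rewrite hornerM pP qQ.
Qed.

(** If the inverse of [x] tended to 0 on the part where the place lives, the relation divided by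
    [x ^+ d] would tend to the nonzero [b d]. *)
Lemma integral_finite (P : set ((X -> K) * K)) d (a : nat -> X -> K) (b : nat -> K) (x : X -> K) :
  maximal_graph P -> (forall i, P (a i, b i)) -> b d != 0 ->
  (forall g, \sum_(i < d.+1) a i g * x g ^+ i = 0) -> exists y, P (x, y).
Proof.
move=> maxP Pa bd rel; have limP := maxP.1.
have [//|P0] := limit_dichotomy maxP x.
have [Pe|Pe] := limit_idem maxP (indicator_inv x).
  exists 0; apply: (limit_null maxP _ Pe) => g.
  by have [->|xg] := eqVneq (x g) 0; rewrite ?mul0r// divff// mulr1.
have H (i : 'I_d.+1) : true -> P (fun g => a i g * (x g)^-1 ^+ (d - i) * (x g / x g), b i * 0 ^+ (d - i) * 1).
  by move=> _; exact: (limitM limP (limitM limP (Pa i) (limitX limP _ P0)) Pe).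
have := limit_sum limP (index_enum _) H.
rewrite big_ord_recr /= subnn expr0 !mulr1 big1 => [|i _]; last first.
  by rewrite expr0n subn_eq0 leqNgt ltn_ord /= mulr0 mul0r.
rewrite add0r => /(limit_zero limP) Z; case/eqP: bd; apply: Z => g.
have [->|xg] := eqVneq (x g) 0; first by rewrite big1// => i _; rewrite !mul0r mulr0.
transitivity ((x g)^-1 ^+ d * \sum_(i < d.+1) a i g * x g ^+ i); last by rewrite rel mulr0.
rewrite mulr_sumr; apply: eq_bigr => i _.
rewrite divff// mulr1 mulrCA; congr (_ * _).
have E : (d = d - i + i)%N by rewrite subnK// -ltnS.
by rewrite [(x g)^-1 ^+ d](congr1 (GRing.exp (x g)^-1) E) exprD -mulrA -exprMn mulVf// expr1n mulr1.
Qed.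

(** [Pr] plays the role of the regular functions on an irreducible variety: stable under polynomial
    expressions and free of zero divisors. *)
Variable Pr : set (X -> K).
Hypothesis Pr_alg : forall (J : Type) (w : J -> X -> K) F, (forall j, Pr (w j)) ->
  alg (@coordf J) F -> Pr (fun g => F (fun j => w j g)).
Hypothesis Pr_prime : forall f h, Pr f -> Pr h -> (forall g, f g * h g = 0) ->
  (forall g, f g = 0) \/ (forall g, h g = 0).

Variable x0 : X.

Lemma graph_alg (J : Type) (w : J -> X -> K) y F (P : set ((X -> K) * K)) : limit_graph P ->
  (forall j, P (w j, y j)) -> alg (@coordf J) F -> P (fun g => F (fun j => w j g), F y).
Proof.
move=> limP Pw; elim=> [a|j|p q _ Lp _ Lq|p q _ Lp _ Lq].
- exact: limit_cst.
- exact: Pw.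
- exact: (limitD limP Lp Lq).
- exact: (limitM limP Lp Lq).
Qed.

(* A variant of the extension theorem for specializations: the functions of [l]
   are added one at a time. A transcendental one may be given any value, and an
   algebraic one stays finite once its leading coefficient does not vanish. *)
Lemma generic_extension (l : seq (X -> K)) (J : Type) (w : J -> X -> K) :
  (forall j, Pr (w j)) -> (forall x, List.In x l -> Pr x) ->
  exists h, [/\ alg (@coordf J) h, exists g, h (fun j => w j g) <> 0 &
    forall y, consistent w y -> h y <> 0 -> exists P, [/\ maximal_graph P,
      forall j, P (w j, y j) & forall x, List.In x l -> exists a, P (x, a)]].
Proof.
elim: l J w => [|x l IH] J w Pw Pl.
  exists (fun=> 1); split; [exact: alg_cst|by exists x0; apply/eqP; rewrite oner_eq0|].
  move=> y cy _; pose P0 : set ((X -> K) * K) :=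
    [set z | exists F, [/\ alg (@coordf J) F, z.1 = fun g => F (fun j => w j g) & z.2 = F y]].
  have [|P maxP P0P] := @maximal_graph_exists _ _ P0.
    split=> [a|u v a b [f [pf /= -> ->]] [h [ph /= -> ->]]|u v a b [f [pf /= -> ->]] [h [ph /= -> ->]]|a].
    - by exists (fun=> a); split=> //; exact: alg_cst.
    - by exists (fun r => f r + h r); split=> //; exact: alg_add.
    - by exists (fun r => f r * h r); split=> //; exact: alg_mul.
    - move=> [f [pf /= E ->]]; apply: cy => // g.
      by have := congr1 (fun u => u g) E.
  exists P; split=> // j; apply: P0P; exists (coordf j).
  by split=> //; exact: alg_gen.
have Px : Pr x by apply: Pl; left.
have Pl' z : List.In z l -> Pr z by move=> zl; apply: Pl; right.
pose algebraic := exists d (c : nat -> (J -> K) -> K), [/\ forall i, alg (@coordf J) (c i),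
  forall g, \sum_(i < d) c i (fun j => w j g) * x g ^+ i = 0 &
  exists i, (i < d)%N /\ exists g, c i (fun j => w j g) <> 0].
have [[d [c [ac rel [i0 [i0d nz0]]]]]|nalg] := pselect algebraic.
  (* The largest index whose coefficient is not identically zero gives the true leading coefficient,
     which has to stay nonzero at [y]. *)
  pose Q i := (i < d)%N && `[< exists g, c i (fun j => w j g) <> 0 >].
  have exQ : exists i, Q i by exists i0; rewrite /Q i0d; apply/asboolP.
  have [|m /andP[md /asboolP nz] mmax] := ex_maxnP exQ (m := d).
    by move=> i /andP[/ltnW].
  have [h [ah [g hg] Hh]] := IH J w Pw Pl'.
  exists (fun v => h v * c m v); split; first exact: alg_mul.
    apply: contrapT => H; have [] := Pr_prime (Pr_alg Pw ah) (Pr_alg Pw (ac m)).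
    - by move=> g'; apply: contrapT => ng; apply: H; exists g'.
    - by move/(_ g).
    - by have [g' cg'] := nz; move/(_ g').
  move=> y cy /eqP; rewrite mulf_eq0 negb_or => /andP[/eqP hy cmy].
  have [P [maxP Pwy Pfin]] := Hh y cy hy.
  exists P; split=> // z [<-|]; last exact: Pfin.
  apply: (@integral_finite P m (fun i g => c i (fun j => w j g)) (fun i => c i y)) => //.
    by move=> i; exact: (graph_alg maxP.1 Pwy (ac i)).
  move=> g'; rewrite -[RHS](rel g').
  rewrite (@big_ord_widen _ _ _ m.+1 d (fun i => c i (fun j => w j g') * x g' ^+ i))//.
  rewrite big_mkcond; apply: eq_bigr => i _; case: ltnP => // mi.
  suff -> : c i (fun j => w j g') = 0 by rewrite mul0r.
  apply: contrapT => ci; have := mmax i; rewrite /Q ltn_ord /= leqNgt mi.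
  by move=> H; apply/notF/H/asboolP; exists g'.
pose w' (j : option J) := if j is Some j then w j else x.
have Pw' j : Pr (w' j) by case: j.
have [h [ah [g hg] Hh]] := IH _ w' Pw' Pl'.
have [d [c [ac hE]]] := alg_option ah.
have [i nz] : exists i : 'I_d, exists g, c i (fun j => w j g) <> 0.
  apply: contrapT => H; apply: hg; rewrite hE big1// => i _.
  have [->|ci] := eqVneq (c i (fun j => w' (Some j) g)) 0; first by rewrite mul0r.
  by exfalso; apply: H; exists i, g; apply/eqP.
exists (c i); split=> // y cy ciy.
pose q := \poly_(i < d) c i y.
(* A value [t] for the transcendental [x] at which [h], seen as a polynomial in [x], does not
   vanish. *)
have [t qt] : exists t, q.[t] <> 0.
  apply: contrapT => H; apply: ciy; have q0 : q = 0.
    apply: poly_fun_inj => t; rewrite horner0; apply: contrapT => qt; by apply: H; exists t.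
  by have := congr1 (fun p : {poly K} => p`_i) q0; rewrite coef_poly ltn_ord coef0.
pose y' (j : option J) := if j is Some j then y j else t.
have cy' : consistent w' y'.
  move=> F /alg_option[e [b [ab FE]]] F0; rewrite FE big1// => j _.
  suff -> : b j (fun k => y' (Some k)) = 0 by rewrite mul0r.
  apply: (cy (b j)) => // g'; apply: contrapT => bj; apply: nalg.
  exists e, b; split=> // [g''|]; first by rewrite -(FE (fun k => w' k g'')).
  by exists j; split=> //; exists g'.
have [|P [maxP Pwy Pfin]] := Hh y' cy'.
  rewrite hE; move: qt; rewrite horner_poly => qt; exact: qt.
exists P; split=> // [j|z [<-|]]; first exact: (Pwy (Some j)); last exact: Pfin.
by exists t; exact: (Pwy None).
Qed.

End FiniteExtension.

Section Ranges.
Variables (K : numClosedFieldType) (n : nat) (G : groupType).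
Local Notation M := 'M[K]_n.+1.
Variables (s : G -> M) (J : M).
Hypotheses (lgs : linear_group s J) (cG : zconn s setT).
Let sT : subgroup [set: G]. Proof. by []. Qed.

(** Two images with the same closure meet. [generic_extension] gives an [h] such that the points of
    the closure with [h] nonzero are values of [phi]; having the same relations, [psi] takes one of
    these points as a value. *)
Lemma ranges_meet (Q : Type) (phi psi : Q -> M -> K) :
  (forall j, polyf (phi j)) -> (forall j, polyf (psi j)) ->
  (forall F, alg (@coordf K Q) F -> (forall x, F (fun j => phi j (s x)) = 0) <->
     (forall x, F (fun j => psi j (s x)) = 0)) ->
  exists x y, forall j, phi j (s x) = psi j (s y).
Proof.
move=> pphi ppsi same.
pose Pr : set (G -> K) := [set f | exists2 p, polyf p & f = p \o s].
have Pr_alg (I : Type) (w : I -> G -> K) F : (forall j, Pr (w j)) ->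
    alg (@coordf K I) F -> Pr (fun g => F (fun j => w j g)).
  move=> Pw; elim=> [a|j|f h _ [p pp pE] _ [q pq qE]|f h _ [p pp pE] _ [q pq qE]].
  - by exists (fun=> a) => //; exact: alg_cst.
  - exact: Pw.
  - exists (fun A => p A + q A); first exact: alg_add.
    apply/funext => g; have /= -> := congr1 (fun u => u g) pE.
    by have /= -> := congr1 (fun u => u g) qE.
  - exists (fun A => p A * q A); first exact: alg_mul.
    apply/funext => g; have /= -> := congr1 (fun u => u g) pE.
    by have /= -> := congr1 (fun u => u g) qE.
have Pr_prime f h : Pr f -> Pr h -> (forall g, f g * h g = 0) ->
    (forall g, f g = 0) \/ (forall g, h g = 0).
  move=> [p pp ->] [q pq ->] pq0.
  have [|[_ H]|[_ H]] := vanish_prime lgs sT cG pp pq.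
  - by split; [exact: alg_mul|move=> x _; exact: pq0].
  - by left=> g; exact: H.
  - by right=> g; exact: H.
pose l := [seq (fun x => s x k.1 k.2) | k <- enum [set: 'I_n.+1 * 'I_n.+1]%SET].
have lP i j : List.In (fun x => s x i j) l.
  rewrite /l; have : (i, j) \in enum [set: 'I_n.+1 * 'I_n.+1]%SET by rewrite mem_enum inE.
  elim: (enum _) => // k r IH; rewrite inE => /orP[/eqP <-|/IH]; first by left.
  by right.
have Pl x : List.In x l -> Pr x.
  rewrite /l; elim: (enum _) => [//|k r IH] /= [<-|/IH//].
  by exists (mxentry k) => //; exact: alg_gen.
have Pphi j : Pr (fun x => phi j (s x)) by exists (phi j).
have [h [ah [x hx] Hh]] := generic_extension Pr_alg Pr_prime 1%g Pphi Pl.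
have [y hy] : exists y, h (fun j => psi j (s y)) <> 0.
  apply: contrapT => H; apply: hx; move: x; apply: (proj2 (same _ ah)) => y; apply: contrapT => hy.
  by apply: H; exists y.
have [|P [maxP Pw Pfin]] := Hh _ _ hy.
  by move=> F aF F0; exact: (proj1 (same _ aF) F0).
have [A LA] : exists A, mxlimit P s A.
  have /choice[a Ha] : forall k : 'I_n.+1 * 'I_n.+1, exists a, P (fun x => s x k.1 k.2, a).
    by move=> k; exact: Pfin.
  exists (\matrix_(i, j) a (i, j)) => i j; rewrite mxE; exact: (Ha (i, j)).
have [|z zA] := lg_closed lgs (A := A).
  by move=> f [pf f0]; apply: (limit_zero maxP.1 _ (limit_polyf maxP pf LA)) => g; exact: f0.
exists z, y => j; rewrite zA.
exact: (limit_unique maxP.1 (limit_polyf maxP (pphi j) LA) (Pw j)).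
Qed.

End Ranges.

(** * Linearization of affine algebraic groups *)

Lemma poly_evalP (K : fieldType) n (F : 'rV[K]_n -> K) :
  alg (fun (j : 'I_n) (v : 'rV[K]_n) => v ord0 j) F <-> exists p, forall v, F v = poly_eval p v.
Proof.
split=> [|[p Fp]].
  elim=> [a|j|f h _ [p pE] _ [q qE]|f h _ [p pE] _ [q qE]].
  - by exists (mpolyC n a) => v; rewrite /poly_eval mevalC.
  - by exists (mpolyX K (mnm1 j)) => v; rewrite /poly_eval mevalXU.
  - by exists (p + q) => v; rewrite pE qE /poly_eval mevalD.
  - by exists (p * q) => v; rewrite pE qE /poly_eval mevalM.
pose X := fun (j : 'I_n) (v : 'rV[K]_n) => v ord0 j.
have H m : true -> alg X (fun v => mcoeff m p * \prod_i X i v ^+ fun_of_multinom m i).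
  move=> _; apply: alg_mul; first exact: alg_cst.
  by apply: alg_prod => i _; apply: alg_exp; exact: alg_gen.
by apply: alg_ext (alg_sum (msupp p) H) _ => v; rewrite Fp /poly_eval mevalE.
Qed.

Lemma alg_poly_eval (K : fieldType) n (p : mpoly n K) :
  alg (fun (j : 'I_n) (v : 'rV[K]_n) => v ord0 j) (poly_eval p).
Proof. by apply/poly_evalP; exists p. Qed.

Section Separation.
Variables (K : fieldType) (X Y : Type).

(** Functions of finite rank, that is, elements of the tensor product of the two function spaces. *)
Definition separated (F : X -> Y -> K) := exists l : seq ((X -> K) * (Y -> K)),
  forall x y, F x y = \sum_(w <- l) w.1 x * w.2 y.

Lemma separated_alg (J : Type) (z : J -> X * Y -> K) F :
  (forall j, separated (fun x y => z j (x, y))) -> alg z F -> separated (fun x y => F (x, y)).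
Proof.
move=> sz; elim=> [a|j|f h _ [l lE] _ [r rE]|f h _ [l lE] _ [r rE]] //.
- by exists [:: (fun=> a, fun=> 1)] => x y; rewrite big_seq1 mulr1.
- by exists (l ++ r) => x y; rewrite big_cat lE rE.
- exists [seq (fun x => u.1 x * w.1 x, fun y => u.2 y * w.2 y) | u <- l, w <- r] => x y.
  rewrite lE rE big_allpairs_dep big_distrlr; apply: eq_bigr => u _; apply: eq_bigr => w _ /=.
  by rewrite mulrACA.
Qed.

Lemma separated_fst f : separated (fun x _ => f x).
Proof. by exists [:: (f, fun=> 1)] => x y; rewrite big_seq1 mulr1. Qed.

Lemma separated_snd f : separated (fun _ y => f y).
Proof. by exists [:: (fun=> 1, f)] => x y; rewrite big_seq1 mul1r. Qed.

Lemma separated_bound F : separated F -> exists D, forall m (x : 'I_m -> X) (y : 'I_m -> Y),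
  \matrix_(i, j) F (x i) (y j) \in unitmx -> (m <= D)%N.
Proof.
move=> [l lE]; exists (size l) => m x y /mxrank_unit <-; pose w0 : (X -> K) * (Y -> K) := (fun=> 0, fun=> 0).
have -> : \matrix_(i, j) F (x i) (y j) =
    (\matrix_(i < m, k < size l) (nth w0 l k).1 (x i)) *m (\matrix_(k < size l, j < m) (nth w0 l k).2 (y j)).
  apply/matrixP => i j; rewrite !mxE lE (big_nth w0) big_mkord.
  by apply: eq_bigr => k _; rewrite !mxE.
exact: leq_trans (mxrankM_maxl _ _) (rank_leq_col _).
Qed.

End Separation.
Arguments separated_fst {K X} Y f.
Arguments separated_snd {K} X {Y} f.

(** Bordering an invertible minor of maximal size gives a singular matrix, so its Schur complement
    vanishes, which is the stated formula. *)
Lemma maximal_minor (K : fieldType) (X Y : Type) (F : X -> Y -> K) x0 y0 : separated F ->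
  F x0 y0 != 0 -> exists m (x : 'I_m.+1 -> X) (y : 'I_m.+1 -> Y),
    \matrix_(i, j) F (x i) (y j) \in unitmx /\
    forall a b, F a b = ((\row_j F a (y j)) *m invmx (\matrix_(i, j) F (x i) (y j)) *m
      (\col_i F (x i) b)) 0 0.
Proof.
move=> /separated_bound[D HD] F0.
pose Q m := `[< exists (x : 'I_m -> X) (y : 'I_m -> Y), \matrix_(i, j) F (x i) (y j) \in unitmx >].
have Q1 : Q 1%N.
  apply/asboolP; exists (fun=> x0), (fun=> y0).
  rewrite (_ : \matrix_(_, _) _ = (F x0 y0)%:M) ?unitmxE ?det_scalar1 ?unitfE//.
  by apply/matrixP => i j; rewrite !mxE !ord1.
have [|[|m] /asboolP[x [y Bu]] mmax] := ex_maxnP (ex_intro Q _ Q1) (m := D).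
- by move=> m /asboolP[x [y]]; exact: HD.
- by have := mmax _ Q1.
exists m, x, y; split=> // a b; set B := \matrix_(i, j) _ in Bu *.
apply: contrapT => /eqP nz; have := mmax (1 + m.+1)%N; rewrite ltnn => H; apply/notF/H/asboolP.
pose x' (i : 'I_(1 + m.+1)) := if fintype.split i is inr k then x k else a.
pose y' (i : 'I_(1 + m.+1)) := if fintype.split i is inr k then y k else b.
exists x', y'; set A := \matrix_(i, j) _.
have AE : A = block_mx (F a b)%:M (\row_j F a (y j)) (\col_i F (x i) b) B.
  apply/matrixP => i j; rewrite !mxE /x' /y'.
  by case: splitP => i' _; rewrite !mxE; case: splitP => j' _; rewrite !mxE ?ord1 ?eqxx ?mulr1n.
rewrite -row_free_unit -kermx_eq0; apply/eqP/row_matrixP => i; rewrite row0.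
have := row_sub i (kermx A); rewrite sub_kermx.
rewrite -[row i _]hsubmxK; set u := lsubmx _; set v := rsubmx _.
rewrite AE mul_row_block -[0]row_mx0 => /eqP/eq_row_mx[E1 E2].
have vE : v = - (u *m (\row_j F a (y j)) *m invmx B).
  apply/eqP; rewrite -subr_eq0 opprK -(mulmxK Bu v) -mulmxDl [v *m B + _]addrC E2 mul0mx//.
set q := _ *m _ *m _ in nz.
have qE : (F a b)%:M - q = (F a b - q 0 0)%:M.
  by apply/matrixP => i' j'; rewrite !mxE !ord1 eqxx.
have u0 : u = 0.
  have : u *m ((F a b)%:M - q) = 0 by rewrite mulmxBr /q !mulmxA -mulNmx -vE.
  rewrite qE mul_mx_scalar => /eqP; rewrite scaler_eq0 subr_eq0 (negPf nz) /=.
  by move/eqP.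
by rewrite vE u0 !mul0mx oppr0 row_mx0.
Qed.

Section BlockDiagonal.
Variables (K : comNzRingType) (m : nat).
Implicit Types A B : 'M[K]_m.

Lemma block_diagM A B A' B' :
  block_mx A 0 0 B *m block_mx A' 0 0 B' = block_mx (A *m A') 0 0 (B *m B').
Proof. by rewrite mulmx_block !mulmx0 !mul0mx !addr0 !add0r. Qed.

Let swap : 'M[K]_(m + m) := block_mx 0 1%:M 1%:M 0.

Lemma block_swapK : swap *m swap = 1%:M.
Proof. by rewrite mulmx_block !mulmx0 !mul0mx !mulmx1 !addr0 !add0r -scalar_mx_block. Qed.

Lemma block_swap_tr A B : swap *m (block_mx A 0 0 B)^T *m swap = block_mx B^T 0 0 A^T.
Proof.
by rewrite tr_block_mx !mulmx_block !trmx0 !mulmx0 !mul0mx !mulmx1 !mul1mx !addr0 !add0r.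
Qed.

End BlockDiagonal.

Section Linearization.
Variables (K : numClosedFieldType) (G : groupType) (n : nat) (c : G -> 'rV[K]_n).
Hypothesis agG : affine_algebraic_group c.

Definition regular : (G -> K) -> Prop := alg (fun (j : 'I_n) x => c x ord0 j).

Lemma regular_poly p : regular (fun x => poly_eval p (c x)).
Proof.
by apply: alg_comp (alg_poly_eval p) => j; exact: (alg_gen (fun (j : 'I_n) x => c x ord0 j) j).
Qed.

Lemma regularP f : regular f <-> exists p, forall x, f x = poly_eval p (c x).
Proof.
split=> [|[p fp]]; last by apply: alg_ext (regular_poly p) _ => x; rewrite fp.
move=> rf; suff [F aF fF] : exists2 F, alg (fun (j : 'I_n) (v : 'rV[K]_n) => v ord0 j) F & forall x, f x = F (c x).
  by have [p Fp] := (poly_evalP F).1 aF; exists p => x; rewrite fF Fp.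
elim: rf => [a|j|g h _ [F aF gF] _ [H aH hH]|g h _ [F aF gF] _ [H aH hH]].
- by exists (fun=> a) => //; exact: alg_cst.
- exists (fun v => v ord0 j) => //; exact: (alg_gen (fun (j : 'I_n) (v : 'rV[K]_n) => v ord0 j) j).
- by exists (fun v => F v + H v) => [|x]; [exact: alg_add|rewrite gF hH].
- by exists (fun v => F v * H v) => [|x]; [exact: alg_mul|rewrite gF hH].
Qed.

Let coord2 (j : 'I_n + 'I_n) (w : G * G) : K :=
  match j with inl j => c w.1 ord0 j | inr j => c w.2 ord0 j end.

Lemma regular_mul j : alg coord2 (fun w => c (w.1 * w.2)%g ord0 j).
Proof.
have [_ [q Hq] _] := agG.
have := alg_poly_eval (q j) => /(@alg_comp _ _ (G * G)%type _ ('I_n + 'I_n)%type _ coord2 (prod_coord c c)) H.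
apply: alg_ext (H _) _ => [k|w]; last by rewrite Hq// mxE.
rewrite -(splitK k); case: (fintype.split k) => k' /=.
  by apply: alg_ext (alg_gen coord2 (inl k')) _ => w; rewrite /prod_coord row_mxEl.
by apply: alg_ext (alg_gen coord2 (inr k')) _ => w; rewrite /prod_coord row_mxEr.
Qed.

Lemma regular_transl f a : regular f -> regular (fun x => f (a * x)%g).
Proof.
apply: alg_comp => j; have := regular_mul j.
apply: (@alg_comp _ _ G _ _ _ _ (fun x => (a, x))) => -[k|k] /=; first exact: alg_cst.
exact: (alg_gen (fun (j : 'I_n) x => c x ord0 j) k).
Qed.

Lemma regular_transr f a : regular f -> regular (fun x => f (x * a)%g).
Proof.
apply: alg_comp => j; have := regular_mul j.
apply: (@alg_comp _ _ G _ _ _ _ (fun x => (x, a))) => -[k|k] /=; last exact: alg_cst.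
exact: (alg_gen (fun (j : 'I_n) x => c x ord0 j) k).
Qed.

Lemma regular_inv f : regular f -> regular (fun x => f x^-1%g).
Proof.
have [_ _ [q Hq]] := agG; apply: alg_comp => j.
by apply: alg_ext (regular_poly (q j)) _ => x; rewrite Hq// mxE.
Qed.

(** The right translates of the coordinate functions span a space of finite dimension, since [F] has
    finite rank. A maximal minor of [F] selects a basis [b] of translates and points [x i]
    separating it, and [S h] is the matrix of translation by [h] in this basis. *)
Theorem linearization : exists m (s : G -> 'M[K]_m.+1) J, [/\ linear_group s J,
  forall i j, regular (fun x => s x i j) &
  forall j, exists2 f, polyf f & forall x, c x ord0 j = f (s x)].
Proof.
(* The index [None] adds the constant function 1, which supplies the nonzero value of [F] for
   [maximal_minor]. *)
pose e (j : option 'I_n) x : K := if j is Some j then c x ord0 j else 1.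
pose F x (y : G * option 'I_n) := e y.2 (x * y.1)%g.
have e_reg j : regular (e j).
  by case: j => [j|]; [exact: (alg_gen (fun (j : 'I_n) x => c x ord0 j) j)|exact: alg_cst].
have sepF : separated F.
  pose z (k : option 'I_n + ('I_n + 'I_n)) (w : G * (G * option 'I_n)) : K :=
    match k with inl j => (w.2.2 == j)%:R | inr k => coord2 k (w.1, w.2.1) end.
  have sepz k : separated (fun x y => z k (x, y)).
    case: k => [j|[j|j]]; [|exact: (separated_fst (G * option 'I_n) (fun x => c x ord0 j))|].
      exact: (separated_snd G (fun y : G * option 'I_n => (y.2 == j)%:R)).
    exact: (separated_snd G (fun y : G * option 'I_n => c y.1 ord0 j)).
  have : alg z (fun w => \sum_j (w.2.2 == j)%:R * e j (w.1 * w.2.1)%g).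
    apply: alg_sum => j _; apply: alg_mul; first exact: (alg_gen z (inl j)).
    case: j => [j|]; last exact: alg_cst.
    have := regular_mul j; apply: (@alg_comp _ _ _ _ _ _ z (fun w => (w.1, w.2.1))) => k.
    exact: (alg_gen z (inr k)).
  move=> /(separated_alg sepz)[l lE]; exists l => x y; rewrite -lE /F /=.
  by rewrite (bigD1 y.2)//= eqxx mul1r big1 ?addr0// => j /negPf jn; rewrite eq_sym jn mul0r.
have [|m [x [y [Bu FE]]]] := maximal_minor (x0 := 1%g) (y0 := (1%g, None)) sepF.
  by rewrite /F /= oner_eq0.
set B := \matrix_(i, j) _ in Bu FE.
pose b g : 'rV[K]_m.+1 := \row_j F g (y j).
pose S h : 'M[K]_m.+1 := invmx B *m \matrix_(i, j) F (x i) (h * (y j).1, (y j).2)%g.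
have bS g h : b (g * h)%g = b g *m S h.
  apply/rowP => j; rewrite mxE /S mulmxA.
  have -> : F (g * h)%g (y j) = F g (h * (y j).1, (y j).2)%g by rewrite /F /= mulgA.
  rewrite FE !mxE; apply: eq_bigr => k _; by rewrite !mxE.
have BS h : B *m S h = \matrix_(i, j) F (x i) (h * (y j).1, (y j).2)%g by rewrite mulKVmx.
have row_B i : row i B = b (x i) by apply/rowP => j; rewrite !mxE.
have S_inj A A' : (forall i, b (x i) *m A = b (x i) *m A') -> A = A' :> 'M[K]_m.+1.
  move=> H; rewrite -[A](mulKmx Bu) -[A'](mulKmx Bu); congr (_ *m _).
  by apply/row_matrixP => i; rewrite !row_mul row_B H.
have SM g h : S (g * h)%g = S g *m S h.
  by apply: S_inj => i; rewrite -bS mulgA bS bS mulmxA.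
have S1 : S 1%g = 1%:M by apply: S_inj => i; rewrite -bS mulg1 mulmx1.
have S_reg i j : regular (fun h => S h i j).
  apply: alg_ext (_ : regular (fun h => \sum_k invmx B i k * F (x k) (h * (y j).1, (y j).2)%g)) _ => [|h].
    apply: alg_sum => k _; apply: alg_mul; first exact: alg_cst.
    exact: (regular_transr (y j).1 (regular_transl (x k) (e_reg (y j).2))).
  by rewrite !mxE; apply: eq_bigr => k _; rewrite !mxE.
pose s h : 'M[K]_((m + m.+1).+1) := block_mx (S h) 0 0 (S h^-1%g)^T.
pose J : 'M[K]_((m + m.+1).+1) := block_mx 0 (1%:M : 'M[K]_m.+1) (1%:M : 'M[K]_m.+1) 0.
have sul A : exists2 f : 'M[K]_((m + m.+1).+1) -> 'M[K]_m.+1, mxalg mxentry f & forall h, f (s h) = A *m S h.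
  exists (fun C => A *m ulsubmx (C : 'M[K]_(m.+1 + m.+1))) => [|h]; last by rewrite block_mxKul.
  apply: mxalgM; first exact: mxalg_cst.
  by move=> i j; apply: alg_ext (alg_gen mxentry (lshift m.+1 i, lshift m.+1 j)) _ => C; rewrite !mxE.
have c_lin j : exists2 f, polyf f & forall h, c h ord0 j = f (s h).
  pose v : 'cV[K]_m.+1 := \col_i F (x i) (1%g, Some j).
  have [f af fE] := sul (1%:M : 'M[K]_m.+1).
  exists (fun C => ((b 1%g) *m f C *m (invmx B *m v)) ord0 ord0).
    apply: mxalgM; last exact: mxalg_cst.
    by apply: mxalgM => //; exact: mxalg_cst.
  move=> h; rewrite fE mul1mx -bS mul1g mulmxA.
  by have := FE h (1%g, Some j); rewrite /F /= mulg1.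
have s_reg i j : regular (fun h => s h i j).
  rewrite -(splitK (i : 'I_(m.+1 + m.+1))) -(splitK (j : 'I_(m.+1 + m.+1))).
  case: (fintype.split _) => i'; case: (fintype.split _) => j' /=.
  - apply: alg_ext (S_reg i' j') _ => h.
    have -> : s h (lshift m.+1 i') (lshift m.+1 j') = (S h) i' j' by exact: block_mxEul.
    by rewrite ?mxE.
  - apply: alg_ext (alg_cst _ 0) _ => h.
    have -> : s h (lshift m.+1 i') (rshift m.+1 j') = (0 : 'M[K]_m.+1) i' j' by exact: block_mxEur.
    by rewrite ?mxE.
  - apply: alg_ext (alg_cst _ 0) _ => h.
    have -> : s h (rshift m.+1 i') (lshift m.+1 j') = (0 : 'M[K]_m.+1) i' j' by exact: block_mxEdl.
    by rewrite ?mxE.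
  - apply: alg_ext (regular_inv (S_reg j' i')) _ => h.
    have -> : s h (rshift m.+1 i') (rshift m.+1 j') = (S h^-1%g)^T i' j' by exact: block_mxEdr.
    by rewrite ?mxE.
have [f Hf] : exists f : 'I_n -> 'M[K]_((m + m.+1).+1) -> K, forall j, polyf (f j) /\ forall h, c h ord0 j = f j (s h).
  suff /choice[f Hf] : forall j, exists f : 'M[K]_((m + m.+1).+1) -> K, polyf f /\ forall h, c h ord0 j = f (s h).
    by exists f.
  by move=> j; have [f pf fE] := c_lin j; exists f.
exists (m + m.+1)%N, s, J; split=> //.
have [[c_inj [S0 rc]] _ _] := agG.
split.
- by move=> g h; rewrite /s SM invgM SM trmx_mul; exact: (esym (block_diagM (S g) (S g^-1%g)^T (S h) (S h^-1%g)^T)).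
- by rewrite /s invg1 S1 trmx1; exact: (esym (scalar_mx_block m.+1 m.+1 1)).
- exact: (@block_swapK K m.+1).
- by move=> h; rewrite /s invgK; have := block_swap_tr (S h) (S h^-1%g)^T; rewrite trmxK => /esym.
- move=> g h E; apply: c_inj; apply/rowP => j.
  by have [_ fE] := Hf j; rewrite !fE E.
- move=> A HA.
  pose v : 'rV[K]_n := \row_j f j A.
  have poly_f p : polyf (fun C => poly_eval p (\row_j f j C)).
    apply: alg_comp (alg_poly_eval p) => j; have [pf _] := Hf j.
    by apply: alg_ext pf _ => C; rewrite mxE.
  have cf h : \row_j f j (s h) = c h.
    by apply/rowP => j; rewrite mxE; have [_ ->] := Hf j.
  have : range c v.
    rewrite rc => p Sp; apply: (HA (fun C => poly_eval p (\row_j f j C))); split=> // h _.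
    have : range c (c h) by exists h.
    by rewrite cf rc; apply.
  move=> [h _ hv]; exists h; apply/matrixP => i j.
  have [p pE] := (regularP _).1 (s_reg i j).
  have := HA (fun C => mxentry (i, j) C - poly_eval p (\row_j f j C)).
  rewrite -/v -hv -pE => /(_ _)/subr0_eq => H; apply/esym/H; split.
    by apply: alg_sub; [exact: alg_gen|exact: poly_f].
  by move=> h' _; rewrite cf -pE subrr.
Qed.

End Linearization.

(** * Representations *)

Section Transfer.
Variables (K : numClosedFieldType) (G : groupType) (n m : nat) (c : G -> 'rV[K]_n).
Variables (s : G -> 'M[K]_m.+1) (J : 'M[K]_m.+1).
Hypotheses (agG : affine_algebraic_group c) (lgs : linear_group s J).
Hypothesis s_reg : forall i j, regular c (fun x => s x i j).
Hypothesis c_poly : forall j, exists2 f, polyf f & forall x, c x ord0 j = f (s x).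

Lemma polyf_regular f : polyf f -> regular c (fun x => f (s x)).
Proof. by apply: alg_comp => k; exact: s_reg. Qed.

Lemma regular_polyf f : regular c f -> exists2 p, polyf p & forall x, f x = p (s x).
Proof.
elim=> [a|j|g h _ [p pp gp] _ [q pq hq]|g h _ [p pp gp] _ [q pq hq]].
- by exists (fun=> a) => //; exact: alg_cst.
- exact: c_poly.
- by exists (fun A => p A + q A) => [|x]; [exact: alg_add|rewrite gp hq].
- by exists (fun A => p A * q A) => [|x]; [exact: alg_mul|rewrite gp hq].
Qed.

Lemma closed_zclosed (Z : set G) : closed (Z : set (zariski c)) <-> zclosed s Z.
Proof.
rewrite zariski_closedP; split=> [[S ->] x Hx p Sp|Zc].
  have [f pf fE] := regular_polyf (@regular_poly K G n c p).
  by rewrite fE; apply: Hx => // z /(_ p Sp); rewrite fE.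
exists [set p | forall z, Z z -> poly_eval p (c z) = 0]; apply/seteqP; split=> x /= Zx.
  by move=> p; exact.
apply: Zc => f /polyf_regular/(@regularP K G n c)[p pE] f0.
by rewrite pE; apply: Zx => z Zz; rewrite -pE; exact: f0.
Qed.

Lemma connected_zconn (H : set G) : connected (H : set (zariski c)) <-> zconn s H.
Proof.
split=> [cH Z1 Z2 /closed_zclosed c1 /closed_zclosed c2 HZ dis|cH B [b Bb] [C oC BC] [D cD BD]].
  have [[x [Hx Zx]]|nB] := pselect ((H `&` Z1) !=set0); last first.
    by right=> x Hx; have [Zx|//] := HZ x Hx; exfalso; apply: nB; exists x.
  left; have E : H `&` Z1 = H; last by move=> y; rewrite -{1}E => -[].
  apply: cH.
  - by exists x.
  - exists (~` Z2 : set (zariski c)); first by rewrite openC.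
    apply/seteqP; split=> y [Hy Zy]; split=> //; first by move=> Zy2; exact: (dis y).
    by have [] := HZ y Hy.
  - by exists Z1.
have cC : closed (~` C : set (zariski c)) by rewrite closedC.
move/closed_zclosed: cD => cD; move/closed_zclosed: cC => cC.
have [||HD|HC] := cH D (~` C) cD cC.
- move=> x Hx; have [Cx|nCx] := pselect (C x); last by right.
  by left; have : B x by [rewrite BC]; rewrite BD => -[].
- by move=> x Hx Dx; apply; have : B x by [rewrite BD]; rewrite BC => -[].
- by rewrite BD; apply/seteqP; split=> [x []//|x Hx]; split=> //; exact: HD.
- by move: Bb; rewrite BC => -[Hb Cb]; have := HC b Hb.
Qed.

Lemma connected_solvable_conn_solv (H : set G) : connected_solvable c H <-> conn_solv s H.
Proof.
split=> [[[sH /closed_zclosed cH] /connected_zconn kH solH]|[sH cH kH solH]]; split=> //.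
  by split=> //; exact/closed_zclosed.
exact/connected_zconn.
Qed.

Lemma borel_borel_group (B : set G) : borel c B <-> borel_group s B.
Proof.
by split=> -[/connected_solvable_conn_solv csB maxB]; split=> // B' /connected_solvable_conn_solv; exact: maxB.
Qed.

Lemma reductive_reductive_lie : reductive c -> zconn s setT /\ reductive_lie s.
Proof.
move=> [_ /connected_zconn cG [H [_ nH HP] [k [f [h [_ hf _ _ [q Hq]]]]]]]; split=> //.
(* The first half of the torus coordinates of [h] is enough: these are the entries of [h x]
   themselves, and they are nonzero. *)
have /choice[chr Hchr] : forall i : 'I_k, exists p, polyf p /\ forall x, H x -> h x ord0 i = p (s x).
  move=> i; have [p pp pE] := regular_polyf (@regular_poly K G n c (q (lshift k i))).
  exists p; split=> // x Hx; rewrite -pE.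
  by have /rowP/(_ (lshift k i)) := Hq x Hx; rewrite /torus_coord row_mxEl mxE.
apply: (@no_nil_ideal K m G s J lgs H k chr).
- by move=> H' csH' nH'; apply: HP => //; exact/connected_solvable_conn_solv.
- by move=> i; have [] := Hchr i.
- by move=> x i Hx; have [_ <-//] := Hchr i; have [+ _] := hf x Hx; exact.
- move=> x y Hx Hy E; have [_ <-] := hf x Hx; have [_ <-] := hf y Hy; congr f.
  apply/rowP => i; have [_ Hi] := Hchr i; rewrite (Hi x Hx) (Hi y Hy); exact: E.
Qed.

Lemma good_Ad a u p : good s u p -> good s (linfun (Ad s a) @: u)%VS (linfun (Ad s a) @: p)%VS.
Proof.
have inj : lker (linfun (Ad s a)) == 0%VS.
  apply/lker0P => x y; rewrite !lfunE /= => /(congr1 (Ad s a^-1%g)).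
  by rewrite !(AdK lgs).
have memA (U : {vspace 'M[K]_m.+1}) x : x \in (linfun (Ad s a) @: U)%VS -> exists2 y, y \in U & x = Ad s a y.
  by move=> /memv_imgP[y yU ->]; exists y => //; rewrite lfunE.
have Amem (U : {vspace 'M[K]_m.+1}) x : x \in U -> Ad s a x \in (linfun (Ad s a) @: U)%VS.
  by move=> xU; have := memv_img (linfun (Ad s a)) xU; rewrite lfunE.
move=> [[up pg u0] tr0 dg br nilp]; split.
- split.
  + exact: limgS.
  + apply/subvP => _ /memA[y yp ->]; apply: (lie_Ad_sub lgs) => //; exact: (subvP pg).
  + by rewrite -dimv_eq0 limg_dim_eq ?dimv_eq0// (eqP inj) capv0.
- by move=> _ _ /memA[x xu ->] /memA[y yp ->]; rewrite -(AdM lgs) (Ad_trace lgs); exact: tr0.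
- by rewrite !limg_dim_eq// (eqP inj) capv0.
- by move=> _ _ /memA[y yp ->] /memA[x xu ->]; rewrite -!(AdM lgs) -linearB; apply: Amem; exact: br.
- by move=> _ /memA[x xu ->]; rewrite -(Ad_exp lgs) nilp ?linear0.
Qed.

Lemma bad_conj (T : Type) (r : T -> G) a : bad s (range (fun k => a * r k * a^-1)%g) -> bad s (range r).
Proof.
move=> [u [p [gup Hu]]]; exists (linfun (Ad s a^-1%g) @: u)%VS, (linfun (Ad s a^-1%g) @: p)%VS.
split; first exact: good_Ad.
move=> _ [k _ <-] _ /memv_imgP[x xu ->]; rewrite lfunE /=.
have H : Ad s (a * r k * a^-1)%g x \in u by apply: Hu => //; exists k.
have := memv_img (linfun (Ad s a^-1%g)) H; rewrite lfunE /= -!(Ad_comp lgs).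
by rewrite !mulgA mulVg mul1g.
Qed.

Section Hom.
Variables (Gamma : groupType) (N : nat) (g : 'I_N -> Gamma).
Hypothesis gen : generated (range g) = [set: Gamma].
Implicit Types (rho : {multiplicative Gamma -> G}) (Z : set {multiplicative Gamma -> G}).

Definition tup rho : 'I_N -> G := fun i => rho (g i).

Lemma hom1 rho : rho 1%g = 1%g.
Proof. by apply: (mulgI (rho 1%g)); rewrite -gmulfM !mulg1. Qed.

Lemma homV rho x : rho x^-1%g = (rho x)^-1%g.
Proof. by apply: (mulgI (rho x)); rewrite -gmulfM !mulgV hom1. Qed.

Lemma tup_inj rho rho' : tup rho = tup rho' -> rho = rho'.
Proof.
move=> E; apply: multiplicative_ext => x.
have : generated (range g) x by rewrite gen.
move=> /(_ [set y | rho y = rho' y]); apply; last first.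
  by move=> _ [i _ <-]; have := congr1 (fun t => t i) E.
split=> [|y z /= Ey Ez]; first by rewrite /= !hom1.
by rewrite /= !gmulfM !homV Ey Ez.
Qed.

Lemma tup_conj a rho : tup (conj_action a rho) = tconj a (tup rho).
Proof. by []. Qed.

Lemma bad_tup rho : bad s (range rho) <-> bad s (range (tup rho)).
Proof.
split=> -[u [p [gup Hu]]]; exists u, p; split=> //.
  by move=> _ [i _ <-]; apply: Hu; exists (g i).
move=> _ [x _ <-]; have : generated (range g) x by rewrite gen.
have [N1 NB] := normalizer_subgroup lgs u.
move=> /(_ [set y | normalizes s u (rho y)]); apply; last by move=> _ [i _ <-]; apply: Hu; exists i.
split=> [|y z /= Hy Hz]; first by rewrite /= hom1.
by rewrite /= gmulfM homV; exact: NB.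
Qed.

Lemma closed_hom Z : closed (Z : set (zariski (hom_coord c g))) <->
  forall rho, (forall f, tpoly s f -> (forall r, Z r -> f (tup r) = 0) -> f (tup rho) = 0) -> Z rho.
Proof.
rewrite zariski_closedP; split=> [[S ->] rho H p Sp|H].
  have [F tF FE] : exists2 F, tpoly s F & forall r, poly_eval p (hom_coord c g r) = F (tup r).
    have /choice[f Hf] : forall j, exists f, polyf f /\ forall x, c x ord0 j = f (s x).
      by move=> j; have [f pf fE] := c_poly j; exists f.
    exists (fun t : 'I_N -> G => poly_eval p (mxvec (\matrix_(i < N, j < n) f j (s (t i))))).
      apply: alg_comp (alg_poly_eval p) => k; case/mxvec_indexP: k => i j.
      have [pf _] := Hf j.
      apply: alg_ext (_ : tpoly s (fun t => f j (s (t i)))) _ => [|t]; last by rewrite mxvecE mxE.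
      by apply: polyf_mxalg pf _ => a b; exact: (alg_gen (tentry s) (i, (a, b))).
    move=> r; congr (poly_eval p (mxvec _)); apply/matrixP => i j.
    by rewrite !mxE; have [_ ->] := Hf j.
  by rewrite FE; apply: H => // r /(_ p Sp); rewrite FE.
exists [set p | forall r, Z r -> poly_eval p (hom_coord c g r) = 0].
apply/seteqP; split=> rho /= Zrho; first by move=> p; exact.
apply: H => f tf f0.
have [F /poly_evalP[p pE] FE] : exists2 F, alg (fun (j : 'I_(N * n)) (v : 'rV[K]_(N * n)) => v ord0 j) F &
    forall r, f (tup r) = F (hom_coord c g r).
  have entry i a b : exists2 F, alg (fun (j : 'I_(N * n)) (v : 'rV[K]_(N * n)) => v ord0 j) F &
      forall r, s (tup r i) a b = F (hom_coord c g r).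
    have [p pE] := (@regularP K G n c _).1 (s_reg a b).
    exists (fun v => poly_eval p (\row_j v ord0 (mxvec_index i j))).
      apply: alg_comp (alg_poly_eval p) => j.
      apply: alg_ext (alg_gen (fun (j : 'I_(N * n)) (v : 'rV[K]_(N * n)) => v ord0 j) (mxvec_index i j)) _ => v.
      by rewrite mxE.
    move=> r; rewrite pE; congr (poly_eval p _); apply/rowP => j.
    by rewrite mxE /hom_coord mxvecE !mxE.
  elim: tf => [a|[i [a b]]|h k _ [F aF hF] _ [F' aF' kF']|h k _ [F aF hF] _ [F' aF' kF']].
  - by exists (fun=> a) => //; exact: alg_cst.
  - exact: entry.
  - by exists (fun v => F v + F' v) => [|r]; [exact: alg_add|rewrite hF kF'].
  - by exists (fun v => F v * F' v) => [|r]; [exact: alg_mul|rewrite hF kF'].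
by rewrite FE pE; apply: Zrho => r Zr; rewrite -pE -FE; exact: f0.
Qed.

Lemma irreducible_bad (cG : zconn s setT) (red : reductive_lie s) rho :
  irreducible_rep c rho <-> ~ bad s (range rho).
Proof.
split=> [irr bad|nbad P [[sP /closed_zclosed cP] [B /borel_borel_group bB BP]] RP].
  have [P [sP cP RP PT [B bB BP]]] := bad_parabolic lgs red bad.
  apply: PT; apply: irr RP; split; last by exists B => //; exact/borel_borel_group.
  by split=> //; exact/closed_zclosed.
by apply: contrapT => PT; apply: nbad; exact: (parabolic_bad lgs red cG sP cP RP PT bB BP).
Qed.

End Hom.
End Transfer.

Section ClosedOrbits.
Variables (K : numClosedFieldType) (m : nat) (G : groupType) (T : finType).
Variables (s : G -> 'M[K]_m.+1) (J : 'M[K]_m.+1).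
Hypotheses (lgs : linear_group s J) (red : reductive_lie s) (cG : zconn s setT).
Implicit Types (r z : T -> G).

Lemma closed_tuple_orbit r z : ~ bad s (range r) -> tclosure s (range (fun a => tconj a r)) z ->
  exists a, tconj a r = z.
Proof.
move=> nbad Oz; pose Q := (T * ('I_m.+1 * 'I_m.+1))%type.
pose phi t (j : Q) (A : 'M[K]_m.+1) : K := (A *m s (t j.1) *m tau J A) j.2.1 j.2.2.
have pphi t j : polyf (phi t j).
  suff H : mxalg mxentry (fun A => A *m s (t j.1) *m tau J A) by exact: (H j.2.1 j.2.2).
  apply: mxalgM; last by apply: mxalg_tau; exact: mxalg_id.
  by apply: mxalgM; [exact: mxalg_id|exact: mxalg_cst].
have phiE t j a : phi t j (s a) = tentry s j (tconj a t).
  by rewrite /phi -(AdE lgs) /Ad /tentry /tconj !(lgM lgs).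
have [F aF|x [y xy]] := ranges_meet lgs cG (pphi r) (pphi z).
  have tF : tpoly s (fun t => F (fun j => tentry s j t)).
    by apply: alg_comp aF => j; exact: alg_gen.
  have E t a : F (fun j => phi t j (s a)) = F (fun j => tentry s j (tconj a t)).
    by congr F; apply/funext => j; exact: phiE.
  have H := tpoly_orbit lgs red cG nbad Oz tF.
  by split=> F0 a; rewrite E; apply: H.1 => b || (apply: H.2 => b); rewrite -E.
have xyE : tconj x r = tconj y z.
  apply/funext => k; apply: (lg_inj lgs); apply/matrixP => a b.
  by have := xy (k, (a, b)); rewrite !phiE.
exists (y^-1 * x)%g; apply/funext => k.
have /(congr1 (fun w => y^-1 * w * y)%g) := congr1 (fun t => t k) xyE.
by rewrite /tconj !invgM !invgK !mulgA mulVg mul1g -[X in _ = X -> _]mulgA mulVg mulg1.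
Qed.

(** Commutation with [s a] is a linear condition satisfied on the group, so it passes to the tangent
    space. *)
Lemma center_Ad a x : center G a -> x \in lie s setT -> Ad s a x = x.
Proof.
move=> Za xg; pose h (A : 'M[K]_m.+1) := s a *m A - A *m s a.
have hlin : linear h.
  by move=> b A B; rewrite /h mulmxDr mulmxDl scalerBr -scalemxAr -scalemxAl opprD addrACA.
pose hl : {linear 'M[K]_m.+1 -> 'M[K]_m.+1} := HB.pack h (GRing.isLinear.Build _ _ _ _ h hlin).
have hs y : h (s y) = 0 by rewrite /h -!(lgM lgs) Za subrr.
have hx : h x = 0.
  apply/matrixP => i j; rewrite [RHS]mxE.
  pose f (A : 'M[K]_m.+1) := mxentry (i, j) (hl A).
  have vf : vanish s setT f.
    split=> [|y _]; last by rewrite /f /= hs /mxentry mxE.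
    have H : mxalg mxentry (fun A => hl A) by apply: mxalg_lin; exact: mxalg_id.
    exact: (H i j).
  have /lieP/(_ f vf) := xg.
  rewrite /f (lder_linmap (mxentry (i, j)) hl).
  by rewrite lder_entry.
rewrite /Ad; have /subr0_eq -> := hx; rewrite -mulmxA (sVr lgs); exact: mulmx1.
Qed.

End ClosedOrbits.

(** * Stability of representations *)

Section Main.
Variables (K : numClosedFieldType) (G : groupType) (n m : nat) (c : G -> 'rV[K]_n).
Variables (s : G -> 'M[K]_m.+1) (J : 'M[K]_m.+1).
Hypotheses (lgs : linear_group s J) (red : reductive_lie s) (cG : zconn s setT).
Hypothesis s_reg : forall i j, regular c (fun x => s x i j).
Hypothesis c_poly : forall j, exists2 f, polyf f & forall x, c x ord0 j = f (s x).
Variables (Gamma : groupType) (N : nat) (g : 'I_N -> Gamma).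
Hypothesis gen : generated (range g) = [set: Gamma].
Implicit Types (rho : {multiplicative Gamma -> G}).
Local Notation cl := (closed_hom s_reg c_poly g).

Lemma center_orbit rho : Defs.orbit (@center_conj_action Gamma G) rho = Defs.orbit (@conj_action Gamma G) rho.
Proof.
apply/seteqP; split=> _ [a _ <-]; first by exists (repr a).
by exists (center_proj a) => //; exact: center_conj_actionE.
Qed.

Lemma orbit_closed rho : ~ bad s (range rho) ->
  closed (Defs.orbit (@center_conj_action Gamma G) rho : set (zariski (hom_coord c g))).
Proof.
move=> nbad; rewrite center_orbit; apply/cl => rho' H.
have [||a aE] := @closed_tuple_orbit K m G _ s J lgs red cG (tup g rho) (tup g rho').
- by move=> /(bad_tup lgs gen).
- move=> f tf f0; apply: H => // _ [a _ <-]; apply: f0; by exists a.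
- by exists a => //; apply: (tup_inj gen); rewrite tup_conj.
Qed.

Lemma bad_locus_closed : closed ([set rho : {multiplicative Gamma -> G} | bad s (range rho)]
  : set (zariski (hom_coord c g))).
Proof.
apply/cl => rho H; apply/(bad_tup lgs gen)/(bad_closed lgs) => f tf f0.
by apply: H => // r /(bad_tup lgs gen) br; exact: f0.
Qed.

Lemma not_bad_properly_stable rho : ~ bad s (range rho) ->
  properly_stable_point (hom_coord c g) (@center_conj_action Gamma G) rho.
Proof.
move=> nbad; split.
  exists (~` [set r : {multiplicative Gamma -> G} | bad s (range r)]
    : set (zariski (hom_coord c g))); split=> //.
  - by rewrite openC; exact: bad_locus_closed.
  - by move=> a y nby /(bad_conj lgs (a := repr a)).
  - by move=> y; exact: orbit_closed.
have nbt : ~ bad s (range (tup g rho)) by move=> /(bad_tup lgs gen).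
have [Phi [fPhi Phi_center]] := tstabilizer_finite lgs red cG nbt.
pose F := [set a | tconj a (tup g rho) = tup g rho].
apply: (sub_finite_set (B := (fun a : center_quot G => Phi (repr a)) @^-1` (Phi @` F))).
  by move=> a aE; exists (repr a) => //=; rewrite /F /= -tup_conj; congr (tup g _).
apply: finite_preimage fPhi => a b _ _ /Phi_center Z.
rewrite -(center_projK a) -(center_projK b); apply/center_projP.
by exists ((repr a)^-1 * repr b)%g => //; rewrite mulVKg.
Qed.

Lemma properly_stable_not_bad rho :
  properly_stable_point (hom_coord c g) (@center_conj_action Gamma G) rho -> ~ bad s (range rho).
Proof.
move=> [[U [_ Urho _ /(_ _ Urho) clo]] finS] [u [p [gup Hu]]].
have [d [phi [x [k [xg k0 phiE Hd]]]]] := degeneration lgs red gup.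
have /choice[b Hb] : forall y, exists bQ : G * 'M[{poly K}]_m.+1,
   [/\ forall t, t != 0 -> path_eval bQ.2 t = s (d t * rho y * (d t)^-1)%g,
       path_eval bQ.2 0 = s bQ.1 & forall t, t != 0 -> (d t * bQ.1 * (d t)^-1)%g = bQ.1].
  by move=> y; have [|b [Q H]] := Hd (rho y); [by apply: Hu; exists y|exists (b, Q)].
pose rho0f y := (b y).1.
have rho0M : {morph rho0f : y z / (y * z)%g}.
  move=> y z; apply: (lg_inj lgs); rewrite (lgM lgs).
  have [Eyz E0yz _] := Hb (y * z)%g; have [Ey E0y _] := Hb y; have [Ez E0z _] := Hb z.
  rewrite -E0yz -E0y -E0z; apply/matrixP => i j.
  have E : (b (y * z)%g).2 i j = ((b y).2 *m (b z).2) i j.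
    apply/eqP; rewrite -subr_eq0; apply/eqP/poly_punctured => t t0; rewrite hornerD hornerN.
    have Et : path_eval (b (y * z)%g).2 t = path_eval (b y).2 t *m path_eval (b z).2 t.
      rewrite Eyz// Ey// Ez// -(lgM lgs) gmulfM; congr (s _).
      by rewrite -!mulgA mulKg.
    have /matrixP/(_ i j) := Et; rewrite ![path_eval _ _ _ _]mxE => ->.
    rewrite !mxE horner_sum -sumrB big1// => l _.
    by rewrite !mxE hornerM subrr.
  rewrite [LHS]mxE E !mxE horner_sum; apply: eq_bigr => l _.
  by rewrite !mxE hornerM.
pose rho0 : {multiplicative Gamma -> G} :=
  HB.pack rho0f (isMultiplicative.Build Gamma G rho0f rho0M).
have [a _ aE] : Defs.orbit (@center_conj_action Gamma G) rho rho0.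
  move: clo => /cl; apply=> f tf f0.
  have [F FE] : exists F : {poly K}, (forall t, t != 0 -> F.[t] = f (tconj (d t) (tup g rho))) /\
      F.[0] = f (tup g rho0).
    elim: tf => [e|[i [a1 a2]]|h h' _ [P [PE P0]] _ [Q [QE Q0]]|h h' _ [P [PE P0]] _ [Q [QE Q0]]].
    - by exists e%:P; split=> [t _|]; rewrite hornerC.
    - have [E1 E0 _] := Hb (g i); exists ((b (g i)).2 a1 a2); split=> [t t0|].
        by have /matrixP/(_ a1 a2) := E1 t t0; rewrite mxE.
      by have /matrixP/(_ a1 a2) := E0; rewrite mxE.
    - by exists (P + Q); split=> [t t0|]; [rewrite hornerD PE// QE|rewrite hornerD P0 Q0].
    - by exists (P * Q); split=> [t t0|]; [rewrite hornerM PE// QE|rewrite hornerM P0 Q0].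
  rewrite -FE.2 (_ : F = 0) ?horner0//; apply: poly_punctured => t t0.
  rewrite FE.1// -tup_conj; apply: f0; rewrite center_orbit; by exists (d t).
(* The torus fixes [rho0], which is the conjugate of [rho] by [e]; conjugating back gives a torus in
   the stabilizer of [rho]. *)
pose e := repr a; pose w t := center_proj (e^-1 * d t * e)%g.
have wS t : t != 0 -> stabilizer (@center_conj_action Gamma G) rho (w t).
  move=> t0; rewrite /stabilizer /= center_conj_actionE.
  apply: multiplicative_ext => y; rewrite /= /conj_fun.
  have [_ _ /(_ t t0) E] := Hb y.
  have ry : (b y).1 = (e * rho y * e^-1)%g.
    by have := congr1 (fun r : {multiplicative Gamma -> G} => r y) aE.
  rewrite ry in E; have := congr1 (fun v => e^-1 * v * e)%g E.
  by rewrite !invgM invgK !mulgA mulVg mul1g -[in X in _ = X -> _]mulgA mulVg mulg1.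
(* The function [v] is insensitive to the center and equals [t ^+ k] at [w t]. A finite stabilizer
   would confine these powers to a finite list [rs], and a monic polynomial would then vanish at
   every nonzero [t]. *)
pose v (q : center_quot G) : K := phi (Ad s (e * repr q * e^-1)%g x).
have vw t : t != 0 -> v (w t) = t ^+ k.
  move=> t0; rewrite /v /w; have [z Zz ->] := repr_center_proj (e^-1 * d t * e)%g.
  have -> : (e * (e^-1 * d t * e * z) * e^-1 = d t * z)%g.
    by rewrite -!mulgA mulVKg; congr (_ * _)%g; rewrite (Zz e^-1%g) mulVKg.
  by rewrite (Ad_comp lgs) (center_Ad lgs Zz xg) phiE.
have /finite_seqP[rs rsE] := finite_image v finS.
have /poly_punctured Z : forall t, t != 0 -> (\prod_(y <- rs) ('X^k - y%:P)).[t] = 0.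
  move=> t t0; rewrite horner_prod; apply/eqP; rewrite prodf_seq_eq0; apply/hasP.
  have tk : [set` rs] (t ^+ k) by rewrite -rsE; exists (w t); [exact: wS|exact: vw].
  by exists (t ^+ k) => //=; rewrite hornerD hornerN hornerXn hornerC subrr.
have : \prod_(y <- rs) ('X^k - y%:P) \is monic by apply: monic_prod => y _; exact: monicXnsubC.
by rewrite Z => /monic_neq0; rewrite eqxx.
Qed.

(** The actions of [G] and of its quotient have the same orbits, and the stabilizer in [G] is the
    preimage of the other one, hence finite exactly when that one and the center are. *)
Lemma properly_stable_center rho :
  properly_stable_point (hom_coord c g) (@conj_action Gamma G) rho <->
  properly_stable_point (hom_coord c g) (@center_conj_action Gamma G) rho /\ finite_set (center G).
Proof.
have ZS z : center G z -> stabilizer (@conj_action Gamma G) rho z.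
  by move=> Zz; apply: multiplicative_ext => y; rewrite /= /conj_fun Zz mulgK.
split=> [[[U [oU Ur invU cU]] finS]|[[[U [oU Ur invU cU]] finS] finZ]].
  split; last exact: sub_finite_set finS.
  split.
    exists U; split=> //; first by move=> a y; exact: invU.
    by move=> y Uy; rewrite center_orbit; exact: cU.
  apply: sub_finite_set (finite_image (@center_proj G) finS) => a aE.
  by exists (repr a); [exact: aE|exact: center_projK].
split.
  exists U; split=> //; last by move=> y Uy; rewrite -center_orbit; exact: cU.
  by move=> a y Uy; rewrite -center_conj_actionE; exact: invU.
apply: sub_finite_set (finite_image2 (fun (q : center_quot G) z => (repr q * z)%g) finS finZ).
move=> a aE; exists (center_proj a); first by rewrite /stabilizer /= center_conj_actionE.
have [z Zz E] := repr_center_proj a; exists z^-1%g; first exact: centerV.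
by rewrite E mulgK.
Qed.

End Main.

Theorem corollary32 (R : realType) (G : groupType) (n : nat)
    (c : G -> 'rV[R[i]]_n) (Gamma : groupType) (N : nat) (g : 'I_N -> Gamma)
    (rho : {multiplicative Gamma -> G})
    (G_reductive : reductive c)
    (g_generates : generated (range g) = [set: Gamma]) :
  (properly_stable_point (hom_coord c g) (@conj_action Gamma G) rho
     <-> irreducible_rep c rho /\ finite_set (center G))
  /\
  (properly_stable_point (hom_coord c g) (@center_conj_action Gamma G) rho
     <-> irreducible_rep c rho).
Proof.
have [agG _ _] := G_reductive.
have [m [s [J [lgs s_reg c_poly]]]] := linearization agG.
have [cG red] := reductive_reductive_lie lgs s_reg c_poly G_reductive.
have irr := irreducible_bad lgs s_reg c_poly cG red rho.
have E2 : properly_stable_point (hom_coord c g) (@center_conj_action Gamma G) rho <->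
    irreducible_rep c rho.
  split=> [/(properly_stable_not_bad lgs red s_reg c_poly)/irr//|/irr].
  exact: (not_bad_properly_stable lgs red cG s_reg c_poly g_generates).
split=> //; split=> [/(properly_stable_center c g)[/E2 ? ?]//|[/E2 ? ?]].
exact/(properly_stable_center c g).
Qed.
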